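(* Let $\Omega\subset\mathbb{R}^N$ be a bounded domain, and let $g:\Omega\times[0,\infty)\to[0,\infty)$ and $G(x,t)=\int_0^t g(x,s)\,\mathrm{d}s$ satisfy $(SC)$ (with constants $g^0\ge g_0>1$), $(A_0)$ and $(A_1)$ as stated in the context, with $g^0<\min\{g_0^*,N\}$, where $g_0^*=\frac{Ng_0}{N-g_0}$. Let $\alpha\in\left(\frac1{g_0}-\frac1{g^0},\frac1N\right)$, let $\Psi$ be the generalized $\Phi$-function determined by $\Psi^{-1}(x,t)=t^{-\alpha}G^{-1}(x,t)$, and let $\psi(x,t)=\partial_t\Psi(x,t)$ be its density. Let $f:\Omega\times\mathbb{R}\to\mathbb{R}$ be a Carathéodory function, put $F(x,t)=\int_0^t f(x,s)\,\mathrm{d}s$, and assume: (i) there is a constant $C>0$ such that $|f(x,t)|\le C\,(1+\psi(x,|t|))$ for a.e. $x\in\Omega$ and all $t\in\mathbb{R}$; (ii) $f(x,t)=o(|t|^{g^0-1})$ as $t\to0$, uniformly in $x\in\Omega$; (iii) there exist $t_0>0$ and $\theta>g^0$ such that $0<\theta F(x,t)\le t f(x,t)$ for a.e. $x\in\Omega$ and all $t\in\mathbb{R}$ with $|t|\ge t_0$. Then the problem $$-\operatorname{div}\left(\frac{g(x,|\nabla u|)}{|\nabla u|}\nabla u\right)=f(x,u)\ \text{ in }\Omega,\qquad u=0\ \text{ on }\partial\Omega,$$ has a nontrivial weak solution, i.e. there exists $u\in W^{1,G(\cdot)}_0(\Omega)$, $u\neq0$, such that $$\int_\Omega\frac{g(x,|\nabla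 u|)}{|\nabla u|}\nabla u\cdot\nabla\varphi\,\mathrm{d}x=\int_\Omega f(x,u)\varphi\,\mathrm{d}x\quad\text{for all }\varphi\in W^{1,G(\cdot)}_0(\Omega).$$
   Context: Assumptions on $g$: for each $t\ge0$, $g(\cdot,t)$ is measurable on $\Omega$; for a.e. $x\in\Omega$, $g(x,\cdot)\in C^1([0,\infty))$; $g'$ denotes the derivative in $t$. Further: $(SC)$: there are constants $g^0\ge g_0>1$ such that $g_0-1\le\frac{t g'(x,t)}{g(x,t)}\le g^0-1$ for a.e. $x\in\Omega$ and all $t>0$. $(A_0)$: there is a constant $C>1$ such that $\frac1C\le g(x,1)\le C$ for a.e. $x\in\Omega$. $(A_1)$: there is a constant $C>0$ such that for every ball $B_R\subset\mathbb{R}^N$ of radius $R<1$ and all (almost every) $x,y\in B_R\cap\Omega$, one has $G(x,t)\le C\,G(y,t)$ whenever $G^-_{B}(t)\in[1,R^{-N}]$, where $G^-_B(t):=\operatorname{ess\,inf}_{z\in B_R\cap\Omega}G(z,t)$. Inverses $G^{-1}(x,\cdot)$ and $\Psi^{-1}(x,\cdot)$ are taken in the second variable, for fixed $x$. The expression $\frac{g(x,|\xi|)}{|\xi|}\xi$ is read as $0$ when $\xi=0$. Spaces: $L^{G(\cdot)}(\Omega)$ is the set of measurable $u$ with $\int_\Omega G(x,|u|)\,\mathrm{d}x<\infty$, with the norm $\|u\|_{G(\cdot)}=\inf\{\lambda>0:\int_\Omega G(x,|u|/\lambda)\,\mathrm{d}x\le1\}$. $W^{1,G(\cdot)}(\Omega)$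 is the set of $u\in L^{G(\cdot)}(\Omega)$ whose distributional gradient satisfies $|\nabla u|\in L^{G(\cdot)}(\Omega)$, with norm $\|u\|_{1,G(\cdot)}=\|u\|_{G(\cdot)}+\|\nabla u\|_{G(\cdot)}$. $W^{1,G(\cdot)}_0(\Omega)$ is the closure of $C_0^\infty(\Omega)$ in $W^{1,G(\cdot)}(\Omega)$. A Carathéodory function $f$ is measurable in $x$ for every $t$ and continuous in $t$ for a.e. $x$. *)

(* Defs.v *)
From HB Require Import structures.
From mathcomp Require Import all_boot all_order all_algebra.
From mathcomp Require Import all_classical all_reals all_analysis ess_sup_inf.

Set Implicit Arguments.
Unset Strict Implicit.
Unset Printing Implicit Defensive.

Import Order.TTheory GRing.Theory Num.Theory.
Import numFieldNormedType.Exports.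

Local Open Scope classical_set_scope.
Local Open Scope ring_scope.

(** The sigma-algebra on ['rV[R]_n] generated by the coordinates is the Borel
    one.  Lebesgue measure is built on n-tuples by iterated products, pushed
    forward to row vectors, and then completed (Caratheodory), so that
    measurability over [Rn R n] below, whose carrier is ['rV[R]_n], is Lebesgue measurability. *)

Definition rV_display : measure_display -> measure_display.
Proof. exact. Qed.

Section measurable_rV.
Context {R : realType} {n : nat}.

Let coord (i : 'I_n) (v : 'rV[R]_n) : measurableTypeR R := v 0 i.

Let rV_set0 : g_sigma_preimage coord set0.
Proof. exact: sigma_algebra0. Qed.

Let rV_setC A : g_sigma_preimage coord A -> g_sigma_preimage coord (~` A).
Proof. exact: sigma_algebraC. Qed.

Let rV_bigcup (F : _^nat) : (forall i, g_sigma_preimage coord (F i)) ->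
  g_sigma_preimage coord (\bigcup_i (F i)).
Proof. exact: sigma_algebra_bigcup. Qed.

HB.instance Definition _ := @isMeasurable.Build (rV_display default_measure_display)
  'rV[R]_n (g_sigma_preimage coord) rV_set0 rV_setC rV_bigcup.

End measurable_rV.

Section lebesgue_tuple.
Context {R : realType}.
Let T : measurableType _ := measurableTypeR R.

Definition tuple_cons {n : nat} (p : T * n.-tuple T) : n.+1.-tuple T :=
  [the n.+1.-tuple T of p.1 :: p.2].

Lemma measurable_tuple_cons n : measurable_fun [set: T * n.-tuple T] tuple_cons.
Proof. exact: measurable_cons. Qed.

Section cons_measure.
Context {n : nat} (mu : {sigma_finite_measure set (n.-tuple T) -> \bar R}).

Definition cons_measure : set (n.+1.-tuple T) -> \bar R :=
  pushforward (@lebesgue_measure R \x mu)%E tuple_cons.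

Let mpush : {measure set (n.+1.-tuple T) -> \bar R} :=
  measure_function_pushforward__canonical__measure_function_Measure
    (@lebesgue_measure R \x mu)%E (@measurable_tuple_cons n).

Let cons_measure0 : cons_measure set0 = 0%E.
Proof. exact: (measure0 mpush). Qed.

Let cons_measure_ge0 A : (0 <= cons_measure A)%E.
Proof. exact: (measure_ge0 mpush). Qed.

Let cons_measure_semi_sigma_additive : semi_sigma_additive cons_measure.
Proof. exact: (@measure_semi_sigma_additive _ _ _ mpush). Qed.

HB.instance Definition _ := isMeasure.Build _ _ _ cons_measure
  cons_measure0 cons_measure_ge0 cons_measure_semi_sigma_additive.

Let cons_measure_sigma_finite : sigma_finite setT cons_measure.
Proof.
have /sigma_finiteP[F [TF ndF Foo]] := sigma_finiteT (@lebesgue_measure R).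
have /sigma_finiteP[G [TG ndG Goo]] := sigma_finiteT mu.
pose uncons (t : n.+1.-tuple T) : T * n.-tuple T :=
  (thead t, [tuple of behead t]).
have uncons_consK : cancel (@tuple_cons n) uncons.
  move=> [a t]; rewrite /uncons /tuple_cons theadE/=; congr (_, _).
  exact/val_inj.
have munc : measurable_fun setT uncons.
  apply: measurable_fun_pair; last exact: measurable_behead.
  exact: measurable_tnth.
exists (fun i => uncons @^-1` (F i `*` G i)).
  apply/esym; rewrite -subTset => t _.
  have [k _ Fk] : (\bigcup_i F i) (uncons t).1 by rewrite -TF.
  have [l _ Gl] : (\bigcup_i G i) (uncons t).2 by rewrite -TG.
  exists (maxn k l) => //; split.
    by move: Fk; exact/subsetPset/ndF/leq_maxl.
  by move: Gl; exact/subsetPset/ndG/leq_maxr.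
move=> i; have [mF Fi] := Foo i; have [mG Gi] := Goo i.
have mFG : measurable (F i `*` G i) by exact: measurableX.
split; first by rewrite -[X in measurable X]setTI; exact: munc.
rewrite /cons_measure /pushforward -comp_preimage.
rewrite (_ : uncons \o _ = id) ?funeqE; last by move=> p /=; rewrite uncons_consK.
by rewrite preimage_id product_measure1E// lte_mul_pinfty// ge0_fin_numE.
Qed.

HB.instance Definition _ := Measure_isSigmaFinite.Build _ _ _ cons_measure
  cons_measure_sigma_finite.

End cons_measure.

Fixpoint tuple_measure (n : nat) :
    {sigma_finite_measure set (n.-tuple T) -> \bar R} :=
  match n with
  | 0 => \d_([tuple] : 0.-tuple T)
  | m.+1 => cons_measure (tuple_measure m)
  end.

Definition rV_of_tuple {n : nat} (t : n.-tuple T) : 'rV[R]_n :=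
  \row_i tnth t i.

Lemma measurable_rV_of_tuple n :
  measurable_fun [set: n.-tuple T] (@rV_of_tuple n).
Proof.
apply: (@measurability _ _ _ _ _ _
  (\big[setU/set0]_(i < n) preimage_set_system setT
     (fun v : 'rV[R]_n => v 0 i : T) measurable)) => //.
move=> _ [B + <-].
rewrite -bigcup_seq => -[i /= _ [C mC <-]].
rewrite !setTI -comp_preimage.
rewrite (_ : _ \o _ = fun t : n.-tuple T => tnth t i).
  by rewrite -[X in measurable X]setTI; exact: measurable_tnth.
by apply/funext => t /=; rewrite mxE.
Qed.

Definition borel_lebesgue (n : nat) : {measure set 'rV[R]_n -> \bar R} :=
  measure_function_pushforward__canonical__measure_function_Measure
    (tuple_measure n) (@measurable_rV_of_tuple n).

End lebesgue_tuple.

Definition Rn (R : realType) (n : nat) : measurableType _ :=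
  caratheodory_type (mu_ext (@borel_lebesgue R n)).

Definition lebesgue_Rn (R : realType) (n : nat) : set (Rn R n) -> \bar R :=
  @completed_measure_extension _ _ _ (@borel_lebesgue R n).

HB.instance Definition _ (R : realType) (n : nat) :=
  Measure.on (@lebesgue_Rn R n).

Lemma tuple_measure_box (R : realType) n (A : 'I_n -> set R) :
  (forall i, measurable (A i)) ->
  measurable [set t : n.-tuple (measurableTypeR R) | forall i, A i (tnth t i)] /\
  tuple_measure n [set t | forall i, A i (tnth t i)] =
  (\prod_(i < n) lebesgue_measure (A i))%E.
Proof.
move=> mA; split.
  rewrite (_ : [set _ | _] = \bigcap_(i in [set: 'I_n]) ((@tnth _ (measurableTypeR R))^~ i @^-1` A i)).
    apply: fin_bigcap_measurable => // i _.
    rewrite -[X in measurable X]setTI; apply: measurable_tnth => //.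
    exact: mA.
  by apply/seteqP; split => t /= h i => [_|]; [exact: h|exact: (h i Logic.I)].
elim: n A mA => [|n IH] A mA.
  rewrite big_ord0 /= diracE mem_set// => -[m i]; by exfalso.
rewrite big_ord_recl -IH//=.
rewrite /cons_measure /pushforward -product_measure1E//.
  congr (_ _); apply/seteqP; split => -[a t] /=.
    move=> h; split; first by have := h ord0; rewrite /tuple_cons /= tnth0.
    by move=> i; have := h (lift ord0 i); rewrite /tuple_cons /= tnthS.
  move=> [h0 h] i; case: (unliftP ord0 i) => [j|] ->.
    by rewrite /tuple_cons /= tnthS.
  by rewrite /tuple_cons /= tnth0.
  exact: mA.
rewrite (_ : [set _ | _] = \bigcap_(i in [set: 'I_n]) ((@tnth _ (measurableTypeR R))^~ i @^-1` A (lift ord0 i))).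
    apply: fin_bigcap_measurable => // i _.
    rewrite -[X in measurable X]setTI; apply: measurable_tnth => //.
    exact: mA.
  by apply/seteqP; split => t /= h i => [_|]; [exact: h|exact: (h i Logic.I)].
Qed.

Lemma lebesgue_Rn_box (R : realType) n (A : 'I_n -> set R) :
  (forall i, measurable (A i)) ->
  lebesgue_Rn [set v : 'rV[R]_n | forall i, A i (v 0 i)] =
  (\prod_(i < n) lebesgue_measure (A i))%E.
Proof.
move=> mA.
have [mB <-] := tuple_measure_box mA.
have mV : measurable [set v : 'rV[R]_n | forall i, A i (v 0 i)].
  rewrite (_ : [set _ | _] = \bigcap_(i in [set: 'I_n]) ((fun v : 'rV[R]_n => v 0 i) @^-1` A i)); last first.
    by apply/seteqP; split => t /= h i => [_|]; [exact: h|exact: (h i Logic.I)].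
  apply: fin_bigcap_measurable => // i _; apply: sub_sigma_algebra.
  rewrite -bigcup_seq; exists i; first by rewrite /= mem_index_enum.
  by exists (A i); [exact: mA|rewrite setTI].
rewrite /lebesgue_Rn /completed_measure_extension measurable_mu_extE//.
rewrite /= /pushforward; congr (_ _); apply/seteqP; split => t /= h i.
  by have := h i; rewrite mxE.
by rewrite mxE.
Qed.

Section euclidean.
Context {R : realType} {N : nat}.
Implicit Types u v c : 'rV[R]_N.

Definition dotv u v : R := \sum_i u 0 i * v 0 i.

(* the library norm on ['rV[R]_N] is the sup norm (same topology) *)
Definition enorm v : R := Num.sqrt (dotv v v).

Definition eball c (r : R) : set 'rV[R]_N := [set x | enorm (x - c) < r].

Definition bounded_domain (Omega : set 'rV[R]_N) : Prop :=
  [/\ Omega !=set0, open Omega, connected Omega & bounded_set Omega].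

End euclidean.

Section half_line.
Context {R : realType}.
Implicit Types h : R -> R.

Definition diff_quot h (t s : R) : R := (h s - h t) / (s - t).

(* derivative of a function on [0, +oo[: two-sided for t > 0, right derivative
   at t = 0 *)
Definition derive_half_line h (t : R) : R :=
  lim (diff_quot h t s @[s --> within `[0, +oo[%classic t^']).

Definition C1_half_line h : Prop :=
  (forall t, 0 <= t ->
    cvg (diff_quot h t s @[s --> within `[0, +oo[%classic t^'])) /\
  {within `[0, +oo[%classic, continuous (derive_half_line h)}.

Definition primitive h (t : R) : R :=
  if 0 <= t then \int[lebesgue_measure]_(s in `[0, t]) h s
  else - \int[lebesgue_measure]_(s in `[t, 0]) h s.

(* left-continuous inverse of a nondecreasing function on [0, +oo[ *)
Definition Phi_inverse h (t : R) : R := inf [set s | 0 <= s /\ t <= h s].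

End half_line.

Section generalized_orlicz.
Context {R : realType} {N : nat}.
Variable Omega : set 'rV[R]_N.
Implicit Types (g G H : 'rV[R]_N -> R -> R) (u : 'rV[R]_N -> R).

Let mu := @lebesgue_Rn R N.

Definition ae_in (P : 'rV[R]_N -> Prop) : Prop :=
  {ae mu, forall x : Rn R N, Omega x -> P x}.

Definition Lmeasurable (D : set 'rV[R]_N) u : Prop :=
  @measurable_fun _ _ (Rn R N) R D u.

Definition ess_inf_on (D : set 'rV[R]_N) u : \bar R :=
  ess_inf mu (fun z : Rn R N => if z \in D then (u z)%:E else +oo%E).

Definition standing_g g : Prop :=
  [/\ forall x t, Omega x -> 0 <= t -> 0 <= g x t,
      forall t, 0 <= t -> Lmeasurable Omega (g ^~ t) &
      ae_in (fun x => C1_half_line (g x))].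

Definition cond_SC (g0 g1 : R) g : Prop :=
  ae_in (fun x => forall t, 0 < t ->
    g0 - 1 <= t * derive_half_line (g x) t / g x t <= g1 - 1).

Definition cond_A0 g : Prop :=
  exists2 C : R, 1 < C & ae_in (fun x => C^-1 <= g x 1 <= C).

Definition cond_A1 G : Prop :=
  exists2 C : R, 0 < C &
    forall (c : 'rV[R]_N) (r : R), 0 < r < 1 ->
    let B := eball c r `&` Omega in
    exists2 E : set (Rn R N), mu.-negligible E &
    forall x y, (B `\` E) x -> (B `\` E) y ->
    forall t, 0 <= t ->
      (1%:E <= ess_inf_on B (G ^~ t) <= (r ^- N)%:E)%E ->
      G x t <= C * G y t.

(* generalized weak Phi-function, finite-valued: the last clause is (aInc)_1 *)
Definition generalized_Phi H : Prop :=
  [/\ forall u, Lmeasurable Omega u -> Lmeasurable Omega (fun x => H x `|u x|),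
      ae_in (fun x =>
        [/\ forall s t, 0 <= s -> s <= t -> H x s <= H x t,
            H x 0 = 0,
            H x t @[t --> 0^'+] --> 0 &
            H x t @[t --> +oo] --> +oo]) &
      exists2 L : R, 1 <= L & ae_in (fun x => forall s t, 0 < s -> s <= t ->
        H x s / s <= L * (H x t / t))].

Definition caratheodory_fun (f : 'rV[R]_N -> R -> R) : Prop :=
  (forall t, Lmeasurable Omega (f ^~ t)) /\
  ae_in (fun x => continuous (f x)).

Definition modular G u : \bar R :=
  \int[mu]_(x in (Omega : set (Rn R N))) (G x `|u x|)%:E.

Definition LG G u : Prop := Lmeasurable Omega u /\ (modular G u < +oo)%E.

Definition normLG G u : \bar R :=
  ereal_inf [set l%:E | l in
    [set l : R | 0 < l /\ (modular G (fun x => (u x) / l)%R <= 1)%E]].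

Definition partial (i : 'I_N) u (x : 'rV[R]_N) : R := 'D_(delta_mx 0 i) u x.

Definition gradient u (x : 'rV[R]_N) : 'rV[R]_N := \row_i partial i u x.

Fixpoint Ck (k : nat) u : Prop :=
  continuous u /\
  match k with
  | 0 => True
  | k'.+1 => forall i : 'I_N,
      (forall x, derivable u x (delta_mx 0 i)) /\ Ck k' (partial i u)
  end.

Definition test_function u : Prop :=
  (forall k, Ck k u) /\
  exists2 K : set 'rV[R]_N, compact K /\ K `<=` Omega &
    forall x, ~ K x -> u x = 0.

Definition loc_integrable u : Prop :=
  Lmeasurable Omega u /\
  forall K : set (Rn R N), compact (K : set 'rV[R]_N) -> K `<=` Omega ->
    mu.-integrable K (fun x => (u x)%:E).

(* [Du] is the distributional gradient of [u] on [Omega] *)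
Definition weak_gradient u (Du : 'rV[R]_N -> 'rV[R]_N) : Prop :=
  [/\ loc_integrable u,
      forall i, loc_integrable (fun x => Du x 0 i) &
      forall phi, test_function phi -> forall i,
        \int[mu]_(x in (Omega : set (Rn R N))) (u x * partial i phi x) =
        - \int[mu]_(x in (Omega : set (Rn R N))) (Du x 0 i * phi x)].

(* a Sobolev function is represented by the pair of the function and its
   distributional gradient *)
Definition W1G G u (Du : 'rV[R]_N -> 'rV[R]_N) : Prop :=
  [/\ LG G u, weak_gradient u Du & LG G (enorm \o Du)].

Definition normW1G G u (Du : 'rV[R]_N -> 'rV[R]_N) : \bar R :=
  (normLG G u + normLG G (enorm \o Du))%E.

Definition W1G0 G u (Du : 'rV[R]_N -> 'rV[R]_N) : Prop :=
  W1G G u Du /\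
  forall e : R, 0 < e -> exists2 phi, test_function phi &
    (normW1G G (u \- phi)%R (fun x => Du x - gradient phi x)%R < e%:E)%E.

(* at [xi = 0] the value is 0, as division by 0 yields 0 *)
Definition flux g (x xi : 'rV[R]_N) : 'rV[R]_N :=
  (g x (enorm xi) / enorm xi) *: xi.

(* the two integrability clauses say that both integrals are well defined *)
Definition weak_solution g (f : 'rV[R]_N -> R -> R) u
    (Du : 'rV[R]_N -> 'rV[R]_N) : Prop :=
  let G := fun x => primitive (g x) in
  W1G0 G u Du /\
  forall phi Dphi, W1G0 G phi Dphi ->
  [/\ mu.-integrable Omega (fun x => (dotv (flux g x (Du x)) (Dphi x))%:E),
      mu.-integrable Omega (fun x => (f x (u x) * phi x)%:E) &
      \int[mu]_(x in (Omega : set (Rn R N)))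
        dotv (flux g x (Du x)) (Dphi x) =
      \int[mu]_(x in (Omega : set (Rn R N))) (f x (u x) * phi x)].

End generalized_orlicz.

(* Main.v *)
(** After discarding a null set, all pointwise hypotheses hold everywhere in [Omega].  The equation
    for the inverses reads [Psi x (a G(x,a)^(-alpha)) = G(x,a)]; hence the elasticity of [Psi x]
    lies between [g0 / (1 - alpha g0)], which exceeds [g1], and [g1 / (1 - alpha g1)].

    For a test function [u], the difference between [u x] and its mean over a cube is bounded by
    averages of [|grad u|] over the cubes of size [2^-k] around [x].  As (A1) compares
    [G x] at different points of a small cube, these averages bound the [Psi]-modular of [u] by the
    [G]-modular of its gradient; splitting the sum over [k] gives moreover total boundedness in the
    [Psi]-modular.

    Take a countable family that is dense among the test functions.  On the span of its first [n]
    members the energy has the mountain pass geometry: (ii) with [Psi] growing faster than [t^g1]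
    gives a ridge, and (iii) makes the energy negative far away along the first member.  This gives
    critical points [u_n] with energies in a fixed interval [[rho/2, M]] with [rho > 0], whose
    gradients are bounded by (iii).  A subsequence is Cauchy in the [Psi]-modular; testing
    the [n]-th equation with approximations of [u_m], uniform convexity of the [G]-modular makes
    the gradients Cauchy as well.  The limit solves the equation and has positive energy, so it does
    not vanish. *)

From HB Require Import structures.
Require Import Defs.
From mathcomp Require Import all_boot all_order all_algebra.
From mathcomp Require Import all_classical all_reals all_analysis ess_sup_inf.
From mathcomp Require Import measurable_realfun.
From mathcomp Require Import ring lra.

Set Implicit Arguments.
Unset Strict Implicit.
Unset Printing Implicit Defensive.

Import Order.TTheory GRing.Theory Num.Theory.
Import numFieldNormedType.Exports.

Local Open Scope classical_set_scope.
Local Open Scope ring_scope.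

(** * Functions of controlled growth *)

Section real_functions.
Context {R : realType}.
Implicit Types (h f df : R -> R) (x t s a b c l p q r e : R).

(** No weak topology, duality or deformation lemma in a Banach space is involved. Each Galerkin
    space is a copy of some [R^k], where closed bounded sets are compact, and the passage to the
    limit works with modulars alone. Modulars are not homogeneous and obey the triangle inequality
    only up to a factor, so convergence statements are made with weights, finite colourings and
    suprema of increments instead of norms. The strict inequality [alpha < 1/N] leaves a factor
    [r^(1 - alpha N)] on an average over a cube of size [r]: half of this exponent is spent on
    summing the dyadic scales inside [Psi], the other half on summing the modulars that result. Two
    obstacles shape the analytic part. The exceptional null set in (A1) depends on the ball, so only
    balls with rational data are used and their null sets are united. And the space with zero
    boundary values is a closure in the [G]-norm, while the right-hand side is controlled by the
    [Psi]-modular, so its elements must be shown to be limits of test functions in the [Psi]-modular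
    as well. *)

Lemma powR_homo r a b : 0 <= r -> 0 <= a -> a <= b -> a `^ r <= b `^ r.
Proof. by move=> r0 a0 ab; rewrite ge0_ler_powR ?nnegrE// (le_trans a0). Qed.

Lemma powR_ge1 r a : 0 <= r -> 1 <= a -> 1 <= a `^ r.
Proof. by move=> r0 a1; have := powR_homo r0 ler01 a1; rewrite powR1. Qed.

Lemma powR_gt1 r a : 0 < r -> 1 < a -> 1 < a `^ r.
Proof.
move=> r0 a1; have := @gt0_ltr_powR R r r0 1 a; rewrite powR1; apply => //.
  by rewrite nnegrE.
by rewrite nnegrE (le_trans ler01)// ltW.
Qed.

Lemma powRV r a : 0 < a -> a^-1 `^ r = (a `^ r)^-1.
Proof. by move=> a0; rewrite -[X in X `^ _]powR_inv1 ?(ltW a0)// -powRrM mulN1r powRN. Qed.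

Lemma powRK r a : 0 < r -> 0 <= a -> (a `^ r^-1) `^ r = a.
Proof. by move=> r0 a0; rewrite -powRrM mulVf ?gt_eqF// powRr1. Qed.

Lemma mean_value f df (a b : R) : a <= b ->
  (forall x, a < x < b -> is_derive x 1 f (df x)) ->
  {within `[a, b], continuous f} ->
  exists2 c, a <= c <= b /\ (a < b -> a < c < b) & f b - f a = df c * (b - a).
Proof.
rewrite le_eqVlt => /predU1P[->|ab] df1 cf.
  by exists b; rewrite ?subrr ?mulr0//; split; rewrite ?lexx// ltxx.
have [c + E] := @MVT R f df a b ab (fun x => df1 x) cf.
rewrite in_itv/= => /andP[ac cb]; exists c => //.
by split => [|_]; rewrite ?(ltW ac) ?(ltW cb)// ac cb.
Qed.

Lemma is_derive_continuousW f df (a b : R) :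
  (forall x, is_derive x 1 f (df x)) -> {within `[a, b], continuous f}.
Proof.
move=> df1; apply: continuous_subspaceT => x.
by apply/differentiable_continuous/derivable1_diffP; have [] := df1 x.
Qed.

(** The integrands are only controlled on [[0, +oo[]. Their continuity on intervals is borrowed from
    a globally continuous function [fc], in practice the primitive of the even extension of the
    density. *)
Lemma eq_within_continuous f fc a b : 0 <= a -> continuous fc ->
  (forall s, 0 <= s -> fc s = f s) -> {within `[a, b], continuous f}.
Proof.
move=> a0 /(@continuous_subspaceT _ _ `[a, b]%classic) + E.
apply: subspace_eq_continuous => s; rewrite inE/= in_itv/= => /andP[as_ _].
by rewrite /from_subspace/= E// (le_trans a0).
Qed.

Lemma ge0_derive_ge0 f df (t : R) : 0 <= t -> f 0 = 0 ->
  (forall x, 0 < x -> is_derive x 1 f (df x)) ->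
  {within `[0, t], continuous f} ->
  (forall x, 0 < x -> 0 <= df x) -> 0 <= f t.
Proof.
move=> t0 f0 df1 cf df0.
have [c [ct ct'] E] : exists2 c, 0 <= c <= t /\ (0 < t -> 0 < c < t)
    & f t - f 0 = df c * (t - 0).
  by apply: mean_value => // x /andP[x0 _]; exact: df1.
move: E; rewrite f0 !subr0 => ->.
move: t0; rewrite le_eqVlt => /predU1P[<-|t0]; first by rewrite mulr0.
have /andP[c0 _] := ct' t0.
by rewrite mulr_ge0 ?df0// ltW.
Qed.

(** At [t > 0] the restriction to the half-line is no restriction: points at distance less than
    [Num.min r t] from [t] are nonnegative. *)
Lemma diff_quot_cvg_derive h (t l : R) : 0 < t ->
  diff_quot h t s @[s --> within `[0, +oo[%classic t^'] --> l ->
  is_derive t 1 h l.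
Proof.
move=> t0 hl.
have H : (fun s => s^-1 *: ((h \o shift t) (s *: (1 : R)) - h t)) @ 0^' --> l.
  apply/cvgrPdist_lt => e e0.
  move/cvgrPdist_lt : hl => /(_ _ e0).
  rewrite /within/= !near_withinE => -[r /= r0 hr].
  have m0 : 0 < Num.min r t by rewrite lt_min r0.
  exists (Num.min r t) => //= s; rewrite /ball_/= sub0r normrN lt_min => /andP[sr st s0].
  have sb : ball_ (Num.Def.normr) t r (s + t).
    by rewrite /ball_/= opprD addrCA subrr addr0 normrN.
  have := hr _ sb.
  have stn : s + t != t by rewrite -subr_eq0 addrK.
  have st0 : s + t \in `[0, +oo[.
    by rewrite in_itv/= andbT; move: st; rewrite ltr_norml; lra.
  move=> /(_ stn st0); rewrite /diff_quot addrK !scaler1.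
  by rewrite [X in _ -> `|_ - X| < _]mulrC.
split; last exact/cvg_lim.
by apply/cvg_ex; exists l.
Qed.

Lemma C1_half_line_derive h : C1_half_line h ->
  forall t : R, 0 < t -> is_derive t 1 h (derive_half_line h t).
Proof. by move=> [ch _] t t0; apply: diff_quot_cvg_derive => //; exact: ch (ltW t0). Qed.

(** The even extension is the object to which the fundamental theorem of calculus is applied later.
    Its continuity at 0 comes from the bounded difference quotients there. *)
Lemma C1_half_line_continuous h : C1_half_line h -> continuous (fun t => h `|t|).
Proof.
move=> Ch t; have [->|t0] := eqVneq t 0; last first.
  have tp : 0 < `|t| by rewrite normr_gt0.
  have hc : {for `|t|, continuous h}.
    by apply/differentiable_continuous/derivable1_diffP; have [] := C1_half_line_derive Ch tp.
  exact: (cvg_comp _ _ (@norm_continuous R R t) hc).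
have [/(_ _ (lexx _)) /cvg_ex[/= l hl] _] := Ch.
apply/cvgrPdist_lt => e e0.
move/cvgrPdist_lt : hl => /(_ 1 ltr01).
rewrite /within/= !near_withinE => -[r /= r0 hr].
have l0 : 0 < `|l| + 1 by rewrite ltr_wpDl.
have m0 : 0 < Num.min r (e / (`|l| + 1)) by rewrite lt_min r0 divr_gt0.
exists (Num.min r (e / (`|l| + 1))) => //= s.
rewrite /ball_/= sub0r normrN lt_min => /andP[sr se].
have [->|s0] := eqVneq s 0; first by rewrite subrr normr0.
have sb : ball_ (Num.Def.normr) 0 r `|s| by rewrite /ball_/= sub0r normrN normr_id.
have sn : `|s| != 0 by rewrite normr_eq0.
have si : `|s| \in `[0, +oo[ by rewrite in_itv/= andbT.
have := hr _ sb sn si; rewrite /diff_quot subr0 normr0 => H.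
have H2 : `|(h `|s| - h 0) / `|s| | < `|l| + 1.
  rewrite -[X in `|X|](subrK l) [X in _ < X]addrC.
  by apply: (le_lt_trans (ler_normD _ _)); rewrite ltrD2r distrC.
rewrite distrC -[X in `|X|](@mulfVK _ `|s|)// normrM normr_id.
rewrite -(@mulfVK _ (`|l| + 1) _ e) ?gt_eqF ?ltr_wpDl//.
rewrite mulrC; apply: ltr_pM => //.
Qed.

Lemma primitive_ge0E h t : 0 <= t -> primitive h t = primitive (fun s => h `|s|) t.
Proof.
move=> t0; rewrite /primitive t0; apply: eq_Rintegral => s /=.
by rewrite inE/= in_itv/= => /andP[s0 _]; rewrite ger0_norm.
Qed.

Lemma primitive0 h : primitive h 0 = 0.
Proof. by rewrite /primitive lexx set_itv1 Rintegral_set1. Qed.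

Lemma primitive_is_derive h : continuous h ->
  forall t : R, is_derive t 1 (primitive h) (h t).
Proof.
move=> ch t.
(* Moving the base point from 0 to [- A] makes [t] an interior point whatever its sign; the two
   primitives differ by the constant [P 0]. *)
pose A := `|t| + 1.
pose P (y : R) : R := \int[lebesgue_measure]_(s in `[- A, y]) h s.
have ih a b : lebesgue_measure.-integrable `[a, b] (EFin \o h).
  apply: continuous_compact_integrable; first exact: segment_compact.
  exact: continuous_subspaceT.
have tA : - A < t < A by rewrite -ltr_norml ltrDl.
have A0 : 0 < A by rewrite ltr_wpDl.
have [tA1 tA2] := andP tA.
have [dP P't] : derivable P t 1 /\ (P^`())%classic t = h t.
  by apply: (@continuous_FTC1 R h (BLeft (- A)) t A tA2 (ih _ _)) => //; exact: ch.
have PE y : - A < y < A -> primitive h y = P y - P 0.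
  move=> /andP[yA Ay]; rewrite /primitive; case: ifPn => y0.
    rewrite /P (Rintegral_itvB (ih _ _)) ?bnd_simp ?oppr_le0 ?(ltW A0)//.
    by rewrite Rintegral_itv_obnd_cbnd//; apply: integrableS (ih 0 y) => //; apply: subset_itvr; rewrite bnd_simp.
  rewrite -ltNge in y0.
  rewrite -[RHS]opprB; congr (- _); rewrite /P (Rintegral_itvB (ih _ _)) ?bnd_simp ?(ltW y0) ?(ltW yA)//.
  by rewrite Rintegral_itv_obnd_cbnd//; apply: integrableS (ih y 0) => //; apply: subset_itvr; rewrite bnd_simp.
clearbody P.
have dP1 : is_derive t 1 P (h t) by split => //; rewrite -derive1E.
have dPd : is_derive t 1 (fun y => P y - P 0) (h t).
  by apply: is_derive_eq; rewrite subr0.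
apply: near_eq_is_derive dPd.
near=> y; apply/esym/PE.
near: y; have := @near_in_itvoo R (- A) A t; rewrite in_itv/= tA => /(_ isT); apply: filterS => z; rewrite in_itv.
Unshelve. all: by end_near. Qed.

Lemma primitive_continuous h : continuous h -> continuous (primitive h).
Proof.
move=> ch t; apply/differentiable_continuous/derivable1_diffP.
by have [] := primitive_is_derive ch t.
Qed.

(* For differentiable [h] this says that the elasticity [t h'(t) / h(t)] lies between [p] and [q]. *)
Definition growth (p q : R) h := forall l t : R, 1 <= l -> 0 <= t ->
  l `^ p * h t <= h (l * t) <= l `^ q * h t.

Lemma growth_homo p q h : 0 <= p -> growth p q h ->
  (forall t, 0 <= t -> 0 <= h t) -> h 0 = 0 ->
  forall s t, 0 <= s -> s <= t -> h s <= h t.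
Proof.
move=> p0 gh h0 h00 s t; rewrite le_eqVlt => /predU1P[<-|s0 st].
  by move=> t0; rewrite h00 h0.
have l1 : 1 <= t / s by rewrite ler_pdivlMr// mul1r.
have /andP[H _] := gh _ _ l1 (ltW s0); rewrite divfK ?gt_eqF// in H.
apply: le_trans H; rewrite ler_peMl ?h0 ?(ltW s0)//.
have P1 : 1 `^ p = 1 :> R by rewrite powR1.
by rewrite -[leLHS]P1 ge0_ler_powR ?nnegrE// (le_trans ler01).
Qed.

Lemma growth_shrink p q h : growth p q h ->
  forall l t : R, 0 < l <= 1 -> 0 <= t -> l `^ q * h t <= h (l * t) <= l `^ p * h t.
Proof.
move=> gh l t /andP[l0 l1] t0.
have il : 1 <= l^-1 by rewrite invf_ge1.
have lt0 : 0 <= l * t by rewrite mulr_ge0// ltW.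
have := gh _ _ il lt0; rewrite mulKf ?gt_eqF//.
have pw r : l^-1 `^ r = (l `^ r)^-1 by rewrite -powR_inv1 ?ltW// -powRrM mulN1r powRN.
rewrite !pw => /andP[A B].
rewrite -ler_pdivrMl ?powR_gt0// A.
by rewrite -ler_pdivlMl ?powR_gt0// B.
Qed.

Section density.
Variables (h : R -> R) (p q : R).
Hypothesis Ch : C1_half_line h.
Hypothesis h_ge0 : forall t, 0 <= t -> 0 <= h t.
Hypothesis p1 : 1 < p.
Hypothesis SC : forall t, 0 < t -> p - 1 <= t * derive_half_line h t / h t <= q - 1.

Lemma SC_gt0 t : 0 < t -> 0 < h t.
Proof.
move=> t0; rewrite lt_neqAle h_ge0 ?ltW// andbT eq_sym; apply/eqP => ht0.
(* Division by zero yields 0, so a zero of [h] would give elasticity 0, below [p - 1 > 0]. *)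
have := SC t0; rewrite ht0 invr0 mulr0 => /andP[]; have := p1; lra.
Qed.

Let ln_pow l t : 1 <= l -> 0 < t ->
  ln (l * t) - ln t = ln l.
Proof.
by move=> l1 t0; rewrite lnM ?posrE// ?addrK// (lt_le_trans ltr01).
Qed.

Let dln c t : 0 < t -> is_derive t 1 (fun s => ln (h s) - c * ln s)
  (derive_half_line h t / h t - c / t).
Proof.
move=> t0.
have ht := C1_half_line_derive Ch t0.
have h0 := SC_gt0 t0.
have dl := is_derive1_ln t0.
have dlh := is_derive1_ln h0.
have d1 : is_derive t 1 (fun s => ln (h s)) ((h t)^-1 * derive_half_line h t).
  exact: (@is_derive1_comp _ (@ln R) h t _ _ dlh ht).
apply: is_derive_eq.
by rewrite [X in X - _]mulrC.
Qed.

Let ln_growth (c : R) l t : 1 <= l -> 0 < t ->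
  exists2 xi, 0 < xi & ln (h (l * t)) - ln (h t) - c * ln l =
   (derive_half_line h xi / h xi - c / xi) * (l * t - t).
Proof.
move=> l1 t0.
have lt : t <= l * t by rewrite ler_peMl// ltW.
have [||z [/andP[tz _] _] H] := @mean_value (fun s => ln (h s) - c * ln s)
  (fun t => derive_half_line h t / h t - c / t) t (l * t) lt.
- by move=> x /andP[tx _]; apply: dln; exact: lt_trans tx.
- apply: derivable_within_continuous => x; rewrite in_itv/= => /andP[tx _].
  by have [] := @dln c x (lt_le_trans t0 tx).
exists z; first exact: lt_le_trans tz.
rewrite -H -(@ln_pow l t l1 t0); ring.
Qed.

(** [t h'(t) / h(t)] is the derivative of [ln h] with respect to [ln t], so [ln h - c ln] is
    nondecreasing for [c = p - 1] and nonincreasing for [c = q - 1]. *)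
Lemma SC_growth_gt0 l t : 1 <= l -> 0 < t ->
  l `^ (p - 1) * h t <= h (l * t) <= l `^ (q - 1) * h t.
Proof.
move=> l1 t0.
have l0 : 0 < l by exact: lt_le_trans ltr01 l1.
have lt0 : 0 < l * t by rewrite mulr_gt0.
have lt : 0 <= l * t - t by rewrite subr_ge0 ler_peMl// ltW.
have E c : ln (l `^ c * h t) = ln (h t) + c * ln l.
  by rewrite lnM ?posrE ?powR_gt0 ?SC_gt0// ln_powR addrC.
rewrite -ler_ln ?posrE ?mulr_gt0 ?powR_gt0 ?SC_gt0//.
rewrite -[X in _ && X]ler_ln ?posrE ?mulr_gt0 ?powR_gt0 ?SC_gt0// !E.
have S (z c : R) : 0 < z -> derive_half_line h z / h z - c / z =
    z^-1 * (z * derive_half_line h z / h z - c).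
  by move=> z0; rewrite mulrBr !mulrA mulVf ?gt_eqF// mul1r [c / z]mulrC.
apply/andP; split.
  have [z z0 H] := ln_growth (p - 1) l1 t0.
  rewrite -subr_ge0 opprD addrA H S//; apply: mulr_ge0 => //.
  apply: mulr_ge0; first by rewrite invr_ge0 ltW.
  by have /andP[] := SC z0; rewrite -subr_ge0.
have [z z0 H] := ln_growth (q - 1) l1 t0.
rewrite -subr_le0 opprD addrA H S//; apply: mulr_le0_ge0 => //.
apply: mulr_ge0_le0; first by rewrite invr_ge0 ltW.
by rewrite subr_le0; have /andP[] := SC z0.
Qed.

(** For [t <= 1] the growth bound gives [h t <= t^(p-1) h 1], which tends to 0 because [p > 1], and
    [h] is continuous at 0. *)
Lemma SC_at0 : h 0 = 0.
Proof.
have hc := C1_half_line_continuous Ch.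
have p10 : 0 < p - 1 by rewrite subr_gt0.
have h1 : h t @[t --> 0^'+] --> (0 : R).
  apply: (@squeeze_cvgr _ _ _ _ (fun=> 0) (fun t => t `^ (p - 1) * h 1)).
  - near=> t.
    have t0 : 0 < t by [].
    have t1 : t <= 1 by near: t; exact: nbhs_right_le.
    rewrite (h_ge0 (ltW t0))/=.
    have it : 1 <= t^-1 by rewrite invf_ge1.
    have /andP[+ _] := SC_growth_gt0 it t0.
    rewrite mulVf ?gt_eqF// -[X in X `^ _]powR_inv1 ?(ltW t0)// -powRrM mulN1r powRN.
    by rewrite ler_pdivrMl ?powR_gt0.
  - exact: cvg_cst.
  - rewrite -[X in _ --> X](mul0r (h 1)); apply: cvgMl; exact: powR_cvg0.
have h2 : h t @[t --> 0^'+] --> h 0.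
  have := cvg_at_right_filter (hc 0); rewrite normr0; apply: cvg_trans.
  apply: near_eq_cvg; near=> t; rewrite ger0_norm//.
exact: (cvg_unique _ h2 h1).
Unshelve. all: by end_near. Qed.

Lemma SC_growth : growth (p - 1) (q - 1) h.
Proof.
move=> l t l1; rewrite le_eqVlt => /predU1P[<-|]; last exact: SC_growth_gt0.
by rewrite !mulr0 SC_at0 !mulr0 lexx.
Qed.

Lemma SC_homo s t : 0 <= s -> s <= t -> h s <= h t.
Proof. by apply: growth_homo SC_growth h_ge0 SC_at0 _ _; rewrite subr_ge0 ltW. Qed.

Local Notation H := (primitive h).

Lemma prim_is_derive t : 0 < t -> is_derive t 1 H (h t).
Proof.
move=> t0.
have := primitive_is_derive (C1_half_line_continuous Ch) t; rewrite ger0_norm ?ltW//.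
apply: near_eq_is_derive; near=> s; rewrite -primitive_ge0E// ltW//.
by near: s; exact: lt_nbhsr.
Unshelve. all: by end_near. Qed.

Let Hc := primitive (fun s => h `|s|).

Let Hc_continuous : continuous Hc.
Proof. exact: primitive_continuous (C1_half_line_continuous Ch). Qed.

Let HcE s : 0 <= s -> Hc s = H s. Proof. by move=> s0; rewrite /Hc -primitive_ge0E. Qed.

Lemma prim_within a b : 0 <= a -> {within `[a, b], continuous H}.
Proof. by move=> a0; exact: (eq_within_continuous a0 Hc_continuous HcE). Qed.

Lemma prim_mean_value a b : 0 <= a -> a <= b ->
  exists2 c, a <= c <= b & H b - H a = h c * (b - a).
Proof.
move=> a0 ab; have [c [? _] ?] := mean_value ab
  (fun x Hx => @prim_is_derive x (le_lt_trans a0 (proj1 (andP Hx)))) (prim_within a0).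
by exists c.
Qed.

(** The density is nondecreasing, so the primitive lies above its tangents. This subgradient form is
    what the variational argument uses; it needs no separate treatment of 0. *)
Lemma prim_convex a b : 0 <= a -> 0 <= b -> h a * (b - a) <= H b - H a.
Proof.
move=> a0 b0; have [ab|/ltW ba] := leP a b.
  have [c /andP[ac _] ->] := prim_mean_value a0 ab.
  by rewrite ler_wpM2r ?subr_ge0// SC_homo.
have [c /andP[bc ca] E] := prim_mean_value b0 ba.
rewrite -[leRHS]opprB E -mulrN opprB -subr_ge0 -mulrBl.
rewrite mulr_le0//; first by rewrite subr_le0 SC_homo// (le_trans b0).
by rewrite subr_le0.
Qed.

Lemma prim_ge0 t : 0 <= t -> 0 <= H t.
Proof.
by move=> t0; have := prim_convex (lexx 0) t0; rewrite SC_at0 mul0r primitive0 subr0.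
Qed.

Lemma prim_le t : 0 <= t -> H t <= t * h t.
Proof.
move=> t0; have := prim_convex t0 (lexx 0); rewrite primitive0 !sub0r mulrN lerN2.
by rewrite mulrC.
Qed.

Let dcomp_scale l t : 0 < l -> 0 < t -> is_derive t 1 (fun s => H (l * s)) (l * h (l * t)).
Proof.
move=> l0 t0.
have dm : is_derive t 1 (fun s : R => l * s) l.
  by apply: is_derive_eq; rewrite scaler1.
have lt0 : 0 < l * t by rewrite mulr_gt0.
have := @is_derive1_comp _ H (fun s : R => l * s) t _ _ (prim_is_derive lt0) dm.
by rewrite mulrC.
Qed.

Let scale_continuous l : continuous (fun s => Hc (l * s)).
Proof.
move=> s; apply: (cvg_comp _ _ (@mulrl_continuous R l s)); exact: Hc_continuous.
Qed.

(** For fixed [l] both sides vanish at [t = 0], so it suffices to compare derivatives in [t]; after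
    division by [l] these are the growth bounds of the density, with exponents lower by one. *)
Lemma prim_growth : growth p q H.
Proof.
move=> l t l1 t0.
have l0 : 0 < l by exact: lt_le_trans ltr01 l1.
have dH c x (x0 : 0 < x) : is_derive x 1 (fun s => c * H s) (c * h x).
  have := prim_is_derive x0 => ?; exact: is_derive_eq.
have cH c : continuous (fun s => c * Hc s).
  by move=> s; apply: cvgM; [exact: cvg_cst|exact: Hc_continuous].
have lH s : 0 <= s -> Hc (l * s) = H (l * s) by move=> s0; rewrite HcE// mulr_ge0// ltW.
have le c : 0 < c -> l `^ c = l * l `^ (c - 1) by move=> c0; rewrite mulr_powRB1// ltW.
apply/andP; split; rewrite -subr_ge0.
  apply: (@ge0_derive_ge0 (fun s => H (l * s) - l `^ p * H s)
   (fun s => l * h (l * s) - l `^ p * h s)) => //.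
  - by rewrite mulr0 primitive0 mulr0 subr0.
  - by move=> x x0; have := dcomp_scale l0 x0; have := dH (l `^ p) x x0 => ? ?; exact: is_deriveB.
  - apply: (@eq_within_continuous _ (fun s => Hc (l * s) - l `^ p * Hc s)) => //.
      by move=> s; apply: cvgB; [exact: scale_continuous|exact: cH].
    by move=> s s0; rewrite lH// HcE.
  - move=> x x0; rewrite le ?(lt_trans ltr01)// -mulrA -mulrBr mulr_ge0 ?(ltW l0)//.
    by rewrite subr_ge0; have /andP[] := SC_growth l1 (ltW x0).
apply: (@ge0_derive_ge0 (fun s => l `^ q * H s - H (l * s))
   (fun s => l `^ q * h s - l * h (l * s))) => //.
- by rewrite mulr0 primitive0 mulr0 subr0.
- by move=> x x0; have := dcomp_scale l0 x0; have := dH (l `^ q) x x0 => ? ?; exact: is_deriveB.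
- apply: (@eq_within_continuous _ (fun s => l `^ q * Hc s - Hc (l * s))) => //.
    by move=> s; apply: cvgB; [exact: cH|exact: scale_continuous].
  by move=> s s0; rewrite lH// HcE.
- have q0 : 0 < q by have /andP[? ?] := SC ltr01; have := p1; lra.
  move=> x x0; rewrite le// -mulrA -mulrBr mulr_ge0 ?(ltW l0)//.
  by rewrite subr_ge0; have /andP[] := SC_growth l1 (ltW x0).
Qed.

(** The difference vanishes at 0 and has derivative [(q - 1) h - s h'], which (SC) makes
    nonnegative. *)
Lemma prim_ge t : 0 <= t -> t * h t <= q * H t.
Proof.
move=> t0; rewrite -subr_ge0.
apply: (@ge0_derive_ge0 (fun s => q * H s - s * h s)
   (fun s => q * h s - (h s + s * derive_half_line h s))) => //.
- by rewrite primitive0 mulr0 mul0r subr0.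
- move=> x x0; have := prim_is_derive x0; have := C1_half_line_derive Ch x0 => ? ?.
  apply: is_derive_eq; rewrite /GRing.scale/=; ring.
- apply: (@eq_within_continuous _ (fun s => q * Hc s - s * h `|s|)) => //.
    move=> s; apply: cvgB; first by apply: cvgM; [exact: cvg_cst|exact: Hc_continuous].
    by apply: cvgM; [exact: cvg_id|exact: C1_half_line_continuous].
  by move=> s s0; rewrite HcE// ger0_norm.
- move=> x x0; have /andP[_] := SC x0; rewrite ler_pdivrMr ?SC_gt0//; lra.
Qed.

End density.

End real_functions.

(** * The function whose inverse is [t^(-alpha)] times the inverse of [G] *)

Section inverse_relation.
Context {R : realType}.
Variables (G P : R -> R) (p q alpha : R).
Hypothesis p0 : 0 < p.
Hypothesis gG : growth p q G.
Hypothesis G0 : G 0 = 0.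
Hypothesis G1 : 0 < G 1.
Hypothesis cG : exists2 Gc : R -> R, continuous Gc & forall t, 0 <= t -> Gc t = G t.
Hypothesis P_homo : forall s t, 0 <= s -> s <= t -> P s <= P t.
Hypothesis P0 : P 0 = 0.
Hypothesis Py : P t @[t --> +oo] --> +oo.
Hypothesis a0 : 0 < alpha.
Hypothesis aq : alpha * q < 1.
Hypothesis inv : forall t : R, 0 < t ->
  Phi_inverse P t = t `^ (- alpha) * Phi_inverse G t.
Implicit Types (a b s t v l y : R).

Let l_gt0 l : 1 <= l -> 0 < l. Proof. exact: lt_le_trans. Qed.

Lemma growth_gt0 t : 0 < t -> 0 < G t.
Proof.
move=> t0; have [t1|/ltW t1] := leP 1 t.
  have := gG t1 ler01; rewrite mulr1 => /andP[+ _]; apply: lt_le_trans.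
  by rewrite mulr_gt0 ?powR_gt0.
have t01 : 0 < t <= 1 by rewrite t0.
have := growth_shrink gG t01 ler01; rewrite mulr1 => /andP[+ _]; apply: lt_le_trans.
by rewrite mulr_gt0 ?powR_gt0.
Qed.

Lemma growth_ge0 t : 0 <= t -> 0 <= G t.
Proof. by rewrite le_eqVlt => /predU1P[<-|/growth_gt0/ltW//]; rewrite G0. Qed.

Lemma growth_strict s t : 0 <= s -> s < t -> G s < G t.
Proof.
rewrite le_eqVlt => /predU1P[<- t0|s0 st]; first by rewrite G0 growth_gt0.
have l1 : 1 < t / s by rewrite ltr_pdivlMr// mul1r.
have /andP[+ _] := gG (ltW l1) (ltW s0); rewrite divfK ?gt_eqF//; apply: lt_le_trans.
rewrite ltr_pMl ?growth_gt0//.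
have P1 : 1 `^ p = 1 :> R by rewrite powR1.
rewrite -[ltLHS]P1 gt0_ltr_powR// ?nnegrE//.
by rewrite (le_trans ler01)// ltW.
Qed.

Lemma growth_surj v : 0 < v -> exists2 a, 0 < a & G a = v.
Proof.
move=> v0.
pose T : R := Num.max 1 ((v / G 1) `^ p^-1).
have T1 : 1 <= T by rewrite le_max lexx.
have vT : v <= G T.
  have /andP[+ _] := gG T1 ler01; rewrite mulr1; apply: le_trans.
  rewrite -ler_pdivrMr//.
  have vG : 0 <= v / G 1 by rewrite divr_ge0 ?(ltW v0) ?(ltW G1).
  rewrite -[leLHS](powRK p0 vG); apply: powR_homo; rewrite ?powR_ge0 ?(ltW p0)//.
  by rewrite le_max lexx orbT.
have T0 : 0 <= T by exact: le_trans ler01 T1.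
have [Gc cGc GcE] := cG.
have [|c] := @IVT R Gc 0 T v T0 (continuous_subspaceT cGc).
  by rewrite !GcE// G0 ge_min le_max (ltW v0) vT orbT.
rewrite in_itv/= => /andP[c0 _]; rewrite GcE// => cv; exists c => //.
rewrite lt_neqAle c0 andbT eq_sym; apply/eqP => c00.
by move: v0; rewrite -cv c00 G0 ltxx.
Qed.

Lemma Phi_inverseK a : 0 < a -> Phi_inverse G (G a) = a.
Proof.
move=> a_gt0; rewrite /Phi_inverse.
set S := [set s | _]; have Sa : S a by split => //; exact: ltW.
have lb : lbound S a.
  move=> s [s0 Gs]; rewrite leNgt; apply/negP => sa.
  by have := growth_strict s0 sa; rewrite ltNge Gs.
apply/eqP; rewrite eq_le; apply/andP; split.
  by apply: ge_inf => //; exists a.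
by apply: lb_le_inf => //; exists a.
Qed.

(** By the relation between the inverses at [t = G a], this is the inverse of [P] at [G a]. *)
Definition inv_arg a := a * G a `^ (- alpha).

Lemma inv_arg_gt0 a : 0 < a -> 0 < inv_arg a.
Proof. by move=> a1; rewrite mulr_gt0 ?powR_gt0 ?growth_gt0. Qed.

Lemma inv_arg_scale l a : 1 <= l -> 0 < a ->
  l `^ (1 - alpha * q) * inv_arg a <= inv_arg (l * a) <= l `^ (1 - alpha * p) * inv_arg a.
Proof.
move=> l1 a_gt0; have l0 := l_gt0 l1.
have /andP[A B] := gG l1 (ltW a_gt0).
have E r : l `^ (1 - alpha * r) * inv_arg a = l * a * (l `^ r * G a) `^ (- alpha).
  rewrite /inv_arg powRM ?powR_ge0 ?growth_ge0 ?ltW// -powRrM mulrN [r * _]mulrC.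
  rewrite powRD ?(gt_eqF l0) ?implybT// powRr1 ?ltW//; ring.
have la : 0 < l * a by rewrite mulr_gt0.
have K (u v : R) : 0 < u -> u <= v -> v `^ (- alpha) <= u `^ (- alpha).
  move=> u0 uv; rewrite !powRN lef_pV2 ?posrE ?powR_gt0 ?(lt_le_trans u0)//.
  by rewrite ge0_ler_powR ?nnegrE ?(ltW a0) ?(ltW u0)// (le_trans (ltW u0)).
rewrite (E q) (E p) /inv_arg; apply/andP; split; (apply: ler_wpM2l; first exact: ltW); apply: K.
- exact: growth_gt0.
- exact: B.
- by rewrite mulr_gt0 ?powR_gt0 ?growth_gt0.
- exact: A.
Qed.

Lemma inv_arg_strict a b : 0 < a -> a < b -> inv_arg a < inv_arg b.
Proof.
move=> a_gt0 ab.
have l1 : 1 < b / a by rewrite ltr_pdivlMr// mul1r.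
have /andP[+ _] := inv_arg_scale (ltW l1) a_gt0; rewrite divfK ?gt_eqF//; apply: lt_le_trans.
rewrite ltr_pMl ?inv_arg_gt0//.
have P1 : 1 `^ (1 - alpha * q) = 1 :> R by rewrite powR1.
by rewrite -[ltLHS]P1 gt0_ltr_powR// ?nnegrE// ?subr_gt0// (le_trans ler01)// ltW.
Qed.

Let inv' a : 0 < a -> Phi_inverse P (G a) = inv_arg a.
Proof. by move=> a1; rewrite inv ?growth_gt0// Phi_inverseK// mulrC. Qed.

Let hasinf v : has_inf [set s | 0 <= s /\ v <= P s].
Proof.
split; last by exists 0 => s [].
have /cvgryPge/(_ v) := Py; case=> M [Mr HM].
exists (Num.max 0 (M + 1)); split; first by rewrite le_max lexx.
by apply: HM; rewrite lt_max ltrDl ltr01 orbT.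
Qed.

Let gt_inv a s : 0 < a -> inv_arg a < s -> G a <= P s.
Proof.
move=> a1; rewrite -inv'// => /(inf_lt (hasinf (G a)).1)[s' [s'0 Gs'] s's].
by apply: le_trans Gs' _; apply: P_homo => //; exact: ltW.
Qed.

Let lt_inv a s : 0 < a -> 0 <= s -> s < inv_arg a -> P s < G a.
Proof.
move=> a1 s0; rewrite -inv'// ltNge => sa; rewrite ltNge; apply: contra sa => Gs.
by apply: ge_inf => //; exact: (hasinf _).2.
Qed.

Lemma P_ge0 s : 0 <= s -> 0 <= P s.
Proof. by move=> s0; rewrite -P0 P_homo. Qed.

(** The inverse of [P] is an infimum, so it only tells that [P s < G a] below [inv_arg a] and
    [G a <= P s] strictly above it. The point [inv_arg a] itself is decided by a level [y] strictly
    between [P s] and [G a], attained by [G] at some [b < a]. *)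
Lemma P_ltP a s : 0 < a -> 0 <= s -> (P s < G a) = (s < inv_arg a).
Proof.
move=> a_gt0 s0; apply/idP/idP; last exact: lt_inv.
move=> PG; pose y := (P s + G a) / 2.
have y0 : 0 < y by rewrite divr_gt0// ltr_wpDl ?P_ge0// growth_gt0.
have [b b0 Gb] := growth_surj y0.
have yP : P s < y by rewrite /y; have := PG; lra.
have yG : y < G a by rewrite /y; have := PG; lra.
have ba : b < a.
  rewrite ltNge; apply/negP => ab.
  by have := growth_homo (ltW p0) gG growth_ge0 G0 (ltW a_gt0) ab; rewrite Gb leNgt yG.
apply: le_lt_trans (inv_arg_strict b0 ba).
by rewrite leNgt; apply/negP => /(gt_inv b0); rewrite Gb leNgt yP.
Qed.

Lemma P_leP a s : 0 < a -> 0 <= s -> (G a <= P s) = (inv_arg a <= s).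
Proof. by move=> a_gt0 s0; rewrite leNgt P_ltP// -leNgt. Qed.

(** [P] is not assumed continuous. It cannot jump because [G] is onto: for each [e > 0] the value
    [G a + e] is [G b] with [b > a], and [inv_arg a < inv_arg b]. *)
Lemma P_inv_arg a : 0 < a -> P (inv_arg a) = G a.
Proof.
move=> a_gt0; have n0 := ltW (inv_arg_gt0 a_gt0).
apply/eqP; rewrite eq_le P_leP// lexx andbT.
apply/ler_addgt0Pr => e e0.
have v0 : 0 < G a + e by rewrite addr_gt0 ?growth_gt0.
have [b b0 Gb] := growth_surj v0.
rewrite -Gb ltW// P_ltP// inv_arg_strict// ltNge; apply/negP => ba.
by have := growth_homo (ltW p0) gG growth_ge0 G0 (ltW b0) ba; rewrite Gb -subr_ge0; lra.
Qed.

Hypothesis pq : p <= q.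

Let ap : alpha * p < 1.
Proof. by apply: le_lt_trans aq; rewrite ler_pM2l. Qed.

Lemma inverse_growth : growth (p / (1 - alpha * p)) (q / (1 - alpha * q)) P.
Proof.
move=> l s l1 s0; have l0 := l_gt0 l1.
have ls0 : 0 <= l * s by rewrite mulr_ge0 ?(ltW l0).
(* Multiplying [a] by [m] multiplies [G a] by about [m^r] and [inv_arg a] by about
   [m^(1 - alpha r)]. To scale the argument of [P] by [l] one takes [m = l^(1 / (1 - alpha r))],
   whence the exponent [r / (1 - alpha r)]. *)
have pw (r : R) : 0 < r -> alpha * r < 1 -> let m := l `^ (1 - alpha * r)^-1 in
    [/\ 1 <= m, m `^ (1 - alpha * r) = l & m `^ r = l `^ (r / (1 - alpha * r))].
  move=> r0 ar; have d0 : 0 < 1 - alpha * r by rewrite subr_gt0.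
  split.
  - have P1 : 1 `^ (1 - alpha * r)^-1 = 1 :> R by rewrite powR1.
    by rewrite -[leLHS]P1 ge0_ler_powR ?nnegrE ?invr_ge0 ?(ltW d0) ?(ltW l0).
  - by rewrite -powRrM mulVf ?gt_eqF// powRr1 ?ltW.
  - by rewrite -powRrM mulrC.
apply/andP; split.
  have [m1 mE mE'] := pw _ p0 ap; set m := _ `^ _ in m1 mE mE'.
  rewrite leNgt; apply/negP => H.
  rewrite -mE' -ltr_pdivrMl ?powR_gt0 ?l_gt0// in H.
  have [y y1 y2] : exists2 y, (m `^ p)^-1 * P (l * s) < y & y < P s.
    by exists (((m `^ p)^-1 * P (l * s) + P s) / 2); move: H; lra.
  have y0 : 0 < y.
    apply: le_lt_trans y1; rewrite mulr_ge0 ?P_ge0// invr_ge0 powR_ge0//.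
  have [a a_gt0 Ga] := growth_surj y0.
  have na : inv_arg a <= s by rewrite -P_leP// Ga ltW.
  have /andP[_ nma] := inv_arg_scale m1 a_gt0; rewrite mE in nma.
  have ma : 0 < m * a by apply: mulr_gt0 => //; exact: l_gt0.
  have : G (m * a) <= P (l * s).
    by rewrite P_leP//; apply: le_trans nma _; rewrite ler_wpM2l ?(ltW l0).
  have /andP[+ _] := gG m1 (ltW a_gt0); rewrite Ga => A B.
  have := le_trans A B; rewrite -ler_pdivlMl ?powR_gt0 ?l_gt0// => C.
  by have := lt_le_trans y1 C; rewrite ltxx.
have [m1 mE mE'] := pw _ (lt_le_trans p0 pq) aq; set m := _ `^ _ in m1 mE mE'.
rewrite leNgt; apply/negP => H.
rewrite -mE' -ltr_pdivlMl ?powR_gt0 ?l_gt0// in H.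
have [y y1 y2] : exists2 y, P s < y & y < (m `^ q)^-1 * P (l * s).
  by exists (((m `^ q)^-1 * P (l * s) + P s) / 2); move: H; lra.
have y0 : 0 < y by apply: le_lt_trans y1; exact: P_ge0.
have [a a_gt0 Ga] := growth_surj y0.
have na : s < inv_arg a by rewrite -P_ltP// Ga.
have /andP[nma _] := inv_arg_scale m1 a_gt0; rewrite mE in nma.
have ma : 0 < m * a by apply: mulr_gt0 => //; exact: l_gt0.
have : P (l * s) < G (m * a).
  by rewrite P_ltP//; apply: lt_le_trans nma; rewrite ltr_pM2l.
have /andP[_] := gG m1 (ltW a_gt0); rewrite Ga => A B.
have := lt_le_trans B A; rewrite -ltr_pdivrMl ?powR_gt0 ?l_gt0// => C.
by have := lt_trans y2 C; rewrite ltxx.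
Qed.

(** [P] equals [G 1] at [inv_arg 1 = G(1)^(-alpha)], a point within a factor [C^alpha] of 1. Moving
    from there to 1 costs [C^(alpha q / (1 - alpha q))], and [G 1] itself the last factor [C]. *)
Lemma inverse_at1 C : 1 <= C -> C^-1 <= G 1 <= C ->
  let D := C `^ (alpha * (q / (1 - alpha * q)) + 1) in D^-1 <= P 1 <= D.
Proof.
move=> C1 /andP[CG GC].
have C0 := l_gt0 C1.
have g := inverse_growth; set q1 := q / (1 - alpha * q) in g *.
have E : C `^ (alpha * q1 + 1) = (C `^ alpha) `^ q1 * C.
  by rewrite -powRrM powRD ?(gt_eqF C0) ?implybT// powRr1 ?ltW.
have n1 : inv_arg 1 = (G 1 `^ alpha)^-1 by rewrite /inv_arg mul1r powRN.
have Gp : 0 < G 1 `^ alpha by rewrite powR_gt0.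
have P1 (z : R) : 1 `^ z = 1 :> R by rewrite powR1.
have Ca1 : 1 <= C `^ alpha.
  by rewrite -[leLHS](P1 alpha) ge0_ler_powR ?nnegrE ?(ltW a0) ?(ltW C0).
have PG := P_inv_arg ltr01.
have n0 := ltW (inv_arg_gt0 ltr01).
have up : 1 <= C `^ alpha * inv_arg 1.
  by rewrite n1 ler_pdivlMr// mul1r ge0_ler_powR ?nnegrE ?(ltW a0) ?(ltW C0) ?(ltW G1).
have dn : (C `^ alpha)^-1 * inv_arg 1 <= 1.
  rewrite n1 -invfM invf_le1; last by rewrite mulr_gt0// l_gt0.
  rewrite -powRM ?(ltW C0) ?(ltW G1)// -[leLHS](P1 alpha) ge0_ler_powR ?nnegrE ?(ltW a0)//.
    by rewrite mulr_ge0 ?(ltW C0) ?(ltW G1).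
  by rewrite -ler_pdivrMl// mulr1.
apply/andP; split.
  apply: (@le_trans _ _ (P ((C `^ alpha)^-1 * inv_arg 1))); last first.
    by apply: P_homo dn; rewrite mulr_ge0// invr_ge0 powR_ge0.
  have i01 : 0 < (C `^ alpha)^-1 <= 1 by rewrite invr_gt0 l_gt0//= invf_le1// l_gt0.
  have /andP[+ _] := growth_shrink g i01 n0; apply: le_trans.
  rewrite PG E invfM powRV ?powR_gt0//.
  by rewrite ler_wpM2l// invr_ge0 powR_ge0.
apply: (@le_trans _ _ (P (C `^ alpha * inv_arg 1))); first exact: P_homo.
have /andP[_] := g _ _ Ca1 n0; move=> /le_trans; apply.
by rewrite PG E ler_wpM2l ?powR_ge0.
Qed.

End inverse_relation.

(** * The derivative of a function of controlled growth *)

Section growth_derivative.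
Context {R : realType}.
Variables (P : R -> R) (p q : R).
Hypothesis gP : growth p q P.
Hypothesis q0 : 0 < q.
Hypothesis P_ge0 : forall t, 0 <= t -> 0 <= P t.

Lemma powR1D_le (e : R) : 0 <= e <= 1 -> (1 + e) `^ q - 1 <= q * expR q * e.
Proof.
move=> /andP[e0 e1].
have e10 : 0 < 1 + e by rewrite ltr_wpDr.
rewrite /powR gt_eqF//.
have l0 : ln (1 + e) <= e by apply: le_ln1Dx; lra.
have le : expR (q * ln (1 + e)) <= expR (q * e) by rewrite ler_expR ler_wpM2l ?(ltW q0).
have qe0 : 0 <= q * e by rewrite mulr_ge0 ?(ltW q0).
have h2 : expR (q * e) - 1 <= q * e * expR (q * e).
  have := expR_ge1Dx (- (q * e)); rewrite expRN => h.
  have : (1 - q * e) * expR (q * e) <= 1 by rewrite -ler_pdivlMr ?expR_gt0// mul1r.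
  lra.
have h3 : expR (q * e) <= expR q by rewrite ler_expR ler_piMr ?(ltW q0).
have h4 : q * e * expR (q * e) <= q * e * expR q by rewrite ler_wpM2l.
lra.
Qed.

(** Turns a growth condition stated with the density [psi] into one with [Psi t / t], without
    differentiability of [Psi]: every difference quotient to the right of [t] obeys the bound. *)
Lemma derive_half_line_le (t : R) : 0 < t ->
  derive_half_line P t <= q * expR q * (P t / t).
Proof.
move=> t0; set K := _ * (P t / t).
have K0 : 0 <= K by rewrite !mulr_ge0 ?(ltW q0) ?expR_ge0 ?invr_ge0 ?(ltW t0) ?P_ge0 ?(ltW t0).
rewrite /derive_half_line.
have [[l hl]|ncvg] := pselect (exists l : R,
  diff_quot P t s @[s --> within `[0, +oo[%classic t^'] --> l); last first.
  (* Where the quotient has no limit, [lim] is the default point 0, and the bound holds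
     trivially. *)
  rewrite /lim /lim_in getPN; first exact: K0.
  by move=> /= l hl; apply: ncvg; exists l.
have {}hl := (cvgP l hl : cvg _).
set l' := lim _ in hl *.
apply/ler_addgt0Pr => e e0.
have /cvgrPdist_lt /(_ _ e0) := hl.
rewrite /within/= !near_withinE => -[r /= r0 hr].
(* One test point [s = (1 + d) t] suffices: [d <= 1] for [powR1D_le], and [d t < r] to be within
   reach of the limit. *)
pose d := Num.min 1 (r / (2 * t)).
have d0 : 0 < d by rewrite lt_min ltr01 divr_gt0// mulr_gt0.
have d1 : d <= 1 by rewrite ge_min lexx.
have dr : d * t < r.
  have : d <= r / (2 * t) by rewrite ge_min lexx orbT.
  rewrite ler_pdivlMr ?mulr_gt0//; have := r0; lra.
have dt0 : 0 < d * t by rewrite mulr_gt0.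
pose s := (1 + d) * t.
have st : s - t = d * t by rewrite /s; ring.
have sb : ball_ (Num.Def.normr) t r s by rewrite /ball_/= distrC st gtr0_norm.
have sn : s != t by rewrite -subr_eq0 st gt_eqF.
have si : s \in `[0, +oo[ by rewrite in_itv/= andbT /s mulr_ge0 ?addr_ge0 ?ler01 ?(ltW d0) ?(ltW t0).
have := hr _ sb sn si; rewrite /diff_quot st => H.
have Q : (P s - P t) / (d * t) <= K.
  rewrite ler_pdivrMr//.
  have d01 : 0 <= d <= 1 by rewrite (ltW d0).
  have pd := powR1D_le d01.
  have dd1 : 1 <= 1 + d by rewrite lerDl ltW.
  have /andP[_ up] := gP dd1 (ltW t0); rewrite -/s in up.
  have -> : K * (d * t) = q * expR q * d * P t by rewrite /K; field; rewrite gt_eqF.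
  have := ler_wpM2r (P_ge0 (ltW t0)) pd; have := up; lra.
move: H; rewrite ltr_norml => /andP[H1 H2]; have := Q; lra.
Qed.

End growth_derivative.

(** * Finite-dimensional mountain pass *)

Section compact_uniform.
Context {R : realType}.

(** Heine-Cantor with only one of the two points in [K], since a descent step may leave the compact
    strip. *)
Lemma compact_uniformly_continuous (V W : normedModType R) (F : V -> W) (K : set V) :
  continuous F -> compact K -> forall e : R, 0 < e ->
  exists2 d : R, 0 < d & forall x y, K x -> `|x - y| < d -> `|F x - F y| < e.
Proof.
move=> cF /compact_near_coveringP cK e e0.
have e20 : 0 < e / 2 by rewrite divr_gt0.
have := cK R (0^'+) (fun d x => forall y, `|x - y| < d -> `|F x - F y| < e) _ _.
case.
  move=> x Kx.
  have /cvgrPdist_lt /(_ _ e20) := cF x.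
  move=> /nbhs_ballP[r /= r0 Hr].
  exists (ball x (r / 2), [set d : R | d < r / 2]) => /=.
    split; first by apply: nbhsx_ballx; rewrite divr_gt0.
    by apply: nbhs_right_lt; rewrite divr_gt0.
  move=> [x' d] /= [x'x dr] y x'y.
  rewrite -ball_normE/= in Hr x'x.
  have h1 : `|F x - F x'| < e / 2.
    by apply: Hr => /=; apply: lt_le_trans x'x _; rewrite ler_pdivrMr// ler_pMr// ler1n.
  have h2 : `|F x - F y| < e / 2.
    apply: Hr => /=; rewrite -[x - y](subrKA x') (le_lt_trans (ler_normD _ _))//.
    by rewrite [r]splitr ltrD// (lt_trans x'y).
  rewrite -[F x' - _](subrKA (F x)) (le_lt_trans (ler_normD _ _))// [e]splitr ltrD//.
  by rewrite distrC.
move=> d /= d0 Hd; exists (d / 2); first by rewrite divr_gt0.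
move=> x y Kx xy; apply: (Hd (d / 2)) => //=; last by rewrite divr_gt0.
by rewrite sub0r normrN gtr0_norm ?divr_gt0// ltr_pdivrMr// ltr_pMr// ltr1n.
Qed.

End compact_uniform.

(** * The Euclidean norm and its comparison with the sup norm *)

Section euclid.
Context {R : realType} {N : nat}.
Implicit Types (u v w : 'rV[R]_N) (a : R).

Lemma dotvC u v : dotv u v = dotv v u.
Proof. by apply: eq_bigr => i _; rewrite mulrC. Qed.

Lemma dotvDl u v w : dotv (u + v) w = dotv u w + dotv v w.
Proof. by rewrite -big_split; apply: eq_bigr => i _; rewrite mxE mulrDl. Qed.

Lemma dotvZl a u v : dotv (a *: u) v = a * dotv u v.
Proof. by rewrite /dotv mulr_sumr; apply: eq_bigr => i _; rewrite mxE mulrA. Qed.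

Lemma dotvDr u v w : dotv u (v + w) = dotv u v + dotv u w.
Proof. by rewrite dotvC dotvDl !(dotvC u). Qed.

Lemma dotvZr a u v : dotv u (a *: v) = a * dotv u v.
Proof. by rewrite dotvC dotvZl dotvC. Qed.

Lemma dotvNl u v : dotv (- u) v = - dotv u v.
Proof. by rewrite -scaleN1r dotvZl mulN1r. Qed.

Lemma dotvNr u v : dotv u (- v) = - dotv u v.
Proof. by rewrite dotvC dotvNl dotvC. Qed.

Lemma dotvBl u v w : dotv (u - v) w = dotv u w - dotv v w.
Proof. by rewrite dotvDl dotvNl. Qed.

Lemma dotvBr u v w : dotv u (v - w) = dotv u v - dotv u w.
Proof. by rewrite dotvDr dotvNr. Qed.

Lemma dotv0l v : dotv 0 v = 0.
Proof. by rewrite -(scale0r 0) dotvZl mul0r. Qed.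

Lemma dotvv_ge0 u : 0 <= dotv u u.
Proof. by apply: sumr_ge0 => i _; rewrite -expr2 sqr_ge0. Qed.

Lemma dotvv_eq0 u : (dotv u u == 0) = (u == 0).
Proof.
rewrite /dotv psumr_eq0; last by move=> i _; rewrite -expr2 sqr_ge0.
apply/allP/eqP => [H|-> i _]; last by rewrite mxE mul0r eqxx.
apply/rowP => i; have := H i; rewrite mem_index_enum => /(_ isT).
by rewrite mulf_eq0 orbb mxE => /eqP.
Qed.

Lemma enorm_ge0 u : 0 <= enorm u. Proof. exact: sqrtr_ge0. Qed.

Lemma enorm_sqr u : enorm u ^+ 2 = dotv u u.
Proof. by rewrite sqr_sqrtr// dotvv_ge0. Qed.

Lemma enorm0 : enorm (0 : 'rV[R]_N) = 0.
Proof. by rewrite /enorm dotv0l sqrtr0. Qed.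

Lemma enorm_eq0 u : (enorm u == 0) = (u == 0).
Proof. by rewrite sqrtr_eq0 le_eqVlt ltNge dotvv_ge0 orbF dotvv_eq0. Qed.

Lemma enormZ a u : enorm (a *: u) = `|a| * enorm u.
Proof. by rewrite /enorm dotvZl dotvZr mulrA -expr2 sqrtrM ?sqr_ge0// sqrtr_sqr. Qed.

Lemma enormN u : enorm (- u) = enorm u.
Proof. by rewrite -scaleN1r enormZ normrN1 mul1r. Qed.

Lemma cauchy_schwarz u v : `|dotv u v| <= enorm u * enorm v.
Proof.
have [->|v0] := eqVneq v 0; first by rewrite dotvC dotv0l normr0 mulr_ge0 ?enorm_ge0.
have V0 : 0 < dotv v v by rewrite lt_neqAle eq_sym dotvv_eq0 v0 dotvv_ge0.
rewrite -ler_sqr ?nnegrE ?mulr_ge0 ?enorm_ge0// exprMn !enorm_sqr real_normK ?num_real//.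
have := dotvv_ge0 (dotv v v *: u - dotv u v *: v).
rewrite dotvBl !dotvBr !dotvZl !dotvZr (dotvC v u) => H.
have {}H : 0 <= dotv v v * (dotv u u * dotv v v - dotv u v ^+ 2).
  by apply: le_trans H _; rewrite le_eqVlt; apply/orP; left; apply/eqP; ring.
by rewrite pmulr_rge0// subr_ge0 in H.
Qed.

Lemma dotv_le u v : dotv u v <= enorm u * enorm v.
Proof. exact: le_trans (ler_norm _) (cauchy_schwarz _ _). Qed.

Lemma enormD u v : enorm (u + v) <= enorm u + enorm v.
Proof.
rewrite -ler_sqr ?nnegrE ?addr_ge0 ?enorm_ge0// sqrrD !enorm_sqr dotvDl !dotvDr (dotvC v u).
have := dotv_le u v; lra.
Qed.

Lemma enormB u v : enorm (u - v) <= enorm u + enorm v.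
Proof. by rewrite -(enormN v) enormD. Qed.

Lemma norm_coord u i : `|u 0 i| <= `|u|.
Proof. by rewrite [leRHS]/Num.norm /= mx_normrE; apply/bigmax_geP; right => /=; exists (0, i). Qed.

Lemma norm_le_enorm u : `|u| <= enorm u.
Proof.
rewrite [leLHS]/Num.norm /= mx_normrE; apply/bigmax_leP; split; first exact: enorm_ge0.
move=> [j i] _ /=; rewrite (ord1 j).
rewrite -ler_sqr ?nnegrE ?enorm_ge0// enorm_sqr real_normK ?num_real//.
by rewrite /dotv (bigD1 i)//= expr2 lerDl sumr_ge0// => k _; rewrite -expr2 sqr_ge0.
Qed.

Lemma enorm_le_norm u : enorm u <= Num.sqrt N%:R * `|u|.
Proof.
rewrite -ler_sqr ?nnegrE ?mulr_ge0 ?enorm_ge0 ?sqrtr_ge0// enorm_sqr exprMn sqr_sqrtr//.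
rewrite -[N in N%:R]card_ord -sum1_card natr_sum mulr_suml; apply: ler_sum => i _.
by rewrite mul1r -expr2 -(real_normK (num_real _)) ler_sqr ?nnegrE// norm_coord.
Qed.

Lemma dotv_norm_le u v : `|dotv u v| <= N%:R * `|u| * `|v|.
Proof.
apply: le_trans (ler_norm_sum _ _ _) _.
rewrite -[N in N%:R]card_ord -sum1_card natr_sum !mulr_suml; apply: ler_sum => i _.
by rewrite mul1r normrM ler_pM// norm_coord.
Qed.

Lemma row_coord_continuous (i : 'I_N) : continuous (fun u : 'rV[R]_N => u 0 i).
Proof. exact: coord_continuous. Qed.

Lemma continuous_rowP (T : topologicalType) (f : T -> 'rV[R]_N) :
  (forall i, continuous (fun t => f t 0 i)) -> continuous f.
Proof.
move=> cf t; apply/cvgrPdist_lt => e e0.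
have H : \forall s \near t, forall i, `|f t 0 i - f s 0 i| < e.
  apply: filter_forall => i.
  by have /cvgrPdist_lt /(_ _ e0) := cf i t.
apply: filterS H => s Hs.
rewrite [ltLHS]/Num.norm /= mx_normrE; apply/bigmax_ltP; split => // -[j i] _ /=.
by rewrite (ord1 j) !mxE.
Qed.

Lemma dotv_continuous (T : topologicalType) (f h : T -> 'rV[R]_N) :
  continuous f -> continuous h -> continuous (fun t => dotv (f t) (h t)).
Proof.
move=> cf ch t; rewrite /dotv.
rewrite /continuous_at.
apply: cvg_big; first exact: add_continuous.
move=> i _; apply: cvgM.
  apply: (cvg_comp f (fun u : 'rV[R]_N => u 0 i) (cf t)); exact: coord_continuous.
apply: (cvg_comp h (fun u : 'rV[R]_N => u 0 i) (ch t)); exact: coord_continuous.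
Qed.

End euclid.

Section mountain_pass.
Context {R : realType} {k : nat}.
Variables (J Phi : 'rV[R]_k -> R) (dJ : 'rV[R]_k -> 'rV[R]_k) (e : 'rV[R]_k).
Variables (rho sigma M B : R).
Hypothesis rho0 : 0 < rho.
Hypothesis cJ : continuous J.
Hypothesis cdJ : continuous dJ.
Hypothesis J_mean_value : forall c d, exists2 s : R, 0 <= s <= 1 &
  J (c + d) - J c = dotv (dJ (c + s *: d)) d.
Hypothesis J_bounded : forall c, 0 <= J c -> `|c| <= B.
Hypothesis cPhi : continuous Phi.
Hypothesis Phi_between : Phi 0 < sigma < Phi e.
Hypothesis ridge : forall c, Phi c = sigma -> rho <= J c.
Hypothesis J0 : J 0 <= 0.
Hypothesis Je : J e <= 0.
Hypothesis J_top : forall t : R, 0 <= t <= 1 -> J (t *: e) <= M.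

Let K := [set c | rho / 2 <= J c <= M].

Let K_compact : compact K.
Proof.
apply: bounded_closed_compact.
  exists B; split; first exact: num_real.
  move=> x Bx c /andP[Kc _]; apply: le_trans (ltW Bx); apply: J_bounded.
  by apply: le_trans Kc; rewrite divr_ge0// ltW.
have -> : K = J @^-1` `[rho / 2, M] by apply/seteqP; split => c /=; rewrite in_itv.
by apply: preimage_closed => //; exact: interval_closed.
Qed.

(** A cut-off with slope [4 / rho]: it rises from 0 at [rho / 2] to 1 at [3 rho / 4]. Points of
    nonpositive energy, in particular both ends of the path, do not move. *)
Let chi (t : R) := Num.min 1 (Num.max 0 ((t - rho / 2) * (4 / rho))).

Let chi01 t : 0 <= chi t <= 1.
Proof. by rewrite /chi le_min ler01 le_max lexx ge_min lexx. Qed.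

Let chi_lo t : t <= rho / 2 -> chi t = 0.
Proof.
move=> tr; rewrite /chi (_ : Num.max _ _ = 0) ?min_r//; apply/max_idPl.
by rewrite mulr_le0_ge0 ?subr_le0// divr_ge0// ltW.
Qed.

Let chi_hi t : 3 * rho / 4 <= t -> chi t = 1.
Proof.
move=> tr; rewrite /chi; apply/min_idPl; rewrite le_max; apply/orP; right.
by rewrite mulrA ler_pdivlMr// mul1r; have := tr; lra.
Qed.

Let chi_continuous : continuous chi.
Proof.
have cl : continuous (fun t : R => (t - rho / 2) * (4 / rho)).
  by move=> t; apply: cvgM; [apply: cvgB; [exact: cvg_id|exact: cvg_cst]|exact: cvg_cst].
have c0 : continuous (fun t : R => Num.max 0 ((t - rho / 2) * (4 / rho))).
  by move=> t; apply: (@continuous_max R R (fun=> 0) (fun t => (t - rho / 2) * (4 / rho)) t (cvg_cst _) (cl t)).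
by move=> t; apply: (@continuous_min R R (fun=> 1) (fun t => Num.max 0 ((t - rho / 2) * (4 / rho))) t (cvg_cst _) (c0 t)).
Qed.

(* With no critical point in the compact strip [K], a gradient step of fixed
   length lowers [J] there by a fixed amount. *)
Let descent : (forall c, K c -> dJ c != 0) ->
  exists h d : R, [/\ 0 < h, 0 < d &
   forall c, J c <= M ->
     J (c - (h * chi (J c)) *: dJ c) <= Num.max (3 * rho / 4) (J c - d)].
Proof.
move=> ncrit.
have cn2 : continuous (fun c => dotv (dJ c) (dJ c)) by exact: dotv_continuous.
have [eta eta0 Heta] : exists2 eta : R, 0 < eta & forall c, K c -> eta <= dotv (dJ c) (dJ c).
  have [K0|/set0P K0] := eqVneq K set0; first by exists 1 => // c; rewrite K0.
  have [c /set_mem Kc Hc] := compact_EVT_min K0 K_compact (continuous_subspaceT cn2).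
  exists (dotv (dJ c) (dJ c)); last by move=> c' Kc'; apply: Hc; rewrite inE.
  by rewrite lt_neqAle eq_sym dotvv_eq0 ncrit// dotvv_ge0.
have [L L0 HL] : exists2 L : R, 0 < L & forall c, K c -> `|dJ c| <= L.
  have [K0|/set0P K0] := eqVneq K set0; first by exists 1 => // c; rewrite K0.
  have [c /set_mem Kc Hc] := compact_EVT_max K0 K_compact (continuous_subspaceT cn2).
  exists (enorm (dJ c) + 1) => [|c' Kc']; first by rewrite ltr_wpDl ?enorm_ge0.
  apply: le_trans (norm_le_enorm _) _; apply: (@le_trans _ _ (enorm (dJ c))); last by rewrite lerDl.
  by rewrite ler_wsqrtr// Hc ?inE.
have kL0 : 0 < k%:R * L + 1 by rewrite ltr_wpDl// mulr_ge0// ltW.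
have ep0 : 0 < eta / 2 / (k%:R * L + 1) by rewrite !divr_gt0.
have [del del0 Hdel] := compact_uniformly_continuous cdJ K_compact ep0.
(* A step of length at most [h L = del / 2] stays where [dJ] differs little from its value at [c],
   so that its product with [dJ c] keeps half of the minimum [eta]. *)
exists (del / 2 / L), (del / 2 / L * (eta / 2)).
have h0 : 0 < del / 2 / L by rewrite !divr_gt0.
split=> //; first by rewrite mulr_gt0// divr_gt0.
move=> c cM; have [lo|hi] := leP (J c) (rho / 2).
  rewrite chi_lo// mulr0 scale0r subr0 le_max; apply/orP; left.
  by apply: le_trans lo _; have := rho0; lra.
have Kc : K c by rewrite /K/= (ltW hi).
set h := del / 2 / L in h0 *; set a := h * chi (J c).
have /andP[chi0 chi1] := chi01 (J c).
have a0 : 0 <= a by rewrite mulr_ge0// ltW.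
have ah : a <= h by rewrite ler_piMr// ltW.
have [s /andP[s0 s1]] := J_mean_value c (- (a *: dJ c)).
rewrite dotvNr dotvZr => E.
have near : `|c - (c + s *: - (a *: dJ c))| < del.
  rewrite opprD addrA subrr add0r scalerN opprK scalerA normrZ normrM (ger0_norm s0) (ger0_norm a0) -mulrA.
  apply: (@le_lt_trans _ _ (1 * (h * L))).
    by apply: ler_pM => //; [exact: mulr_ge0|apply: ler_pM => //; exact: HL].
  by rewrite mul1r /h divfK ?gt_eqF// ltr_pdivrMr// ltr_pMr// ltr1n.
have := Hdel _ _ Kc near; set g' := dJ (_ + _) in E *; set g := dJ c in E * => gg'.
have dot_lb : eta / 2 <= dotv g' g.
  have -> : dotv g' g = dotv g g - dotv (g - g') g by rewrite dotvBl; ring.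
  have h1 : dotv (g - g') g <= eta / 2.
    apply: le_trans (ler_norm _) _; apply: le_trans (dotv_norm_le _ _) _.
    apply: (@le_trans _ _ (eta / 2 / (k%:R * L + 1) * (k%:R * L))).
      rewrite -mulrA [leRHS]mulrCA; apply: ler_wpM2l; first exact: ler0n.
      by apply: ler_pM => //; [exact: ltW|exact: HL].
    rewrite mulrAC ler_pdivrMr// ler_wpM2l ?divr_ge0 ?(ltW eta0)//.
    by rewrite lerDl.
  by have := Heta _ Kc; rewrite -/g; have := h1; lra.
have dec : J (c - a *: g) <= J c - a * (eta / 2).
  have := ler_wpM2l a0 dot_lb; have := E; lra.
have [mid|hi'] := ltP (J c) (3 * rho / 4).
  rewrite le_max; apply/orP; left; apply: le_trans dec _.
  have : 0 <= a * (eta / 2) by rewrite mulr_ge0// divr_ge0// ltW.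
  by have := mid; lra.
rewrite le_max; apply/orP; right; apply: le_trans dec _.
by rewrite /a chi_hi// mulr1.
Qed.

(** The step [phi] is continuous, so the image of the segment from 0 to [e] under any iterate still
    crosses the level [sigma] of [Phi] and has a point with [J >= rho]. Without a critical point,
    [n] steps bring the whole path down to [3 rho / 4] once [n d] exceeds [M]. *)
Lemma mountain_pass : exists2 c, dJ c = 0 & rho / 2 <= J c <= M.
Proof.
apply: contrapT => nex.
have ncrit c : K c -> dJ c != 0.
  by move=> Kc; apply/eqP => d0; apply: nex; exists c.
have [h [d [h0 d0 H]]] := descent ncrit.
pose phi c := c - (h * chi (J c)) *: dJ c.
have cphi : continuous phi.
  apply: continuous_rowP => i; rewrite /phi.
  have cchi : continuous (fun c => chi (J c)).
    by move=> c; apply: continuous_comp; [exact: cJ|exact: chi_continuous].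
  have cdJi : continuous (fun c => dJ c 0 i).
    by move=> c; apply: (@continuous_comp _ _ _ dJ (fun u : 'rV[R]_k => u 0 i)); [exact: cdJ|exact: row_coord_continuous].
  rewrite (_ : (fun _ => _) = fun c : 'rV[R]_k => c 0 i - h * chi (J c) * dJ c 0 i).
    move=> c; apply: (cvgB (@row_coord_continuous R k i c)).
    apply: cvgM.
      apply: cvgM; first exact: cvg_cst.
      exact: cchi.
    exact: cdJi.
  by apply/funext => c; rewrite !mxE.
have citer n : continuous (iter n phi).
  elim: n => [|n IH] c; first exact: cvg_id.
  by apply: continuous_comp; [exact: IH|exact: cphi].
have fixphi c n : J c <= 0 -> iter n phi c = c.
  move=> Jc; elim: n => //= n ->; rewrite /phi chi_lo ?mulr0 ?scale0r ?subr0//.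
  by rewrite (le_trans Jc)// divr_ge0// ltW.
(* The end points are fixed by [phi], so [Phi] keeps its values there and the intermediate value
   theorem applies to the deformed path. *)
have hit n : exists2 t : R, 0 <= t <= 1 & rho <= J (iter n phi (t *: e)).
  have cpath : continuous (fun t : R => Phi (iter n phi (t *: e))).
  have cl : continuous (fun t : R => t *: e).
    by move=> t; apply: cvgZr_tmp; exact: cvg_id.
  have ci : continuous (fun t : R => iter n phi (t *: e)).
    by move=> t; apply: (@continuous_comp _ _ _ (fun t : R => t *: e) (iter n phi)); [exact: cl|exact: citer].
  by move=> t; apply: (@continuous_comp _ _ _ (fun t : R => iter n phi (t *: e)) Phi); [exact: ci|exact: cPhi].
have [||t] := @IVT R (fun t => Phi (iter n phi (t *: e))) 0 1 sigma ler01.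
- exact: continuous_subspaceT.
- rewrite scale0r scale1r !fixphi//.
  by have /andP[A1 A2] := Phi_between; rewrite ge_min le_max (ltW A1) (ltW A2) orbT.
  by rewrite in_itv/= => t01 /ridge; exists t.
have rhoM : rho <= M.
  by have [t t01 /le_trans] := hit 0%N; apply; exact: J_top.
have low n t : 0 <= t <= 1 -> J (iter n phi (t *: e)) <= Num.max (3 * rho / 4) (M - n%:R * d).
  move=> t01; elim: n => [|n IH].
    by rewrite mul0r subr0 le_max; apply/orP; right; exact: J_top.
  rewrite iterS.
  have JM : J (iter n phi (t *: e)) <= M.
    apply: le_trans IH _; rewrite ge_max; apply/andP; split; last first.
      by rewrite gerBl mulr_ge0// ltW.
    by have := rhoM; have := rho0; lra.
  apply: le_trans (H _ JM) _; rewrite ge_max !le_max lexx/=.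
  move: IH; rewrite le_max => /orP[lo|hi]; apply/orP; [left|right].
    by apply: le_trans lo; rewrite gerBl ltW.
  by rewrite -natr1 mulrDl mul1r opprD addrA lerB.
have [n Hn] : exists n : nat, M - n%:R * d <= 3 * rho / 4.
  have := archi_boundP (_ : 0 <= `|M| / d) ; set m := Num.bound _ => /(_ _) B'.
  exists m; have : `|M| / d < m%:R by apply: B'; rewrite divr_ge0// ltW.
  rewrite ltr_pdivrMr// => B''.
  have := ler_norm M; have : 0 <= 3 * rho / 4 by rewrite divr_ge0// mulr_ge0// ltW.
  by move: B''; lra.
have [t t01] := hit n.
have := low n t t01; rewrite (max_l Hn) => A1 A2.
have := le_trans A2 A1; have := rho0; lra.
Qed.

End mountain_pass.

(** * Integrands and modulars *)

Section growth_facts.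
Context {R : realType}.
Variables (p q C : R) (h : R -> R).
Implicit Types (s t l e a b : R).
Hypothesis p1 : 1 <= p.
Hypothesis gh : growth p q h.
Hypothesis h0 : h 0 = 0.
Hypothesis C1 : 1 <= C.
Hypothesis hC : C^-1 <= h 1 <= C.

Let C0 : 0 < C. Proof. exact: lt_le_trans C1. Qed.

Let h1 : 0 < h 1.
Proof. by have /andP[+ _] := hC; apply: lt_le_trans; rewrite invr_gt0. Qed.

Lemma gf_gt0 t : 0 < t -> 0 < h t.
Proof.
move=> t0; have [t1|/ltW t1] := leP 1 t.
  have := gh t1 ler01; rewrite mulr1 => /andP[+ _]; apply: lt_le_trans.
  by rewrite mulr_gt0 ?powR_gt0.
have t01 : 0 < t <= 1 by rewrite t0.
have := growth_shrink gh t01 ler01; rewrite mulr1 => /andP[+ _]; apply: lt_le_trans.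
by rewrite mulr_gt0 ?powR_gt0.
Qed.

Lemma gf_ge0 t : 0 <= t -> 0 <= h t.
Proof. by rewrite le_eqVlt => /predU1P[<-|/gf_gt0/ltW//]; rewrite h0. Qed.

Lemma gf_homo s t : 0 <= s -> s <= t -> h s <= h t.
Proof. by apply: growth_homo gh gf_ge0 h0 _ _; exact: le_trans p1. Qed.

Lemma gf_shrink l t : 0 <= l <= 1 -> 0 <= t -> h (l * t) <= l * h t.
Proof.
move=> /andP[]; rewrite le_eqVlt => /predU1P[<-|l0] l1 t0; first by rewrite !mul0r h0.
have l01 : 0 < l <= 1 by rewrite l0.
have /andP[_ /le_trans] := growth_shrink gh l01 t0; apply.
by apply: ler_wpM2r; [exact: gf_ge0|exact: ge1r_powR].
Qed.

Lemma gf_shrinkp l t : 0 <= l <= 1 -> 0 <= t -> h (l * t) <= l `^ p * h t.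
Proof.
move=> /andP[]; rewrite le_eqVlt => /predU1P[<-|l0] l1 t0.
  by rewrite mul0r h0 mulr_ge0 ?powR_ge0 ?gf_ge0.
have l01 : 0 < l <= 1 by rewrite l0.
by have /andP[_] := growth_shrink gh l01 t0.
Qed.

Lemma gf_grow l t : 1 <= l -> 0 <= t -> h (l * t) <= l `^ q * h t.
Proof. by move=> l1 t0; have /andP[_] := gh l1 t0. Qed.

Lemma gf_ge t : 0 <= t -> t <= 1 + C * h t.
Proof.
move=> t0; have [t1|/ltW t1] := leP t 1.
  by apply: le_trans t1 _; rewrite lerDl mulr_ge0 ?(ltW C0) ?gf_ge0.
have := gh t1 ler01; rewrite mulr1 => /andP[+ _] => H.
have tp : t <= t `^ p by apply: le1r_powR.
have : t * C^-1 <= h t.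
  apply: le_trans H; apply: ler_pM => //; first by rewrite invr_ge0 ltW.
  by have /andP[] := hC.
by rewrite ler_pdivrMr// mulrC => /le_trans; apply; rewrite lerDr.
Qed.

Hypothesis q0 : 0 <= q.

Lemma gf_add a b : 0 <= a -> 0 <= b -> h (a + b) <= 2 `^ q * (h a + h b).
Proof.
move=> a0 b0; rewrite mulrDr.
have P0 x : 0 <= x -> 0 <= 2 `^ q * h x by move=> x0; rewrite mulr_ge0 ?powR_ge0 ?gf_ge0.
have [ab|/ltW ba] := leP a b.
  apply: (@le_trans _ _ (h (2 * b))).
    by apply: gf_homo; rewrite ?addr_ge0//; have := ab; lra.
  by apply: le_trans (gf_grow _ b0) _; rewrite ?ler1n// lerDr P0.
apply: (@le_trans _ _ (h (2 * a))).
  by apply: gf_homo; rewrite ?addr_ge0//; have := ba; lra.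
by apply: le_trans (gf_grow _ a0) _; rewrite ?ler1n// lerDl P0.
Qed.

(** Young's inequality without the conjugate function. If [s <= e t] the left side is at most
    [e h t]; otherwise [t] is a fraction of [s / e] and sublinear shrinking gives [e h (s / e)]. *)
Lemma gf_young e s t : 0 < e <= 1 -> 0 <= s -> 0 <= t ->
  h t / t * s <= e * (h t + h (s / e)).
Proof.
move=> /andP[e0 e1] s0; rewrite le_eqVlt => /predU1P[<-|t0].
  by rewrite h0 mul0r mul0r add0r mulr_ge0 ?(ltW e0)// gf_ge0// divr_ge0// ltW.
have se0 : 0 <= s / e by rewrite divr_ge0// ltW.
have [st|ts] := leP s (e * t).
  apply: (@le_trans _ _ (e * h t)); last first.
    by rewrite ler_wpM2l ?(ltW e0)// lerDl gf_ge0.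
  rewrite mulrAC ler_pdivrMr// [e * _]mulrC -mulrA; apply: ler_wpM2l => //.
  by apply: gf_ge0; exact: ltW.
have sp : 0 < s by apply: lt_trans ts; rewrite mulr_gt0.
apply: (@le_trans _ _ (e * h (s / e))); last first.
  by rewrite ler_wpM2l ?(ltW e0)// lerDr gf_ge0// ltW.
have l01 : 0 <= t * e / s <= 1.
  rewrite divr_ge0 ?mulr_ge0 ?(ltW t0) ?(ltW e0)//= ler_pdivrMr// mul1r mulrC ltW//.
have := gf_shrink l01 se0.
rewrite (_ : t * e / s * (s / e) = t); last by field; rewrite !gt_eqF.
move=> H; rewrite mulrAC ler_pdivrMr//.
apply: le_trans (ler_wpM2r s0 H) _.
rewrite le_eqVlt; apply/orP; left; apply/eqP; field; by rewrite gt_eqF.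
Qed.

Lemma gf_ratio t : 0 <= t -> h t / t <= C + h t.
Proof.
rewrite le_eqVlt => /predU1P[<-|t0]; first by rewrite invr0 mulr0 h0 addr0 ltW.
have [t1|/ltW t1] := leP 1 t.
  apply: (@le_trans _ _ (h t)); last by rewrite lerDr ltW.
  by rewrite ler_pdivrMr// ler_peMr// gf_ge0 ?ltW.
apply: (@le_trans _ _ C); last by rewrite lerDl gf_ge0// ltW.
have t01 : 0 <= t <= 1 by rewrite (ltW t0).
have := gf_shrink t01 ler01; rewrite mulr1 => H.
rewrite ler_pdivrMr//; apply: le_trans H _; rewrite mulrC ler_wpM2r ?(ltW t0)//.
by have /andP[] := hC.
Qed.

Lemma gf_ratio_homo s t : 0 <= s -> s <= t -> h s / s <= h t / t.
Proof.
rewrite le_eqVlt => /predU1P[<-|s0] st.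
  by rewrite invr0 mulr0 divr_ge0 ?gf_ge0.
have t0 : 0 < t by exact: lt_le_trans st.
have l01 : 0 <= s / t <= 1 by rewrite divr_ge0 ?(ltW s0) ?(ltW t0)//= ler_pdivrMr// mul1r.
have := gf_shrink l01 (ltW t0); rewrite divfK ?gt_eqF// => H.
rewrite ler_pdivrMr//; apply: le_trans H _.
by rewrite le_eqVlt; apply/orP; left; apply/eqP; ring.
Qed.

Lemma gf_bound B t : 1 <= B -> 0 <= t -> t <= B -> h t <= B `^ q * C.
Proof.
move=> B1 t0 tB; apply: le_trans (gf_homo t0 tB) _.
rewrite -[B in h B]mulr1; apply: le_trans (gf_grow B1 ler01) _.
by rewrite ler_wpM2l ?powR_ge0//; have /andP[] := hC.
Qed.

End growth_facts.

(** Brings continuity of a parameter integral within reach of dominated convergence, a statement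
    about sequences; a point of discontinuity yields a bad sequence at the explicit rate
    [1 / (n + 1)]. *)
Lemma sequential_continuous (R : realType) (V : normedModType R) (f : V -> R) :
  (forall (c_ : nat -> V) c, (forall n, `|c - c_ n| < n.+1%:R^-1) ->
    f (c_ n) @[n --> \oo] --> f c) -> continuous f.
Proof.
move=> H c; apply/cvgrPdist_lt => e e0; apply: contrapT => nn.
have He n : exists c', `|c - c'| < n.+1%:R^-1 /\ e <= `|f c - f c'|.
  apply: contrapT => H2; apply: nn; apply/nbhs_ballP.
  exists n.+1%:R^-1 => /=; first by rewrite invr_gt0.
  move=> c'; rewrite -ball_normE /= => cc'; rewrite ltNge; apply/negP => ee.
  by apply: H2; exists c'.
have [c_ Hc] := choice He.
have /cvgrPdist_lt /(_ _ e0) [n _ /(_ n (leqnn n))] := H c_ c (fun n => (Hc n).1).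
by rewrite /= ltNge (Hc n).2.
Qed.

Lemma cvg_dist_natSinv (R : realType) (V : normedModType R) (c_ : nat -> V) c :
  (forall n, `|c - c_ n| < n.+1%:R^-1) -> c_ n @[n --> \oo] --> c.
Proof.
move=> Hc; apply/cvgrPdist_lt => r r0.
near=> n; apply: lt_trans (Hc n) _.
near: n; exact: near_infty_natSinv_lt (PosNum r0).
Unshelve. all: by end_near. Qed.

(** * Real-valued integrals over a set of finite measure *)

Section integrals.
Context d (T : measurableType d) (R : realType) (mu : {measure set T -> \bar R}).
Variables (Om : set T).
Hypothesis mOm : measurable Om.
Hypothesis finOm : (mu Om < +oo)%E.
Implicit Types (f h : T -> R) (a b : R).

Definition itg f := mu.-integrable Om (EFin \o f).
Definition Int f : R := \int[mu]_(x in Om) f x.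

Lemma itg_measurable f : itg f -> measurable_fun Om f.
Proof. by move=> /(measurable_int mu)/measurable_EFinP. Qed.

Lemma itg_le f h : measurable_fun Om f -> itg h ->
  (forall x, Om x -> `|f x| <= h x) -> itg f.
Proof.
move=> mf ih fh; apply: le_integrable ih => //; first exact/measurable_EFinP.
move=> x Ox /=; rewrite lee_fin; apply: le_trans (fh x Ox) _; exact: ler_norm.
Qed.

Lemma itg_cst a : itg (fun=> a).
Proof.
apply: measurable_bounded_integrable => //.
exists `|a|; split; first exact: num_real.
by move=> b ab x _ /=; exact: ltW.
Qed.

Lemma itg_bounded f B : measurable_fun Om f ->
  (forall x, Om x -> `|f x| <= B) -> itg f.
Proof. by move=> mf fB; apply: itg_le (itg_cst B) _. Qed.

Lemma itgD f h : itg f -> itg h -> itg (fun x => f x + h x).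
Proof. by move=> fi hi; have := integrableD mOm fi hi. Qed.

Lemma itgZ a f : itg f -> itg (fun x => a * f x).
Proof. by move=> fi; have := integrableZl mOm a fi. Qed.

Lemma itgN f : itg f -> itg (fun x => - f x).
Proof.
move=> fi; have := itgZ (-1) fi; apply: eq_integrable => // x _ /=.
by rewrite mulN1r.
Qed.

Lemma itgB f h : itg f -> itg h -> itg (fun x => f x - h x).
Proof. by move=> fi hi; exact: itgD (itgN hi). Qed.

Lemma itg_norm f : itg f -> itg (fun x => `|f x|).
Proof.
move=> fi; apply: itg_le (_ : itg (fun x => `|f x|)) _.
- by apply: measurableT_comp => //; exact: itg_measurable.
- by move/integrable_abse : fi.
- by move=> x _; rewrite normr_id.
Qed.

Lemma itg_sum (I : Type) (r : seq I) (F : I -> T -> R) :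
  (forall i, itg (F i)) -> itg (fun x => \sum_(i <- r) F i x).
Proof.
move=> iF; elim: r => [|i r IH].
  by under eq_fun do rewrite big_nil; exact: itg_cst.
by under eq_fun do rewrite big_cons; exact: itgD.
Qed.

Lemma IntD f h : itg f -> itg h -> Int (fun x => f x + h x) = Int f + Int h.
Proof. by move=> fi hi; rewrite /Int RintegralD. Qed.

Lemma IntZ a f : itg f -> Int (fun x => a * f x) = a * Int f.
Proof. by move=> fi; rewrite /Int RintegralZl. Qed.

Lemma IntB f h : itg f -> itg h -> Int (fun x => f x - h x) = Int f - Int h.
Proof. by move=> fi hi; rewrite /Int RintegralB. Qed.

Lemma Int_sum (I : Type) (r : seq I) (F : I -> T -> R) :
  (forall i, itg (F i)) -> Int (fun x => \sum_(i <- r) F i x) = \sum_(i <- r) Int (F i).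
Proof.
move=> iF; elim: r => [|i r IH].
  rewrite big_nil /Int; under eq_Rintegral do rewrite big_nil.
  by rewrite Rintegral_cst// mul0r.
rewrite big_cons -IH -IntD//; last exact: itg_sum.
by apply: eq_Rintegral => x _; rewrite big_cons.
Qed.

Lemma Int_le f h : itg f -> itg h -> (forall x, Om x -> f x <= h x) -> Int f <= Int h.
Proof. by move=> fi hi fh; exact: le_Rintegral. Qed.

Lemma Int_ge0 f : (forall x, Om x -> 0 <= f x) -> 0 <= Int f.
Proof. exact: Rintegral_ge0. Qed.

Lemma Int_cst a : Int (fun=> a) = a * fine (mu Om).
Proof. exact: Rintegral_cst. Qed.

Lemma Int_norm f : itg f -> `|Int f| <= Int (fun x => `|f x|).
Proof. by move=> fi; exact: le_normr_Rintegral. Qed.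

Lemma Int_eq f h : (forall x, Om x -> f x = h x) -> Int f = Int h.
Proof. by move=> fh; apply: eq_Rintegral => x /set_mem/fh. Qed.

Lemma itg_eq f h : (forall x, Om x -> f x = h x) -> itg f -> itg h.
Proof. by move=> fh; apply: eq_integrable => // x /set_mem/fh /= ->. Qed.

Lemma Int_EFin f : itg f -> (\int[mu]_(x in Om) (f x)%:E)%E = (Int f)%:E.
Proof. by move=> fi; rewrite /Int /Rintegral fineK//; exact: integrable_fin_num. Qed.

Lemma Int_lt_EFin f B : measurable_fun Om f -> (forall x, Om x -> 0 <= f x) ->
  (\int[mu]_(x in Om) (f x)%:E <= B%:E)%E -> itg f /\ Int f <= B.
Proof.
move=> mf f0 fB; have fi : itg f.
  apply/integrableP; split; first exact/measurable_EFinP.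
  rewrite (eq_integral (fun x => (f x)%:E)).
    by apply: le_lt_trans fB _; rewrite ltey.
  by move=> x /set_mem Ox /=; rewrite ger0_norm ?f0.
by split=> //; move: fB; rewrite Int_EFin.
Qed.

Lemma Int_eq0 f : itg f -> (forall x, Om x -> 0 <= f x) -> Int f <= 0 ->
  {ae mu, forall x, Om x -> f x = 0}.
Proof.
move=> fi f0 I0.
have : (\int[mu]_(x in Om) `|(EFin \o f) x|)%E = 0%E.
  rewrite (eq_integral (fun x => (f x)%:E)); last first.
    by move=> x /set_mem Ox /=; rewrite ger0_norm ?f0.
  by rewrite Int_EFin//; congr EFin; apply/eqP; rewrite eq_le I0 Int_ge0.
move/ae_eq_integral_abs => H.
have := H mOm (measurable_int mu fi); apply: filterS => x /= + Ox => /(_ Ox) []; done.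
Qed.

Lemma Int_dominated (f_ : nat -> T -> R) f h :
  (forall n, measurable_fun Om (f_ n)) -> measurable_fun Om f ->
  {ae mu, forall x, Om x -> f_ ^~ x @ \oo --> f x} -> itg h ->
  {ae mu, forall x n, Om x -> `|f_ n x| <= h x} ->
  itg f /\ Int (f_ n) @[n --> \oo] --> Int f.
Proof.
move=> mf_ mf cf ih fh.
have [] := @dominated_convergence _ _ _ mu Om mOm (fun n => EFin \o f_ n) (EFin \o f) (EFin \o h).
- by move=> n; exact/measurable_EFinP.
- exact/measurable_EFinP.
- apply: filterS cf => x H Ox; have := H Ox => {}H.
  by apply: cvg_EFin => //; exact: nearW.
- exact: ih.
- by apply: filterS fh => x H n Ox; rewrite /= lee_fin; exact: H.
move=> fi _ H; split=> //.
by rewrite /Int /Rintegral; apply: fine_cvg; rewrite fineK//; exact: integrable_fin_num.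
Qed.

Section parameter.
Variable k : nat.

Lemma Int_continuous (K : T -> 'rV[R]_k -> R) :
  (forall c, measurable_fun Om (K ^~ c)) ->
  (forall x, Om x -> continuous (K x)) ->
  (forall r, exists B, forall c x, `|c| <= r -> Om x -> `|K x c| <= B) ->
  continuous (fun c => Int (K ^~ c)).
Proof.
move=> mK cK bK; apply: sequential_continuous => c_ c Hc.
have cc := cvg_dist_natSinv Hc.
have [B HB] := bK (`|c| + 1).
have [] := @Int_dominated (fun n => K ^~ (c_ n)) (K ^~ c) (fun=> B)
  (fun n => mK _) (mK c) _ (itg_cst B) _ => //.
- apply: aeW => x Ox; have := cK x Ox c.
  exact: cvg_comp cc.
- apply: aeW => x n Ox; apply: HB => //.
  rewrite -[c_ n](subrK c) [leRHS]addrC (le_trans (ler_normD _ _))// lerD2r.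
  by rewrite distrC; apply: le_trans (ltW (Hc n)) _; rewrite invf_le1// ler1n.
Qed.

End parameter.

(** Differentiation under the integral sign followed by the mean value theorem. The bounds are asked
    on []-1, 2[] because the former needs an open interval around [[0, 1]]. *)
Lemma Int_mean_value (K dK : T -> R -> R) B :
  (forall s, measurable_fun Om (K ^~ s)) ->
  (forall x (s : R), Om x -> is_derive s 1 (K x) (dK x s)) ->
  (forall x (s : R), Om x -> -1 < s < 2 -> `|K x s| <= B /\ `|dK x s| <= B) ->
  exists2 s : R, 0 <= s <= 1 &
    Int (K ^~ 1) - Int (K ^~ 0) = Int (dK ^~ s).
Proof.
move=> mK dKE bK.
have D (s : R) : -1 < s < 2 -> is_derive s 1 (fun s => Int (K ^~ s)) (Int (dK ^~ s)).
  move=> s12.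
  have Is : `]-1, (2:R)[%classic s by rewrite /= in_itv.
  have h1 (x : R) : `]-1, 2[%classic x -> itg (K ^~ x).
    by rewrite /= in_itv/= => x12; apply: (@itg_bounded _ B) => // y Oy; have [] := bK y x Oy x12.
  have h2 (x : R) y : `]-1, (2:R)[%classic x -> Om y -> derivable ((fun s y => K y s) ^~ y) x 1.
    by move=> _ Oy; have [] := dKE y x Oy.
  have e2 (x : R) y : Om y -> partial1of2 (fun s y => K y s) x y = dK y x.
    by move=> Oy; rewrite /partial1of2 derive1E; have [] := dKE y x Oy.
  have h3 (x : R) y : `]-1, 2[%classic x -> Om y ->
      `|partial1of2 (fun s y => K y s) x y| <= Num.max 0 B.
    rewrite /= in_itv/= => x12 Oy; rewrite e2// le_max; apply/orP; right.
    by have [] := bK y x Oy x12.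
  have h4 (y : T) : 0 <= Num.max 0 B by rewrite le_max lexx.
  have := @differentiation_under_integral R d T mu (fun s y => K y s) Om mOm s (-1) 2 Is h1 h2
    (fun=> Num.max 0 B) h4 (itg_cst _) h3.
  have := @derivable_under_integral R d T mu (fun s y => K y s) Om mOm s (-1) 2 Is h1 h2
    (fun=> Num.max 0 B) h4 (itg_cst _) h3.
  move=> dv vE; split=> //; rewrite -derive1E vE.
  by apply: eq_Rintegral => y /set_mem Oy; rewrite e2.
have [||s [s01 _] E] := @mean_value R (fun s => Int (K ^~ s)) (fun s => Int (dK ^~ s)) 0 1 ler01.
- by move=> x /andP[x0 x1]; apply: D; move: x0 x1; lra.
- apply: derivable_within_continuous => x; rewrite in_itv/= => /andP[x0 x1].
  by have [] : is_derive x 1 (fun s => Int (K ^~ s)) (Int (dK ^~ x)) by apply: D; move: x0 x1; lra.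
by exists s => //; rewrite E subr0 mulr1.
Qed.

End integrals.

Lemma continuous_dist {R : realType} (V W : normedModType R) (f : V -> W) (x : V) :
  {for x, continuous f} <-> forall e : R, 0 < e ->
    exists2 r : R, 0 < r & forall y, `|x - y| < r -> `|f x - f y| < e.
Proof.
split=> [cf e e0|H].
  have /cvgrPdist_lt /(_ _ e0) /nbhs_ballP[r /= r0 Hr] := cf.
  by exists r => // y xy; apply: Hr; rewrite -ball_normE.
apply/cvgrPdist_lt => e e0; have [r r0 Hr] := H e e0.
by apply/nbhs_ballP; exists r => //= y; rewrite -ball_normE; exact: Hr.
Qed.

(** * Radial integrands: flux, convexity and uniform convexity *)

Section radial.
Context {R : realType} {N : nat}.
Implicit Types (h H : R -> R) (xi eta : 'rV[R]_N) (p q s t a b e : R).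

(** All that the variational argument uses of a density and its primitive, so that (SC) and
    derivatives of the density do not appear again. *)
Definition density_pair p q h H :=
  [/\ growth (p - 1) (q - 1) h, growth p q H, h 0 = 0 & H 0 = 0] /\
  [/\ forall t, 0 <= t -> 0 <= h t,
      forall t, 0 <= t -> 0 <= H t,
      forall a b, 0 <= a -> 0 <= b -> h a * (b - a) <= H b - H a,
      forall t, 0 <= t -> t * h t <= q * H t &
      continuous (fun t => h `|t|)].

Definition radial_flux h xi : 'rV[R]_N := (h (enorm xi) / enorm xi) *: xi.

Lemma enorm_continuous : continuous (@enorm R N).
Proof.
have cd : continuous (fun v : 'rV[R]_N => dotv v v).
  by apply: dotv_continuous => v; exact: cvg_id.
by move=> v; apply: (@continuous_comp _ _ _ (fun v : 'rV[R]_N => dotv v v) Num.sqrt); [exact: cd|exact: sqrt_continuous].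
Qed.

Lemma continuous_scale_row (T : topologicalType) (s : T -> R) (f : T -> 'rV[R]_N) (t : T) :
  {for t, continuous s} -> {for t, continuous f} ->
  {for t, continuous (fun x : T => s x *: f x)}.
Proof. by move=> cs cf; exact: cvgZ. Qed.

Lemma continuous_quot (T : topologicalType) (a b : T -> R) (t : T) : b t != 0 ->
  {for t, continuous a} -> {for t, continuous b} ->
  {for t, continuous (fun x : T => a x / b x)}.
Proof. by move=> b0 ca cb; apply: cvgM => //; exact: cvgV. Qed.

Section pair.
Variables (p q : R) (h H : R -> R).
Hypothesis p1 : 1 < p.
Hypothesis pq : p <= q.
Hypothesis hH : density_pair p q h H.

Let gh : growth (p - 1) (q - 1) h. Proof. by have [[]] := hH. Qed.
Let gH : growth p q H. Proof. by have [[]] := hH. Qed.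
Let h00 : h 0 = 0. Proof. by have [[]] := hH. Qed.
Let H00 : H 0 = 0. Proof. by have [[]] := hH. Qed.
Let h_ge0 : forall t, 0 <= t -> 0 <= h t. Proof. by have [_ []] := hH. Qed.
Let H_ge0 : forall t, 0 <= t -> 0 <= H t. Proof. by have [_ []] := hH. Qed.
Let H_conv : forall a b, 0 <= a -> 0 <= b -> h a * (b - a) <= H b - H a.
Proof. by have [_ []] := hH. Qed.
Let hc : continuous (fun t => h `|t|). Proof. by have [_ []] := hH. Qed.
Let p0 : 0 <= p. Proof. by move: p1; lra. Qed.
Let q0 : 0 <= q. Proof. by move: p1 pq; lra. Qed.
Let h_homo s t : 0 <= s -> s <= t -> h s <= h t.
Proof. by apply: growth_homo gh h_ge0 h00 _ _; move: p1; lra. Qed.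
Let H_homo s t : 0 <= s -> s <= t -> H s <= H t.
Proof. by apply: growth_homo gH H_ge0 H00 _ _; exact: p0. Qed.

Lemma dp_le_density t : 0 <= t -> H t <= t * h t.
Proof. by move=> t0; have := H_conv t0 (lexx 0); rewrite H00; lra. Qed.

Lemma flux_dot_le xi eta : `|dotv (radial_flux h xi) eta| <= h (enorm xi) * enorm eta.
Proof.
rewrite dotvZl normrM.
have [->|xi0] := eqVneq xi 0.
  by rewrite dotv0l normr0 mulr0 mulr_ge0 ?h_ge0 ?enorm_ge0.
have e0 : 0 < enorm xi by rewrite lt_neqAle eq_sym enorm_eq0 xi0 enorm_ge0.
rewrite ger0_norm ?divr_ge0 ?h_ge0 ?enorm_ge0//.
apply: (@le_trans _ _ (h (enorm xi) / enorm xi * (enorm xi * enorm eta))).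
  by rewrite ler_wpM2l ?cauchy_schwarz// divr_ge0 ?h_ge0 ?enorm_ge0.
by rewrite mulrA divfK ?gt_eqF.
Qed.

Lemma flux_dot_self xi : dotv (radial_flux h xi) xi = enorm xi * h (enorm xi).
Proof.
rewrite dotvZl -enorm_sqr.
have [->|xi0] := eqVneq xi 0; first by rewrite enorm0 mul0r expr0n mulr0.
have e0 : enorm xi != 0 by rewrite enorm_eq0.
by field.
Qed.

Lemma flux_convex xi eta :
  dotv (radial_flux h xi) (eta - xi) <= H (enorm eta) - H (enorm xi).
Proof.
rewrite dotvBr flux_dot_self.
apply: le_trans (H_conv (enorm_ge0 xi) (enorm_ge0 eta)).
rewrite mulrBr [h _ * enorm xi]mulrC lerD2r.
by apply: le_trans (flux_dot_le _ _); exact: ler_norm.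
Qed.

Lemma flux_continuous : continuous (radial_flux h).
Proof.
move=> xi.
have [->|xi0] := eqVneq xi 0; last first.
  have hce : continuous (fun v : 'rV[R]_N => h (enorm v)).
    move=> v; have -> : (fun v : 'rV[R]_N => h (enorm v)) = (fun t => h `|t|) \o (@enorm R N).
      by apply/funext => w /=; rewrite ger0_norm// enorm_ge0.
    by apply: continuous_comp; [exact: enorm_continuous|exact: hc].
  have e0 : enorm xi != 0 by rewrite enorm_eq0.
  apply: (@continuous_scale_row _ (fun v : 'rV[R]_N => h (enorm v) / enorm v) id) => //.
  apply: (@continuous_quot _ (fun v : 'rV[R]_N => h (enorm v)) (@enorm R N)) => //.
    exact: hce.
  exact: enorm_continuous.
apply/continuous_dist => e e0.
have hc0 : {for (0 : R), continuous (fun t : R => h `|t|)} by exact: hc.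
have /continuous_dist /(_ _ e0)[r r0 Hr] := hc0.
have ec0 : {for (0 : 'rV[R]_N), continuous (@enorm R N)} by exact: enorm_continuous.
have /continuous_dist /(_ _ r0)[r' r'0 Hr'] := ec0.
exists r' => // eta er; have {er} := Hr' _ er; rewrite enorm0 => /Hr.
rewrite {1 2}/radial_flux scaler0 normr0 h00.
rewrite !sub0r !normrN ger0_norm ?enorm_ge0// ger0_norm ?h_ge0 ?enorm_ge0// => he.
apply: le_lt_trans he; rewrite normrZ ger0_norm ?divr_ge0 ?h_ge0 ?enorm_ge0//.
have [->|eta0] := eqVneq eta 0; first by rewrite normr0 mulr0 h_ge0 ?enorm_ge0.
have en0 : 0 < enorm eta by rewrite lt_neqAle eq_sym enorm_eq0 eta0 enorm_ge0.
rewrite -mulrA ler_piMr ?h_ge0 ?enorm_ge0// mulrC ler_pdivrMr// mul1r.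
exact: norm_le_enorm.
Qed.

(** The norm is not differentiable at 0, so the chain rule is avoided. Along the line the function
    has the continuous subgradient [k], and its difference quotient at [s] lies between [k s] and
    [k (u + s)]. *)
Lemma radial_is_derive xi eta s :
  is_derive s 1 (fun s : R => H (enorm (xi + s *: eta)))
    (dotv (radial_flux h (xi + s *: eta)) eta).
Proof.
pose k t := dotv (radial_flux h (xi + t *: eta)) eta.
have ck : continuous k.
  have cl : continuous (fun t : R => xi + t *: eta).
    move=> t; apply: cvgD; first exact: cvg_cst.
    by apply: cvgZr_tmp; exact: cvg_id.
  apply: dotv_continuous => t; last exact: cvg_cst.
  by apply: (@continuous_comp _ _ _ (fun t : R => xi + t *: eta) (radial_flux h)); [exact: cl|exact: flux_continuous].
pose K t := H (enorm (xi + t *: eta)).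
have sub t u : k t * (u - t) <= K u - K t.
  have := flux_convex (xi + t *: eta) (xi + u *: eta).
  by rewrite opprD addrACA subrr add0r -scalerBl dotvZr mulrC.
have cv : u^-1 *: (K (u *: 1 + s) - K s) @[u --> 0^'] --> k s.
  apply/cvgrPdist_lt => e e0.
  have /cvgrPdist_lt /(_ _ e0) /nbhs_ballP[r /= r0 Hr] := ck s.
  exists r => //= u; rewrite /ball_/= sub0r normrN => ur u0.
  rewrite scaler1.
  have := Hr (u + s); rewrite -ball_normE/= opprD addrCA subrr addr0 normrN => /(_ ur) kus.
  have A := sub s (u + s); have B := sub (u + s) s.
  rewrite addrK in A; rewrite opprD addrCA subrr addr0 in B.
  apply: le_lt_trans kus; rewrite /GRing.scale/=.
  have [u_gt0|u_lt0] : 0 < u \/ u < 0 by move: u0; rewrite neq_lt => /orP[]; [right|left].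
    have A' : k s <= u^-1 * (K (u + s) - K s) by rewrite ler_pdivlMl// mulrC.
    have B' : u^-1 * (K (u + s) - K s) <= k (u + s) by rewrite ler_pdivrMl//; move: B; lra.
    rewrite distrC ger0_norm ?subr_ge0// distrC ger0_norm; last by move: A' B'; lra.
    by move: B'; lra.
  have A' : u^-1 * (K (u + s) - K s) <= k s by rewrite ler_ndivrMl// mulrC.
  have B' : k (u + s) <= u^-1 * (K (u + s) - K s) by rewrite ler_ndivlMl//; move: B; lra.
  rewrite ger0_norm ?subr_ge0// ger0_norm; last by move: A' B'; lra.
  by move: B'; lra.
split; last exact/cvg_lim.
by apply/cvg_ex; exists (k s).
Qed.

(* Strict convexity along a segment on which the norm varies: the midpoint
   estimate is improved by inserting the point half-way to the far end. *)
Lemma midpoint_gap e a b : 0 < e -> 0 <= b -> b <= a -> 0 < a -> e * (a + b) <= a - b ->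
  e / 8 * ((1 + e / 2) `^ (p - 1) - 1) / 2 `^ q * (H a + H b) <=
  H a + H b - 2 * H ((a + b) / 2).
Proof.
move=> e0 b0 ba a0 ab; set k1 := _ - 1.
pose m := (a + b) / 2; pose c := (m + a) / 2.
have m0 : 0 < m by rewrite divr_gt0// ltr_wpDr.
have c0 : 0 <= c by rewrite divr_ge0// addr_ge0 ?(ltW a0)// ltW.
have A1 := H_conv c0 (ltW a0).
have A2 := H_conv (ltW m0) c0.
have A3 := H_conv (ltW m0) b0.
have l1 : 1 <= 1 + e / 2 by rewrite lerDl divr_ge0// ltW.
have k10 : 0 <= k1.
  by rewrite subr_ge0 powR_ge1//; move: p1; lra.
have hc' : (k1 + 1) * h m <= h c.
  have cm : (1 + e / 2) * m <= c by rewrite /c /m; move: ab; lra.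
  have em0 : 0 <= (1 + e / 2) * m by rewrite mulr_ge0 ?(ltW m0)// (le_trans ler01).
  apply: le_trans (h_homo em0 cm).
  by rewrite /k1 subrK; have /andP[] := gh l1 (ltW m0).
have gap : (a - b) / 4 * (k1 * h m) <= H a + H b - 2 * H m.
  have : (a - b) / 4 * ((k1 + 1) * h m) <= (a - b) / 4 * h c.
    by rewrite ler_wpM2l// divr_ge0// subr_ge0.
  have e1 : h c * (a - c) = (a - b) / 4 * h c by rewrite /c /m; field.
  have e2 : h m * (c - m) = (a - b) / 4 * h m by rewrite /c /m; field.
  have e3 : h m * (b - m) = - ((a - b) / 2 * h m) by rewrite /m; field.
  by move: A1 A2 A3; rewrite e1 e2 e3; lra.
apply: le_trans gap.
have Hm : H m <= m * h m by apply: dp_le_density; exact: ltW.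
have H2 : H a + H b <= 2 * (2 `^ q * H m).
  have m2 : H (2 * m) <= 2 `^ q * H m by have /andP[] := gH (ler1n _ 2) (ltW m0).
  have m2a : a <= 2 * m by rewrite /m; move: b0; lra.
  have := H_homo (ltW a0) m2a; have := H_homo b0 (le_trans ba m2a); move: m2; lra.
have P2 : 0 < 2 `^ q :> R by rewrite powR_gt0.
apply: (@le_trans _ _ (e / 8 * k1 / 2 `^ q * (2 * (2 `^ q * H m)))).
  by rewrite ler_wpM2l// !mulr_ge0 ?invr_ge0 ?(ltW e0) ?(ltW P2).
rewrite (_ : _ * _ = e / 4 * (k1 * H m)); last by field; rewrite gt_eqF.
apply: (@le_trans _ _ (e / 4 * (k1 * (m * h m)))).
  by rewrite ler_wpM2l ?divr_ge0 ?(ltW e0)// ler_wpM2l.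
have : e * m * (k1 * h m) <= (a - b) * (k1 * h m).
  rewrite ler_wpM2r ?mulr_ge0 ?h_ge0 ?(ltW m0)//.
  by rewrite /m; have : 0 <= e * (a + b) by [rewrite mulr_ge0 ?addr_ge0 ?(ltW e0) ?(ltW a0)]; move: ab; lra.
lra.
Qed.

Let half_conv a b : 0 <= a -> 0 <= b -> 2 * H ((a + b) / 2) <= H a + H b.
Proof.
move=> a0 b0; have m0 : 0 <= (a + b) / 2 by rewrite divr_ge0// addr_ge0.
have A := H_conv m0 a0; have B := H_conv m0 b0.
have E : h ((a + b) / 2) * (a - (a + b) / 2) + h ((a + b) / 2) * (b - (a + b) / 2) = 0 by field.
lra.
Qed.

(** The minimum in the denominator is the relative convexity gap in the two cases of
    [uniform_convexity]: [e^2 / 16] if the midpoint is short, the constant of [midpoint_gap] at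
    [e / 4] if the two norms differ. The numerator comes from
    [H (enorm (xi - eta)) <= 2^q (H a + H b)]. *)
Definition uc_const e : R :=
  2 * 2 `^ q / Num.min (e ^+ 2 / 16) (e / 32 * ((1 + e / 8) `^ (p - 1) - 1) / 2 `^ q).

Lemma uc_const_gt0 e : 0 < e -> 0 < uc_const e.
Proof.
move=> e0; have P2 : 0 < 2 `^ q :> R by rewrite powR_gt0.
rewrite divr_gt0 ?mulr_gt0// lt_min !divr_gt0 ?exprn_gt0//= !mulr_gt0 ?divr_gt0 ?invr_gt0//.
by rewrite subr_gt0 powR_gt1 ?subr_gt0// ltrDl divr_gt0.
Qed.

(** A difference that is small relative to [a + b] is absorbed by the first term. Otherwise the
    parallelogram law leaves two causes: the midpoint is shorter than the mean of the norms by the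
    factor [1 - e^2 / 16], or the norms themselves differ by [e / 4] of their sum. Either one opens
    a gap proportional to [H a + H b]. *)
Lemma uniform_convexity e xi eta : 0 < e <= 1 ->
  H (enorm (xi - eta)) <= e * (H (enorm xi) + H (enorm eta)) +
   uc_const e * (2^-1 * H (enorm xi) + 2^-1 * H (enorm eta) - H (enorm (2^-1 *: (xi + eta)))).
Proof.
move=> /andP[e0 e1]; set a := enorm xi; set b := enorm eta.
have a0 : 0 <= a := enorm_ge0 _; have b0 : 0 <= b := enorm_ge0 _.
have mE : enorm (2^-1 *: (xi + eta)) = enorm (xi + eta) / 2.
  by rewrite enormZ ger0_norm ?invr_ge0// mulrC.
set m := enorm (2^-1 *: _) in mE *.
have m0 : 0 <= m := enorm_ge0 _.
have mab : m <= (a + b) / 2 by rewrite mE ler_wpM2r ?invr_ge0// enormD.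
have par : enorm (xi - eta) ^+ 2 = 2 * a ^+ 2 + 2 * b ^+ 2 - 4 * m ^+ 2.
  rewrite mE expr_div_n !enorm_sqr !(dotvDl, dotvDr, dotvNl, dotvNr) (dotvC eta xi).
  by field.
set D := _ - H m.
have D0 : 0 <= D.
  have := H_homo m0 mab; have := half_conv a0 b0; rewrite /D; lra.
have sab : 0 <= H a + H b by rewrite addr_ge0 ?H_ge0.
have [small|big] := leP (enorm (xi - eta)) (e / 2 * (a + b)).
  apply: (@le_trans _ _ (e * (H a + H b))); last first.
    by rewrite lerDl mulr_ge0// ltW ?uc_const_gt0.
  have shr t : 0 <= t -> H (e * t) <= e * H t.
    move=> t0; have e01 : 0 < e <= 1 by rewrite e0.
    have /andP[_ /le_trans] := growth_shrink gH e01 t0; apply.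
    by rewrite ler_wpM2r ?H_ge0// ge1r_powR ?e01// ltW.
  apply: le_trans (H_homo (enorm_ge0 _) small) _.
  have [ab|/ltW ba] := leP a b.
    apply: le_trans (_ : _ <= H (e * b)) _.
      apply: H_homo; first by rewrite mulr_ge0 ?divr_ge0 ?addr_ge0 ?(ltW e0).
      by have : e * a <= e * b by [rewrite ler_wpM2l ?(ltW e0)]; lra.
    by apply: le_trans (shr _ b0) _; rewrite ler_wpM2l ?(ltW e0)// lerDr H_ge0.
  apply: le_trans (_ : _ <= H (e * a)) _.
    apply: H_homo; first by rewrite mulr_ge0 ?divr_ge0 ?addr_ge0 ?(ltW e0).
    by have : e * b <= e * a by [rewrite ler_wpM2l ?(ltW e0)]; lra.
  by apply: le_trans (shr _ a0) _; rewrite ler_wpM2l ?(ltW e0)// lerDl H_ge0.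
have s0 : 0 < a + b.
  rewrite lt_neqAle addr_ge0// andbT eq_sym; apply/eqP => ab0.
  have xe : enorm (xi - eta) <= a + b := enormB _ _.
  by move: big xe; rewrite ab0 mulr0; lra.
have P2 : 0 < 2 `^ q :> R by rewrite powR_gt0.
pose k := Num.min (e ^+ 2 / 16) (e / 32 * ((1 + e / 8) `^ (p - 1) - 1) / 2 `^ q).
have k0 : 0 < k.
  by have := uc_const_gt0 e0; rewrite /uc_const -/k pmulr_rgt0 ?invr_gt0// mulr_gt0.
suff gap : k * (H a + H b) <= 2 * D.
  apply: (@le_trans _ _ (uc_const e * D)); last by rewrite lerDr mulr_ge0// ltW.
  have up : H (enorm (xi - eta)) <= 2 `^ q * (H a + H b).
    have g2 t : 0 <= t -> H (2 * t) <= 2 `^ q * H t.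
      by move=> t0; have /andP[] := gH (ler1n _ 2) t0.
    have [ab|/ltW ba] := leP a b.
      apply: le_trans (_ : _ <= H (2 * b)) _.
        by apply: H_homo; [exact: enorm_ge0|apply: le_trans (enormB _ _) _; rewrite -/a -/b; lra].
      by apply: le_trans (g2 _ b0) _; rewrite ler_wpM2l ?(ltW P2)// lerDr H_ge0.
    apply: le_trans (_ : _ <= H (2 * a)) _.
      by apply: H_homo; [exact: enorm_ge0|apply: le_trans (enormB _ _) _; rewrite -/a -/b; lra].
    by apply: le_trans (g2 _ a0) _; rewrite ler_wpM2l ?(ltW P2)// lerDl H_ge0.
  apply: le_trans up _; rewrite /uc_const -/k mulrAC ler_pdivlMr//.
  have := ler_wpM2l (ltW P2) gap; lra.
pose e' := e ^+ 2 / 16.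
have e'0 : 0 <= e' by rewrite divr_ge0// sqr_ge0.
have e'1 : e' <= 1 / 16 by rewrite ler_wpM2r ?invr_ge0// expr_le1// ltW.
have [lo|hi] := leP m ((1 - e') * ((a + b) / 2)).
  have mb0 : 0 <= (a + b) / 2 by rewrite divr_ge0// ltW.
  have l01 : 0 < 1 - e' <= 1 by apply/andP; split; lra.
  have : H m <= (1 - e') * H ((a + b) / 2).
    apply: le_trans (H_homo m0 lo) _.
    have /andP[_ /le_trans] := growth_shrink gH l01 mb0; apply.
    by rewrite ler_wpM2r ?H_ge0// ge1r_powR ?l01// ltW.
  have ke : k <= e' by rewrite /k ge_min lexx.
  have := ler_wpM2r sab ke.
  have : (1 - e') * (2 * H ((a + b) / 2)) <= (1 - e') * (H a + H b).
    by rewrite ler_wpM2l ?half_conv//; lra.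
  by rewrite /D; lra.
(* In the parallelogram law the midpoint now accounts for all but [e^2 (a + b)^2 / 8] of
   [(a + b)^2], while the difference vector has at least [e^2 (a + b)^2 / 4]; the excess must come
   from [(a - b)^2]. *)
have far : (e / 4) * (a + b) <= `|a - b|.
  have A : (e / 2 * (a + b)) ^+ 2 <= enorm (xi - eta) ^+ 2.
    by rewrite ler_sqr ?nnegrE ?mulr_ge0 ?divr_ge0 ?enorm_ge0 ?(ltW e0) ?(ltW s0)// ltW.
  have B : ((1 - e') * ((a + b) / 2)) ^+ 2 <= m ^+ 2.
    by rewrite ler_sqr ?nnegrE ?mulr_ge0 ?divr_ge0 ?(ltW s0)//; [exact: ltW|lra].
  rewrite -ler_sqr ?nnegrE ?mulr_ge0 ?divr_ge0 ?(ltW e0) ?(ltW s0)//.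
  rewrite real_normK ?num_real//.
  have C : (1 - e') ^+ 2 >= 1 - 2 * e' by rewrite expr2; have := sqr_ge0 e'; rewrite expr2; lra.
  have S := sqr_ge0 (a + b).
  have := ler_wpM2r S C.
  have E2 : 2 * e' = e ^+ 2 / 8 by rewrite /e'; field.
  rewrite E2 mulrBl mul1r => H3.
  have EA : (e / 2 * (a + b)) ^+ 2 = e ^+ 2 * (a + b) ^+ 2 / 4 by field.
  have EB : ((1 - e') * ((a + b) / 2)) ^+ 2 = (1 - e') ^+ 2 * (a + b) ^+ 2 / 4 by field.
  have EC : (e / 4 * (a + b)) ^+ 2 = e ^+ 2 * (a + b) ^+ 2 / 16 by field.
  have ED : (a - b) ^+ 2 = 2 * a ^+ 2 + 2 * b ^+ 2 - (a + b) ^+ 2 by ring.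
  have X0 : 0 <= e ^+ 2 * (a + b) ^+ 2 by rewrite mulr_ge0// sqr_ge0.
  move: A B H3 X0; rewrite EA EB EC ED par [e ^+ 2 / 8 * _]mulrAC.
  set X := e ^+ 2 * _; set Y := (1 - e') ^+ 2 * _; set Z := (a + b) ^+ 2.
  clearbody X Y Z; move: (a ^+ 2) (b ^+ 2) (m ^+ 2) => u v w; lra.
have kle : k <= e / 32 * ((1 + e / 8) `^ (p - 1) - 1) / 2 `^ q by rewrite /k ge_min lexx orbT.
have e40 : 0 < e / 4 by rewrite divr_gt0.
have E8 : e / 4 / 8 = e / 32 by field.
have E8' : e / 4 / 2 = e / 8 by field.
have fin' : H a + H b - 2 * H ((a + b) / 2) <= 2 * D.
  by have := H_homo m0 mab; rewrite /D; lra.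
apply: le_trans fin'; apply: le_trans (ler_wpM2r sab kle) _.
have [ab|/ltW ba] := leP a b.
  have b1 : 0 < b by move: s0 ab; lra.
  have := @midpoint_gap (e / 4) b a e40 a0 ab b1; rewrite E8 E8' [b + a]addrC [H b + H a]addrC.
  by apply; move: far; rewrite distrC ger0_norm ?subr_ge0.
have a1 : 0 < a by move: s0 ba; lra.
have := @midpoint_gap (e / 4) a b e40 b0 ba a1; rewrite E8 E8'.
by apply; move: far; rewrite ger0_norm ?subr_ge0.
Qed.

End pair.
End radial.

Lemma density_continuous (R : realType) (N : nat) (p q : R) (h H : R -> R) : 1 < p -> p <= q ->
  density_pair p q h H -> continuous (fun xi : 'rV[R]_N => H (enorm xi)).
Proof.
move=> p1 pq [[gh _ h0 _] [h_ge0 _ conv _ _]].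
have hh : forall s t : R, 0 <= s -> s <= t -> h s <= h t.
  by apply: growth_homo gh h_ge0 h0; move: p1; lra.
have cH : continuous (fun t : R => H `|t|).
  move=> t; apply/(@continuous_dist R R^o R^o) => e e0.
  have L0 : 0 < h (`|t| + 1) + 1 by rewrite ltr_wpDl// h_ge0// addr_ge0.
  exists (Num.min 1 (e / (h (`|t| + 1) + 1))); first by rewrite lt_min ltr01 divr_gt0.
  move=> s; rewrite lt_min ltr_pdivlMr// => /andP[st1 st2].
  have sn : `|s| <= `|t| + 1.
    have -> : s = t - (t - s) by ring.
    by apply: le_trans (ler_normB _ _) _; rewrite lerD2l ltW.
  apply: le_lt_trans st2.
  have hs : h `|s| <= h (`|t| + 1) by apply: hh.
  have ht : h `|t| <= h (`|t| + 1) by apply: hh; rewrite // lerDl.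
  have d1 := ler_dist_dist t s; have d0 := normr_ge0 (t - s).
  have c1 := conv _ _ (normr_ge0 t) (normr_ge0 s).
  have c2 := conv _ _ (normr_ge0 s) (normr_ge0 t).
  have hs0 := h_ge0 _ (normr_ge0 s); have ht0 := h_ge0 _ (normr_ge0 t).
  apply: (@le_trans _ _ (h (`|t| + 1) * `| `|t| - `|s| |)); last first.
    by rewrite mulrC ler_pM// ?h_ge0 ?addr_ge0// lerDl.
  have a1 : h `|t| * `| `|t| - `|s| | <= h (`|t| + 1) * `| `|t| - `|s| | by rewrite ler_wpM2r.
  have a2 : h `|s| * `| `|t| - `|s| | <= h (`|t| + 1) * `| `|t| - `|s| | by rewrite ler_wpM2r.
  have b1 : - (h `|t| * `| `|t| - `|s| |) <= h `|t| * (`|s| - `|t|).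
    by rewrite -mulrN ler_wpM2l// lerNl opprB ler_norm.
  have b2 : - (h `|s| * `| `|t| - `|s| |) <= h `|s| * (`|t| - `|s|).
    by rewrite -mulrN ler_wpM2l// lerNl opprB distrC ler_norm.
  by rewrite ler_norml; move: c1 c2 a1 a2 b1 b2; lra.
rewrite (_ : (fun xi => _) = (fun t : R => H `|t|) \o (@enorm R N)); last first.
  by apply/funext => xi /=; rewrite ger0_norm ?enorm_ge0.
by move=> xi; apply: continuous_comp; [exact: enorm_continuous|exact: cH].
Qed.

Lemma continuous_sumM (R : realType) (T : topologicalType) (I : Type) (l : seq I)
  (a : I -> T -> R) (b : I -> R) :
  (forall i, continuous (a i)) -> continuous (fun t => \sum_(i <- l) a i t * b i).
Proof.
move=> ca t; rewrite /continuous_at; apply: cvg_big; first exact: add_continuous.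
by move=> i _; apply: cvgM; [exact: ca|exact: cvg_cst].
Qed.

Lemma continuous_mulr (R : realType) (T : topologicalType) (a : T -> R) (b : R) :
  continuous a -> continuous (fun t => a t * b).
Proof. by move=> ca t; apply: cvgM; [exact: ca|exact: cvg_cst]. Qed.

Lemma continuous_fun_cst (T U : topologicalType) (b : U) : continuous (fun _ : T => b).
Proof. by move=> t; exact: cvg_cst. Qed.

Lemma continuous_norm_powR (R : realType) (a : R) : 0 < a -> continuous (fun t : R => `|t| `^ a).
Proof.
move=> a0 t; have [->|t0] := eqVneq t 0.
  apply/(@continuous_dist R R^o R^o) => e e0.
  exists (e `^ a^-1) => [|s]; first by rewrite powR_gt0.
  rewrite sub0r normrN normr0 powR0 ?gt_eqF// sub0r normrN (ger0_norm (powR_ge0 _ _)) => H.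
  by rewrite -[ltRHS](@powRK R a) ?(ltW e0)//; apply: gt0_ltr_powR; rewrite // nnegrE ?powR_ge0.
apply: (@continuous_comp _ _ _ (fun t : R => `|t|) (fun t : R => t `^ a)).
  exact: norm_continuous.
have tp : 0 < `|t| by rewrite normr_gt0.
apply/differentiable_continuous/derivable1_diffP.
by have [] := @is_derive1_powR R a _ tp.
Qed.

(** * Linear combinations of functions paired with their gradients *)

Section combinations.
Context {R : realType} {T : Type} {N k : nat}.
Variables (b : 'I_k -> T -> R) (Db : 'I_k -> T -> 'rV[R]_N).

Definition comb (c : 'rV[R]_k) x : R := \sum_i c 0 i * b i x.
Definition Dcomb (c : 'rV[R]_k) x : 'rV[R]_N := \sum_i c 0 i *: Db i x.

Lemma comb_closed (Q : (T -> R) -> (T -> 'rV[R]_N) -> Prop) (c : 'rV[R]_k) :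
  Q (fun=> 0) (fun=> 0) ->
  (forall (a : R) u Du v Dv, Q u Du -> Q v Dv ->
     Q (fun x => a * u x + v x) (fun x => a *: Du x + Dv x)) ->
  (forall i, Q (b i) (Db i)) -> Q (comb c) (Dcomb c).
Proof.
move=> Q0 Q_lin Qb.
rewrite /comb /Dcomb; elim: (index_enum _) => [|i l IH].
  rewrite (_ : (fun x => _) = fun=> 0); last by apply/funext => x; rewrite big_nil.
  by rewrite (_ : (fun x => _) = fun=> 0)//; apply/funext => x; rewrite big_nil.
rewrite (_ : (fun x => _) = fun x => c 0 i * b i x + \sum_(j <- l) c 0 j * b j x); last first.
  by apply/funext => x; rewrite big_cons.
rewrite (_ : (fun x => \sum_(j <- i :: l) c 0 j *: Db j x) =
   fun x => c 0 i *: Db i x + \sum_(j <- l) c 0 j *: Db j x); first exact: Q_lin.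
by apply/funext => x; rewrite big_cons.
Qed.

Lemma combD (c e : 'rV[R]_k) : comb (c + e) = fun x => comb c x + comb e x.
Proof. by apply/funext => x; rewrite /comb -big_split; apply: eq_bigr => i _; rewrite mxE mulrDl. Qed.

Lemma combZ a (c : 'rV[R]_k) : comb (a *: c) = fun x => a * comb c x.
Proof. by apply/funext => x; rewrite /comb mulr_sumr; apply: eq_bigr => i _; rewrite mxE mulrA. Qed.

Lemma DcombD (c e : 'rV[R]_k) : Dcomb (c + e) = fun x => Dcomb c x + Dcomb e x.
Proof. by apply/funext => x; rewrite /Dcomb -big_split; apply: eq_bigr => i _; rewrite mxE scalerDl. Qed.

Lemma DcombZ a (c : 'rV[R]_k) : Dcomb (a *: c) = fun x => a *: Dcomb c x.
Proof. by apply/funext => x; rewrite /Dcomb scaler_sumr; apply: eq_bigr => i _; rewrite mxE scalerA. Qed.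

Lemma comb_continuous x : continuous (fun c => comb c x).
Proof.
by apply: continuous_sumM => i; exact: row_coord_continuous.
Qed.

Lemma Dcomb_continuous x : continuous (fun c => Dcomb c x).
Proof.
apply: continuous_rowP => j.
rewrite (_ : (fun c => _) = fun c : 'rV[R]_k => \sum_i c 0 i * Db i x 0 j); last first.
  by apply/funext => c; rewrite /Dcomb summxE; apply: eq_bigr => i _; rewrite mxE.
by apply: continuous_sumM => i; exact: row_coord_continuous.
Qed.

End combinations.

Lemma ultrafilter_colour (T : Type) (U : set_system T) (F : finType) (c : T -> F) :
  UltraFilter U -> exists i, U [set t | c t = i].
Proof.
move=> UU; apply: contrapT => /forallNP H.
have H1 : \forall t \near U, forall i, c t <> i.
  apply: filter_forall => i.
  by have [/H|] := in_ultra_setVsetC [set t | c t = i] UU.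
by have [t /(_ (c t))] := filter_ex H1.
Qed.

(** Total boundedness is stated by finite colourings because [dist] is a modular, with no triangle
    inequality. An ultrafilter finer than the cofinite filter contains one colour class for each
    tolerance [1 / (j + 1)]; a diagonal choice takes the [k]-th index from the first [k + 1] of
    these classes. *)
Lemma cauchy_subsequence (R : realType) (dist : nat -> nat -> R) :
  (forall e : R, 0 < e -> exists (F : finType) (c : nat -> F),
     forall n m, c n = c m -> dist n m <= e) ->
  exists2 s : nat -> nat, (forall k, (s k < s k.+1)%N) &
    forall e : R, 0 < e -> exists k0, forall n m, (k0 <= n)%N -> (k0 <= m)%N ->
      dist (s n) (s m) <= e.
Proof.
move=> tb; have [U [UU sU]] := @ultraFilterLemma nat \oo _.
have UP : ProperFilter U by case: UU.
have HA (j : nat) : exists A : set nat, U A /\ forall n m, A n -> A m -> dist n m <= j.+1%:R^-1.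
  have [|F [c Hc]] := tb j.+1%:R^-1; first by rewrite invr_gt0.
  have [i Ui] := ultrafilter_colour c UU.
  by exists [set n | c n = i]; split => // n m /= ni mi; apply: Hc; rewrite ni mi.
have [A {}HA] := choice HA.
have UB k : U [set n | forall j, (j <= k)%N -> A j n].
  elim: k => [|k IH].
    by apply: filterS (HA 0%N).1 => n /= An j; rewrite leqn0 => /eqP ->.
  apply: filterS (filterI IH (HA k.+1).1) => n [/= An An'] j.
  by rewrite leq_eqVlt => /predU1P[->//|]; rewrite ltnS; exact: An.
have Hn (km : nat * nat) : exists n, (km.2 < n)%N /\ forall j, (j <= km.1)%N -> A j n.
  have Um : U [set n | (km.2 < n)%N] by apply: sU; exists km.2.+1.
  by have [n [? ?]] := filter_ex (filterI Um (UB km.1)); exists n.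
have [nx {}Hn] := choice Hn.
pose s := fix s k := if k is k'.+1 then nx (k, s k') else nx (0, 0)%N.
exists s => [k|e e0]; first by have [] := Hn (k.+1, s k).
have sA k j : (j <= k)%N -> A j (s k).
  by case: k => [|k] /= jk; [have [_] := Hn (0, 0)%N|have [_] := Hn (k.+1, s k)]; apply.
have [k0 Hk0] : exists k0 : nat, k0.+1%:R^-1 <= e.
  have := @near_infty_natSinv_lt R (PosNum e0); case=> k0 _ /(_ k0 (leqnn _)) /ltW /=.
  by exists k0.
exists k0 => n m nk mk; apply: le_trans Hk0.
by apply: (HA k0).2; exact: sA.
Qed.

(** Supplies the summable consecutive increments that [modular_limit] asks for. *)
Lemma rapid_subsequence (Q : nat -> nat -> nat -> Prop) :
  (forall k, exists n0, forall n m, (n0 <= n)%N -> (n0 <= m)%N -> Q k n m) ->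
  exists2 t : nat -> nat, (forall k, (k <= t k)%N) & forall k, Q k (t k.+1) (t k).
Proof.
move=> /choice[N HN].
pose t := fix t k := if k is k'.+1 then maxn (t k').+1 (N k) else N 0%N.
have Nt k : (N k <= t k)%N by case: k => // k; exact: leq_maxr.
have tS k : (t k < t k.+1)%N by exact: leq_maxl.
exists t => [|k].
  by elim=> // k IH; exact: leq_ltn_trans (tS k).
by apply: HN => //; apply: leq_trans (Nt k) _; exact: ltnW.
Qed.

(** An almost decreasing sequence that comes within [e / 2] of the infimum of its tail stays within
    [e] of it from then on. *)
Lemma quasi_monotone_cauchy (R : realType) (a : nat -> R) : (forall n, 0 <= a n) ->
  (forall e : R, 0 < e -> exists n0, forall n m, (n0 <= n)%N -> (n <= m)%N -> a m <= a n + e) ->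
  forall e : R, 0 < e -> exists n0, forall n m, (n0 <= n)%N -> (n0 <= m)%N -> a n <= a m + e.
Proof.
move=> a0 qa e e0; have [|n0 H0] := qa (e / 2); first by rewrite divr_gt0.
pose E := [set a n | n in [set n | (n0 <= n)%N]].
have hE : has_inf E.
  split; first by exists (a n0); exists n0 => //=.
  by exists 0 => _ [n _ <-].
have [|_ [n1 /= n01 <-] Hn1] := @inf_adherent R E (e / 2) _ hE; first by rewrite divr_gt0.
exists n1 => n m n1n n1m.
have A : inf E <= a m.
  by apply: ge_inf; [exact: hE.2|exists m => //=; exact: leq_trans n1m].
have B := H0 n1 n n01 n1n.
by move: A B Hn1; lra.
Qed.

Lemma gf_cvg0 (R : realType) (p q C : R) (h : R -> R) (z : nat -> R) : 1 <= p -> growth p q h ->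
  h 0 = 0 -> 1 <= C -> C^-1 <= h 1 <= C -> (forall k, 0 <= z k) ->
  z k @[k --> \oo] --> 0 -> h (z k) @[k --> \oo] --> 0.
Proof.
move=> p1 gh h0 C1 h1 z0 cz; have C0 : 0 < C by exact: lt_le_trans C1.
apply/cvgrPdist_lt => e e0.
have m0 : 0 < Num.min 1 (e / C) by rewrite lt_min ltr01 divr_gt0.
have /cvgrPdist_lt /(_ _ m0) := cz; apply: filterS => k.
rewrite !sub0r !normrN ger0_norm// lt_min ltr_pdivlMr// => /andP[zk1 zke].
rewrite ger0_norm ?(gf_ge0 gh h0 C1 h1)//; apply: le_lt_trans zke.
have z01 : 0 <= z k <= 1 by rewrite z0 ltW.
have := gf_shrink p1 gh h0 C1 h1 z01 ler01; rewrite mulr1 => /le_trans; apply.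
by rewrite ler_wpM2l//; have /andP[] := h1.
Qed.

(** * Completeness with respect to a modular *)

Section modular_limit.
Context d (T : measurableType d) (R : realType) (mu : {measure set T -> \bar R}).
Variables (Om : set T).
Hypothesis mOm : measurable Om.
Hypothesis finOm : (mu Om < +oo)%E.
Variables (p q C : R) (H : T -> R -> R).
Hypothesis p1 : 1 <= p.
Hypothesis gH : forall x, growth p q (H x).
Hypothesis H0 : forall x, H x 0 = 0.
Hypothesis C1 : 1 <= C.
Hypothesis H1 : forall x, C^-1 <= H x 1 <= C.
Hypothesis mH : forall w : T -> R, measurable_fun Om w -> (forall x, 0 <= w x) ->
  measurable_fun Om (fun x => H x (w x)).
Variable w : nat -> T -> R.
Hypothesis mw : forall k, measurable_fun Om (w k).
Hypothesis iw : forall k : nat, itg mu Om (fun x => H x (2 ^+ k * `|w k.+1 x - w k x|)).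
Hypothesis wk : forall k : nat,
  Int mu Om (fun x => H x (2 ^+ k * `|w k.+1 x - w k x|)) <= 2^-1 ^+ k.

Let b (k : nat) x : R := 2 ^+ k * `|w k.+1 x - w k x|.
Let b_ge0 k x : 0 <= b k x. Proof. by rewrite mulr_ge0// exprn_ge0. Qed.
Let Hb_ge0 k x : 0 <= H x (b k x). Proof. exact: (gf_ge0 (gH x) (H0 x) C1 (H1 x)). Qed.
Let S x := (\sum_(k <oo) (H x (b k x))%:E)%E.
Let mb k : measurable_fun Om (b k).
Proof. by apply: measurable_funM => //; apply: measurableT_comp => //; exact: measurable_funB. Qed.
Let mHb k : measurable_fun Om (fun x => (H x (b k x))%:E).
Proof. by apply/measurable_EFinP; exact: mH. Qed.
Let S_ge0 x : (0 <= S x)%E. Proof. by apply: nneseries_ge0 => n _ _; rewrite lee_fin. Qed.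

Let mS : measurable_fun Om S.
Proof.
have := @ge0_emeasurable_sum _ T R Om (fun k x => (H x (b k x))%:E) xpredT.
apply=> //; by move=> k x _ _; rewrite lee_fin.
Qed.

Let intS : (\int[mu]_(x in Om) S x <= 2%:E)%E.
Proof.
rewrite integral_nneseries//; last by move=> n x _; rewrite lee_fin.
apply: (@le_trans _ _ (\sum_(k <oo) (2 / (2 ^ k.+1)%:R)%:E)%E); last exact: epsilon_trick0.
apply: lee_nneseries => [k _ _|k _]; first by apply: integral_ge0 => x _; rewrite lee_fin.
rewrite (Int_EFin mOm (iw k)) lee_fin; apply: le_trans (wk k) _.
by rewrite natrX exprS invfM mulrA divff// mul1r exprVn.
Qed.

Let iS : mu.-integrable Om S.
Proof.
apply/integrableP; split => //.
under eq_integral do rewrite gee0_abs//.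
by apply: le_lt_trans intS _; rewrite ltry.
Qed.

Let A := [set x | Om x /\ S x \is a fin_num].
Let mA : measurable A. Proof. exact: emeasurable_fin_num. Qed.

(** Off [A] the increments are replaced by 0, so that the series converges at every point and its
    sum is measurable as a pointwise limit. *)
Let e (k : nat) x : R := \1_A x * (w k.+1 x - w k x).
Let me k : measurable_fun Om (e k).
Proof. by apply: measurable_funM; [exact: measurable_indic|exact: measurable_funB]. Qed.

Let HS k x : A x -> H x (b k x) <= fine (S x).
Proof.
move=> [_ fS]; rewrite -lee_fin fineK//.
apply: (@le_trans _ _ (\sum_(0 <= i < k.+1) (H x (b i x))%:E)%E); last first.
  by apply: nneseries_lim_ge => i _ _; rewrite lee_fin.
by rewrite big_nat_recr//= leeDr// sume_ge0// => i _; rewrite lee_fin.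
Qed.

Let eb k x : A x -> `|e k x| = 2^-1 ^+ k * b k x.
Proof.
move=> Ax; rewrite /e /b indicE mem_set// mul1r mulrA -exprMn mulVf// expr1n mul1r//.
Qed.

Let e_out k x : ~ A x -> e k x = 0.
Proof. by move=> Ax; rewrite /e indicE memNset// mul0r. Qed.

Let geom n : \sum_(0 <= k < n) (2^-1 : R) ^+ k <= 2.
Proof.
suff -> : \sum_(0 <= k < n) (2^-1 : R) ^+ k = 2 - 2 * 2^-1 ^+ n.
  by rewrite gerBl mulr_ge0// exprn_ge0// invr_ge0.
elim: n => [|n IH]; first by rewrite big_nil expr0; lra.
by rewrite big_nat_recr//= IH exprS; field.
Qed.

Let sum_le (B : R) x n : A x -> (forall k, b k x <= B) -> \sum_(0 <= k < n) `|e k x| <= 2 * B.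
Proof.
move=> Ax bB; have B0 : 0 <= B by apply: le_trans (bB 0%N).
apply: (@le_trans _ _ (\sum_(0 <= k < n) 2^-1 ^+ k * B)).
  apply: ler_sum => k _; rewrite eb// ler_wpM2l// exprn_ge0// invr_ge0//.
by rewrite -mulr_suml ler_wpM2r.
Qed.

Let b_le k x : A x -> b k x <= 1 + C * fine (S x).
Proof.
move=> Ax; apply: le_trans (gf_ge p1 (gH x) (H0 x) C1 (H1 x) (b_ge0 k x)) _.
by rewrite lerD2l ler_wpM2l ?HS//; exact: le_trans C1.
Qed.

Let cvg_e x : cvgn [normed series (e ^~ x)].
Proof.
apply: nondecreasing_is_cvgn.
  apply/nondecreasing_seqP => n; rewrite /normed_series_of /series/= big_nat_recr//=.
  by rewrite lerDl.
have [Ax|nAx] := pselect (A x).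
  exists (2 * (1 + C * fine (S x))) => _ [n _ <-].
  by apply: sum_le => // k; exact: b_le.
exists 0 => _ [n _ <-]; rewrite /normed_series_of /series/= big1// => k _.
by rewrite e_out// normr0.
Qed.

(** A Riesz-Fischer theorem without a norm. The weights [2^k] inside [H] make the sum of the
    modulars dominate the modular of the sum of all increments, so that one integrable majorant [h]
    serves the limit and the whole sequence. *)
Lemma modular_limit : exists (v h : T -> R),
  [/\ measurable_fun Om v, measurable_fun Om h,
      forall x, 0 <= h x /\ `|v x - w 0%N x| <= h x,
      itg mu Om (fun x => H x (h x)) &
      {ae mu, forall x, Om x -> w ^~ x @ \oo --> v x /\ forall k, `|w k x - w 0%N x| <= h x}].
Proof.
pose h x := limn [normed series (e ^~ x)].
have mh : measurable_fun Om h.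
  apply: (@measurable_fun_cvg _ T R Om (fun n x => \sum_(0 <= k < n) `|e k x|)) => [n|x _].
    by apply: measurable_sum => k; exact: measurableT_comp.
  exact: cvg_e.
have cve x : cvgn (series (e ^~ x)) by apply: normed_cvg; exact: cvg_e.
pose v x := w 0%N x + limn (series (e ^~ x)).
have hge n x : \sum_(0 <= k < n) `|e k x| <= h x.
  suff nd : nondecreasing_seq [normed series (e ^~ x)].
    exact: (nondecreasing_cvgn_le nd (@cvg_e x) n).
  by apply/nondecreasing_seqP => m; rewrite /normed_series_of /series/= big_nat_recr//= lerDl.
have h0 x : 0 <= h x by have := hge 0%N x; rewrite big_nil.
exists v, h; split.
- apply: measurable_funD => //.
  apply: (@measurable_fun_cvg _ T R Om (fun n x => \sum_(0 <= k < n) e k x)) => [n|x _].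
    exact: measurable_sum.
  exact: cve.
- exact: mh.
- by move=> x; rewrite h0 /v addrC addKr; split => //; apply: lim_series_norm; exact: cvg_e.
- apply: (@itg_le _ T R mu Om mOm _ (fun x => 4 `^ q * fine (S x))).
  + exact: mH.
  + apply: itgZ => //; apply: le_integrable iS => //.
      by apply/measurable_EFinP; apply: measurableT_comp => //; exact: measurable_fine.
    move=> x _ /=; case: (S x) (S_ge0 x) => [s s0||]//=; by rewrite normr0 leey.
  move=> x _; have P0 : 0 <= 4 `^ q * fine (S x) by rewrite mulr_ge0 ?powR_ge0 ?fine_ge0.
  have [h00|hx0] := eqVneq (h x) 0; first by rewrite h00 H0 normr0.
  have hp : 0 < h x by rewrite lt_neqAle eq_sym hx0 h0.
  have [Ax|nAx] := pselect (A x); last first.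
    exfalso; move/eqP: hx0; apply; rewrite /h.
    rewrite (_ : [normed series _] = fun=> 0) ?lim_cst//.
    by apply/funext => n; rewrite /normed_series_of /series/= big1// => k _; rewrite e_out// normr0.
  rewrite ger0_norm ?(gf_ge0 (gH x) (H0 x) C1 (H1 x))//.
  (* The increments are [2^(-k) b_k], so their sum is at most twice any common bound of the [b_k].
     The bound [h x / 4] is therefore impossible, and [H x (h x)] is at most [4^q] times a single
     term of the series. *)
  have [j hj] : exists j, h x <= 4 * b j x.
    apply: contrapT => /forallNP Hn.
    have Hb j : b j x <= h x / 4.
      by rewrite ler_pdivlMr// mulrC ltW// ltNge; apply/negP/Hn.
    have : h x <= 2 * (h x / 4).
      apply: limr_le; first exact: cvg_e.
      by apply: nearW => n; exact: sum_le.
    by move: hp; lra.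
  apply: le_trans (gf_homo p1 (gH x) (H0 x) C1 (H1 x) (h0 x) hj) _.
  apply: le_trans (gf_grow (gH x) _ (b_ge0 j x)) _; first by rewrite ler1n.
  by rewrite ler_wpM2l ?powR_ge0// HS.
have := integrable_ae mOm iS; apply: filterS => x fS Ox.
have Ax : A x by split => //; exact: fS.
have wE n : w n x = w 0%N x + series (e ^~ x) n.
  rewrite /series/= (eq_bigr (fun k => w k.+1 x - w k x)).
    by rewrite telescope_sumr// addrC subrK.
  by move=> k _; rewrite /e indicE mem_set// mul1r.
split.
  rewrite (_ : w ^~ x = fun n => w 0%N x + series (e ^~ x) n); last by apply/funext => n; exact: wE.
  by apply: cvgD; [exact: cvg_cst|exact: cve].
move=> k; rewrite wE addrC addKr.
by apply: le_trans (hge k x); exact: ler_norm_sum.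
Qed.

End modular_limit.

(** The hypothesis says that the elasticity of [F] is at least [theta], so [ln F - theta ln] is
    nondecreasing beyond [t0]. *)
Lemma superlinear_growth (R : realType) (F f : R -> R) (t0 theta : R) : 0 < t0 ->
  (forall t : R, is_derive t 1 F (f t)) ->
  (forall t, t0 <= t -> 0 < theta * F t /\ theta * F t <= t * f t) -> 0 < theta ->
  forall t, t0 <= t -> F t0 * (t / t0) `^ theta <= F t.
Proof.
move=> t00 dF AR th0 t tt.
have Fp s : t0 <= s -> 0 < F s by move=> /AR[]; rewrite pmulr_rgt0.
have tp : 0 < t by exact: lt_le_trans tt.
have dl s : t0 <= s -> is_derive s 1 (fun s => ln (F s) - theta * ln s) (f s / F s - theta / s).
  move=> ts; have dF1 := dF s.
  have d1 := is_derive1_ln (lt_le_trans t00 ts); have d2 := is_derive1_ln (Fp _ ts).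
  have d3 : is_derive s 1 (fun s => ln (F s)) ((F s)^-1 * f s).
    exact: (@is_derive1_comp _ (@ln R) F s _ _ d2 dF1).
  by apply: is_derive_eq; rewrite [X in X - _]mulrC.
have [||c [/andP[c1 _] _]] := @mean_value R (fun s => ln (F s) - theta * ln s)
    (fun s => f s / F s - theta / s) t0 t tt.
- by move=> x /andP[tx _]; apply: dl; exact: ltW.
- apply: derivable_within_continuous => x; rewrite in_itv/= => /andP[tx _].
  by have [] := dl x tx.
move=> E.
have cp : 0 < c by exact: lt_le_trans c1.
have k0 : 0 <= f c / F c - theta / c.
  rewrite subr_ge0 ler_pdivrMr// mulrAC ler_pdivlMr ?Fp// [f c * _]mulrC.
  by have [] := AR c c1.
have k1 : 0 <= t - t0 by rewrite subr_ge0.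
have := mulr_ge0 k0 k1; rewrite -E => H.
rewrite -ler_ln ?posrE ?mulr_gt0 ?powR_gt0 ?divr_gt0 ?Fp//.
rewrite lnM ?posrE ?powR_gt0 ?divr_gt0 ?Fp// ln_powR ln_div ?posrE//.
by move: H; lra.
Qed.

(** * The energy and its Galerkin critical points *)

Section energy.
Context d (T : measurableType d) (R : realType) (mu : {measure set T -> \bar R}).
Variables (Om : set T) (N : nat).
Hypothesis mOm : measurable Om.
Hypothesis finOm : (mu Om < +oo)%E.
Variables (p q r r' C : R) (G g Psi f F : T -> R -> R).
Hypothesis p1 : 1 < p.
Hypothesis pq : p <= q.
Hypothesis qr : q < r.
Hypothesis rr' : r <= r'.
Hypothesis C1 : 1 <= C.
Hypothesis gG : forall x, density_pair p q (g x) (G x).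
Hypothesis G1 : forall x, C^-1 <= G x 1 <= C.
Hypothesis gP : forall x, growth r r' (Psi x).
Hypothesis P0 : forall x, Psi x 0 = 0.
Hypothesis P1 : forall x, C^-1 <= Psi x 1 <= C.
Hypothesis mG : forall w : T -> R, measurable_fun Om w -> (forall x, 0 <= w x) ->
  measurable_fun Om (fun x => G x (w x)).
Hypothesis mg : forall w : T -> R, measurable_fun Om w -> (forall x, 0 <= w x) ->
  measurable_fun Om (fun x => g x (w x)).
Hypothesis mP : forall w : T -> R, measurable_fun Om w -> (forall x, 0 <= w x) ->
  measurable_fun Om (fun x => Psi x (w x)).
Hypothesis mf : forall w : T -> R, measurable_fun Om w -> measurable_fun Om (fun x => f x (w x)).
Hypothesis mF : forall w : T -> R, measurable_fun Om w -> measurable_fun Om (fun x => F x (w x)).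
Hypothesis fc : forall x, continuous (f x).
Hypothesis Fd : forall x (t : R), is_derive t 1 (F x) (f x t).
Hypothesis F0 : forall x, F x 0 = 0.
Hypothesis fb : forall x t, `|f x t| <= C * (1 + Psi x `|t| / `|t|).
Hypothesis fs : forall e : R, 0 < e -> exists2 del : R, 0 < del &
  forall x t, `|t| < del -> `|f x t| <= e * `|t| `^ (q - 1).
Variables (t0 theta : R).
Hypothesis t0_gt0 : 0 < t0.
Hypothesis thq : q < theta.
Hypothesis AR : forall x t, t0 <= `|t| ->
  0 < theta * F x t /\ theta * F x t <= t * f x t.

Local Notation itg := (itg mu Om).
Local Notation Int := (Int mu Om).
Implicit Types (u v : T -> R) (Du Dv : T -> 'rV[R]_N) (x : T) (s t e : R).

Let q1 : 1 < q. Proof. exact: lt_le_trans pq. Qed.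
Let r1 : 1 <= r. Proof. by move: q1 qr; lra. Qed.
Let q0 : 0 <= q. Proof. by move: q1; lra. Qed.
Let r'0 : 0 <= r'. Proof. by move: r1 rr'; lra. Qed.
Let th0 : 0 < theta. Proof. by move: q1 thq; lra. Qed.
Let C0 : 0 < C. Proof. exact: lt_le_trans C1. Qed.
Let p1' : 1 <= p. Proof. exact: ltW. Qed.
Let gGx x : growth p q (G x). Proof. by have [[]] := gG x. Qed.
Let G0 x : G x 0 = 0. Proof. by have [[]] := gG x. Qed.
Let g0 x : g x 0 = 0. Proof. by have [[]] := gG x. Qed.
Let G_ge0 x t : 0 <= t -> 0 <= G x t.
Proof. exact: (gf_ge0 (gGx x) (G0 x) C1 (G1 x)). Qed.
Let P_ge0 x t : 0 <= t -> 0 <= Psi x t.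
Proof. exact: (gf_ge0 (gP x) (P0 x) C1 (P1 x)). Qed.
Let g_ge0 x t : 0 <= t -> 0 <= g x t.
Proof. by have [_ [+ _ _ _ _]] := gG x; apply. Qed.
Let tg_le x t : 0 <= t -> t * g x t <= q * G x t.
Proof. by have [_ [_ _ _ + _]] := gG x; apply. Qed.
Let g_homo x s t : 0 <= s -> s <= t -> g x s <= g x t.
Proof.
have [[gg _ _ _] [gg0 _ _ _ _]] := gG x.
by apply: growth_homo gg gg0 (g0 x) _ _; move: p1; lra.
Qed.
Let G_homo x s t : 0 <= s -> s <= t -> G x s <= G x t.
Proof. exact: gf_homo p1' (gGx x) (G0 x) C1 (G1 x) s t. Qed.
Let P_homo x s t : 0 <= s -> s <= t -> Psi x s <= Psi x t.
Proof. exact: gf_homo r1 (gP x) (P0 x) C1 (P1 x) s t. Qed.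

Lemma f_le x t : `|f x t| <= C * (1 + C + Psi x `|t|).
Proof.
apply: le_trans (fb x t) _; rewrite ler_wpM2l ?(ltW C0)// -addrA lerD2l.
exact: (gf_ratio r1 (gP x) (P0 x) C1 (P1 x) (normr_ge0 t)).
Qed.

Lemma F_mean_value x t : exists2 s, `|s| <= `|t| & F x t = f x s * t.
Proof.
have [t_ge0|/ltW t_le0] := leP 0 t.
  have [c [/andP[c0 ct] _] E] := mean_value t_ge0 (fun y _ => Fd x y) (is_derive_continuousW (Fd x)).
  exists c; first by rewrite !ger0_norm// (le_trans c0).
  by rewrite -[LHS]subr0 -(F0 x) E subr0.
have [c [/andP[tc c0] _] E] := mean_value t_le0 (fun y _ => Fd x y) (is_derive_continuousW (Fd x)).
exists c; first by rewrite !ler0_norm ?lerN2.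
by move: E; rewrite F0 !sub0r mulrN => /oppr_inj.
Qed.

Lemma F_le x t : `|F x t| <= C * (`|t| + Psi x `|t|).
Proof.
have [s st ->] := F_mean_value x t; rewrite normrM.
apply: (@le_trans _ _ (C * (1 + Psi x `|t| / `|t|) * `|t|)).
  rewrite ler_wpM2r//; apply: le_trans (fb x s) _.
  rewrite ler_wpM2l ?(ltW C0)// lerD2l.
  exact: (gf_ratio_homo r1 (gP x) (P0 x) C1 (P1 x) (normr_ge0 s) st).
rewrite -mulrA ler_wpM2l ?(ltW C0)// mulrDl mul1r lerD2l.
have [->|tn] := eqVneq t 0; first by rewrite normr0 mulr0 P0.
by rewrite divfK// normr_eq0.
Qed.

(** Below [del] the smallness of [f] at 0 is used; above it the linear part of [F_le] is absorbed
    into [Psi], which grows at least linearly from [del] on. *)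
Lemma F_small e : 0 < e -> exists2 K, 0 < K &
  forall x t, `|F x t| <= e * `|t| `^ q + K * Psi x `|t|.
Proof.
move=> e0; have [del del0 Hdel] := fs e0.
have tgt : 0 < C * (del * (C * (Num.max 1 (del^-1)) `^ r') + 1).
  by rewrite mulr_gt0// ltr_wpDl// mulr_ge0 ?(ltW del0)// mulr_ge0 ?(ltW C0)// powR_ge0.
exists (C * (del * (C * (Num.max 1 (del^-1)) `^ r') + 1)) => // x t.
have pos : 0 <= e * `|t| `^ q by rewrite mulr_ge0 ?powR_ge0// ltW.
have [td|dt] := ltP `|t| del.
  have [s st ->] := F_mean_value x t.
  apply: (@le_trans _ _ (e * `|t| `^ q)); last first.
    by rewrite lerDl mulr_ge0 ?P_ge0// ltW.
  rewrite normrM -(@mulr_powRB1 R `|t| q)//; last by move: q1; lra.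
  rewrite [`|t| * _]mulrC mulrA ler_wpM2r//.
  apply: le_trans (Hdel x s (le_lt_trans st td)) _.
  by rewrite ler_wpM2l ?(ltW e0)// powR_homo// subr_ge0 ltW.
apply: (@le_trans _ _ (C * (del * (C * (Num.max 1 del^-1) `^ r') + 1) * Psi x `|t|)); last first.
  by rewrite lerDr.
apply: le_trans (F_le x t) _; rewrite -mulrA ler_wpM2l ?(ltW C0)//.
rewrite mulrDl mul1r lerD2r.
(* A lower bound for [Psi x del] that is uniform in [x]: the bound at 1 is carried to [del] by the
   upper growth exponent. *)
have Pd : 1 <= C * (Num.max 1 del^-1) `^ r' * Psi x del.
  have m1 : 1 <= Num.max 1 del^-1 by rewrite le_max lexx.
  have m2 : 1 <= Num.max 1 del^-1 * del.
    by rewrite -ler_pdivrMr// div1r le_max lexx orbT.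
  have := gf_grow (gP x) m1 (ltW del0) => H.
  have /andP[A _] := P1 x.
  rewrite -mulrA -ler_pdivrMl// mulr1; apply: le_trans A _.
  by apply: le_trans H; exact: P_homo.
have tp : 0 < `|t| by exact: lt_le_trans dt.
have l1 : 1 <= `|t| / del by rewrite ler_pdivlMr// mul1r.
have Pt : `|t| / del * Psi x del <= Psi x `|t|.
  have /andP[H _] := gP x l1 (ltW del0); rewrite divfK ?gt_eqF// in H.
  by apply: le_trans H; rewrite ler_wpM2r ?P_ge0 ?(ltW del0)//; exact: le1r_powR.
set K := C * _ in Pd *.
have K0 : 0 <= K by rewrite mulr_ge0 ?powR_ge0// ltW.
apply: (@le_trans _ _ (del * K * (`|t| / del * Psi x del))); last first.
  by rewrite ler_wpM2l// mulr_ge0// ltW.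
rewrite [leRHS](_ : _ = `|t| * (K * Psi x del)); last by field; rewrite gt_eqF.
by rewrite ler_peMr.
Qed.

(** The coefficient [F1] depends on [x], since positivity of [F x t0] and [F x (- t0)] gives no
    uniform positive lower bound. On a finite-dimensional space a positive weight is enough. *)
Lemma F_superlinear : exists F1 : T -> R, exists K, [/\ measurable_fun Om F1,
  forall x, 0 < F1 x <= K & forall x t, F1 x * `|t| `^ theta - K <= F x t].
Proof.
pose F1 x := Num.min (F x t0) (F x (- t0)) / t0 `^ theta.
pose B0 := C * (t0 + (Num.max 1 t0) `^ r' * C).
have B00 : 0 < B0 by rewrite mulr_gt0// ltr_wpDr// mulr_ge0 ?powR_ge0// ltW.
have FB x t : `|t| <= t0 -> `|F x t| <= B0.
  move=> tt; apply: le_trans (F_le x t) _; rewrite ler_wpM2l ?(ltW C0)// lerD//.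
  have := gf_bound r1 (gP x) (P0 x) C1 (P1 x); apply => //; first by rewrite le_max lexx.
  by rewrite le_max tt orbT.
have Pt : 0 < t0 `^ theta by rewrite powR_gt0.
have Fp x t : t0 <= `|t| -> 0 < F x t.
  by move=> /(AR x)[]; rewrite pmulr_rgt0.
have nt0 : `|t0| = t0 by rewrite gtr0_norm.
have F10 x : 0 < F1 x by rewrite divr_gt0// lt_min !Fp// ?normrN nt0.
have F1le x : F1 x * t0 `^ theta <= F x t0 /\ F1 x * t0 `^ theta <= F x (- t0).
  by rewrite /F1 divfK ?gt_eqF//; split; rewrite ge_min lexx ?orbT.
exists F1, (B0 / t0 `^ theta + 2 * B0); split.
- apply: measurable_funM; last exact: measurable_cst.
  by apply: measurable_minr; apply: mF; exact: measurable_cst.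
- move=> x; rewrite F10/=; apply: (@le_trans _ _ (B0 / t0 `^ theta)); last first.
    by rewrite lerDl mulr_ge0// ltW.
  rewrite ler_wpM2r ?invr_ge0 ?(ltW Pt)// ge_min; apply/orP; left.
  by apply: le_trans (ler_norm _) _; apply: FB; rewrite nt0.
move=> x t; have [tt|tt] := leP t0 `|t|.
  apply: (@le_trans _ _ (F1 x * `|t| `^ theta)).
    rewrite gerBl addr_ge0//; first by rewrite divr_ge0 ?(ltW B00) ?(ltW Pt).
    by rewrite mulr_ge0 ?(ltW B00).
  have E : `|t| `^ theta = t0 `^ theta * (`|t| / t0) `^ theta.
    rewrite powRM ?invr_ge0 ?(ltW t0_gt0)// powRV//; field; by rewrite gt_eqF.
  rewrite E mulrA.
  have [tp|tn] := leP 0 t.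
    rewrite ger0_norm// in tt *.
    have AR' s : t0 <= s -> 0 < theta * F x s /\ theta * F x s <= s * f x s.
      by move=> ts; apply: AR; apply: le_trans ts (ler_norm _).
    apply: le_trans (superlinear_growth t0_gt0 (Fd x) AR' th0 tt).
    by rewrite ler_wpM2r ?powR_ge0//; have [] := F1le x.
  rewrite ltr0_norm// in tt *.
  have AR' s : t0 <= s -> 0 < theta * F x (- s) /\ theta * F x (- s) <= s * - f x (- s).
    move=> ts; have := @AR x (- s); rewrite normrN mulNr mulrN; apply.
    exact: le_trans ts (ler_norm _).
  have Fd' s : is_derive s 1 (fun s => F x (- s)) (- f x (- s)).
    have dN : is_derive s 1 (fun s : R => - s) (-1).
      exact: is_deriveNid.
    have := @is_derive1_comp _ (F x) (fun s : R => - s) s _ _ (Fd x (- s)) dN.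
    by rewrite mulrN1.
  have := superlinear_growth t0_gt0 Fd' AR' th0 tt; rewrite opprK; apply: le_trans.
  by rewrite ler_wpM2r ?powR_ge0//; have [] := F1le x.
apply: (@le_trans _ _ (- B0)); last first.
  have := FB x t (ltW tt); rewrite ler_norml => /andP[]//.
have : F1 x * `|t| `^ theta <= B0.
  apply: (@le_trans _ _ (F1 x * t0 `^ theta)).
    by rewrite ler_wpM2l ?(ltW (F10 x))// powR_homo ?(ltW th0)// ltW.
  apply: le_trans (F1le x).1 _; apply: le_trans (ler_norm _) _; apply: FB.
  by rewrite nt0.
have : 0 <= B0 / t0 `^ theta by rewrite divr_ge0 ?(ltW B00)// ltW.
lra.
Qed.

Definition measurable_vec Du := forall i, measurable_fun Om (fun x => Du x 0 i).

Lemma measurable_dotv Du Dv : measurable_vec Du -> measurable_vec Dv ->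
  measurable_fun Om (fun x => dotv (Du x) (Dv x)).
Proof.
move=> mu_ mv; rewrite /dotv; apply: measurable_sum => i.
by apply: measurable_funM; [exact: mu_|exact: mv].
Qed.

Lemma measurable_fun_powR (w : T -> R) s :
  measurable_fun Om w -> measurable_fun Om (fun x => w x `^ s).
Proof. by move=> mw; exact: (measurableT_comp (@measurable_powR R s) mw). Qed.

Lemma measurable_enorm Du : measurable_vec Du -> measurable_fun Om (fun x => enorm (Du x)).
Proof.
move=> mD; rewrite (_ : (fun _ => _) = fun x => dotv (Du x) (Du x) `^ 2^-1).
  by apply: measurable_fun_powR; exact: measurable_dotv.
by apply/funext => x; rewrite powR12_sqrt ?dotvv_ge0.
Qed.

Lemma measurable_flux_dot Du Dv : measurable_vec Du -> measurable_vec Dv ->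
  measurable_fun Om (fun x => dotv (radial_flux (g x) (Du x)) (Dv x)).
Proof.
move=> mu_ mv; rewrite (_ : (fun _ => _) =
   fun x => g x (enorm (Du x)) / enorm (Du x) * dotv (Du x) (Dv x)); last first.
  by apply/funext => x; rewrite dotvZl.
apply: measurable_funM; last exact: measurable_dotv.
apply: measurable_funM; first by apply: mg => [|x]; [exact: measurable_enorm|exact: enorm_ge0].
rewrite (_ : (fun _ => _) = fun x => enorm (Du x) `^ (-1)).
  by apply: measurable_fun_powR; exact: measurable_enorm.
by apply/funext => x; rewrite powR_inv1 ?enorm_ge0.
Qed.

(* The pairs (test function, gradient), kept abstract so that the variational argument
   needs no differentiability on [T]. *)
Variable P : (T -> R) -> (T -> 'rV[R]_N) -> Prop.
Hypothesis P_zero : P (fun=> 0) (fun=> 0).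
Hypothesis P_lin : forall a u Du v Dv, P u Du -> P v Dv ->
  P (fun x => a * u x + v x) (fun x => a *: Du x + Dv x).
Hypothesis P_meas : forall u Du, P u Du -> measurable_fun Om u /\ measurable_vec Du.
Hypothesis P_bdd : forall u Du, P u Du ->
  exists B : R, forall x, `|u x| <= B /\ enorm (Du x) <= B.

Definition Phi Du := Int (fun x => G x (enorm (Du x))).
Definition energy u Du := Phi Du - Int (fun x => F x (u x)).
Definition stress Du Dv := Int (fun x => dotv (radial_flux (g x) (Du x)) (Dv x)).
Definition force u v := Int (fun x => f x (u x) * v x).

Lemma P_bdd1 u Du : P u Du ->
  exists2 B : R, 1 <= B & forall x, `|u x| <= B /\ enorm (Du x) <= B.
Proof.
move=> /P_bdd[B HB]; exists (Num.max 1 B); first by rewrite le_max lexx.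
by move=> x; have [? ?] := HB x; rewrite !le_max; split; apply/orP; right.
Qed.

Lemma PZ a u Du : P u Du -> P (fun x => a * u x) (fun x => a *: Du x).
Proof.
move=> Pu; have := P_lin a Pu P_zero.
rewrite (_ : (fun x => _ + 0) = fun x => a * u x); last by apply/funext => x; rewrite addr0.
by rewrite (_ : (fun x => _ + 0) = fun x => a *: Du x)//; apply/funext => x; rewrite addr0.
Qed.

Lemma G_bound (B : R) x t : 1 <= B -> 0 <= t -> t <= B -> G x t <= B `^ q * C.
Proof. exact: (gf_bound p1' (gGx x) (G0 x) C1 (G1 x)). Qed.

Lemma Psi_bound (B : R) x t : 1 <= B -> 0 <= t -> t <= B -> Psi x t <= B `^ r' * C.
Proof. exact: (gf_bound r1 (gP x) (P0 x) C1 (P1 x)). Qed.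

Lemma g_bound (B : R) x t : 1 <= B -> 0 <= t -> t <= B -> g x t <= q * (B `^ q * C).
Proof.
move=> B1 t0' tB; have B0 : 0 <= B by exact: le_trans B1.
apply: le_trans (g_homo x t0' tB) _; apply: (@le_trans _ _ (B * g x B)).
  by rewrite ler_peMl// g_ge0.
by apply: le_trans (tg_le _ B0) _; rewrite ler_wpM2l// G_bound.
Qed.

Lemma f_bound (B : R) x t : 1 <= B -> `|t| <= B -> `|f x t| <= C * (1 + C + B `^ r' * C).
Proof.
move=> B1 tB; apply: le_trans (f_le x t) _.
by rewrite ler_wpM2l ?(ltW C0)// lerD2l Psi_bound.
Qed.

Lemma F_bound (B : R) x t : 1 <= B -> `|t| <= B -> `|F x t| <= C * (B + B `^ r' * C).
Proof.
move=> B1 tB; apply: le_trans (F_le x t) _.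
by rewrite ler_wpM2l ?(ltW C0)// lerD// Psi_bound.
Qed.

Lemma itg_G u Du : P u Du -> itg (fun x => G x (enorm (Du x))).
Proof.
move=> Pu; have [B B1 HB] := P_bdd1 Pu; have [_ mDu] := P_meas Pu.
apply: (itg_bounded mOm finOm (B := B `^ q * C)).
  by apply: mG => [|x]; [exact: measurable_enorm|exact: enorm_ge0].
by move=> x _; rewrite ger0_norm ?G_ge0 ?enorm_ge0// G_bound ?enorm_ge0//; have [] := HB x.
Qed.

Lemma itg_Psi u Du : P u Du -> itg (fun x => Psi x `|u x|).
Proof.
move=> Pu; have [B B1 HB] := P_bdd1 Pu; have [mu_ _] := P_meas Pu.
apply: (itg_bounded mOm finOm (B := B `^ r' * C)).
  by apply: mP => [|x]; [exact: measurableT_comp|].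
by move=> x _; rewrite ger0_norm ?P_ge0// Psi_bound//; have [] := HB x.
Qed.

Lemma itg_F u Du : P u Du -> itg (fun x => F x (u x)).
Proof.
move=> Pu; have [B B1 HB] := P_bdd1 Pu; have [mu_ _] := P_meas Pu.
apply: (itg_bounded mOm finOm (B := C * (B + B `^ r' * C))); first exact: mF.
by move=> x _; rewrite F_bound//; have [] := HB x.
Qed.

Lemma itg_pow u Du s : 0 <= s -> P u Du -> itg (fun x => `|u x| `^ s).
Proof.
move=> s0 Pu; have [B B1 HB] := P_bdd1 Pu; have [mu_ _] := P_meas Pu.
apply: (itg_bounded mOm finOm (B := B `^ s)).
  by apply: measurable_fun_powR; exact: measurableT_comp.
by move=> x _; rewrite ger0_norm ?powR_ge0// powR_homo//; have [] := HB x.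
Qed.

Lemma itg_stress u Du v Dv : P u Du -> P v Dv ->
  itg (fun x => dotv (radial_flux (g x) (Du x)) (Dv x)).
Proof.
move=> Pu Pv; have [B B1 HB] := P_bdd1 Pu; have [_ mDu] := P_meas Pu.
have [B' B'1 HB'] := P_bdd1 Pv; have [_ mDv] := P_meas Pv.
apply: (itg_bounded mOm finOm (B := q * (B `^ q * C) * B')).
  exact: measurable_flux_dot.
move=> x _; apply: le_trans (flux_dot_le (gG x) _ _) _.
apply: ler_pM; rewrite ?g_ge0 ?enorm_ge0//; last by have [] := HB' x.
by apply: g_bound; rewrite ?enorm_ge0//; have [] := HB x.
Qed.

Lemma itg_force u Du v Dv : P u Du -> P v Dv -> itg (fun x => f x (u x) * v x).
Proof.
move=> Pu Pv; have [B B1 HB] := P_bdd1 Pu; have [mu_ _] := P_meas Pu.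
have [B' B'1 HB'] := P_bdd1 Pv; have [mv _] := P_meas Pv.
apply: (itg_bounded mOm finOm (B := C * (1 + C + B `^ r' * C) * B')).
  by apply: measurable_funM => //; exact: mf.
move=> x _; rewrite normrM; apply: ler_pM => //; last by have [] := HB' x.
by apply: f_bound => //; have [] := HB x.
Qed.

Lemma Phi_ge0 Du : 0 <= Phi Du.
Proof. by apply: Int_ge0 => x _; rewrite G_ge0 ?enorm_ge0. Qed.

Lemma energy_lower : exists2 K : R, 0 <= K & forall u Du, P u Du -> energy u Du <= Phi Du + K.
Proof.
have [F1 [K [mF1 F1K HF]]] := F_superlinear.
exists (Num.max 0 K * fine (mu Om)) => [|u Du Pu].
  by rewrite mulr_ge0 ?le_max ?lexx// fine_ge0.
rewrite /energy lerD2l lerNl -mulNr -Int_cst//.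
apply: Int_le => //; [exact: itg_cst|exact: itg_F Pu|move=> x _].
apply: (@le_trans _ _ (- K)); first by rewrite lerN2 le_max lexx orbT.
apply: le_trans (HF x (u x)); rewrite lerDr mulr_ge0 ?powR_ge0//.
by have /andP[/ltW] := F1K x.
Qed.

Lemma AR_below : exists2 K : R, 0 <= K & forall x t,
  - K <= theta^-1 * (t * f x t) - F x t.
Proof.
pose B := Num.max 1 t0.
have B1 : 1 <= B by rewrite le_max lexx.
pose K := theta^-1 * (t0 * (C * (1 + C + B `^ r' * C))) + C * (B + B `^ r' * C).
have ti : 0 <= theta^-1 by rewrite invr_ge0 ltW.
have BB : 0 <= B `^ r' * C by rewrite mulr_ge0 ?powR_ge0 ?(ltW C0).
have K0 : 0 <= K.
  rewrite /K addr_ge0// ?mulr_ge0// ?addr_ge0 ?(ltW C0) ?(ltW t0_gt0)//.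
  exact: le_trans B1.
exists K => // x t; have [tt|tt] := leP t0 `|t|.
  have [_ H] := AR x tt; apply: (@le_trans _ _ 0); first by rewrite oppr_le0.
  by rewrite subr_ge0 -ler_pdivrMl ?invr_gt0// invrK.
have tB : `|t| <= B by rewrite /B le_max (ltW tt) orbT.
have := F_bound x B1 tB; have := f_bound x B1 tB => A1 A2.
have A3 : theta^-1 * `|t * f x t| <= theta^-1 * (t0 * (C * (1 + C + B `^ r' * C))).
  by rewrite ler_wpM2l// normrM ler_pM// ltW.
have A4 := ler_norm (F x t).
have A5 : - `|t * f x t| <= t * f x t by rewrite lerNl -normrN ler_norm.
have A6 := ler_wpM2l ti A5; rewrite mulrN in A6.
by rewrite /K; lra.
Qed.

(** Subtracting [theta^-1] times the equation tested with [u] from the energy leaves at least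
    [(1 - q / theta) Phi Du], up to the constant of [AR_below], because
    [stress Du Du <= q Phi Du]. *)
Lemma AR_bounded (M : R) : exists2 K : R, 0 <= K & forall u Du, P u Du ->
  energy u Du <= M -> stress Du Du = force u u -> Phi Du <= K.
Proof.
have [K K0 HK] := AR_below.
have th1 : 0 < 1 - q / theta by rewrite subr_gt0 ltr_pdivrMr// mul1r.
pose B := (M + K * fine (mu Om)) / (1 - q / theta).
exists (Num.max 0 B) => [|u Du Pu JM crit]; first by rewrite le_max lexx.
rewrite le_max; apply/orP; right; rewrite /B ler_pdivlMr//.
have s1 : stress Du Du <= q * Phi Du.
  rewrite /Phi -IntZ//; last exact: itg_G Pu.
  apply: Int_le => //; first exact: (itg_stress Pu Pu).
    by apply: itgZ => //; exact: itg_G Pu.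
  by move=> x _; rewrite flux_dot_self tg_le ?enorm_ge0.
have s2 : - K * fine (mu Om) <= theta^-1 * force u u - Int (fun x => F x (u x)).
  have iuu : itg (fun x => u x * f x (u x)).
    by apply: (itg_eq mOm _ (itg_force Pu Pu)) => x _; rewrite mulrC.
  rewrite -Int_cst// (_ : force u u = Int (fun x => u x * f x (u x))); last first.
    by apply: Int_eq => x _; rewrite mulrC.
  rewrite -IntZ// -IntB//; [|exact: itgZ|exact: itg_F Pu].
  apply: Int_le => //; first exact: itg_cst.
  by apply: itgB => //; [exact: itgZ|exact: itg_F Pu].
have := ler_wpM2l (_ : 0 <= theta^-1) s1; rewrite invr_ge0 (ltW th0) => /(_ isT).
rewrite crit mulrA [theta^-1 * q]mulrC => s3.
by move: JM; rewrite /energy; move: s2 s3; rewrite mulNr; lra.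
Qed.

Hypothesis emb : exists2 Ce : R, 0 < Ce & forall u Du, P u Du -> Phi Du <= 1 ->
  Int (fun x => Psi x `|u x|) <= Ce.

(** The embedding is applied to [u / l], whose modular is at most [l^(-q) Phi Du <= 1]; returning to
    [u] gains [l^r]. The second bound comes from [t^q <= 1 + C Psi t], which explains the three
    summands of the constant. *)
Lemma emb_scaled : exists2 Ce : R, 0 < Ce & forall (l : R) u Du, P u Du -> 0 < l <= 1 ->
  Phi Du <= l `^ q -> Int (fun x => Psi x `|u x|) <= Ce * l `^ r /\
    Int (fun x => `|u x| `^ q) <= Ce * l `^ q.
Proof.
have [Ce Ce0 H] := emb.
exists (Ce + fine (mu Om) + C * Ce) => [|l u Du Pu /andP[l0 l1] Pl].
  by rewrite -addrA ltr_pwDl// addr_ge0 ?fine_ge0// mulr_ge0// ltW.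
have il : 1 <= l^-1 by rewrite invf_ge1.
have Pv := PZ l^-1 Pu.
have Phl : Phi (fun x => l^-1 *: Du x) <= 1.
  apply: (@le_trans _ _ (l^-1 `^ q * Phi Du)).
    rewrite /Phi -IntZ//; last exact: itg_G Pu.
    apply: Int_le => //; [exact: itg_G Pv|by apply: itgZ => //; exact: itg_G Pu|].
    move=> x _; rewrite enormZ ger0_norm ?invr_ge0 ?(ltW l0)//.
    by apply: (gf_grow (gGx x)); rewrite ?enorm_ge0.
  by rewrite powRV// ler_pdivrMl ?powR_gt0// mulr1.
have Iv := H _ _ Pv Phl.
have vE x : `|u x| = l * `|l^-1 * u x|.
  by rewrite normrM ger0_norm ?invr_ge0 ?(ltW l0)// mulVKf ?gt_eqF.
have l01 : 0 <= l <= 1 by rewrite (ltW l0).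
split.
  apply: (@le_trans _ _ (l `^ r * Ce)); last first.
    rewrite mulrC ler_wpM2r ?powR_ge0// -addrA lerDl addr_ge0 ?fine_ge0//.
    by rewrite mulr_ge0// ltW.
  apply: (@le_trans _ _ (l `^ r * Int (fun x => Psi x `|l^-1 * u x|))); last first.
    by rewrite ler_wpM2l// powR_ge0.
  rewrite -IntZ//; last exact: itg_Psi Pv.
  apply: Int_le => //; [exact: itg_Psi Pu|by apply: itgZ => //; exact: itg_Psi Pv|].
  by move=> x _; rewrite {1}vE (gf_shrinkp (gP x) (P0 x) C1 (P1 x)).
apply: (@le_trans _ _ (l `^ q * (fine (mu Om) + C * Ce))); last first.
  by rewrite mulrC ler_wpM2r ?powR_ge0// -addrA lerDr ltW.
apply: (@le_trans _ _ (l `^ q * Int (fun x => 1 + C * Psi x `|l^-1 * u x|))); last first.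
  rewrite ler_wpM2l ?powR_ge0// IntD//; last 2 first.
  - exact: itg_cst.
  - by apply: itgZ => //; exact: itg_Psi Pv.
  rewrite Int_cst// mul1r lerD2l IntZ//; last exact: itg_Psi Pv.
  by rewrite ler_wpM2l ?(ltW C0).
have i1 : itg (fun x => 1 + C * Psi x `|l^-1 * u x|).
  by apply: itgD => //; [exact: itg_cst|apply: itgZ => //; exact: itg_Psi Pv].
rewrite -IntZ//; apply: Int_le => //; [exact: itg_pow Pu|exact: itgZ|].
move=> x _; rewrite {1}vE powRM ?(ltW l0)//; rewrite ler_wpM2l ?powR_ge0//.
set t := `|_|; have t_ge0 : 0 <= t by rewrite normr_ge0.
have [t1|/ltW t1] := leP 1 t.
  apply: (@le_trans _ _ (C * Psi x t)); last by rewrite lerDr.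
  have /andP[A _] := gP x t1 ler01; rewrite mulr1 in A.
  have /andP[B _] := P1 x.
  rewrite -ler_pdivrMl// mulrC; apply: le_trans A; apply: ler_pM; rewrite ?powR_ge0 ?invr_ge0 ?(ltW C0)//.
  by apply: ler_powR => //; exact: ltW.
apply: (@le_trans _ _ 1); last by rewrite lerDl mulr_ge0 ?P_ge0 ?(ltW C0).
have E1 : 1 `^ q = 1 :> R by rewrite powR1.
by rewrite -[leRHS]E1 powR_homo.
Qed.

Lemma energy_ridge : exists2 sigma : R, 0 < sigma &
  forall u Du, P u Du -> Phi Du = sigma -> sigma / 2 <= energy u Du.
Proof.
have [Ce Ce0 H] := emb_scaled.
(* With this coefficient the power term takes a quarter of [sigma = l^q]. As [r > q], a small [l]
   makes the [Psi] term at most another quarter, and half of [sigma] remains. *)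
have e0 : 0 < 4^-1 / Ce by rewrite divr_gt0.
have [K K0 HF] := F_small e0.
have rq : 0 < r - q by rewrite subr_gt0.
pose l := Num.min 1 ((4 * K * Ce)^-1 `^ (r - q)^-1).
have kc : 0 < 4 * K * Ce by rewrite !mulr_gt0.
have l0 : 0 < l by rewrite lt_min ltr01 powR_gt0// invr_gt0.
have l1 : l <= 1 by rewrite ge_min lexx.
have lrq : 4 * K * Ce * l `^ (r - q) <= 1.
  rewrite -ler_pdivlMl// mulr1.
  apply: le_trans (_ : _ <= ((4 * K * Ce)^-1 `^ (r - q)^-1) `^ (r - q)) _.
    by rewrite powR_homo ?(ltW rq) ?(ltW l0)// ge_min lexx orbT.
  by rewrite powRK// invr_ge0 ltW.
exists (l `^ q) => [|u Du Pu PE]; first by rewrite powR_gt0.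
have l01 : 0 < l <= 1 by rewrite l0.
have PE' : Phi Du <= l `^ q by rewrite PE.
have [A B] := H l u Du Pu l01 PE'.
have Fle : Int (fun x => F x (u x)) <= 4^-1 / Ce * Int (fun x => `|u x| `^ q) + K * Int (fun x => Psi x `|u x|).
  rewrite -!IntZ//; [|exact: itg_Psi Pu|exact: itg_pow Pu].
  have i1 : itg (fun x => 4^-1 / Ce * `|u x| `^ q) by apply: itgZ => //; exact: itg_pow Pu.
  have i2 : itg (fun x => K * Psi x `|u x|) by apply: itgZ => //; exact: itg_Psi Pu.
  rewrite -IntD//; apply: Int_le => //; [exact: itg_F Pu|exact: itgD|].
  by move=> x _; apply: le_trans (HF x (u x)); exact: ler_norm.
rewrite /energy PE.
have lr : l `^ r = l `^ q * l `^ (r - q).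
  by rewrite -powRD ?(gt_eqF l0) ?implybT// addrC subrK.
have B' : 4^-1 / Ce * Int (fun x => `|u x| `^ q) <= 4^-1 * l `^ q.
  apply: le_trans (ler_wpM2l (ltW e0) B) _.
  by rewrite mulrA divfK ?gt_eqF.
have A' : K * Int (fun x => Psi x `|u x|) <= 4^-1 * l `^ q.
  apply: le_trans (ler_wpM2l (ltW K0) A) _.
  rewrite lr (_ : K * _ = (4 * K * Ce * l `^ (r - q)) * (4^-1 * l `^ q)); last by field.
  by rewrite ler_piMl// mulr_ge0 ?powR_ge0.
have := powR_ge0 l q; lra.
Qed.

Lemma energy_mean_value u Du v Dv : P u Du -> P v Dv ->
  exists2 s : R, 0 <= s <= 1 &
    energy (fun x => u x + v x) (fun x => Du x + Dv x) - energy u Du =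
    stress (fun x => Du x + s *: Dv x) Dv - force (fun x => u x + s * v x) v.
Proof.
move=> Pu Pv.
have Puv s : P (fun x => u x + s * v x) (fun x => Du x + s *: Dv x).
  have := P_lin s Pv Pu.
  rewrite (_ : (fun x => s * v x + u x) = fun x => u x + s * v x); last first.
    by apply/funext => x; rewrite addrC.
  by rewrite (_ : (fun x => s *: Dv x + Du x) = fun x => Du x + s *: Dv x)//; apply/funext => x; rewrite addrC.
have [B B1 HB] := P_bdd1 Pu; have [B' B'1 HB'] := P_bdd1 Pv.
pose K x (s : R) := G x (enorm (Du x + s *: Dv x)) - F x (u x + s * v x).
pose dK x (s : R) := dotv (radial_flux (g x) (Du x + s *: Dv x)) (Dv x) - f x (u x + s * v x) * v x.
pose B2 := B + 2 * B'.
have B21 : 1 <= B2 by rewrite /B2; move: B1 B'1; lra.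
have B2b x (s : R) : -1 < s < 2 -> `|u x + s * v x| <= B2 /\ enorm (Du x + s *: Dv x) <= B2.
  move=> /andP[s1 s2]; have sn : `|s| <= 2 by rewrite ler_norml; move: s1 s2; lra.
  have [a1 a2] := HB x; have [b1 b2] := HB' x; split.
    by apply: le_trans (ler_normD _ _) _; rewrite lerD// normrM ler_pM.
  by apply: le_trans (enormD _ _) _; rewrite lerD// enormZ ler_pM// enorm_ge0.
pose BB := Num.max (B2 `^ q * C + C * (B2 + B2 `^ r' * C))
   (q * (B2 `^ q * C) * B' + C * (1 + C + B2 `^ r' * C) * B').
have [||| s s01 E] := @Int_mean_value _ T R mu Om mOm finOm K dK BB.
- move=> s; apply: measurable_funB.
    by apply: mG => [|x]; [apply: measurable_enorm; exact: (P_meas (Puv s)).2|exact: enorm_ge0].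
  by apply: mF; exact: (P_meas (Puv s)).1.
- move=> x s _.
  have d1 := radial_is_derive (gG x) (Du x) (Dv x) s.
  have dl : is_derive s 1 (fun s : R => u x + s * v x) (v x).
    apply: is_derive_eq.
    by rewrite add0r mul1r scaler0 add0r /GRing.scale/= mulr1.
  have d2 := @is_derive1_comp _ (F x) (fun s : R => u x + s * v x) s _ _ (Fd x (u x + s * v x)) dl.
  exact: is_deriveB.
- move=> x s _ s12; have [a1 a2] := B2b x s s12; have [_ b2] := HB' x; have [b1 _] := HB' x.
  split; rewrite /BB le_max; apply/orP; [left|right].
    apply: le_trans (ler_normB _ _) _; apply: lerD; last exact: F_bound.
    by rewrite ger0_norm ?G_ge0 ?enorm_ge0// G_bound ?enorm_ge0.
  apply: le_trans (ler_normB _ _) _; apply: lerD.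
    apply: le_trans (flux_dot_le (gG x) _ _) _.
    by apply: ler_pM; rewrite ?g_ge0 ?enorm_ge0// g_bound ?enorm_ge0.
  by rewrite normrM; apply: ler_pM => //; exact: f_bound.
exists s => //.
have := E; rewrite /K /dK IntB//; last 2 first.
- exact: itg_G (Puv 1).
- exact: itg_F (Puv 1).
rewrite IntB//; [|exact: itg_G (Puv 0)|exact: itg_F (Puv 0)].
rewrite IntB//; [|exact: (itg_stress (Puv s) Pv)|exact: (itg_force (Puv s) Pv)].
rewrite /energy /Phi => <-.
by congr (_ - _ - (_ - _)); apply: Int_eq => x _; rewrite ?scale1r ?mul1r ?scale0r ?mul0r ?addr0.
Qed.

(** * The energy on a finite-dimensional space of test functions *)

Section finite_dimensional.
Variables (k : nat) (b : 'I_k -> T -> R) (Db : 'I_k -> T -> 'rV[R]_N).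
Hypothesis Pb : forall i, P (b i) (Db i).

Local Notation comb := (comb b).
Local Notation Dcomb := (Dcomb Db).

Lemma P_comb (c : 'rV[R]_k) : P (comb c) (Dcomb c).
Proof. exact: comb_closed. Qed.

Lemma comb_bound (rho : R) : exists2 B : R, 1 <= B & forall c x, `|c| <= rho ->
  `|comb c x| <= B /\ enorm (Dcomb c x) <= B.
Proof.
have HB i : exists B : R, forall x, `|b i x| <= B /\ enorm (Db i x) <= B by exact: P_bdd (Pb i).
have [B {}HB] := choice HB.
exists (Num.max 1 (\sum_i rho * B i)); first by rewrite le_max lexx.
move=> c x crho; rewrite !le_max; split; apply/orP; right.
  apply: le_trans (ler_norm_sum _ _ _) _; apply: ler_sum => i _.
  rewrite normrM ler_pM//; last by have [] := HB i x.
  by apply: le_trans crho; exact: norm_coord.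
rewrite /Dcomb; elim/big_ind2 : _ => [||i _].
- by rewrite enorm0.
- by move=> v1 w1 v2 w2 h1 h2; apply: le_trans (enormD _ _) _; exact: lerD.
rewrite enormZ ler_pM ?enorm_ge0//; last by have [] := HB i x.
by apply: le_trans crho; exact: norm_coord.
Qed.

Definition fin_energy c := energy (comb c) (Dcomb c).
Definition fin_gradient c : 'rV[R]_k :=
  \row_i (stress (Dcomb c) (Db i) - force (comb c) (b i)).

Lemma fin_gradientE (c e : 'rV[R]_k) : dotv (fin_gradient c) e =
  stress (Dcomb c) (Dcomb e) - force (comb c) (comb e).
Proof.
have Pc := P_comb c.
have -> : stress (Dcomb c) (Dcomb e) = \sum_i e 0 i * stress (Dcomb c) (Db i).
  rewrite /stress; under [RHS]eq_bigr do rewrite -(IntZ mOm _ (itg_stress Pc (Pb _))).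
  rewrite -Int_sum//; last by move=> i; apply: itgZ => //; exact: (itg_stress Pc (Pb i)).
  apply: Int_eq => x _; move: (radial_flux _ _) => xi; rewrite /Dcomb.
  elim: (index_enum _) => [|i l IH]; first by rewrite !big_nil dotvC dotv0l.
  by rewrite !big_cons dotvDr dotvZr IH.
have -> : force (comb c) (comb e) = \sum_i e 0 i * force (comb c) (b i).
  rewrite /force; under [RHS]eq_bigr do rewrite -(IntZ mOm _ (itg_force Pc (Pb _))).
  rewrite -Int_sum//; last by move=> i; apply: itgZ => //; exact: (itg_force Pc (Pb i)).
  by apply: Int_eq => x _; rewrite /comb mulr_sumr; apply: eq_bigr => i _; rewrite mulrCA.
rewrite -sumrB; apply: eq_bigr => i _; rewrite mxE.
by rewrite mulrBl ![_ * e 0 i]mulrC.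
Qed.

Lemma fin_mean_value (c e : 'rV[R]_k) : exists2 s : R, 0 <= s <= 1 &
  fin_energy (c + e) - fin_energy c = dotv (fin_gradient (c + s *: e)) e.
Proof.
have [s s01 E] := energy_mean_value (P_comb c) (P_comb e).
exists s => //; rewrite fin_gradientE /fin_energy !combD !DcombD combZ DcombZ.
exact: E.
Qed.

Lemma Phi_continuous : continuous (fun c => Phi (Dcomb c)).
Proof.
apply: (@Int_continuous _ T R mu Om mOm finOm k (fun x c => G x (enorm (Dcomb c x)))).
- by move=> c; exact: (itg_measurable (itg_G (P_comb c))).
- move=> x _ c; apply: (@continuous_comp _ _ _ (fun c => Dcomb c x) (fun xi => G x (enorm xi))).
    exact: Dcomb_continuous.
  exact: (density_continuous p1 pq (gG x)).
- move=> rho; have [B B1 HB] := comb_bound rho; exists (B `^ q * C) => c x crho _.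
  rewrite ger0_norm ?G_ge0 ?enorm_ge0// G_bound ?enorm_ge0//.
  by have [] := HB c x crho.
Qed.

Lemma fin_energy_continuous : continuous fin_energy.
Proof.
have cF : continuous (fun c => Int (fun x => F x (comb c x))).
  apply: (@Int_continuous _ T R mu Om mOm finOm k (fun x c => F x (comb c x))).
  - by move=> c; exact: (itg_measurable (itg_F (P_comb c))).
  - move=> x _ c; apply: (@continuous_comp _ _ _ (fun c => comb c x) (F x)).
      exact: comb_continuous.
    by apply/differentiable_continuous/derivable1_diffP; have [] := Fd x (comb c x).
  - move=> rho; have [B B1 HB] := comb_bound rho; exists (C * (B + B `^ r' * C)) => c x crho _.
    by rewrite F_bound//; have [] := HB c x crho.
have cP := Phi_continuous.
move=> c; exact: (cvgB (cP c) (cF c)).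
Qed.

Lemma fin_gradient_continuous : continuous fin_gradient.
Proof.
apply: continuous_rowP => i.
rewrite (_ : (fun c => _) = fun c => Int (fun x =>
   dotv (radial_flux (g x) (Dcomb c x)) (Db i x) - f x (comb c x) * b i x)); last first.
  apply/funext => c; rewrite mxE IntB//.
    exact: (itg_stress (P_comb c) (Pb i)).
  exact: (itg_force (P_comb c) (Pb i)).
have [B' B'1 HB'] := P_bdd1 (Pb i).
apply: (@Int_continuous _ T R mu Om mOm finOm k (fun x c =>
   dotv (radial_flux (g x) (Dcomb c x)) (Db i x) - f x (comb c x) * b i x)).
- move=> c; apply: measurable_funB.
    exact: (itg_measurable (itg_stress (P_comb c) (Pb i))).
  exact: (itg_measurable (itg_force (P_comb c) (Pb i))).
- move=> x _.
  have c1 : continuous (fun c => radial_flux (g x) (Dcomb c x)).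
    move=> c; apply: (@continuous_comp _ _ _ (fun c => Dcomb c x) (radial_flux (g x))).
      exact: Dcomb_continuous.
    exact: (flux_continuous (gG x)).
  have c2 : continuous (fun c : 'rV[R]_k => dotv (radial_flux (g x) (Dcomb c x)) (Db i x)).
    exact: (dotv_continuous c1 (@continuous_fun_cst _ _ (Db i x))).
  have c3 : continuous (fun c => f x (comb c x)).
    move=> c; apply: (@continuous_comp _ _ _ (fun c => comb c x) (f x)).
      exact: comb_continuous.
    exact: fc.
  have c4 : continuous (fun c => f x (comb c x) * b i x).
    exact: continuous_mulr.
  by move=> c; exact: (cvgB (c2 c) (c4 c)).
- move=> rho; have [B B1 HB] := comb_bound rho.
  exists (q * (B `^ q * C) * B' + C * (1 + C + B `^ r' * C) * B') => c x crho _.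
  have [a1 a2] := HB c x crho; have [b1 b2] := HB' x.
  apply: le_trans (ler_normB _ _) _; apply: lerD.
    apply: le_trans (flux_dot_le (gG x) _ _) _.
    by apply: ler_pM; rewrite ?g_ge0 ?enorm_ge0// g_bound ?enorm_ge0.
  by rewrite normrM; apply: ler_pM => //; exact: f_bound.
Qed.

Hypothesis b_free : forall c, {ae mu, forall x, Om x -> comb c x = 0} -> c = 0.

(** The weighted integral [m] of the power [theta] is continuous, homogeneous of degree [theta] and,
    by [b_free], positive away from 0, hence bounded below on the compact unit sphere. Along rays it
    overtakes the term of order [q < theta]. *)
Lemma fin_energy_bounded : exists B : R, forall c, 0 <= fin_energy c -> `|c| <= B.
Proof.
have [F1 [K [mF1 F1K HF]]] := F_superlinear.
have F10 x : 0 < F1 x by have /andP[] := F1K x.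
have [B1 B11 HB1] := comb_bound 1.
pose m c := Int (fun x => F1 x * `|comb c x| `^ theta).
have mcomb c : measurable_fun Om (comb c) by have [] := P_meas (P_comb c).
have mm c : measurable_fun Om (fun x => F1 x * `|comb c x| `^ theta).
  by apply: measurable_funM => //; apply: measurable_fun_powR; exact: measurableT_comp.
have im c : itg (fun x => F1 x * `|comb c x| `^ theta).
  have [B B11' HB] := comb_bound `|c|.
  apply: (itg_bounded mOm finOm (B := K * B `^ theta)) => // x _.
  rewrite ger0_norm ?mulr_ge0 ?powR_ge0 ?(ltW (F10 x))//.
  apply: ler_pM; rewrite ?powR_ge0 ?(ltW (F10 x))//; first by have /andP[] := F1K x.
  by rewrite powR_homo ?(ltW th0)//; have [] := HB c x (lexx _).
have cm : continuous m.
  apply: (@Int_continuous _ T R mu Om mOm finOm k (fun x c => F1 x * `|comb c x| `^ theta)) => //.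
  - move=> x _; rewrite (_ : (fun c => _) = fun c => `|comb c x| `^ theta * F1 x); last first.
      by apply/funext => c; rewrite mulrC.
    apply: continuous_mulr => c.
    apply: (@continuous_comp _ _ _ (fun c => comb c x) (fun t : R => `|t| `^ theta)).
      exact: comb_continuous.
    exact: (continuous_norm_powR th0).
  - move=> rho; have [B B11' HB] := comb_bound rho; exists (K * B `^ theta) => c x crho _.
    rewrite ger0_norm ?mulr_ge0 ?powR_ge0 ?(ltW (F10 x))//.
    apply: ler_pM; rewrite ?powR_ge0 ?(ltW (F10 x))//; first by have /andP[] := F1K x.
    by rewrite powR_homo ?(ltW th0)//; have [] := HB c x crho.
have m_gt0 c : c != 0 -> 0 < m c.
  move=> c0; rewrite ltNge; apply/negP => mc.
  have /= H0 := Int_eq0 mOm (im c) (fun x _ => mulr_ge0 (ltW (F10 x)) (powR_ge0 _ _)) mc.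
  move/eqP: c0; apply; apply: b_free; apply: filterS H0 => x + Ox => /(_ Ox)/eqP.
  by rewrite mulf_eq0 gt_eqF//= powR_eq0 => /andP[/eqP/normr0_eq0].
have mZ (s : R) c : 0 <= s -> m (s *: c) = s `^ theta * m c.
  move=> s0; rewrite /m -IntZ//; apply: Int_eq => x _.
  by rewrite combZ normrM ger0_norm// powRM// mulrCA.
have [kap kap0 Hkap] : exists2 kap : R, 0 < kap & forall c : 'rV[R]_k, `|c| = 1 -> kap <= m c.
  pose S : set 'rV[R]_k := [set c | `|c| = 1].
  have cS : compact S.
    apply: bounded_closed_compact.
      by exists 1; split; [exact: num_real|move=> y y1 c /= ->; exact: ltW].
    have -> : S = (fun c : 'rV[R]_k => `|c|) @^-1` `[1, 1].
      by apply/seteqP; split => c /=; rewrite in_itv/= -eq_le eq_sym => /eqP.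
    apply: preimage_closed; last exact: interval_closed.
    by move=> c _; exact: norm_continuous.
  have [S0|/set0P S0] := eqVneq S set0.
    by exists 1 => // c c1; have : S c by []; rewrite S0.
  have [c /set_mem Sc Hc] := compact_EVT_min S0 cS (continuous_subspaceT cm).
  exists (m c) => [|e e1]; last by apply: Hc; exact/mem_set.
  by apply: m_gt0; rewrite -normr_eq0 (_ : `|c| = 1)// oner_eq0.
pose A := B1 `^ q * C * fine (mu Om) + `|K| * fine (mu Om).
have A0 : 0 <= A.
  by rewrite addr_ge0// mulr_ge0 ?fine_ge0// mulr_ge0 ?powR_ge0 ?(ltW C0).
have Jle (s : R) c : 1 <= s -> `|c| = 1 -> fin_energy (s *: c) <= s `^ q * A - s `^ theta * kap.
  move=> s1 c1; have s0 : 0 <= s by move: s1; lra.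
  have a1 : Phi (Dcomb (s *: c)) <= s `^ q * (B1 `^ q * C * fine (mu Om)).
    rewrite -Int_cst// -IntZ//; last exact: itg_cst.
    apply: Int_le => //; [exact: (itg_G (P_comb _))|by apply: itgZ => //; exact: itg_cst|].
    move=> x _; rewrite DcombZ enormZ ger0_norm//.
    apply: le_trans (gf_grow (gGx x) s1 (enorm_ge0 _)) _.
    rewrite ler_wpM2l ?powR_ge0// G_bound ?enorm_ge0//.
    by have [] := HB1 c x; rewrite ?c1.
  have a2 : s `^ theta * m c - `|K| * fine (mu Om) <= Int (fun x => F x (comb (s *: c) x)).
    rewrite -mZ// -Int_cst// -IntB//; last exact: itg_cst.
    apply: Int_le => //; [by apply: itgB => //; exact: itg_cst|exact: (itg_F (P_comb _))|].
    by move=> x _; apply: le_trans (HF x _); rewrite lerD2l lerN2 ler_norm.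
  have a3 : s `^ theta * kap <= s `^ theta * m c by rewrite ler_wpM2l ?powR_ge0// Hkap.
  have a4 : `|K| * fine (mu Om) <= s `^ q * (`|K| * fine (mu Om)).
    by apply: ler_peMl; [rewrite mulr_ge0 ?fine_ge0|exact: (powR_ge1 q0 s1)].
  by rewrite /fin_energy /energy; move: a1 a2 a3 a4; rewrite /A mulrDr; lra.
have thq0 : 0 < theta - q by rewrite subr_gt0.
exists (Num.max 1 ((A / kap) `^ (theta - q)^-1)) => c Jc.
rewrite le_max; have [c1|c1] := leP `|c| 1 => //=.
have c0 : 0 < `|c| by exact: lt_trans c1.
have := Jle `|c| (`|c|^-1 *: c) (ltW c1).
rewrite scalerA divff ?gt_eqF// scale1r normrZ normrV ?unitfE ?gt_eqF// normr_id mulVf ?gt_eqF//.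
move=> /(_ erefl) /(le_trans Jc).
have -> : `|c| `^ theta = `|c| `^ q * `|c| `^ (theta - q).
  by rewrite -powRD ?(gt_eqF c0) ?implybT// addrC subrK.
rewrite -mulrA -mulrBr pmulr_rge0 ?powR_gt0// subr_ge0 -ler_pdivlMr// => Hc.
rewrite -[leLHS](@powRK R ((theta - q)^-1) `|c|) ?invr_gt0 ?(ltW c0)// invrK.
by apply: powR_homo => //; rewrite ?invr_ge0 ?powR_ge0 ?(ltW thq0).
Qed.

End finite_dimensional.

(** * Galerkin spaces and their critical points *)

Section galerkin.
Hypothesis P_nondeg : forall u Du, P u Du -> {ae mu, forall x, Om x -> u x = 0} ->
  u = (fun=> 0) /\ Du = (fun=> 0).
Variables (e_ : nat -> T -> R) (De_ : nat -> T -> 'rV[R]_N).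
Hypothesis Pe : forall n, P (e_ n) (De_ n).
Hypothesis e0_neq0 : ~ {ae mu, forall x, Om x -> e_ 0%N x = 0}.

(** The span is generated on pairs, which keeps each gradient attached to its function; only its
    closure properties are needed outside [span_basis]. *)
Inductive span (n : nat) : (T -> R) -> (T -> 'rV[R]_N) -> Prop :=
| span_e i : (i < n)%N -> span n (e_ i) (De_ i)
| span0 : span n (fun=> 0) (fun=> 0)
| span_lin a u Du v Dv : span n u Du -> span n v Dv ->
    span n (fun x => a * u x + v x) (fun x => a *: Du x + Dv x).

Lemma span_P n u Du : span n u Du -> P u Du.
Proof. by elim=> [i _|//|a u1 Du1 v Dv _ Pu _ Pv]; [exact: Pe|exact: P_lin]. Qed.

Lemma span_le m n u Du : (m <= n)%N -> span m u Du -> span n u Du.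
Proof.
move=> mn; elim=> [i im||a u1 Du1 v Dv _ Su _ Sv].
- by apply: span_e; exact: leq_trans mn.
- exact: span0.
- exact: span_lin.
Qed.

Lemma spanZ n a u Du : span n u Du -> span n (fun x => a * u x) (fun x => a *: Du x).
Proof.
move=> Su; have := span_lin a Su (span0 n).
rewrite (_ : (fun x => a * u x + 0) = (fun x => a * u x)); last by apply/funext => x; rewrite addr0.
by rewrite (_ : (fun x => a *: Du x + 0) = (fun x => a *: Du x))//; apply/funext => x; rewrite addr0.
Qed.

Lemma comb0 k (b : 'I_k -> T -> R) : comb b 0 = fun=> 0.
Proof. by apply/funext => x; rewrite /comb big1// => i _; rewrite mxE mul0r. Qed.

Lemma Dcomb0 k (Db : 'I_k -> T -> 'rV[R]_N) : Dcomb Db 0 = fun=> 0.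
Proof. by apply/funext => x; rewrite /Dcomb big1// => i _; rewrite mxE scale0r. Qed.

Lemma span_ind_comb n k (b : 'I_k -> T -> R) (Db : 'I_k -> T -> 'rV[R]_N) :
  (forall i, (i < n)%N -> exists c, e_ i = comb b c /\ De_ i = Dcomb Db c) ->
  forall u Du, span n u Du -> exists c, u = comb b c /\ Du = Dcomb Db c.
Proof.
move=> He u Du; elim=> [i /He//||a u1 Du1 v Dv _ [c [-> ->]] _ [c' [-> ->]]].
  by exists 0; rewrite comb0 Dcomb0.
by exists (a *: c + c'); rewrite combD DcombD combZ DcombZ.
Qed.

(** Bounding coefficients by the energy requires that a function determine them up to null sets. A
    new generator is kept only if it is not already a combination; by [P_nondeg] a combination
    vanishing almost everywhere vanishes identically together with its gradient. *)
Lemma span_basis n : exists k (b : 'I_k -> T -> R) (Db : 'I_k -> T -> 'rV[R]_N),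
  [/\ forall i, span n (b i) (Db i),
      forall c, {ae mu, forall x, Om x -> comb b c x = 0} -> c = 0 &
      forall u Du, span n u Du -> exists c, u = comb b c /\ Du = Dcomb Db c].
Proof.
elim: n => [|n [k [b [Db [Sb fb_ Hb]]]]].
  exists 0%N, (fun _ => fun=> 0), (fun _ => fun=> 0); split.
  - by case.
  - by move=> c _; apply/rowP; case.
  - exact: span_ind_comb.
have Sb' i : span n.+1 (b i) (Db i) by apply: span_le (Sb i); exact: leqnSn.
have [H|H] := pselect (exists c, e_ n = comb b c /\ De_ n = Dcomb Db c).
  exists k, b, Db; split => //; apply: span_ind_comb => i.
  rewrite ltnS leq_eqVlt => /predU1P[->//|i_n].
  by apply: Hb; exact: span_e.
pose b' (i : 'I_k.+1) := if unlift ord0 i is Some j then b j else e_ n.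
pose Db' (i : 'I_k.+1) := if unlift ord0 i is Some j then Db j else De_ n.
pose tl (c : 'rV[R]_k.+1) : 'rV[R]_k := \row_j c 0 (lift ord0 j).
have cE c x : comb b' c x = c 0 ord0 * e_ n x + comb b (tl c) x.
  rewrite /comb big_ord_recl /b' unlift_none; congr (_ + _).
  by apply: eq_bigr => j _; rewrite liftK mxE.
have DE c x : Dcomb Db' c x = c 0 ord0 *: De_ n x + Dcomb Db (tl c) x.
  rewrite /Dcomb big_ord_recl /Db' unlift_none; congr (_ + _).
  by apply: eq_bigr => j _; rewrite liftK mxE.
have S' i : span n.+1 (b' i) (Db' i).
  by rewrite /b' /Db'; case: (unlift ord0 i) => [j|]; [exact: Sb'|exact: span_e].
exists k.+1, b', Db'; split => //.
- move=> c c0.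
  have Pc : P (comb b' c) (Dcomb Db' c).
    by apply: P_comb => i; exact: span_P (S' i).
  have [/funeqP E1 /funeqP E2] := P_nondeg Pc c0.
  (* A nonzero coefficient could be solved for, exhibiting [e_ n] and [De_ n] as a combination of
     the earlier basis, against [H]. *)
  have [c00|c00] := eqVneq (c 0 ord0) 0; last first.
    exfalso; apply: H; exists (- (c 0 ord0)^-1 *: tl c); rewrite combZ DcombZ; split; apply/funext => x.
      have := E1 x; rewrite cE => /eqP; rewrite addr_eq0 => /eqP E.
      by rewrite mulNr -mulrN -E mulrA mulVf// mul1r.
    have := E2 x; rewrite DE => /eqP; rewrite addr_eq0 => /eqP E.
    by rewrite scaleNr -scalerN -E scalerA mulVf// scale1r.
  have tc0 : tl c = 0.
    apply: fb_; apply: aeW => x _; have := E1 x; rewrite cE c00 mul0r add0r; done.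
  apply/rowP => i; rewrite [RHS]mxE; case: (unliftP ord0 i) => [j|] -> //.
  by have /rowP/(_ j) := tc0; rewrite !mxE.
- pose ext a (c : 'rV[R]_k) : 'rV[R]_k.+1 := \row_i (if unlift ord0 i is Some j then c 0 j else a).
  have te a c : tl (ext a c) = c by apply/rowP => j; rewrite !mxE liftK.
  have he a c : ext a c 0 ord0 = a by rewrite mxE unlift_none.
  apply: span_ind_comb => i; rewrite ltnS leq_eqVlt => /predU1P[->|i_n].
    exists (ext 1 0); split; apply/funext => x.
      by rewrite cE te he comb0 mul1r addr0.
    by rewrite DE te he Dcomb0 scale1r addr0.
  have [c [E1 E2]] := Hb _ _ (span_e i_n).
  exists (ext 0 c); split; apply/funext => x.
    by rewrite cE te he E1 mul0r add0r.
  by rewrite DE te he E2 scale0r add0r.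
Qed.

Lemma PhiZ_le a Du u : P u Du -> 0 <= a <= 1 -> Phi (fun x => a *: Du x) <= a * Phi Du.
Proof.
move=> Pu /andP[a0 a1]; rewrite /Phi -IntZ//; last exact: itg_G Pu.
apply: Int_le => //; [exact: (itg_G (PZ a Pu))|by apply: itgZ => //; exact: itg_G Pu|].
move=> x _; rewrite enormZ ger0_norm//.
by rewrite (gf_shrink p1' (gGx x) (G0 x) C1 (G1 x)) ?a0 ?enorm_ge0.
Qed.

(** If [Phi Du = 0], the scaled embedding holds for every [l] in []0, 1]] and forces the
    [Psi]-modular of [u] to be 0. *)
Lemma Phi_gt0 u Du : P u Du -> ~ {ae mu, forall x, Om x -> u x = 0} -> 0 < Phi Du.
Proof.
move=> Pu u0; rewrite lt_neqAle Phi_ge0 andbT eq_sym; apply/eqP => Phi0; apply: u0.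
have [Ce Ce0 H] := emb_scaled.
pose a := Int (fun x => Psi x `|u x|).
have a0 : a <= 0.
  rewrite leNgt; apply/negP => a_gt0.
  pose l := Num.min 1 (a / (2 * Ce)).
  have l0 : 0 < l by rewrite lt_min ltr01 divr_gt0// mulr_gt0.
  have l1 : l <= 1 by rewrite ge_min lexx.
  have l01 : 0 < l <= 1 by rewrite l0.
  have Pl : Phi Du <= l `^ q by rewrite Phi0 powR_ge0.
  have [A _] := H l u Du Pu l01 Pl.
  have lr : l `^ r <= l by have := ger_powR l01 r1; rewrite powRr1// ltW.
  have B : Ce * l `^ r <= Ce * (a / (2 * Ce)).
    by rewrite ler_wpM2l ?(ltW Ce0)//; apply: le_trans lr _; rewrite ge_min lexx orbT.
  have E : Ce * (a / (2 * Ce)) = a / 2 by field; rewrite gt_eqF.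
  by move: A B; rewrite E -/a; lra.
have := Int_eq0 mOm (itg_Psi Pu) (fun x _ => P_ge0 x (normr_ge0 (u x))) a0.
apply: filterS => x + Ox => /(_ Ox) E; apply/eqP/negPn/negP => ux.
have := gf_gt0 (gP x) C1 (P1 x) (_ : 0 < `|u x|).
by rewrite E normr_gt0 ltxx => /(_ ux).
Qed.

Lemma PhiZ_ge a Du u : P u Du -> 1 <= a -> a * Phi Du <= Phi (fun x => a *: Du x).
Proof.
move=> Pu a1; have a0 : 0 < a by exact: lt_le_trans a1.
rewrite -ler_pdivlMl//.
have := PhiZ_le (PZ a Pu) (_ : 0 <= a^-1 <= 1).
rewrite invr_ge0 (ltW a0) invf_le1// a1 => /(_ isT); congr (_ <= _).
by apply: Int_eq => x _; rewrite scalerA mulVf ?gt_eqF// scale1r.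
Qed.

(** [fin_energy_bounded] is used in dimension one: nonnegative energy bounds the multiple of [e_ 0],
    so beyond that bound the energy is negative. Convexity makes [Phi] exceed [sigma] there too. *)
Lemma energy_far (sigma : R) : exists a : R, 1 <= a /\
  energy (fun x => a * e_ 0%N x) (fun x => a *: De_ 0%N x) <= 0 /\
  sigma < Phi (fun x => a *: De_ 0%N x).
Proof.
have Phi0 := Phi_gt0 (Pe 0%N) e0_neq0.
pose b (i : 'I_1) := e_ 0%N; pose Db (i : 'I_1) := De_ 0%N.
have Pb i : P (b i) (Db i) by exact: Pe.
have cE c : comb b c = fun x => c 0 0 * e_ 0%N x.
  by apply/funext => x; rewrite /comb big_ord1.
have DE c : Dcomb Db c = fun x => c 0 0 *: De_ 0%N x.
  by apply/funext => x; rewrite /Dcomb big_ord1.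
have bfree c : {ae mu, forall x, Om x -> comb b c x = 0} -> c = 0.
  move=> c0; apply/rowP => i; rewrite (ord1 i) mxE; apply/eqP/negPn/negP => cn.
  apply: e0_neq0; apply: filterS c0 => x + Ox => /(_ Ox); rewrite cE => /eqP.
  by rewrite mulf_eq0 (negPf cn) => /eqP.
have [B HB] := fin_energy_bounded Pb bfree.
pose a := Num.max 1 (Num.max (B + 1) ((sigma + 1) / Phi (De_ 0%N))).
have a1 : 1 <= a by rewrite le_max lexx.
exists a; split => //; split.
  rewrite leNgt; apply/negP => J0.
  have := HB (const_mx a); rewrite /fin_energy cE DE mxE => /(_ (ltW J0)).
  move=> /(le_trans (norm_coord _ 0)); rewrite mxE ger0_norm; last by move: a1; lra.
  apply/negP; rewrite -ltNge; apply: (@lt_le_trans _ _ (B + 1)); first by rewrite ltrDl.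
  by rewrite !le_max lexx !orbT.
apply: lt_le_trans (PhiZ_ge (Pe 0%N) a1).
rewrite -ltr_pdivrMr//; apply: (@lt_le_trans _ _ ((sigma + 1) / Phi (De_ 0%N))).
  by rewrite ltr_pM2r ?invr_gt0// ltrDl.
by rewrite !le_max lexx !orbT.
Qed.

(** The levels do not depend on [n]: the ridge is common to all test functions, and the segment to
    the far multiple of [e_ 0] lies in every space [span n.+1]. *)
Lemma galerkin_critical : exists (rho M : R), 0 < rho /\ forall n, exists u Du,
  [/\ span n.+1 u Du, rho <= energy u Du <= M &
      forall v Dv, span n.+1 v Dv -> stress Du Dv = force u v].
Proof.
have [sigma sigma0 ridge] := energy_ridge.
have [a [a1 [Ja Pa]]] := energy_far sigma.
have [K K0 HK] := energy_lower.
exists (sigma / 2 / 2), (Phi (fun x => a *: De_ 0%N x) + K); split.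
  by rewrite !divr_gt0.
move=> n; have [k [b [Db [Sb bfree Hb]]]] := span_basis n.+1.
have Pb i : P (b i) (Db i) by exact: span_P (Sb i).
have Pa0 : P (fun x => a * e_ 0%N x) (fun x => a *: De_ 0%N x) by exact: PZ (Pe 0%N).
have [ca [E1 E2]] := Hb _ _ (spanZ a (@span_e n.+1 0 isT)).
have [B HB] := fin_energy_bounded Pb bfree.
have [|||||||||||c dc0 Jc] := @mountain_pass R k (fin_energy b Db) (fun c => Phi (Dcomb Db c))
  (fin_gradient b Db) ca (sigma / 2) sigma (Phi (fun x => a *: De_ 0%N x) + K) B.
- by rewrite divr_gt0.
- exact: fin_energy_continuous.
- exact: fin_gradient_continuous.
- exact: fin_mean_value.
- exact: HB.
- exact: Phi_continuous.
- rewrite -E2 Pa andbT Dcomb0 /Phi (_ : Int _ = 0)//.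
  by rewrite -[RHS](mul0r (fine (mu Om))) -Int_cst//; apply: Int_eq => x _; rewrite enorm0 G0.
- by move=> c Pc; apply: ridge => //; exact: P_comb.
- rewrite /fin_energy /energy comb0 Dcomb0 /Phi.
  rewrite (@Int_eq _ _ _ mu Om _ (fun=> 0)) => [|x _]; last by rewrite enorm0 G0.
  rewrite (@Int_eq _ _ _ mu Om (fun x => F x 0) (fun=> 0)) => [|x _]; last by rewrite F0.
  by rewrite subrr.
- by rewrite /fin_energy -E1 -E2.
- move=> t t01; rewrite /fin_energy.
  apply: le_trans (HK _ _ (P_comb Pb _)) _; rewrite lerD2r DcombZ -E2.
  apply: le_trans (PhiZ_le Pa0 t01) _.
  by rewrite ler_piMl ?Phi_ge0//; have /andP[] := t01.
exists (comb b c), (Dcomb Db c); split => //.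
- by apply: comb_closed => //; [exact: span0|exact: span_lin].
- move=> v Dv /Hb[c' [-> ->]]; apply/eqP; rewrite -subr_eq0 -fin_gradientE//.
  by rewrite dc0 dotv0l.
Qed.

(** * Passage to the limit in the Galerkin equations *)

Section limit.
Hypothesis e_dense : forall u Du (eps : R), P u Du -> 0 < eps ->
  exists n, Phi (fun x => Du x - De_ n x) <= eps.
Hypothesis tot : forall K eps : R, 0 < eps -> exists (I : finType) (col : (T -> R) -> I),
  forall u Du v Dv, P u Du -> P v Dv -> Phi Du <= K -> Phi Dv <= K -> col u = col v ->
    Int (fun x => Psi x `|u x - v x|) <= eps.

(** The pairs for which both sides of the weak equation are integrable. Being a gradient plays no
    part here, so differences and pointwise limits are covered. *)
Definition adm u Du := [/\ measurable_fun Om u, measurable_vec Du,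
  itg (fun x => Psi x `|u x|) & itg (fun x => G x (enorm (Du x)))].

Lemma P_adm u Du : P u Du -> adm u Du.
Proof. by move=> Pu; have [? ?] := P_meas Pu; split => //; [exact: itg_Psi Pu|exact: itg_G Pu]. Qed.

Lemma PB u Du v Dv : P u Du -> P v Dv -> P (fun x => u x - v x) (fun x => Du x - Dv x).
Proof.
move=> Pu Pv; have := P_lin (-1) Pv Pu.
rewrite (_ : (fun x => _ * _ + _) = (fun x => u x - v x)); last by apply/funext => x; rewrite mulN1r addrC.
by rewrite (_ : (fun x => _ *: _ + _) = (fun x => Du x - Dv x))//; apply/funext => x; rewrite scaleN1r addrC.
Qed.

Lemma spanB n u Du v Dv : span n u Du -> span n v Dv ->
  span n (fun x => u x - v x) (fun x => Du x - Dv x).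
Proof.
move=> Pu Pv; have := span_lin (-1) Pv Pu.
rewrite (_ : (fun x => _ * _ + _) = (fun x => u x - v x)); last by apply/funext => x; rewrite mulN1r addrC.
by rewrite (_ : (fun x => _ *: _ + _) = (fun x => Du x - Dv x))//; apply/funext => x; rewrite scaleN1r addrC.
Qed.

Lemma measurable_vecB Du Dv : measurable_vec Du -> measurable_vec Dv ->
  measurable_vec (fun x => Du x - Dv x).
Proof.
move=> mu_ mv i; rewrite (_ : (fun x => _) = fun x => Du x 0 i - Dv x 0 i).
  exact: measurable_funB.
by apply/funext => x; rewrite !mxE.
Qed.

Lemma itg_G_le Du (h : T -> R) : measurable_vec Du -> itg (fun x => G x (h x)) ->
  (forall x, enorm (Du x) <= h x) -> itg (fun x => G x (enorm (Du x))).
Proof.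
move=> mDu ih Dh; apply: (itg_le mOm _ ih) => [|x _].
  by apply: mG => [|x]; [exact: measurable_enorm|exact: enorm_ge0].
by rewrite ger0_norm ?G_ge0 ?enorm_ge0// G_homo ?enorm_ge0.
Qed.

Lemma itg_Psi_le u (h : T -> R) : measurable_fun Om u -> itg (fun x => Psi x (h x)) ->
  (forall x, `|u x| <= h x) -> itg (fun x => Psi x `|u x|).
Proof.
move=> mu_ ih Dh; apply: (itg_le mOm _ ih) => [|x _].
  by apply: mP => [|x]; [exact: measurableT_comp|].
by rewrite ger0_norm ?P_ge0// P_homo.
Qed.

Lemma itg_GD (h k : T -> R) : measurable_fun Om h -> measurable_fun Om k ->
  (forall x, 0 <= h x) -> (forall x, 0 <= k x) ->
  itg (fun x => G x (h x)) -> itg (fun x => G x (k x)) -> itg (fun x => G x (h x + k x)).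
Proof.
move=> mh mk h0 k0 ih ik.
apply: (itg_le mOm (h := fun x => 2 `^ q * (G x (h x) + G x (k x)))).
- by apply: mG => [|x]; [exact: measurable_funD|exact: addr_ge0].
- by apply: itgZ => //; exact: itgD.
move=> x _; rewrite ger0_norm ?G_ge0 ?addr_ge0//.
exact: (gf_add p1' (gGx x) (G0 x) C1 (G1 x)).
Qed.

Lemma itg_PsiD (h k : T -> R) : measurable_fun Om h -> measurable_fun Om k ->
  (forall x, 0 <= h x) -> (forall x, 0 <= k x) ->
  itg (fun x => Psi x (h x)) -> itg (fun x => Psi x (k x)) -> itg (fun x => Psi x (h x + k x)).
Proof.
move=> mh mk h0 k0 ih ik.
apply: (itg_le mOm (h := fun x => 2 `^ r' * (Psi x (h x) + Psi x (k x)))).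
- by apply: mP => [|x]; [exact: measurable_funD|exact: addr_ge0].
- by apply: itgZ => //; exact: itgD.
move=> x _; rewrite ger0_norm ?P_ge0 ?addr_ge0//.
exact: (gf_add r1 (gP x) (P0 x) C1 (P1 x)).
Qed.

Lemma admB u Du v Dv : adm u Du -> adm v Dv -> adm (fun x => u x - v x) (fun x => Du x - Dv x).
Proof.
move=> [mu_ mDu iu iDu] [mv mDv iv iDv].
have mD := measurable_vecB mDu mDv; have md := measurable_funB mu_ mv.
split => //.
- apply: (itg_Psi_le (h := fun x => `|u x| + `|v x|)) => // [|x]; last exact: ler_normB.
  by apply: itg_PsiD => //; exact: measurableT_comp.
- apply: (itg_G_le (h := fun x => enorm (Du x) + enorm (Dv x))) => // [|x]; last exact: enormB.
  by apply: itg_GD => //; by [exact: measurable_enorm|move=> x; exact: enorm_ge0].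
Qed.

(** The coefficient of the first argument can be made arbitrarily small, at the cost of the second;
    this yields smallness of [force u v] when only [v] is small in the [Psi]-modular. *)
Lemma force_young (e : R) : 0 < e <= 1 -> exists2 K : R, 0 < K &
  forall x s t, `|f x s * t| <= C * e * (1 + Psi x `|s|) + K * Psi x `|t|.
Proof.
move=> e01; have /andP[e0 e1] := e01.
exists (C * e * (C + 1) * (e^-1) `^ r'); first by rewrite !mulr_gt0 ?powR_gt0 ?invr_gt0 ?(addr_gt0 C0 ltr01) ?C0 ?e0.
move=> x s t; rewrite normrM.
have ei : 1 <= e^-1 by rewrite invf_ge1.
have Pe' : Psi x (`|t| / e) <= e^-1 `^ r' * Psi x `|t| by rewrite mulrC (gf_grow (gP x)).
have te0 : 0 <= `|t| / e by rewrite divr_ge0// ltW.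
have A : `|t| <= e * (1 + C * (e^-1 `^ r' * Psi x `|t|)).
  rewrite -ler_pdivrMl// mulrC; apply: le_trans (gf_ge r1 (gP x) (P0 x) C1 (P1 x) te0) _.
  by rewrite lerD2l ler_wpM2l ?(ltW C0).
have B := gf_young r1 (gP x) (P0 x) C1 (P1 x) e01 (normr_ge0 t) (normr_ge0 s).
apply: (@le_trans _ _ (C * (`|t| + Psi x `|s| / `|s| * `|t|))).
  by rewrite -[X in X + _]mul1r -mulrDl mulrA ler_wpM2r// fb.
rewrite [leRHS](_ : _ = C * (e * (1 + C * (e^-1 `^ r' * Psi x `|t|)) +
   e * (Psi x `|s| + e^-1 `^ r' * Psi x `|t|))); last by ring.
rewrite ler_wpM2l ?(ltW C0)// lerD//; apply: le_trans B _.
by rewrite ler_wpM2l ?(ltW e0)// lerD2l.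
Qed.

Lemma stress_young (e : R) : 0 < e <= 1 -> exists2 K : R, 0 < K &
  forall x (xi eta : 'rV[R]_N), `|dotv (radial_flux (g x) xi) eta| <=
    q * e * G x (enorm xi) + K * G x (enorm eta).
Proof.
move=> e01; have /andP[e0 e1] := e01.
have q00 : 0 < q by move: q1; lra.
exists (q * e * (e^-1) `^ q); first by rewrite !mulr_gt0 ?powR_gt0 ?invr_gt0.
move=> x xi eta; have ei : 1 <= e^-1 by rewrite invf_ge1.
apply: le_trans (flux_dot_le (gG x) xi eta) _.
have [->|xi0] := eqVneq xi 0.
  by rewrite enorm0 g0 mul0r addr_ge0// mulr_ge0 ?G_ge0 ?enorm_ge0// !mulr_ge0 ?powR_ge0// ltW.
have n0 : 0 < enorm xi by rewrite lt_neqAle eq_sym enorm_eq0 xi0 enorm_ge0.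
have A : g x (enorm xi) <= q * (G x (enorm xi) / enorm xi).
  by rewrite mulrA ler_pdivlMr// mulrC tg_le// ltW.
have B := gf_young p1' (gGx x) (G0 x) C1 (G1 x) e01 (enorm_ge0 eta) (enorm_ge0 xi).
apply: (@le_trans _ _ (q * (G x (enorm xi) / enorm xi * enorm eta))).
  by rewrite mulrA ler_wpM2r ?enorm_ge0.
rewrite [leRHS](_ : _ = q * (e * (G x (enorm xi) + e^-1 `^ q * G x (enorm eta)))); last by ring.
rewrite ler_wpM2l ?(ltW q00)//; apply: le_trans B _.
rewrite ler_wpM2l ?(ltW e0)// lerD2l [X in G x X]mulrC.
by apply: (gf_grow (gGx x)); rewrite ?enorm_ge0.
Qed.

Lemma adm_stress u Du v Dv : adm u Du -> adm v Dv ->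
  itg (fun x => dotv (radial_flux (g x) (Du x)) (Dv x)).
Proof.
move=> [_ mDu _ iDu] [_ mDv _ iDv]; have [|K K0 H] := @stress_young 1; first by rewrite ltr01 lexx.
apply: (itg_le mOm (h := fun x => q * 1 * G x (enorm (Du x)) + K * G x (enorm (Dv x)))).
- exact: measurable_flux_dot.
- by apply: itgD => //; exact: itgZ.
- by move=> x _; exact: H.
Qed.

Lemma adm_force u Du v Dv : adm u Du -> adm v Dv -> itg (fun x => f x (u x) * v x).
Proof.
move=> [mu_ _ iu _] [mv _ iv _]; have [|K K0 H] := @force_young 1; first by rewrite ltr01 lexx.
apply: (itg_le mOm (h := fun x => C * 1 * (1 + Psi x `|u x|) + K * Psi x `|v x|)).
- by apply: measurable_funM => //; exact: mf.
- by apply: itgD => //; apply: itgZ => //; apply: itgD => //; exact: itg_cst.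
- by move=> x _; exact: H.
Qed.

Lemma small_factor (A eps : R) : 0 <= A -> 0 < eps -> exists2 e : R, 0 < e <= 1 & e * A <= eps.
Proof.
move=> A0 eps0; have A1 : 0 < A + 1 by rewrite ltr_wpDl.
exists (Num.min 1 (eps / (A + 1))); first by rewrite lt_min ltr01 divr_gt0//= ge_min lexx.
apply: (@le_trans _ _ (eps / (A + 1) * A)); first by rewrite ler_wpM2r// ge_min lexx orbT.
by rewrite mulrAC ler_pdivrMr// ler_wpM2l ?(ltW eps0)// lerDl.
Qed.

Lemma force_small (K eps : R) : 0 < eps -> exists2 del : R, 0 < del &
  forall u Du v Dv, adm u Du -> adm v Dv -> Int (fun x => Psi x `|u x|) <= K ->
    Int (fun x => Psi x `|v x|) <= del -> `|force u v| <= eps.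
Proof.
move=> eps0; have A0 : 0 <= C * (fine (mu Om) + `|K|).
  by rewrite mulr_ge0 ?(ltW C0)// addr_ge0 ?fine_ge0.
have [|e e01 He] := @small_factor _ (eps / 2) A0; first by rewrite divr_gt0.
have /andP[e0 e1] := e01; have [L L0 H] := force_young e01.
exists (eps / 2 / L) => [|u Du v Dv Au Av uK vd]; first by rewrite !divr_gt0.
have [mu_ _ iu _] := Au; have [mv _ iv _] := Av.
have ifo := adm_force Au Av.
apply: le_trans (Int_norm mOm ifo) _.
have i1 : itg (fun x => C * e * (1 + Psi x `|u x|)).
  by apply: itgZ => //; apply: itgD => //; exact: itg_cst.
have i2 : itg (fun x => L * Psi x `|v x|) by apply: itgZ.
apply: (@le_trans _ _ (Int (fun x => C * e * (1 + Psi x `|u x|) + L * Psi x `|v x|))).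
  have n1 := itg_norm mOm ifo; have n2 := itgD mOm i1 i2.
  by apply: Int_le => // x _; exact: H.
have i0 : itg (fun=> 1) by exact: itg_cst.
rewrite IntD// !IntZ//; last exact: itgD.
rewrite IntD// Int_cst// mul1r.
have B1 : L * Int (fun x => Psi x `|v x|) <= eps / 2 by rewrite mulrC -ler_pdivlMr.
have B2 : C * e * (fine (mu Om) + Int (fun x => Psi x `|u x|)) <= eps / 2.
  apply: le_trans He; rewrite mulrA [e * C]mulrC ler_wpM2l ?mulr_ge0 ?(ltW C0) ?(ltW e0)//.
  by rewrite lerD2l; apply: le_trans uK _; exact: ler_norm.
by move: B1 B2; lra.
Qed.

Lemma stress_small (K eps : R) : 0 < eps -> exists2 del : R, 0 < del &
  forall u Du v Dv, adm u Du -> adm v Dv -> Phi Du <= K -> Phi Dv <= del ->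
    `|stress Du Dv| <= eps.
Proof.
move=> eps0; have A0 : 0 <= q * `|K| by exact: mulr_ge0 q0 (normr_ge0 _).
have [|e e01 He] := @small_factor _ (eps / 2) A0; first by rewrite divr_gt0.
have /andP[e0 e1] := e01; have [L L0 H] := stress_young e01.
exists (eps / 2 / L) => [|u Du v Dv Au Av uK vd]; first by rewrite !divr_gt0.
have [_ mDu _ iu] := Au; have [_ mDv _ iv] := Av.
have ist := adm_stress Au Av.
apply: le_trans (Int_norm mOm ist) _.
have i1 : itg (fun x => q * e * G x (enorm (Du x))) by apply: itgZ.
have i2 : itg (fun x => L * G x (enorm (Dv x))) by apply: itgZ.
apply: (@le_trans _ _ (Int (fun x => q * e * G x (enorm (Du x)) + L * G x (enorm (Dv x))))).
  have n1 := itg_norm mOm ist; have n2 := itgD mOm i1 i2.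
  by apply: Int_le => // x _; exact: H.
rewrite IntD// !IntZ//.
have B1 : L * Phi Dv <= eps / 2 by rewrite mulrC -ler_pdivlMr.
have B2 : q * e * Phi Du <= eps / 2.
  apply: le_trans He; rewrite mulrA [e * q]mulrC ler_wpM2l ?(mulr_ge0 q0 (ltW e0))//.
  by apply: le_trans uK _; exact: ler_norm.
by move: B1 B2; rewrite /Phi; lra.
Qed.

Lemma stressB u Du v Dv w Dw : adm u Du -> adm v Dv -> adm w Dw ->
  stress Du (fun x => Dv x - Dw x) = stress Du Dv - stress Du Dw.
Proof.
move=> Au Av Aw; rewrite /stress -IntB//; last 2 first.
- exact: adm_stress Au Av.
- exact: adm_stress Au Aw.
by apply: Int_eq => x _; rewrite dotvBr.
Qed.

Lemma forceB u Du v Dv w Dw : adm u Du -> adm v Dv -> adm w Dw ->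
  force u (fun x => v x - w x) = force u v - force u w.
Proof.
move=> Au Av Aw; rewrite /force -IntB//; last 2 first.
- exact: adm_force Au Av.
- exact: adm_force Au Aw.
by apply: Int_eq => x _; rewrite mulrBr.
Qed.

(** Both sides are linear in the test pair and, for fixed [u], continuous in the modular sense by
    [stress_small] and [force_small]. *)
Lemma weak_equation_closed u Du v Dv : adm u Du -> adm v Dv ->
  (forall eps : R, 0 < eps -> exists v' Dv', [/\ adm v' Dv', stress Du Dv' = force u v',
     Phi (fun x => Dv x - Dv' x) <= eps & Int (fun x => Psi x `|v x - v' x|) <= eps]) ->
  stress Du Dv = force u v.
Proof.
move=> Au Av H; apply/eqP; rewrite -subr_eq0 -normr_eq0 eq_le normr_ge0 andbT.
apply/ler_addgt0Pr => eps eps0; rewrite add0r; have eps2 : 0 < eps / 2 by rewrite divr_gt0.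
have [d1 d10 H1] := stress_small (Phi Du) eps2.
have [d2 d20 H2] := force_small (Int (fun x => Psi x `|u x|)) eps2.
have [|v' [Dv' [Av' E A B]]] := H (Num.min d1 d2); first by rewrite lt_min d10.
move: A B; rewrite !le_min => /andP[A _] /andP[_ B].
have S := H1 _ _ _ _ Au (admB Av Av') (lexx _) A.
have Fo := H2 _ _ _ _ Au (admB Av Av') (lexx _) B.
rewrite (stressB Au Av Av') in S; rewrite (forceB Au Av Av') in Fo.
have -> : stress Du Dv - force u v = (stress Du Dv - stress Du Dv') - (force u v - force u v').
  by rewrite E; ring.
by apply: le_trans (ler_normB _ _) _; move: S Fo; lra.
Qed.

Lemma Psi_modular_bound (K : R) : exists2 K2 : R, 0 <= K2 & forall u Du, P u Du -> Phi Du <= K ->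
  Int (fun x => Psi x `|u x|) <= K2.
Proof.
have [Ce Ce0 H] := emb; pose l := Num.max 1 K.
have l1 : 1 <= l by rewrite le_max lexx.
have l0 : 0 < l by exact: lt_le_trans l1.
exists (l `^ r' * Ce) => [|u Du Pu PK]; first by rewrite mulr_ge0 ?powR_ge0// ltW.
have li : 0 <= l^-1 <= 1 by rewrite invr_ge0 (ltW l0) invf_le1.
have Pv := PZ l^-1 Pu.
have Iv : Int (fun x => Psi x `|l^-1 * u x|) <= Ce.
  apply: H Pv _; apply: le_trans (PhiZ_le Pu li) _.
  by rewrite ler_pdivrMl// mulr1; apply: le_trans PK _; rewrite le_max lexx orbT.
apply: (@le_trans _ _ (l `^ r' * Int (fun x => Psi x `|l^-1 * u x|))); last first.
  by rewrite ler_wpM2l ?powR_ge0.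
rewrite -IntZ//; last exact: itg_Psi Pv.
apply: Int_le => //; [exact: itg_Psi Pu|by apply: itgZ => //; exact: itg_Psi Pv|move=> x _].
rewrite -[X in Psi x X <= _](_ : l * `|l^-1 * u x| = _); first exact: (gf_grow (gP x)).
by rewrite normrM ger0_norm ?invr_ge0 ?(ltW l0)// mulVKf ?gt_eqF.
Qed.

Lemma Phi_convex u Du v Dv : P u Du -> P v Dv ->
  stress Du (fun x => Dv x - Du x) <= Phi Dv - Phi Du.
Proof.
move=> Pu Pv; rewrite /Phi -IntB//; [|exact: itg_G Pv|exact: itg_G Pu].
apply: Int_le => //; first exact: (itg_stress Pu (PB Pv Pu)).
  by apply: itgB => //; [exact: itg_G Pv|exact: itg_G Pu].
by move=> x _; exact: flux_convex (gG x) _ _.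
Qed.

Lemma Phi_uniform_convex (e : R) u Du v Dv : P u Du -> P v Dv -> 0 < e <= 1 ->
  Phi (fun x => Du x - Dv x) <= e * (Phi Du + Phi Dv) +
   uc_const p q e * (2^-1 * Phi Du + 2^-1 * Phi Dv - Phi (fun x => 2^-1 *: (Du x + Dv x))).
Proof.
move=> Pu Pv e01.
have Puv : P (fun x => 2^-1 * (u x + v x)) (fun x => 2^-1 *: (Du x + Dv x)).
  apply: PZ; have := P_lin 1 Pu Pv.
  rewrite (_ : (fun x => 1 * u x + v x) = (fun x => u x + v x)); last by apply/funext => x; rewrite mul1r.
  by rewrite (_ : (fun x => 1 *: Du x + Dv x) = (fun x => Du x + Dv x))//; apply/funext => x; rewrite scale1r.
have iu := itg_G Pu; have iv := itg_G Pv; have iuv := itg_G Puv.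
have h1 : itg (fun x => 2^-1 * G x (enorm (Du x))) by apply: itgZ.
have h2 : itg (fun x => 2^-1 * G x (enorm (Dv x))) by apply: itgZ.
have h3 := itgD mOm h1 h2.
have h4 := itgB mOm h3 iuv.
have h5 := itgZ mOm (uc_const p q e) h4.
have h6 := itgZ mOm e (itgD mOm iu iv).
rewrite /Phi -(IntZ mOm 2^-1 iu) -(IntZ mOm 2^-1 iv) -(IntD mOm h1 h2) -(IntB mOm h3 iuv).
rewrite -(IntZ mOm _ h4) -(IntD mOm iu iv) -(IntZ mOm e (itgD mOm iu iv)) -(IntD mOm h6 h5).
apply: Int_le => //; [exact: (itg_G (PB Pu Pv))|exact: itgD|].
move=> x _; exact: (uniform_convexity p1 (gG x) (Du x) (Dv x) e01).
Qed.

Lemma Phi_sym Du Dv : Phi (fun x => Du x - Dv x) = Phi (fun x => Dv x - Du x).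
Proof. by apply: Int_eq => x _; rewrite -enormN opprB. Qed.

(** The Galerkin spaces are nested, so for [n <= m] the difference of the two solutions is itself a
    test pair for the [m]-th equation. Total boundedness controls the right-hand side, and convexity
    of [Phi] turns the resulting smallness of the stress into convergence of the gradients. *)
Lemma galerkin_cauchy : exists (rho : R) (v : nat -> T -> R) (Dv : nat -> T -> 'rV[R]_N),
  [/\ 0 < rho, forall k, P (v k) (Dv k) /\ rho <= energy (v k) (Dv k),
      forall eps : R, 0 < eps -> exists n0, forall n m, (n0 <= n)%N -> (n0 <= m)%N ->
        Phi (fun x => Dv n x - Dv m x) <= eps /\ Int (fun x => Psi x `|v n x - v m x|) <= eps,
      forall k, stress (Dv k) (Dv k) = force (v k) (v k) &
      forall j k, (j <= k)%N -> stress (Dv k) (De_ j) = force (v k) (e_ j)].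
Proof.
have [rho [M [rho0 Hn]]] := galerkin_critical.
have /choice[w Hw] : forall n, exists w : (T -> R) * (T -> 'rV[R]_N),
    [/\ span n.+1 w.1 w.2, rho <= energy w.1 w.2 <= M &
      forall v Dv, span n.+1 v Dv -> stress w.2 Dv = force w.1 v].
  by move=> n; have [u [Du H]] := Hn n; exists (u, Du).
pose u_ n := (w n).1; pose Du_ n := (w n).2.
have Pw n : P (u_ n) (Du_ n) by have [/span_P] := Hw n.
have [K K0 HK] := AR_bounded M.
have wK n : Phi (Du_ n) <= K.
  have [Sw /andP[_ JM] Ew] := Hw n; apply: HK (Pw n) JM _; exact: Ew.
have [K2 K20 HK2] := Psi_modular_bound K.
have [|s sS Hs] := @cauchy_subsequence R (fun n m => Int (fun x => Psi x `|u_ n x - u_ m x|)).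
  move=> eps /(tot K)[I [col Hc]]; exists I, (fun n => col (u_ n)) => n m nm.
  exact: (Hc _ _ _ _ (Pw n) (Pw m)).
have sM n m : (n <= m)%N -> (s n <= s m)%N.
  move=> /subnK <-; elim: (m - n)%N => [|i IH] //=; rewrite addSn.
  by apply: leq_trans IH _; exact: ltnW.
have sk k : (k <= s k)%N by elim: k => // k IH; exact: leq_ltn_trans (sS k).
pose v k := u_ (s k); pose Dv k := Du_ (s k).
have Pv k : P (v k) (Dv k) by exact: Pw.
have Av k := P_adm (Pv k).
have vK k : Phi (Dv k) <= K by exact: wK.
have crit n m : (n <= m)%N -> stress (Dv m) (fun x => Dv n x - Dv m x) = force (v m) (fun x => v n x - v m x).
  move=> nm; have [Sm _ Em] := Hw (s m); apply: Em; apply: spanB => //.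
  by have [Sn _ _] := Hw (s n); apply: span_le Sn; rewrite ltnS; exact: sM.
(* By the equation the stress equals the force, which is small because [v n - v m] is small in the
   [Psi]-modular. *)
have stepA (eps : R) : 0 < eps -> exists n0, forall n m, (n0 <= n)%N -> (n <= m)%N ->
    `|stress (Dv m) (fun x => Dv n x - Dv m x)| <= eps.
  move=> eps0; have [del del0 H] := force_small K2 eps0.
  have [n0 Hn0] := Hs _ del0; exists n0 => n m n0n nm; rewrite crit//.
  apply: (H _ (Dv m) _ (fun x => Dv n x - Dv m x)) => //.
  - exact: admB.
  - exact: HK2 (Pv m) (vK m).
  - by apply: Hn0 => //; exact: leq_trans nm.
(* The tangent inequality at [Dv m] makes the sequence of the [Phi (Dv n)] almost decreasing; being
   bounded below, it is Cauchy. *)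
have stepB : forall eps : R, 0 < eps -> exists n0, forall n m, (n0 <= n)%N -> (n0 <= m)%N ->
    Phi (Dv n) <= Phi (Dv m) + eps.
  apply: quasi_monotone_cauchy => [n|eps /stepA[n0 Hn0]]; first exact: Phi_ge0.
  exists n0 => n m n0n nm; have := Phi_convex (Pv m) (Pv n); have := Hn0 n m n0n nm.
  by rewrite ler_norml => /andP[+ _]; lra.
(* The tangent at [Dv m], evaluated at the midpoint, shows that [Phi] of the midpoint is almost
   [Phi (Dv m)]. The convexity gap is then small, as uniform convexity requires. *)
have half n m : Phi (Dv m) - `|stress (Dv m) (fun x => Dv n x - Dv m x)| <=
    Phi (fun x => 2^-1 *: (Dv n x + Dv m x)).
  have Puv : P (fun x => 2^-1 * v n x + 2^-1 * v m x) (fun x => 2^-1 *: Dv n x + 2^-1 *: Dv m x).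
    by apply: P_lin => //; exact: PZ.
  have E : (fun x => 2^-1 *: Dv n x + 2^-1 *: Dv m x) = (fun x => 2^-1 *: (Dv n x + Dv m x)).
    by apply/funext => x; rewrite scalerDr.
  rewrite E in Puv; have := Phi_convex (Pv m) Puv.
  have -> : stress (Dv m) (fun x => 2^-1 *: (Dv n x + Dv m x) - Dv m x) =
      2^-1 * stress (Dv m) (fun x => Dv n x - Dv m x).
    rewrite /stress -IntZ//; last exact: (itg_stress (Pv m) (PB (Pv n) (Pv m))).
    apply: Int_eq => x _; rewrite -dotvZr; congr dotv; apply/rowP => i; rewrite !mxE.
    by field.
  set S := stress (Dv m) _ => H.
  have := ler_norm (- S); rewrite normrN; have := normr_ge0 S; move: H; lra.
have stepC (eps : R) : 0 < eps -> exists n0, forall n m, (n0 <= n)%N -> (n <= m)%N ->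
    Phi (fun x => Dv n x - Dv m x) <= eps.
  move=> eps0; have KK : 0 <= K + K by lra.
  have [|e e01 He] := @small_factor _ (eps / 2) KK; first by rewrite divr_gt0.
  have /andP[e0 _] := e01.
  have uc0 : 0 < uc_const p q e by exact: uc_const_gt0.
  have eps'0 : 0 < eps / 4 / uc_const p q e by apply: divr_gt0 => //; apply: divr_gt0.
  have [n1 H1] := stepA _ eps'0; have [n2 H2] := stepB _ eps'0.
  exists (maxn n1 n2) => n m; rewrite geq_max => /andP[n1n n2n] nm.
  apply: le_trans (Phi_uniform_convex (Pv n) (Pv m) e01) _.
  have h1 := H1 n m n1n nm; have h2 := H2 n m n2n (leq_trans n2n nm).
  have h3 := half n m.
  have B1 : e * (Phi (Dv n) + Phi (Dv m)) <= eps / 2.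
    by apply: le_trans He; rewrite ler_wpM2l ?(ltW e0)// lerD.
  have B2 : 2^-1 * Phi (Dv n) + 2^-1 * Phi (Dv m) - Phi (fun x => 2^-1 *: (Dv n x + Dv m x)) <=
     2 * (eps / 4 / uc_const p q e) by move: h1 h2 h3; lra.
  have := ler_wpM2l (ltW uc0) B2.
  rewrite (_ : uc_const p q e * (2 * _) = eps / 2); last by field; rewrite gt_eqF.
  by move: B1; lra.
exists rho, v, Dv; split => //.
- by move=> k; split => //; have [_ /andP[]] := Hw (s k).
- move=> eps eps0; have [n1 H1] := stepC _ eps0; have [n2 H2] := Hs _ eps0.
  exists (maxn n1 n2) => n m; rewrite !geq_max => /andP[n1n n2n] /andP[n1m n2m].
  split; last exact: H2.
  by have [nm|/ltnW mn] := leqP n m; [exact: H1|rewrite Phi_sym; exact: H1].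
- by move=> k; have [Sk _ Ek] := Hw (s k); exact: Ek.
- move=> j k jk; have [_ _ Ek] := Hw (s k); apply: Ek; apply: span_e.
  by rewrite ltnS; exact: leq_trans (sk k).
Qed.

Lemma row_cvg (w : nat -> 'rV[R]_N) (l : 'rV[R]_N) :
  (forall i, w n 0 i @[n --> \oo] --> l 0 i) -> w n @[n --> \oo] --> l.
Proof.
move=> cw; apply/cvgrPdist_lt => e e0.
have H : \forall n \near \oo, forall i, `|l 0 i - w n 0 i| < e.
  by apply: filter_forall => i; have /cvgrPdist_lt /(_ _ e0) := cw i.
apply: filterS H => n Hn.
rewrite [ltLHS]/Num.norm /= mx_normrE; apply/bigmax_ltP; split => // -[j i] _ /=.
by rewrite (ord1 j) !mxE.
Qed.

Lemma enorm_le_sum (v : 'rV[R]_N) : enorm v <= \sum_i `|v 0 i|.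
Proof.
have {1}-> : v = \sum_i v 0 i *: delta_mx 0 i by rewrite -row_sum_delta.
elim/big_ind2 : _ => [|v1 s1 v2 s2 h1 h2|i _]; first by rewrite enorm0.
  by apply: le_trans (enormD _ _) _; exact: lerD.
rewrite enormZ -[leRHS]mulr1 ler_wpM2l// -[leRHS]sqrtr1 /enorm.
apply: ler_wsqrtr; rewrite /dotv (bigD1 i)//= big1 ?addr0 => [|j ji].
  by rewrite mxE !eqxx mulr1.
by rewrite mxE eqxx (negPf ji) mulr0.
Qed.

Lemma g_le x t : 0 <= t -> g x t <= q * (C + G x t).
Proof.
rewrite le_eqVlt => /predU1P[<-|t_gt0].
  by rewrite g0 mulr_ge0 ?q0// addr_ge0 ?G_ge0 ?(ltW C0).
apply: (@le_trans _ _ (q * (G x t / t))); first by rewrite mulrA ler_pdivlMr// mulrC tg_le// ltW.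
by rewrite ler_wpM2l ?q0//; apply: (gf_ratio p1' (gGx x) (G0 x) C1 (G1 x)); exact: ltW.
Qed.

Lemma f_mul_le x t : `|f x t * t| <= C * (`|t| + Psi x `|t|).
Proof.
rewrite normrM; apply: (@le_trans _ _ (C * (1 + Psi x `|t| / `|t|) * `|t|)).
  by rewrite ler_wpM2r// fb.
rewrite -mulrA ler_wpM2l ?(ltW C0)// mulrDl mul1r lerD2l.
have [->|tn] := eqVneq t 0; first by rewrite normr0 mulr0 P0.
by rewrite divfK// normr_eq0.
Qed.

Lemma small_pair v Dv (eps : R) : P v Dv -> 0 < eps -> exists j,
  Phi (fun x => Dv x - De_ j x) <= eps /\ Int (fun x => Psi x `|v x - e_ j x|) <= eps.
Proof.
move=> Pv eps0; have [Ce Ce0 H] := emb_scaled.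
have [l l01 Hl] := small_factor (ltW Ce0) eps0; have /andP[l0 l1] := l01.
have [|j Hj] := e_dense Pv (_ : 0 < Num.min eps (l `^ q)); first by rewrite lt_min eps0 powR_gt0.
move: Hj; rewrite le_min => /andP[H1 H2]; exists j; split => //.
have [A _] := H l _ _ (PB Pv (Pe j)) l01 H2; apply: le_trans A _.
apply: le_trans Hl; rewrite mulrC ler_wpM2r ?(ltW Ce0)//.
by have := ger_powR l01 r1; rewrite powRr1// ltW.
Qed.

(** A rapidly converging subsequence has integrable majorants for functions and gradients, so all
    limits are taken by dominated convergence, with no monotonicity argument for the flux. *)
Lemma galerkin_limit : exists u Du (w : nat -> T -> R) (Dw : nat -> T -> 'rV[R]_N),
  [/\ adm u Du, forall k, P (w k) (Dw k),
      forall eps : R, 0 < eps -> exists k,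
        Phi (fun x => Dw k x - Du x) <= eps /\ Int (fun x => Psi x `|w k x - u x|) <= eps,
      forall v Dv, P v Dv -> stress Du Dv = force u v &
      ~ {ae mu, forall x, Om x -> u x = 0}].
Proof.
have [rho [v [Dv [rho0 Hv cv self eqn]]]] := galerkin_cauchy.
have Pv k : P (v k) (Dv k) by have [] := Hv k.
pose Q k n m :=
  Int (fun x => Psi x (2 ^+ k * `|v n x - v m x|)) <= 2^-1 ^+ k /\
  Int (fun x => G x (2 ^+ k * enorm (Dv n x - Dv m x))) <= 2^-1 ^+ k.
have k1 (k : nat) : (1 : R) <= 2 ^+ k by rewrite exprn_ege1// ler1n.
have k0 (k : nat) : (0 : R) < 2 ^+ k by rewrite exprn_gt0.
have iPsi k n m : itg (fun x => Psi x (2 ^+ k * `|v n x - v m x|)).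
  apply: itg_eq (itg_Psi (PZ (2 ^+ k) (PB (Pv n) (Pv m)))) => // x _.
  by rewrite normrM ger0_norm// ltW.
have iG k n m : itg (fun x => G x (2 ^+ k * enorm (Dv n x - Dv m x))).
  apply: itg_eq (itg_G (PZ (2 ^+ k) (PB (Pv n) (Pv m)))) => // x _.
  by rewrite enormZ ger0_norm// ltW.
have [|t tk HQ] := @rapid_subsequence Q.
  (* A factor [2^k] inside the integrands multiplies the modulars by at most [(2^k)^r'] and
     [(2^k)^q]; the divisors compensate for this. *)
  move=> k; pose eps : R := Num.min (2^-1 ^+ k / (2 ^+ k) `^ r') (2^-1 ^+ k / (2 ^+ k) `^ q).
  have [|n0 Hn0] := cv eps; first by rewrite lt_min !divr_gt0 ?powR_gt0 ?exprn_gt0 ?invr_gt0.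
  exists n0 => n m n0n n0m; have [H1 H2] := Hn0 n m n0n n0m; split.
  - apply: (@le_trans _ _ ((2 ^+ k) `^ r' * Int (fun x => Psi x `|v n x - v m x|))).
      have i1 := itg_Psi (PB (Pv n) (Pv m)).
      rewrite -(IntZ mOm _ i1); apply: Int_le => //; first exact: itgZ.
      by move=> x _; exact: (gf_grow (gP x)).
    rewrite mulrC -ler_pdivlMr ?powR_gt0//; apply: le_trans H2 _.
    by rewrite ge_min lexx.
  - apply: (@le_trans _ _ ((2 ^+ k) `^ q * Phi (fun x => Dv n x - Dv m x))).
      have i1 := itg_G (PB (Pv n) (Pv m)).
      rewrite /Phi -(IntZ mOm _ i1); apply: Int_le => //; first exact: itgZ.
      by move=> x _; apply: (gf_grow (gGx x)); rewrite ?enorm_ge0.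
    rewrite mulrC -ler_pdivlMr ?powR_gt0//; apply: le_trans H1 _.
    by rewrite ge_min lexx orbT.
pose w k := v (t k); pose Dw k := Dv (t k).
have Pw k : P (w k) (Dw k) by exact: Pv.
have mw k : measurable_fun Om (w k) by have [] := P_meas (Pw k).
have mDw k : measurable_vec (Dw k) by have [] := P_meas (Pw k).
have [u [hu [mu_ mhu hu0 ihu cu]]] := @modular_limit _ T R mu Om mOm r r' C Psi r1 gP P0 C1 P1 mP
  w mw (fun k => iPsi k _ _) (fun k => (HQ k).1).
have coord_le (z : 'rV[R]_N) i : `|z 0 i| <= enorm z.
  exact: le_trans (norm_coord _ _) (norm_le_enorm _).
have Gle k x i : G x (2 ^+ k * `|Dw k.+1 x 0 i - Dw k x 0 i|) <=
    G x (2 ^+ k * enorm (Dw k.+1 x - Dw k x)).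
  apply: G_homo; first by rewrite mulr_ge0// ltW.
  rewrite ler_wpM2l ?(ltW (k0 k))//; have := coord_le (Dw k.+1 x - Dw k x) i.
  by rewrite !mxE.
have iGi k i : itg (fun x => G x (2 ^+ k * `|Dw k.+1 x 0 i - Dw k x 0 i|)).
  apply: (itg_le mOm _ (iG k (t k.+1) (t k))).
    apply: mG => [|x]; last by rewrite mulr_ge0// ltW.
    apply: measurable_funM; first exact: measurable_cst.
    by apply: measurableT_comp => //; exact: (measurable_funB (mDw k.+1 i) (mDw k i)).
  by move=> x _; rewrite ger0_norm ?G_ge0 ?mulr_ge0 ?(ltW (k0 k))//; exact: Gle.
(* [modular_limit] is scalar, so it is applied to each coordinate of the gradients. *)
have /choice[c Hc] : forall i, exists c : (T -> R) * (T -> R),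
  [/\ measurable_fun Om c.1, measurable_fun Om c.2,
      forall x, 0 <= c.2 x /\ `|c.1 x - Dw 0%N x 0 i| <= c.2 x,
      itg (fun x => G x (c.2 x)) &
      {ae mu, forall x, Om x -> Dw k x 0 i @[k --> \oo] --> c.1 x /\
        forall k, `|Dw k x 0 i - Dw 0%N x 0 i| <= c.2 x}].
  move=> i.
  have [|ui [hi H]] := @modular_limit _ T R mu Om mOm p q C G p1' gGx G0 C1 G1 mG
    (fun k x => Dw k x 0 i) (fun k => mDw k i) (fun k => iGi k i).
    move=> k; apply: le_trans (HQ k).2; apply: Int_le => // x _; exact: Gle.
  by exists (ui, hi).
pose Du x : 'rV[R]_N := \row_i (c i).1 x.
pose hD x := \sum_i (c i).2 x.
have hDi0 i x : 0 <= (c i).2 x by have [_ _ /(_ x)[]] := Hc i.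
have hD0 x : 0 <= hD x by apply: sumr_ge0 => i _.
have mDu : measurable_vec Du.
  move=> i; rewrite (_ : (fun x => _) = (c i).1); first by have [] := Hc i.
  by apply/funext => x; rewrite mxE.
have [mhD ihD] : measurable_fun Om hD /\ itg (fun x => G x (hD x)).
  rewrite /hD; elim: (index_enum _) => [|i l [IH1 IH2]].
    rewrite (_ : (fun x => _) = fun=> 0); last by apply/funext => x; rewrite big_nil.
    split; first exact: measurable_cst.
    by apply: itg_eq (itg_cst mOm finOm 0) => // x _; rewrite big_nil G0.
  have E x : \sum_(j <- i :: l) (c j).2 x = (c i).2 x + \sum_(j <- l) (c j).2 x by rewrite big_cons.
  have [_ mi _ ii _] := Hc i; split.
    by rewrite (eq_fun E); exact: measurable_funD.
  apply: (itg_eq mOm (f := fun x => G x ((c i).2 x + \sum_(j <- l) (c j).2 x))).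
    by move=> x _; rewrite E.
  by apply: itg_GD => // x; exact: sumr_ge0.
have DuD x : enorm (Du x - Dw 0%N x) <= hD x.
  apply: le_trans (enorm_le_sum _) _; apply: ler_sum => i _; rewrite !mxE.
  by have [_ _ /(_ x)[]] := Hc i.
have uu x : `|u x - w 0%N x| <= hu x by have [] := hu0 x.
have hu00 x : 0 <= hu x by have [] := hu0 x.
have cD : {ae mu, forall x, Om x -> Dw k x @[k --> \oo] --> Du x /\
    forall k, enorm (Dw k x - Dw 0%N x) <= hD x}.
  have H : {ae mu, forall x, forall i, Om x -> Dw k x 0 i @[k --> \oo] --> (c i).1 x /\
        forall k, `|Dw k x 0 i - Dw 0%N x 0 i| <= (c i).2 x}.
    by apply: filter_forall => i; have [] := Hc i.
  apply: filterS H => x Hx Ox; split.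
    by apply: row_cvg => i; rewrite mxE; have [] := Hx i Ox.
  move=> k; apply: le_trans (enorm_le_sum _) _; apply: ler_sum => i _; rewrite !mxE.
  by have [_] := Hx i Ox; apply.
(* Majorants of the whole subsequence and of its limit: first term plus total variation. *)
pose U x := `|w 0%N x| + hu x; pose DU x := enorm (Dw 0%N x) + hD x.
have mU : measurable_fun Om U by apply: measurable_funD => //; exact: measurableT_comp.
have mDU : measurable_fun Om DU by apply: measurable_funD => //; exact: measurable_enorm.
have U0 x : 0 <= U x by rewrite addr_ge0.
have DU0 x : 0 <= DU x by rewrite addr_ge0 ?enorm_ge0.
have iU : itg (fun x => Psi x (U x)).
  by apply: itg_PsiD => //; [exact: measurableT_comp|exact: (itg_Psi (Pw 0%N))].
have iDU : itg (fun x => G x (DU x)).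
  by apply: itg_GD => //; [exact: measurable_enorm|move=> x; exact: enorm_ge0|exact: (itg_G (Pw 0%N))].
have leU (a b c0 : R) : `|a - b| <= c0 -> `|a| <= `|b| + c0.
  by move=> H; rewrite -[a](subrK b) addrC; apply: le_trans (ler_normD _ _) _; rewrite lerD2l.
have leDU (a b : 'rV[R]_N) (c0 : R) : enorm (a - b) <= c0 -> enorm a <= enorm b + c0.
  by move=> H; rewrite -[a](subrK b) addrC; apply: le_trans (enormD _ _) _; rewrite lerD2l.
have uU x : `|u x| <= U x by exact: leU.
have DuDU x : enorm (Du x) <= DU x by exact: leDU.
have Au : adm u Du by split => //; [exact: itg_Psi_le iU uU|exact: itg_G_le iDU DuDU].
have bU : {ae mu, forall x k, Om x -> `|w k x| <= U x}.
  by apply: filterS cu => x H k Ox; apply: leU; have [_] := H Ox; apply.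
have bDU : {ae mu, forall x k, Om x -> enorm (Dw k x) <= DU x}.
  by apply: filterS cD => x H k Ox; apply: leDU; have [_] := H Ox; apply.
have I0 : Int (fun=> 0) = 0 by rewrite -[RHS](mul0r (fine (mu Om))) -Int_cst.
have cG : Phi (fun x => Dw k x - Du x) @[k --> \oo] --> 0.
  have [] := @Int_dominated _ T R mu Om mOm (fun k x => G x (enorm (Dw k x - Du x)))
    (fun=> 0) (fun x => G x (DU x + DU x)).
  - move=> k; apply: mG => [|x]; last exact: enorm_ge0.
    by apply: measurable_enorm; exact: measurable_vecB.
  - exact: measurable_cst.
  - apply: filterS cD => x H Ox; have [H1 _] := H Ox.
    apply: (gf_cvg0 p1' (gGx x) (G0 x) C1 (G1 x)) => [k|]; first exact: enorm_ge0.
    have H2 : Dw k x - Du x @[k --> \oo] --> (0 : 'rV[R]_N) by apply/subr_cvg0.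
    have := @enorm_continuous R N (0 : 'rV[R]_N); rewrite /continuous_at enorm0 => ce.
    exact: (cvg_comp (fun k => Dw k x - Du x) (@enorm R N) H2 ce).
  - by apply: itg_GD => // x; exact: DU0.
  - apply: filterS bDU => x H k Ox; rewrite ger0_norm ?G_ge0 ?enorm_ge0//.
    apply: G_homo; rewrite ?enorm_ge0//; apply: le_trans (enormB _ _) _.
    by apply: lerD => //; exact: H.
  by move=> _; rewrite I0.
have cPsi : Int (fun x => Psi x `|w k x - u x|) @[k --> \oo] --> 0.
  have [] := @Int_dominated _ T R mu Om mOm (fun k x => Psi x `|w k x - u x|)
    (fun=> 0) (fun x => Psi x (U x + U x)).
  - move=> k; apply: mP => // ; apply: measurableT_comp => //; exact: measurable_funB.
  - exact: measurable_cst.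
  - apply: filterS cu => x H Ox; have [H1 _] := H Ox.
    apply: (gf_cvg0 r1 (gP x) (P0 x) C1 (P1 x)) => //.
    have H2 : w k x - u x @[k --> \oo] --> 0 by apply/subr_cvg0.
    by rewrite -(normr0 R); exact: cvg_norm.
  - by apply: itg_PsiD => // x; exact: U0.
  - apply: filterS bU => x H k Ox; rewrite ger0_norm ?P_ge0//.
    apply: P_homo => //; apply: le_trans (ler_normB _ _) _.
    by apply: lerD => //; exact: H.
  by move=> _; rewrite I0.
have cst_ j : stress (Dw k) (De_ j) @[k --> \oo] --> stress Du (De_ j).
  have [B B1 HB] := P_bdd1 (Pe j); have [_ mDe] := P_meas (Pe j).
  have [] := @Int_dominated _ T R mu Om mOm (fun k x => dotv (radial_flux (g x) (Dw k x)) (De_ j x))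
    (fun x => dotv (radial_flux (g x) (Du x)) (De_ j x)) (fun x => B * (q * (C + G x (DU x)))).
  - by move=> k; exact: measurable_flux_dot.
  - exact: measurable_flux_dot.
  - apply: filterS cD => x H Ox; have [H1 _] := H Ox.
    have c1 : continuous (fun xi : 'rV[R]_N => dotv (radial_flux (g x) xi) (De_ j x)).
      have cr : continuous (@radial_flux R N (g x)) by exact: (flux_continuous (gG x)).
      exact: (dotv_continuous cr (@continuous_fun_cst _ _ (De_ j x))).
    exact: (cvg_comp (fun k => Dw k x) (fun xi => dotv (radial_flux (g x) xi) (De_ j x)) H1 (c1 (Du x))).
  - by do 2 apply: itgZ => //; apply: itgD => //; exact: itg_cst.
  - apply: filterS bDU => x H k Ox; apply: le_trans (flux_dot_le (gG x) _ _) _.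
    rewrite mulrC; apply: ler_pM; rewrite ?g_ge0 ?enorm_ge0//; first by have [] := HB x.
    apply: le_trans (g_homo _ (enorm_ge0 _) (H k Ox)) _; exact: g_le.
  by [].
have cfo j : force (w k) (e_ j) @[k --> \oo] --> force u (e_ j).
  have [B B1 HB] := P_bdd1 (Pe j); have [me _] := P_meas (Pe j).
  have [] := @Int_dominated _ T R mu Om mOm (fun k x => f x (w k x) * e_ j x)
    (fun x => f x (u x) * e_ j x) (fun x => B * (C * (1 + C + Psi x (U x)))).
  - by move=> k; apply: measurable_funM => //; exact: mf.
  - by apply: measurable_funM => //; exact: mf.
  - apply: filterS cu => x H Ox; have [H1 _] := H Ox.
    apply: cvgM; last exact: cvg_cst.
    exact: (cvg_comp (fun k => w k x) (f x) H1 (@fc x (u x))).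
  - by do 2 apply: itgZ => //; apply: itgD => //; exact: itg_cst.
  - apply: filterS bU => x H k Ox; rewrite normrM mulrC; apply: ler_pM => //; first by have [] := HB x.
    apply: le_trans (f_le x (w k x)) _; rewrite ler_wpM2l ?(ltW C0)// lerD2l.
    by apply: P_homo => //; exact: H.
  by [].
(* The equation tested with [e_ j] is available only from index [j] on, hence the shift. *)
have eqj j : stress Du (De_ j) = force u (e_ j).
  have H1 : stress (Dw (k + j)%N) (De_ j) @[k --> \oo] --> stress Du (De_ j).
    by rewrite (cvg_shiftn j (fun k => stress (Dw k) (De_ j))).
  have H2 : force (w (k + j)%N) (e_ j) @[k --> \oo] --> force u (e_ j).
    by rewrite (cvg_shiftn j (fun k => force (w k) (e_ j))).
  have E : (fun k => stress (Dw (k + j)%N) (De_ j)) = (fun k => force (w (k + j)%N) (e_ j)).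
    by apply/funext => k; apply: eqn; apply: leq_trans (tk _); exact: leq_addl.
  by move: H1; rewrite E => /cvg_lim <- //; move: H2 => /cvg_lim <-.
exists u, Du, w, Dw; split => //.
- move=> eps eps0.
  have N1 : \forall k \near \oo, Phi (fun x => Dw k x - Du x) < eps by exact: cvgr_lt cG _ eps0.
  have N2 : \forall k \near \oo, Int (fun x => Psi x `|w k x - u x|) < eps by exact: cvgr_lt cPsi _ eps0.
  by have [k [/ltW ? /ltW ?]] := filter_ex (filterI N1 N2); exists k.
- move=> z Dz Pz; apply: weak_equation_closed => //; first exact: P_adm.
  move=> eps eps0; have [j [H1 H2]] := small_pair Pz eps0.
  by exists (e_ j), (De_ j); split => //; exact: P_adm.
(* If [u] vanished, both [force (w k) (w k)] and the integrals of [F x (w k x)] would tend to 0. But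
   [Phi <= stress] on the diagonal and the equation bound the energy, which is at least [rho], by
   their difference. *)
move=> u0.
have iB : itg (fun x => C * (1 + C * Psi x (U x) + Psi x (U x))).
  by apply: itgZ => //; apply: itgD => //; apply: itgD => //; [exact: itg_cst|exact: itgZ].
have bb x (a : R) : `|a| <= U x -> C * (`|a| + Psi x `|a|) <= C * (1 + C * Psi x (U x) + Psi x (U x)).
  move=> tU; rewrite ler_wpM2l ?(ltW C0)// lerD//; last exact: P_homo.
  by apply: le_trans tU _; exact: (gf_ge r1 (gP x) (P0 x) C1 (P1 x)).
have cw0 : {ae mu, forall x, Om x -> w k x @[k --> \oo] --> 0}.
  by apply: filterS (filterI cu u0) => x [H H0] Ox; have [+ _] := H Ox; rewrite (H0 Ox).
have cself : force (w k) (w k) @[k --> \oo] --> 0.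
  have [] := @Int_dominated _ T R mu Om mOm (fun k x => f x (w k x) * w k x)
    (fun=> 0) (fun x => C * (1 + C * Psi x (U x) + Psi x (U x))).
  - by move=> k; apply: measurable_funM => //; exact: mf.
  - exact: measurable_cst.
  - apply: filterS cw0 => x H Ox; rewrite -(mulr0 (f x 0)); apply: cvgM; last exact: H.
    exact: (cvg_comp (fun k => w k x) (f x) (H Ox) (@fc x 0)).
  - exact: iB.
  - by apply: filterS bU => x H k Ox; apply: le_trans (f_mul_le x (w k x)) _; apply: bb; exact: H.
  by move=> _; rewrite I0.
have cF0 : Int (fun x => F x (w k x)) @[k --> \oo] --> 0.
  have [] := @Int_dominated _ T R mu Om mOm (fun k x => F x (w k x))
    (fun=> 0) (fun x => C * (1 + C * Psi x (U x) + Psi x (U x))).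
  - by move=> k; exact: mF.
  - exact: measurable_cst.
  - apply: filterS cw0 => x H Ox; rewrite -(F0 x).
    have cF : {for 0, continuous (F x)}.
      by apply/differentiable_continuous/derivable1_diffP; have [] := Fd x 0.
    exact: (cvg_comp (fun k => w k x) (F x) (H Ox) cF).
  - exact: iB.
  - by apply: filterS bU => x H k Ox; apply: le_trans (F_le x (w k x)) _; apply: bb; exact: H.
  by move=> _; rewrite I0.
have c0 : force (w k) (w k) - Int (fun x => F x (w k x)) @[k --> \oo] --> (0 - 0 : R).
  exact: cvgB.
rewrite subrr in c0.
have : rho <= 0.
  rewrite -(cvg_lim _ c0)//; apply: limr_ge; first by apply: cvgP; exact: c0.
  apply: nearW => k.
  have [Pk /le_trans] := Hv (t k); apply; rewrite /energy lerD2r.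
  rewrite -self; apply: Int_le => //; [exact: itg_G Pk|exact: (itg_stress Pk Pk)|].
  by move=> x _; rewrite flux_dot_self; apply: (dp_le_density (gG x)); exact: enorm_ge0.
by rewrite leNgt rho0.
Qed.

End limit.

End galerkin.

End energy.

(** * Lebesgue measure, test functions and averages along rays *)

Section space.
Context {R : realType} {N : nat}.
Local Notation mu := (@lebesgue_Rn R N).
Implicit Types (a b c x y : 'rV[R]_N) (A : set 'rV[R]_N).

Lemma borel_measurable A : measurable A -> measurable (A : set (Rn R N)).
Proof. by move=> mA; apply: sub_caratheodory; exact: sub_sigma_algebra. Qed.

Lemma measurable_fun_id_Rn : measurable_fun [set: Rn R N] (fun x : Rn R N => x : 'rV[R]_N).
Proof. by move=> _ A mA; rewrite setTI; exact: borel_measurable. Qed.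

Lemma measurable_coord_rV (i : 'I_N) : measurable_fun [set: 'rV[R]_N] (fun x => x 0 i).
Proof.
move=> _ A mA; apply: sub_sigma_algebra; rewrite -bigcup_seq.
by exists i; [rewrite /= mem_index_enum|exists A].
Qed.

Lemma measurable_coord_Rn (i : 'I_N) : measurable_fun [set: Rn R N] (fun x : Rn R N => x 0 i).
Proof. exact: (measurableT_comp (measurable_coord_rV i) measurable_fun_id_Rn). Qed.

Definition boxes (B : 'I_N -> set R) : set 'rV[R]_N := [set v | forall i, B i (v 0 i)].

Lemma boxes_measurable (B : 'I_N -> set R) : (forall i, measurable (B i)) -> measurable (boxes B).
Proof.
move=> mB; rewrite (_ : boxes B = \bigcap_(i in [set: 'I_N]) ((fun v : 'rV[R]_N => v 0 i) @^-1` B i)).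
  apply: fin_bigcap_measurable => // i _; rewrite -[X in measurable X]setTI.
  exact: measurable_coord_rV.
by apply/seteqP; split => v /= h i => [_|]; [exact: h|exact: (h i Logic.I)].
Qed.

Lemma lebesgue_boxes (B : 'I_N -> set R) : (forall i, measurable (B i)) ->
  mu (boxes B) = (\prod_(i < N) lebesgue_measure (B i))%E.
Proof. exact: lebesgue_Rn_box. Qed.

Definition cube c (r : R) : set 'rV[R]_N := boxes (fun i => `]c 0 i - r, c 0 i + r[%classic).

Lemma cube_measurable c r : measurable (cube c r).
Proof. by apply: boxes_measurable => i. Qed.

Lemma cube_Lmeasurable c r : measurable (cube c r : set (Rn R N)).
Proof. by apply: borel_measurable; exact: cube_measurable. Qed.

Lemma in_cube c r x : cube c r x <-> forall i, `|x 0 i - c 0 i| < r.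
Proof.
split=> H i; have := H i; rewrite /= in_itv/= ltr_norml.
  by move=> /andP[? ?]; apply/andP; split; lra.
by move=> /andP[? ?]; apply/andP; split; lra.
Qed.

Lemma cube_ball c r x : 0 < r -> cube c r x <-> `|x - c| < r.
Proof.
move=> r0; rewrite in_cube; split=> H.
  rewrite [ltLHS]/Num.norm /= mx_normrE; apply/bigmax_ltP; split => // -[j i] _ /=.
  by rewrite (ord1 j) !mxE.
by move=> i; apply: le_lt_trans H; have := norm_coord (x - c) i; rewrite !mxE.
Qed.

Lemma lebesgue_cube c r : 0 <= r -> mu (cube c r) = ((2 * r) ^+ N)%:E.
Proof.
move=> r0; rewrite lebesgue_Rn_box// (eq_bigr (fun=> (2 * r)%:E)) => [|i _].
  by rewrite prodEFin prodr_const card_ord.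
rewrite lebesgue_measure_itv/= lte_fin; case: ltP => H; last by congr EFin; lra.
by rewrite EFinN -EFinB; congr EFin; ring.
Qed.

Lemma lebesgue_Rn_sigma_finite : sigma_finite [set: Rn R N] mu.
Proof.
exists (fun k => cube 0 k.+1%:R).
  apply/esym; rewrite -subTset => x _; exists (Num.truncn `|x : 'rV[R]_N|) => //.
  by apply/cube_ball => //; rewrite subr0; exact: truncnS_gt.
move=> k; split; first exact: cube_Lmeasurable.
by rewrite lebesgue_cube// ltry.
Qed.

HB.instance Definition _ := Measure_isSigmaFinite.Build _ _ _ mu lebesgue_Rn_sigma_finite.

Lemma rational_cube A x : open A -> A x -> exists (c : 'rV[rat]_N) (n : nat),
  cube (map_mx ratr c) n.+1%:R^-1 x /\ cube (map_mx ratr c) n.+1%:R^-1 `<=` A.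
Proof.
move=> oA Ax; have /nbhs_ballP[r /= r0 rA] := open_nbhs_nbhs (conj oA Ax).
have r2 : 0 < r / 2 by rewrite divr_gt0.
have [n Hn] : exists n : nat, n.+1%:R^-1 < r / 2.
  by have := @near_infty_natSinv_lt R (PosNum r2); case=> k _ /(_ k (leqnn _)); exists k.
have n0 : (0 : R) < n.+1%:R^-1 by rewrite invr_gt0.
have /choice[c Hc] : forall i, exists q : rat, ratr q \in `]x 0 i - n.+1%:R^-1, x 0 i + n.+1%:R^-1[.
  by move=> i; apply: rat_in_itvoo; rewrite ltrBlDr -addrA ltrDl addr_gt0.
exists (\row_i c i), n; move: n.+1%:R^-1 Hn n0 Hc => e Hn e0 Hc.
have xc : cube (map_mx ratr (\row_i c i)) e x.
  apply/in_cube => i; rewrite !mxE; have := Hc i; rewrite in_itv/= ltr_norml => /andP[? ?].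
  by apply/andP; split; lra.
split=> // y /cube_ball -/(_ e0) yc; apply: rA; rewrite -ball_normE /=.
move: xc => /cube_ball -/(_ e0) xc.
have -> : x - y = (x - map_mx ratr (\row_i c i)) - (y - map_mx ratr (\row_i c i)).
  by rewrite opprB addrA subrK.
by apply: le_lt_trans (ler_normB _ _) _; move: xc yc Hn; lra.
Qed.

(** The sigma-algebra on row vectors is generated by the coordinates; an open set belongs to it as a
    countable union of cubes with rational centre and radius [1 / (n + 1)]. *)
Lemma open_borel A : open A -> measurable A.
Proof.
move=> oA; pose C (k : 'rV[rat]_N * nat) : set 'rV[R]_N :=
  [set x | cube (map_mx ratr k.1) k.2.+1%:R^-1 x /\ cube (map_mx ratr k.1) k.2.+1%:R^-1 `<=` A].
have -> : A = \bigcup_k C k.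
  apply/seteqP; split => [x Ax|x [k _ [xC CA]]]; last exact: CA.
  by have [c [n H]] := rational_cube oA Ax; exists (c, n).
apply: countable_bigcupT_measurable => [|k]; first exact: countableP.
have [H|H] := pselect (cube (map_mx ratr k.1) k.2.+1%:R^-1 `<=` A).
  rewrite (_ : C k = cube (map_mx ratr k.1) k.2.+1%:R^-1); first exact: cube_measurable.
  by apply/seteqP; split => x // [].
rewrite (_ : C k = set0)//; by apply/seteqP; split => x // [].
Qed.

Lemma continuous_borel (f : 'rV[R]_N -> R) : continuous f -> measurable_fun setT f.
Proof.
move=> cf; apply: (measurability (@RGenOInfty.G R)) => [|/= _ [_] [r] -> <-].
  exact: RGenOInfty.measurableE.
apply: measurableI => //; apply: open_borel; apply: open_comp => [x _|]; [exact: cf|].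
rewrite (_ : [set` _] = [set x : R | r < x]); first exact: open_gt.
by apply/seteqP; split => x /=; rewrite in_itv/= andbT.
Qed.

Lemma continuous_Lmeasurable (D : set (Rn R N)) (f : 'rV[R]_N -> R) :
  measurable D -> continuous f -> @measurable_fun _ _ (Rn R N) _ D f.
Proof.
move=> mD cf; apply: (@measurable_funS _ _ (Rn R N) _ setT) => //.
exact: (measurableT_comp (continuous_borel cf) measurable_fun_id_Rn).
Qed.

Lemma open_Rn A : open A -> measurable (A : set (Rn R N)).
Proof. by move=> /open_borel/borel_measurable. Qed.

Lemma bounded_in_cube A : bounded_set A -> exists2 r : R, 0 < r & A `<=` cube 0 r.
Proof.
case=> M [_ HM]; have M1 : M < `|M| + 1 by rewrite (le_lt_trans (ler_norm M))// ltrDl.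
exists (`|M| + 2); first by rewrite ltr_wpDl.
move=> x Ax; apply/cube_ball; first by rewrite ltr_wpDl.
by rewrite subr0; apply: le_lt_trans (HM _ M1 x Ax) _; rewrite ltrD2l; lra.
Qed.

Lemma bounded_finite_measure A : measurable (A : set (Rn R N)) -> bounded_set A -> (mu A < +oo)%E.
Proof.
move=> mA /bounded_in_cube[r r0 Ar]; apply: (@le_lt_trans _ _ (mu (cube 0 r))).
  by apply: le_measure; rewrite ?inE//; exact: cube_Lmeasurable.
by rewrite lebesgue_cube ?ltry// ltW.
Qed.

Lemma open_cube A x : open A -> A x -> exists2 r : R, 0 < r & cube x r `<=` A.
Proof.
move=> oA Ax; have /nbhs_ballP[r /= r0 rA] := open_nbhs_nbhs (conj oA Ax).
exists r => // y /cube_ball -/(_ r0) yx; apply: rA; rewrite -ball_normE /=.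
by rewrite distrC.
Qed.

Lemma ae_continuous_eq0 A (f : 'rV[R]_N -> R) : open A -> continuous f ->
  {ae mu, forall x, A x -> f x = 0} -> forall x, A x -> f x = 0.
Proof.
move=> oA cf [B [mB B0 HB]] x Ax; apply: contrapT => fx.
have oD : open (A `&` [set y | f y != 0]).
  apply: openI => //; rewrite (_ : [set y | _] = f @^-1` [set t | t != 0])//.
  by apply: open_comp => [y _|]; [exact: cf|exact: open_neq].
have Dx : (A `&` [set y | f y != 0]) x by split => //=; exact/eqP.
have [r r0 rD] := open_cube oD Dx.
have : (mu (cube x r) <= 0)%E.
  rewrite -B0; apply: le_measure; rewrite ?inE//; first exact: cube_Lmeasurable.
  by move=> y /rD[Ay fy]; apply: HB => /(_ Ay) fy0; move: fy => /=; rewrite fy0 eqxx.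
by rewrite lebesgue_cube ?(ltW r0)// lee_fin leNgt exprn_gt0// mulr_gt0.
Qed.

End space.

(** * Change of variables under translations and dilations *)

Section affine.
Context {R : realType} {N : nat}.
Local Notation mu := (@lebesgue_Rn R N).

Let G : set (set 'rV[R]_N) :=
  [set A | exists a b : 'rV[R]_N, A = boxes (fun i => `]a 0 i, b 0 i[%classic)].

Let G_cube (c : 'rV[R]_N) r : G (cube c r).
Proof.
exists (\row_i (c 0 i - r)), (\row_i (c 0 i + r)).
by apply/seteqP; split => x /= H i; have := H i; rewrite /= !mxE.
Qed.

Let cube_cover : \bigcup_k cube (0 : 'rV[R]_N) k.+1%:R = setT.
Proof.
rewrite -subTset => x _; exists (Num.truncn `|x|) => //.
by apply/cube_ball => //; rewrite subr0; exact: truncnS_gt.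
Qed.

Let G_setI : setI_closed G.
Proof.
move=> _ _ [a [b ->]] [a' [b' ->]].
exists (\row_i Num.max (a 0 i) (a' 0 i)), (\row_i Num.min (b 0 i) (b' 0 i)).
apply/seteqP; split => x /= => [[H H'] i|H].
  have := H i; have := H' i; rewrite /= !mxE !in_itv/= => /andP[? ?] /andP[? ?].
  by rewrite gt_max lt_min; apply/andP; split; apply/andP.
by split=> i; have := H i; rewrite /= !mxE !in_itv/= gt_max lt_min => /andP[/andP[? ?] /andP[? ?]];
  apply/andP.
Qed.

(** It is enough that each coordinate be measurable for the sigma-algebra of boxes; a half-space is
    the union of boxes truncated at [k] in every other direction. *)
Let G_generates : @measurable _ 'rV[R]_N = <<s G >>.
Proof.
apply/seteqP; split; last first.
  apply: smallest_sub; first exact: sigma_algebra_measurable.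
  by move=> _ [a [b ->]]; apply: boxes_measurable => i.
apply: smallest_sub; first exact: smallest_sigma_algebra.
move=> A; rewrite -bigcup_seq => -[i /= _ [C mC <-]].
have mc : @measurable_fun _ _ (g_sigma_algebraType G) R setT (fun x : 'rV[R]_N => x 0 i).
  apply: (measurability (@RGenOInfty.G R)) => [|/= _ [_] [r] -> <-].
    exact: RGenOInfty.measurableE.
  rewrite setTI.
  rewrite (_ : _ @^-1` _ = \bigcup_(k : nat) boxes (fun j => `](if j == i then r else - k%:R), k%:R[%classic)).
    apply: bigcupT_measurable => k; apply: sub_sigma_algebra.
    exists (\row_j (if j == i then r else - k%:R)), (\row_j k%:R).
    by apply/seteqP; split => x /= H j; have := H j; rewrite /= !mxE.
  apply/seteqP; split => [x /=|x [k _ /= /(_ i)]]; last by rewrite /= eqxx !in_itv/= andbT => /andP[].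
  rewrite in_itv/= andbT => rx; exists (Num.truncn `|x|).+1 => // j /=.
  have xj : `|x 0 j| < (Num.truncn `|x|).+1%:R.
    by apply: le_lt_trans (norm_coord x j) _; exact: truncnS_gt.
  rewrite in_itv/=; move: xj; rewrite ltr_norml => /andP[x1 x2].
  by have [ji|_] := eqVneq j i; apply/andP; split => //; rewrite ji.
by have := mc _ C mC; exact.
Qed.

Lemma measurable_affine (a : 'rV[R]_N) (s : R) :
  measurable_fun [set: Rn R N] (fun x : Rn R N => a + s *: (x : 'rV[R]_N) : 'rV[R]_N).
Proof.
suff mf : measurable_fun setT (fun x : 'rV[R]_N => a + s *: x).
  exact: (measurableT_comp mf (@measurable_fun_id_Rn R N)).
apply: (measurability G) => // _ [_ [b [c ->]] <-]; apply: measurableI => //.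
rewrite (_ : _ @^-1` _ = boxes (fun i => (fun t : R => a 0 i + s * t) @^-1` `]b 0 i, c 0 i[%classic)).
  apply: boxes_measurable => i; rewrite -[X in measurable X]setTI.
  have mf : measurable_fun setT (fun t : R => a 0 i + s * t).
    by apply: measurable_funD => //; exact: measurable_funM.
  exact: mf.
by apply/seteqP; split => x /= H i; have := H i; rewrite /= !mxE.
Qed.

(** Both sides are measures in [A]. They agree on half-open boxes, a generating family stable under
    intersection, and are finite on cubes exhausting the space, so uniqueness of measures
    applies. *)
Lemma lebesgue_affine (a : 'rV[R]_N) (s : R) (A : set 'rV[R]_N) : 0 < s -> measurable A ->
  (mu ((fun x => a + s *: x)%R @^-1` A) = (s ^- N)%:E * mu A)%E.
Proof.
move=> s0 mA.
have sN : 0 <= s ^- N by rewrite invr_ge0 exprn_ge0// ltW.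
pose m1 := measure_function_pushforward__canonical__measure_function_Measure mu (measurable_affine a s).
pose m2 := measure_function_pushforward__canonical__measure_function_Measure mu (@measurable_fun_id_Rn R N).
pose m3 := mscale (NngNum sN) m2.
suff : m1 A = m3 A by [].
apply: (@measure_unique _ _ _ G (fun k => cube 0 k.+1%:R)) => //.
- move=> _ [b [c ->]]; rewrite /m1 /m3 /mscale /= /pushforward.
  rewrite (_ : _ @^-1` _ = boxes (fun i => `](b 0 i - a 0 i) / s, (c 0 i - a 0 i) / s[%classic)); last first.
    apply/seteqP; split => x /= H i; have := H i; rewrite /= !mxE !in_itv/= ltr_pdivrMr// ltr_pdivlMr//;
      by move=> /andP[? ?]; apply/andP; split; lra.
  pose B i : set R := `]b 0 i, c 0 i[%classic.
  rewrite -[RHS]/((s ^- N)%:E * mu (boxes B))%E.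
  rewrite !lebesgue_boxes//; last by move=> i; rewrite /B.
  rewrite (eq_bigr (fun i => (s^-1)%:E * lebesgue_measure (B i)))%E => [|i _].
    rewrite big_split/= prodEFin prodr_const card_ord; congr (_%:E * _)%E.
    by rewrite exprVn.
  rewrite /B !lebesgue_measure_itv/= !lte_fin ltr_pM2r ?invr_gt0// ltrD2r.
  case: ifP => _; last by rewrite mule0.
  by rewrite -!EFinB -EFinM; congr EFin; field; rewrite gt_eqF.
- move=> k; rewrite /m1 /= /pushforward.
  rewrite (_ : _ @^-1` _ = cube (- s^-1 *: a) (k.+1%:R / s)).
    by rewrite lebesgue_cube ?ltry// divr_ge0// ltW.
  have E x i : `|x 0 i - - s^-1 * a 0 i| * s = `|a 0 i + s * x 0 i|.
    rewrite -[X in _ * X](ger0_norm (ltW s0)) -normrM; congr (`|_|).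
    by field; rewrite gt_eqF.
  apply/seteqP; split => x /in_cube H; apply/in_cube => i; have := H i; rewrite !mxE subr0.
    by rewrite ltr_pdivlMr// E.
  by rewrite ltr_pdivlMr// E.
Qed.

Lemma ge0_integral_affine (a : 'rV[R]_N) (s : R) (f : 'rV[R]_N -> \bar R) : 0 < s ->
  measurable_fun setT f -> (forall x, 0 <= f x)%E ->
  (\int[mu]_x f (a + s *: (x : 'rV[R]_N))%R = (s ^- N)%:E * \int[mu]_x f x)%E.
Proof.
move=> s0 mf f0; have sN : 0 <= s ^- N by rewrite invr_ge0 exprn_ge0// ltW.
pose m1 := measure_function_pushforward__canonical__measure_function_Measure mu (measurable_affine a s).
pose m2 := measure_function_pushforward__canonical__measure_function_Measure mu (@measurable_fun_id_Rn R N).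
have E1 : (\int[m1]_x f x = \int[mu]_x f (a + s *: (x : 'rV[R]_N))%R)%E.
  have := @ge0_integral_pushforward _ _ _ _ R _ (measurable_affine a s) mu setT f measurableT mf (fun x _ => f0 x).
  by rewrite preimage_setT.
have E2 : (\int[m2]_x f x = \int[mu]_x f x)%E.
  have := @ge0_integral_pushforward _ _ _ _ R _ (@measurable_fun_id_Rn R N) mu setT f measurableT mf (fun x _ => f0 x).
  by rewrite preimage_setT.
have E3 := @ge0_integral_mscale _ _ R m2 setT measurableT (NngNum sN) f mf (fun x _ => f0 x).
rewrite -E1 -E2; apply: etrans E3.
apply: (@eq_measure_integral _ _ R setT (mscale (NngNum sN) m2) m1 f) => A mA _.
exact: lebesgue_affine.
Qed.

End affine.

Lemma is_derive_dist (R : realType) (f : R -> R) (s l : R) :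
  (forall e : R, 0 < e -> exists2 r : R, 0 < r & forall h, h != 0 -> `|h| < r ->
     `|f (s + h) - f s - l * h| <= e * `|h|) -> is_derive s 1 f l.
Proof.
move=> H.
have C : h^-1 *: (f (h *: 1 + s) - f s) @[h --> 0^'] --> l.
  apply/cvgrPdist_le => e e0; have [r r0 Hr] := H e e0.
  near=> h.
  have h0 : h != 0 by near: h; exact: nbhs_dnbhs_neq.
  have hr : `|h| < r.
    near: h; apply: dnbhs0_lt; exact: r0.
  have := Hr h h0 hr; rewrite /GRing.scale/= mulr1 [h + s]addrC => Hh.
  have -> : l - h^-1 * (f (s + h) - f s) = - (h^-1 * (f (s + h) - f s - l * h)) by field.
  rewrite normrN normrM normfV mulrC ler_pdivrMr ?normr_gt0//.
apply: DeriveDef; first by apply/cvg_ex; exists l.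
exact: cvg_lim C.
Unshelve. all: by end_near. Qed.

Lemma continuous_lin (R : realType) (T : topologicalType) (a : R) (u v : T -> R) :
  continuous u -> continuous v -> continuous (fun t => a * u t + v t).
Proof. by move=> cu cv t; apply: cvgD; [apply: cvgM; [exact: cvg_cst|exact: cu]|exact: cv]. Qed.

Lemma continuous_addl (R : realType) (V : normedModType R) (c : V) : continuous (fun x => x + c).
Proof. by move=> x; apply: cvgD; [exact: cvg_id|exact: cvg_cst]. Qed.

Lemma continuous_affine (R : realType) (V : normedModType R) (a : V) (s : R) :
  continuous (fun x => a + s *: x).
Proof. by move=> x; apply: cvgD; [exact: cvg_cst|apply: cvgZ; [exact: cvg_cst|exact: cvg_id]]. Qed.

Lemma near_forall_dist (R : realType) (T : topologicalType) (n : nat) (f : 'I_n -> T -> R) :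
  (forall i, continuous (f i)) -> forall (t : T) (e : R), 0 < e ->
  \forall s \near t, forall i, `|f i t - f i s| < e.
Proof.
move=> cf t e e0; apply: filter_forall => i.
by have /cvgrPdist_lt /(_ _ e0) := cf i t.
Qed.

(** * Differential calculus of test functions *)

Section C1.
Context {R : realType} {N : nat}.
Implicit Types (u v w : 'rV[R]_N -> R) (x y h : 'rV[R]_N).
Local Notation e_ i := (delta_mx 0 i : 'rV[R]_N).

Definition C1 u := continuous u /\
  forall i, (forall x, derivable u x (e_ i)) /\ continuous (partial i u).

Lemma Ck_C1 u : Ck 1 u -> C1 u.
Proof. by move=> [cu H]; split=> // i; have [? []] := H i. Qed.

Lemma quot_line u i x (s : R) :
  (fun h : R => h^-1 *: (u (x + (h *: 1 + s) *: e_ i) - u (x + s *: e_ i))) =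
  (fun h : R => h^-1 *: (u (h *: e_ i + (x + s *: e_ i)) - u (x + s *: e_ i))).
Proof.
apply/funext => h; have -> : h *: (1 : R) = h by rewrite /GRing.scale/= mulr1.
by rewrite scalerDl addrCA.
Qed.

Lemma partial_line u i x (s : R) :
  'D_1 (fun s : R => u (x + s *: e_ i)) s = partial i u (x + s *: e_ i).
Proof. by rewrite /partial /derive /= -quot_line. Qed.

Lemma partial_is_derive u i x (s : R) : C1 u ->
  is_derive s 1 (fun s : R => u (x + s *: e_ i)) (partial i u (x + s *: e_ i)).
Proof.
move=> [_ /(_ i)[du _]]; apply: DeriveDef; last exact: partial_line.
by have := du (x + s *: e_ i); rewrite /derivable /= -quot_line.
Qed.

Lemma C1_coord_increment u i x (t : R) : C1 u -> exists2 s : R, 0 <= s <= 1 &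
  u (x + t *: e_ i) - u x = t * partial i u (x + (s * t) *: e_ i).
Proof.
move=> cu.
pose f (s : R) := u (x + (s * t) *: e_ i).
have df (s : R) : is_derive s 1 f (t * partial i u (x + (s * t) *: e_ i)).
  have dl : is_derive s 1 (fun s : R => s * t) t.
    by apply: is_derive_eq; rewrite scaler0 add0r /GRing.scale/= mulr1.
  have := @is_derive1_comp _ (fun r : R => u (x + r *: e_ i)) (fun s : R => s * t) s _ _
    (partial_is_derive i x (s * t) cu) dl.
  by rewrite mulrC.
have [s [s01 _] E] := mean_value ler01 (fun z _ => df z) (is_derive_continuousW df).
exists s => //; move: E; rewrite /f mul1r mul0r scale0r addr0 subr0 mulr1; exact.
Qed.

(** The increment is split along the coordinate axes through the points [x + hh j], whose first [j]
    coordinates have moved; each piece is a one-variable mean value. *)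
Lemma C1_increment u x h (eta : R) : C1 u ->
  (forall y i, `|y - x| <= `|h| -> `|partial i u y - partial i u x| <= eta) ->
  `|u (x + h) - u x - dotv (gradient u x) h| <= N%:R * (eta * `|h|).
Proof.
move=> cu H.
pose hh (j : nat) : 'rV[R]_N := \row_i (if (i < j)%N then h 0 i else 0).
have E0 : hh 0%N = 0 by apply/rowP => i; rewrite !mxE.
have EN : hh N = h by apply/rowP => i; rewrite !mxE ltn_ord.
have ES (j : 'I_N) : hh j.+1 = hh j + h 0 j *: e_ j.
  apply/rowP => i; rewrite !mxE eqxx/= ltnS leq_eqVlt (_ : (nat_of_ord i == j) = (i == j))//.
  have [->|_] := eqVneq i j; first by rewrite /= ltnn add0r mulr1.
  by rewrite /= mulr0 addr0.
have le_hh (j : 'I_N) (s : R) : 0 <= s <= 1 -> `|hh j + (s * h 0 j) *: e_ j| <= `|h|.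
  move=> /andP[s0 s1]; rewrite [leLHS]/Num.norm /= mx_normrE; apply/bigmax_leP; split => // -[k i] _ /=.
  rewrite !mxE (ord1 k) eqxx/=; have [->|ij] := eqVneq i j.
    rewrite ltnn add0r mulr1 normrM ger0_norm//; apply: le_trans (norm_coord h j).
    by rewrite ler_piMl.
  by rewrite mulr0 addr0; case: ifP => _; rewrite ?normr0// norm_coord.
have tel : u (x + h) - u x = \sum_(j < N) (u (x + hh j.+1) - u (x + hh j)).
  rewrite -(big_mkord xpredT (fun j => u (x + hh j.+1) - u (x + hh j))).
  by rewrite telescope_sumr// E0 EN addr0.
rewrite tel /dotv -sumrB; apply: le_trans (ler_norm_sum _ _ _) _.
rewrite -[N in N%:R]card_ord -sum1_card natr_sum mulr_suml; apply: ler_sum => j _.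
rewrite mul1r ES addrA; have [s s01 ->] := C1_coord_increment j (x + hh j) (h 0 j) cu.
rewrite [gradient u x 0 j]mxE [partial j u x * _]mulrC -mulrBr normrM mulrC.
apply: ler_pM => //; last exact: norm_coord.
by apply: H; rewrite -[x + hh j + _]addrA [x + _]addrC addrK; exact: le_hh.
Qed.

(** Test functions are defined through iterated partial derivatives; continuity of these gives the
    derivative along an arbitrary line, needed for the rays below. *)
Lemma C1_is_derive u x (w : 'rV[R]_N) (s : R) : C1 u ->
  is_derive s 1 (fun s : R => u (x + s *: w)) (dotv (gradient u (x + s *: w)) w).
Proof.
move=> cu; apply: is_derive_dist => e e0; set z := x + s *: w.
pose L := N%:R * (`|w| + 1) + 1.
have L0 : 0 < L by rewrite ltr_wpDl// mulr_ge0// addr_ge0.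
have eL : 0 < e / L by rewrite divr_gt0.
have [r r0 Hr] : exists2 r : R, 0 < r & forall y i, `|y - z| < r -> `|partial i u y - partial i u z| <= e / L.
  have := @near_forall_dist _ _ N (fun i => partial i u) (fun i => (cu.2 i).2) z _ eL.
  move=> /nbhs_ballP[r /= r0 Hr]; exists r => // y i yz.
  by rewrite distrC ltW//; apply: Hr; rewrite -ball_normE /= distrC.
exists (r / (`|w| + 1)) => [|h h0]; first by rewrite divr_gt0// ltr_wpDl.
rewrite ltr_pdivlMr ?ltr_wpDl// => hr.
have hw : `|h *: w| <= `|h| * (`|w| + 1) by rewrite normrZ ler_wpM2l// lerDl.
have -> : x + (s + h) *: w = z + h *: w by rewrite scalerDl addrA.
have -> : dotv (gradient u z) w * h = dotv (gradient u z) (h *: w) by rewrite dotvZr mulrC.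
apply: le_trans (C1_increment (eta := e / L) cu _) _.
  by move=> y i yz; apply: Hr; apply: le_lt_trans yz _; exact: le_lt_trans hw hr.
apply: (@le_trans _ _ (N%:R * (e / L * (`|h| * (`|w| + 1))))).
  by rewrite ler_wpM2l// ler_wpM2l// ltW.
rewrite (_ : N%:R * _ = e * `|h| * ((N%:R * (`|w| + 1)) / L)); last by ring.
rewrite ler_piMr ?mulr_ge0 ?(ltW e0)//.
by rewrite ler_pdivrMr// mul1r /L lerDl.
Qed.

Lemma C1_lin (a : R) u v : C1 u -> C1 v -> C1 (fun x => a * u x + v x) /\
  forall i x, partial i (fun x => a * u x + v x) x = a * partial i u x + partial i v x.
Proof.
move=> [cu du] [cv dv].
have D i x : is_derive x (e_ i) (fun x => a * u x + v x) (a * partial i u x + partial i v x).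
  have [d1 _] := du i; have [d2 _] := dv i.
  have /derivableP h1 := d1 x; have /derivableP h2 := d2 x.
  exact: (is_deriveD (is_deriveZ a h1) h2).
have E i x : partial i (fun x => a * u x + v x) x = a * partial i u x + partial i v x.
  by have [] := D i x.
split=> //; split.
  exact: continuous_lin.
move=> i; split; first by move=> x; have [] := D i x.
have -> : partial i (fun x => a * u x + v x) = fun x => a * partial i u x + partial i v x.
  by apply/funext => x; exact: E.
have [_ c1] := du i; have [_ c2] := dv i.
exact: continuous_lin.
Qed.

Lemma Ck_lin k (a : R) u v : Ck k u -> Ck k v -> Ck k (fun x => a * u x + v x).
Proof.
elim: k u v => [|k IH] u v [cu Hu] [cv Hv]; split.
- exact: continuous_lin.
- by [].
- exact: continuous_lin.
move=> i; have [d1 k1] := Hu i; have [d2 k2] := Hv i.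
have D x : is_derive x (e_ i) (fun x => a * u x + v x) (a * partial i u x + partial i v x).
  have /derivableP h1 := d1 x; have /derivableP h2 := d2 x.
  exact: (is_deriveD (is_deriveZ a h1) h2).
split; first by move=> x; have [] := D x.
have -> : partial i (fun x => a * u x + v x) = fun x => a * partial i u x + partial i v x.
  by apply/funext => x; have [] := D x.
exact: IH.
Qed.

Lemma partial_out u (K : set 'rV[R]_N) i x : closed K -> (forall y, ~ K y -> u y = 0) -> ~ K x ->
  partial i u x = 0.
Proof.
move=> cK uK Kx.
have oK : open (~` K) by rewrite openC.
have [r r0 rK] := open_cube oK Kx.
have D : is_derive (0 : R) 1 (fun s : R => u (x + s *: e_ i)) 0.
  apply: is_derive_dist => e e0; exists r => // h h0 hr.
  rewrite add0r scale0r addr0 mul0r subr0 !uK ?subrr ?normr0 ?mulr_ge0 ?(ltW e0)//.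
  apply: rK; apply/cube_ball => //; rewrite addrAC subrr add0r normrZ.
  apply: le_lt_trans hr; rewrite ler_piMr//.
  rewrite [leLHS]/Num.norm /= mx_normrE; apply/bigmax_leP; split => // -[k j] _ /=.
  by rewrite mxE; case: (_ && _); rewrite ?normr0 ?normr1.
by have := @derive_val _ _ _ _ _ _ _ D; rewrite partial_line scale0r addr0.
Qed.

Variable Om : set 'rV[R]_N.
Hypothesis oOm : open Om.
Hypothesis bOm : bounded_set Om.

Lemma test_C1 u : test_function Om u -> C1 u.
Proof. by move=> [H _]; apply: Ck_C1; exact: H. Qed.

Lemma test0 : test_function Om (fun=> 0).
Proof.
split; last by exists set0 => //; split; [exact: compact0|exact: sub0set].
have P0 i : partial i (fun=> 0) = (fun=> 0) :> ('rV[R]_N -> R).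
  by apply/funext => x; rewrite /partial derive_cst.
elim=> [|k IH]; split => //; try by move=> x; exact: cst_continuous.
by move=> i; split; [move=> x; exact: derivable_cst|rewrite P0].
Qed.

Lemma test_lin (a : R) u v : test_function Om u -> test_function Om v ->
  test_function Om (fun x => a * u x + v x).
Proof.
move=> [cu [K [cK KO] uK]] [cv [L [cL LO] vL]]; split; first by move=> k; exact: Ck_lin.
exists (K `|` L); first by split; [exact: compactU|move=> x [/KO|/LO]].
by move=> x /not_orP[nK nL]; rewrite uK// vL// mulr0 addr0.
Qed.

Lemma gradient_lin (a : R) u v : C1 u -> C1 v ->
  gradient (fun x => a * u x + v x) = fun x => a *: gradient u x + gradient v x.
Proof.
by move=> cu cv; apply/funext => x; apply/rowP => i; rewrite !mxE; have [_ ->] := C1_lin a cu cv.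
Qed.

Lemma gradient0 : gradient (fun=> 0) = (fun=> 0) :> ('rV[R]_N -> 'rV[R]_N).
Proof. by apply/funext => x; apply/rowP => i; rewrite !mxE /partial derive_cst. Qed.

Lemma test_out u x : test_function Om u -> ~ Om x -> u x = 0 /\ gradient u x = 0.
Proof.
move=> [_ [K [cK KO] uK]] nO; have nK : ~ K x by move=> /KO.
split; first exact: uK.
apply/rowP => i; rewrite !mxE; apply: (partial_out i _ uK nK).
exact: compact_closed.
Qed.

Lemma gradient_continuous u : C1 u -> continuous (gradient u).
Proof.
move=> [_ du]; apply: continuous_rowP => i.
rewrite (_ : (fun t => _) = partial i u); first by have [] := du i.
by apply/funext => x; rewrite mxE.
Qed.

Lemma test_bounded u : test_function Om u -> exists B : R, forall x,
  `|u x| <= B /\ enorm (gradient u x) <= B.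
Proof.
move=> tu; have cu := test_C1 tu; have [_ [K [cK KO] uK]] := tu.
have cg : continuous (fun x => enorm (gradient u x)).
  move=> x; apply: (@continuous_comp _ _ _ (gradient u) (@enorm R N)).
    exact: gradient_continuous.
  exact: enorm_continuous.
have B (f : 'rV[R]_N -> R) : continuous f -> exists M : R, forall x, K x -> `|f x| <= M.
  move=> cf; have [M [_ HM]] := compact_bounded (continuous_compact (continuous_subspaceT cf) cK).
  exists (`|M| + 1) => x Kx; apply: HM; last by exists x.
  by rewrite (le_lt_trans (ler_norm M))// ltrDl.
have [M1 H1] := B _ cu.1; have [M2 H2] := B _ cg.
exists (Num.max 0 (Num.max M1 M2)) => x; rewrite !le_max.
have [Kx|Kx] := pselect (K x).
  by rewrite H1//= orbT; split => //; have := H2 x Kx; rewrite ger0_norm ?enorm_ge0// => ->; rewrite !orbT.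
rewrite uK// normr0 lexx; split => //.
rewrite (_ : gradient u x = 0) ?enorm0 ?lexx//.
by apply/rowP => i; rewrite !mxE; apply: (partial_out i (compact_closed _ cK) uK Kx).
Qed.

End C1.

Lemma is_derive_exprn (R : realType) (f : R -> R) (t df : R) m : is_derive t 1 f df ->
  is_derive t 1 (fun s => f s ^+ m) (m%:R * f t ^+ m.-1 * df).
Proof.
move=> Df; elim: m => [|m IH].
  by rewrite mul0r mul0r; under eq_fun do rewrite expr0; exact: is_derive_cst.
under eq_fun do rewrite exprS.
have := is_deriveM Df IH; rewrite /GRing.scale/=; congr is_derive.
case: m {IH} => [|m]; rewrite /= ?expr0; first by ring.
by rewrite exprS -[m.+2]addn1 natrD; ring.
Qed.

Section eta.
Context {R : realType}.
Implicit Types (t : R) (m : nat).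

(** [eta 0] is the classical smooth function flat at 0. The powers of [1 / t] are included because
    differentiation produces them. *)
Definition eta m t : R := if 0 < t then t^-1 ^+ m * expR (- t^-1) else 0.

Lemma eta_ge0 m t : 0 <= eta m t.
Proof. by rewrite /eta; case: ifP => // t0; rewrite mulr_ge0 ?expR_ge0// exprn_ge0// invr_ge0 ltW. Qed.

(** One term of the exponential series at [1 / t] beats the power [t^(-m)] with two orders to spare,
    which gives derivative 0 at the origin. *)
Lemma eta_small m : exists2 C : R, 0 <= C & forall t, eta m t <= C * t ^+ 2.
Proof.
exists (m.+2)`!%:R => // t; rewrite /eta; case: ifPn => [t0|_]; last by rewrite mulr_ge0// sqr_ge0.
have ti : 0 < t^-1 by rewrite invr_gt0.
have H := @expR_ge1Dxn R _ m.+1 (ltW ti).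
have F0 : (0 : R) < (m.+2)`!%:R by rewrite ltr0n fact_gt0.
have H2 : t^-1 ^+ m.+2 <= (m.+2)`!%:R * expR t^-1.
  by rewrite mulrC -ler_pdivrMr//; apply: le_trans H; rewrite lerDr.
rewrite expRN ler_pdivrMr ?expR_gt0// -mulrA [t ^+ 2 * _]mulrC mulrA.
rewrite -ler_pdivrMr ?exprn_gt0//; apply: le_trans H2.
rewrite [in leRHS]exprS [in leRHS]exprS (_ : t^-1 ^+ m / t ^+ 2 = t^-1 * (t^-1 * t^-1 ^+ m))//.
by rewrite -exprVn expr2; ring.
Qed.

Lemma is_derive_eta m t : is_derive t 1 (eta m) (eta m.+2 t - m%:R * eta m.+1 t).
Proof.
have [t0|t0|->] := ltrgtP t 0.
- have E : eta m.+2 t - m%:R * eta m.+1 t = 0 by rewrite /eta ltNge (ltW t0)/= mulr0 subrr.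
  rewrite E; apply: (@near_eq_is_derive _ _ _ (cst (0 : R))).
    near=> s; rewrite /eta ltNge ltW//=.
    near: s; exact: (cvgr_lt t (@cvg_id _ _) 0 t0).
- have tn : t != 0 by rewrite gt_eqF.
  apply: (@near_eq_is_derive _ _ _ (fun s : R => s^-1 ^+ m * expR (- s^-1))).
    near=> s; rewrite /eta ifT//.
    near: s; exact: (cvgr_gt t (@cvg_id _ _) 0 t0).
  have dV : is_derive t 1 (fun s : R => s^-1) (- t ^- 2).
    have := @is_deriveV R (fun s : R => s) t 1 1 tn (is_derive_id _ _).
    by rewrite /GRing.scale/= mulr1.
  have dN : is_derive t 1 (fun s : R => - s^-1) (t ^- 2).
    by apply: is_derive_eq; rewrite opprK.
  have dE := @is_derive1_comp _ expR (fun s : R => - s^-1) t _ _ (is_derive_expR _) dN.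
  have dX : is_derive t 1 (fun s : R => s^-1 ^+ m) (m%:R * t^-1 ^+ m.-1 * - t ^- 2).
    exact: is_derive_exprn.
  have dP := @is_deriveM _ _ (fun s : R => s^-1 ^+ m) (fun s : R => expR (- s^-1)) t 1 _ _ dX dE.
  apply: is_derive_eq; rewrite /eta t0 /GRing.scale/= -exprVn.
  case: m {dX dP} => [|m]; rewrite /= ?exprS ?expr0; ring.
have E : eta m.+2 0 - m%:R * eta m.+1 0 = 0 :> R by rewrite /eta ltxx mulr0 subrr.
rewrite E; apply: is_derive_dist => e e0; have [C C0 H] := eta_small m.
exists (e / (C + 1)) => [|h h0]; first by rewrite divr_gt0// ltr_wpDl.
rewrite ltr_pdivlMr ?ltr_wpDl// => he.
rewrite add0r mul0r subr0 {2}/eta ltxx subr0 ger0_norm ?eta_ge0//.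
apply: le_trans (H h) _; rewrite -real_normK ?num_real// expr2 mulrA ler_wpM2r//.
by apply: le_trans (ltW he); rewrite mulrC ler_wpM2l// lerDl.
Unshelve. all: by end_near. Qed.

Lemma eta_continuous m : continuous (eta m).
Proof.
move=> t; apply/differentiable_continuous/derivable1_diffP.
by have [] := is_derive_eta m t.
Qed.

End eta.

Section bump.
Context {R : realType} {N : nat}.
Implicit Types (u w : 'rV[R]_N -> R) (x : 'rV[R]_N).
Local Notation e_ i := (delta_mx 0 i : 'rV[R]_N).

(* Closed under partial derivatives, by the formula for the derivative of [eta m]. *)
Inductive flat_smooth : ('rV[R]_N -> R) -> Prop :=
| flat_cst c : flat_smooth (fun=> c)
| flat_coord i : flat_smooth (fun x => x 0 i)
| flat_eta m w : flat_smooth w -> flat_smooth (fun x => eta m (w x))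
| flat_add u w : flat_smooth u -> flat_smooth w -> flat_smooth (fun x => u x + w x)
| flat_mul u w : flat_smooth u -> flat_smooth w -> flat_smooth (fun x => u x * w x).

Lemma flat_continuous w : flat_smooth w -> continuous w.
Proof.
elim=> [c|i|m u _ cu|u v _ cu _ cv|u v _ cu _ cv].
- exact: continuous_fun_cst.
- exact: row_coord_continuous.
- by move=> x; apply: (@continuous_comp _ _ _ u (eta m)); [exact: cu|exact: eta_continuous].
- by have := @continuous_lin R _ 1 u v cu cv; under eq_fun do rewrite mul1r.
- by move=> x; exact: (cvgM (cu x) (cv x)).
Qed.

Lemma flat_line w i : flat_smooth w -> exists2 dw, flat_smooth dw &
  forall x, is_derive (0 : R) 1 (fun s : R => w (x + s *: e_ i)) (dw x).
Proof.
elim=> [c|j|m u su [du sdu Hu]|u v su [du sdu Hu] sv [dv sdv Hv]|u v su [du sdu Hu] sv [dv sdv Hv]].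
- by exists (fun=> 0) => [|x]; [exact: flat_cst|exact: is_derive_cst].
- exists (fun=> (i == j)%:R) => [|x]; first exact: flat_cst.
  rewrite (_ : (fun s : R => _) = fun s : R => x 0 j + s * (i == j)%:R); last first.
    by apply/funext => s; rewrite !mxE eqxx/= [j == i]eq_sym.
  apply: is_derive_eq; rewrite add0r ?scaler0 ?add0r /GRing.scale/= ?mulr1 ?mul1r ?mul0r ?add0r ?addr0//.
- exists (fun x => (eta m.+2 (u x) + (- m%:R) * eta m.+1 (u x)) * du x).
    apply: flat_mul => //; apply: flat_add; first exact: flat_eta.
    by apply: flat_mul; [exact: flat_cst|exact: flat_eta].
  move=> x; have dE := is_derive_eta m (u (x + 0 *: e_ i)).
  have := @is_derive1_comp _ (eta m) (fun s : R => u (x + s *: e_ i)) 0 _ _ dE (Hu x).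
  by rewrite scale0r addr0 mulNr.
- exists (fun x => du x + dv x) => [|x]; first exact: flat_add.
  exact: (is_deriveD (Hu x) (Hv x)).
- exists (fun x => u x * dv x + v x * du x) => [|x].
    by apply: flat_add; exact: flat_mul.
  have := is_deriveM (Hu x) (Hv x); rewrite scale0r addr0; exact.
Qed.

Lemma line_derivable u i x (l : R) : is_derive (0 : R) 1 (fun s : R => u (x + s *: e_ i)) l ->
  derivable u x (e_ i) /\ partial i u x = l.
Proof.
move=> [d <-]; split; last by rewrite partial_line scale0r addr0.
by move: d; rewrite /derivable /= quot_line scale0r addr0.
Qed.

Lemma flat_Ck k w : flat_smooth w -> Ck k w.
Proof.
elim: k w => [|k IH] w sw; split; try exact: flat_continuous.
  by [].
move=> i; have [dw sdw H] := flat_line i sw; split.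
  by move=> x; have [] := line_derivable (H x).
rewrite (_ : partial i w = dw); first exact: IH.
by apply/funext => x; have [] := line_derivable (H x).
Qed.

Lemma flat_sum (I : Type) (l : seq I) (w : I -> 'rV[R]_N -> R) : (forall i, flat_smooth (w i)) ->
  flat_smooth (fun x => \sum_(i <- l) w i x).
Proof.
move=> sw; elim: l => [|i l IH].
  by under eq_fun do rewrite big_nil; exact: flat_cst.
by under eq_fun do rewrite big_cons; exact: flat_add.
Qed.

(** The flat function is composed with [r^2 - |x - c|^2]. Its support lies in a sup-norm ball of
    radius [r], half the radius of a cube inside [Om], because the Euclidean norm dominates the sup
    norm. *)
Lemma test_bump (Om : set 'rV[R]_N) c : open Om -> Om c ->
  exists2 u, test_function Om u & u c != 0.
Proof.
move=> oO Oc; have [rho rho0 rO] := open_cube oO Oc.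
pose r := rho / 2; have r0 : 0 < r by rewrite divr_gt0.
pose u x := eta 0 (r ^+ 2 + -1 * \sum_i ((x 0 i + - c 0 i) * (x 0 i + - c 0 i))).
have uE x : u x = eta 0 (r ^+ 2 - dotv (x - c) (x - c)).
  by rewrite /u mulN1r; congr (eta 0 (_ - _)); apply: eq_bigr => i _; rewrite !mxE.
exists u; last first.
  rewrite uE subrr dotv0l subr0 /eta exprn_gt0// expr0 mul1r.
  by rewrite gt_eqF// expR_gt0.
split.
  move=> k; apply: flat_Ck; apply: flat_eta; apply: flat_add; first exact: flat_cst.
  apply: flat_mul; first exact: flat_cst.
  by apply: flat_sum => i; apply: flat_mul; apply: flat_add; [exact: flat_coord|exact: flat_cst|
    exact: flat_coord|exact: flat_cst].
pose K : set 'rV[R]_N := [set x | `|x - c| <= r].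
have cK : compact K.
  apply: bounded_closed_compact.
    exists (r + `|c|); split; first exact: num_real.
    move=> M HM x /= xK; apply: le_trans (ltW HM).
    by rewrite -{1}[x](subrK c); apply: le_trans (ler_normD _ _) _; rewrite lerD2r.
  rewrite (_ : K = closed_ball c r).
    exact: closed_ball_closed.
  by rewrite closed_ballE//; apply/seteqP; split => x; rewrite /K /closed_ball_ /= distrC.
exists K.
  split => // x /= xr; apply: rO; apply/cube_ball => //; apply: le_lt_trans xr _.
  by rewrite /r ltr_pdivrMr// ltr_pMr// ltr1n.
move=> x /= nK; rewrite uE /eta ifN// -leNgt subr_le0 -enorm_sqr.
rewrite ler_sqr ?nnegrE ?enorm_ge0 ?(ltW r0)//.
apply: le_trans (norm_le_enorm _); apply: ltW; rewrite ltNge; exact/negP.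
Qed.

End bump.

(** * Integration by parts for test functions *)

Section integration_by_parts.
Context {R : realType} {N : nat}.
Local Notation mu := (@lebesgue_Rn R N).
Local Notation e_ i := (delta_mx 0 i : 'rV[R]_N).
Implicit Types (u v w : 'rV[R]_N -> R).

Lemma integral_translate (f : 'rV[R]_N -> R) a : measurable_fun setT f ->
  \int[mu]_x f (a + (x : 'rV[R]_N)) = \int[mu]_x f x.
Proof.
move=> mf; rewrite /Rintegral; congr fine.
rewrite integralE [RHS]integralE.
have T (h : 'rV[R]_N -> \bar R) : measurable_fun setT h -> (forall x, 0 <= h x)%E ->
    (\int[mu]_x h (a + (x : 'rV[R]_N))%R = \int[mu]_x h x)%E.
  move=> mh h0; have := @ge0_integral_affine R N a 1 h ltr01 mh h0.
  rewrite expr1n invr1 mul1e => <-.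
  by apply: eq_integral => x _; rewrite scale1r.
have mE : measurable_fun setT (EFin \o f) by exact/measurable_EFinP.
congr (_ - _)%E.
  have := T ((EFin \o f)^\+)%E (measurable_funepos mE) (fun x => funepos_ge0 (EFin \o f) x).
  by move=> <-; apply: eq_integral => x _; rewrite !funeposE.
have := T ((EFin \o f)^\-)%E (measurable_funeneg mE) (fun x => funeneg_ge0 (EFin \o f) x).
  by move=> <-; apply: eq_integral => x _; rewrite !funenegE.
Qed.

Lemma integral_support (D E : set (Rn R N)) (f : 'rV[R]_N -> R) : measurable D -> measurable E ->
  (forall x, ~ D x -> f x = 0) -> (forall x, ~ E x -> f x = 0) ->
  \int[mu]_(x in D) f x = \int[mu]_(x in E) f x.
Proof.
move=> mD mE fD fE; rewrite Rintegral_mkcond [RHS]Rintegral_mkcond.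
apply: eq_Rintegral => x _; rewrite !patchE.
case: ifPn => xD; case: ifPn => xE //.
  by rewrite fE// => /mem_set; exact/negP.
by rewrite fD// => /mem_set; exact/negP.
Qed.

(** The integral of a translate of [w] does not depend on the translation. The mean value theorem in
    the translation parameter therefore gives a translate of [dw] with integral 0, which is the
    integral of [dw]. *)
Lemma integral_partial (w dw : 'rV[R]_N -> R) i (r : R) : continuous w -> continuous dw ->
  (forall x (s : R), is_derive s 1 (fun s : R => w (x + s *: e_ i)) (dw (x + s *: e_ i))) ->
  (forall x, ~ cube 0 r x -> w x = 0 /\ dw x = 0) ->
  \int[mu]_x dw x = 0.
Proof.
move=> cw cdw D out.
(* Large enough to contain the supports of all translates by [s] with [|s| < 2], the range of
   parameters in [Int_mean_value]. *)
pose Q : set (Rn R N) := cube 0 (`|r| + 3).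
have mQ : measurable Q by exact: cube_Lmeasurable.
have finQ : (mu Q < +oo)%E.
  by rewrite [mu Q]lebesgue_cube ?ltry// addr_ge0.
have sub x (s : R) : -1 < s < 2 -> ~ Q x -> ~ cube 0 r (x + s *: e_ i).
  move=> /andP[s1 s2] nQ H; apply: nQ; apply/in_cube => j; move: H => /in_cube /(_ j).
  rewrite !mxE eqxx/= !subr0 => H.
  have E : x 0 j = (x 0 j + s * (j == i)%:R) - s * (j == i)%:R by rewrite addrK.
  rewrite E; apply: le_lt_trans (ler_normB _ _) _.
  have := ler_norm r; have : `|s * (j == i)%:R| <= 2.
    by case: eqP => _; rewrite ?mulr0 ?normr0// mulr1 ler_norml; apply/andP; split; lra.
  by move: H; lra.
have [B HB] : exists B : R, forall x, `|w x| <= B /\ `|dw x| <= B.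
  pose K := [set x : 'rV[R]_N | `|x| <= `|r| + 1].
  have r1 : 0 < `|r| + 1 by rewrite ltr_wpDl.
  have cK : compact K.
    apply: bounded_closed_compact.
      exists (`|r| + 1); split; first exact: num_real.
      by move=> M HM x /= xK; apply: le_trans (ltW HM).
    rewrite (_ : K = closed_ball 0 (`|r| + 1)); first exact: closed_ball_closed.
    by rewrite closed_ballE//; apply/seteqP; split => x; rewrite /K /closed_ball_ /= sub0r normrN.
  have outK x : ~ K x -> ~ cube 0 r x.
    move=> nK H; apply: nK; rewrite /K /=.
    rewrite [leLHS]/Num.norm /= mx_normrE; apply/bigmax_leP; split => // -[k j] _ /=.
    have := H => /in_cube /(_ j); rewrite mxE subr0 (ord1 k) => /ltW /le_trans; apply.
    by apply: le_trans (ler_norm r) _; rewrite lerDl.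
  have Bd (f : 'rV[R]_N -> R) : continuous f -> exists M : R, forall x, K x -> `|f x| <= M.
    move=> cf; have [M [_ HM]] := compact_bounded (continuous_compact (continuous_subspaceT cf) cK).
    exists (`|M| + 1) => x Kx; apply: HM; last by exists x.
    by rewrite (le_lt_trans (ler_norm M))// ltrDl.
  have [M1 H1] := Bd _ cw; have [M2 H2] := Bd _ cdw.
  exists (Num.max 0 (Num.max M1 M2)) => x; rewrite !le_max.
  have [Kx|/outK/out[-> ->]] := pselect (K x); last by rewrite normr0 lexx.
  by rewrite H1// H2// !orbT.
have mtr (f : 'rV[R]_N -> R) (s : R) : continuous f ->
    @measurable_fun _ _ (Rn R N) R Q (fun x => f (x + s *: e_ i)).
  move=> cf; apply: continuous_Lmeasurable => // x.
  apply: (@continuous_comp _ _ _ (fun x : 'rV[R]_N => x + s *: e_ i) f); last exact: cf.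
  exact: continuous_addl.
have [||s s01 E] := @Int_mean_value _ (Rn R N) R mu Q mQ finQ
  (fun x (s : R) => w ((x : 'rV[R]_N) + s *: e_ i)) (fun x (s : R) => dw ((x : 'rV[R]_N) + s *: e_ i)) B.
- by move=> s; exact: mtr.
- by move=> x s _ _; exact: HB.
have tr (f : 'rV[R]_N -> R) (s' : R) : -1 < s' < 2 -> continuous f -> (forall x, ~ cube 0 r x -> f x = 0) ->
    Int mu Q (fun x : Rn R N => f ((x : 'rV[R]_N) + s' *: e_ i)) = \int[mu]_x f x.
  move=> s'1 cf fo.
  have -> : Int mu Q (fun x : Rn R N => f ((x : 'rV[R]_N) + s' *: e_ i)) =
      \int[mu]_x f ((x : 'rV[R]_N) + s' *: e_ i).
    apply: integral_support => // x; last by case.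
    by move=> nQ; apply: fo; exact: sub.
  rewrite -[RHS](integral_translate (s' *: e_ i) (continuous_borel cf)).
  by apply: eq_Rintegral => x _; rewrite addrC.
have s02 : -1 < s < 2 by move: s01 => /andP[? ?]; apply/andP; split; lra.
move: E; rewrite !tr ?subrr//; try by [move=> x /out[]|apply/andP; split; lra].
Qed.

Lemma test_parts (Om : set 'rV[R]_N) u v i : open Om -> bounded_set Om ->
  test_function Om u -> test_function Om v ->
  \int[mu]_(x in (Om : set (Rn R N))) (u x * partial i v x) =
  - \int[mu]_(x in (Om : set (Rn R N))) (partial i u x * v x).
Proof.
move=> oO bO tu tv; have cu := test_C1 tu; have cv := test_C1 tv.
have mO : measurable (Om : set (Rn R N)) by exact: open_Rn.
have finO : (mu Om < +oo)%E by exact: bounded_finite_measure.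
have [r r0 Or] := bounded_in_cube bO.
have [cpu cpv] : continuous (partial i u) /\ continuous (partial i v).
  by split; [have [_ /(_ i)[]] := cu|have [_ /(_ i)[]] := cv].
pose dw x := u x * partial i v x + v x * partial i u x.
have c1 : continuous (fun x => u x * partial i v x).
  by move=> x; exact: (cvgM (cu.1 x) (cpv x)).
have c2 : continuous (fun x => v x * partial i u x).
  by move=> x; exact: (cvgM (cv.1 x) (cpu x)).
have outO x : ~ Om x -> [/\ u x = 0, v x = 0 & dw x = 0].
  move=> nO; have [u0 _] := test_out tu nO; have [v0 _] := test_out tv nO.
  by rewrite /dw u0 v0 !mul0r addr0.
have I0 : \int[mu]_x dw x = 0.
  apply: (@integral_partial (fun x => u x * v x) dw i r).
  - by move=> x; exact: (cvgM (cu.1 x) (cv.1 x)).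
  - by move=> x; exact: (cvgD (c1 x) (c2 x)).
  - move=> x s; exact: (is_deriveM (partial_is_derive i x s cu) (partial_is_derive i x s cv)).
  - move=> x nQ; have nO : ~ Om x by move=> /Or.
    by have [-> _ ->] := outO x nO; rewrite mul0r.
have bd w : (exists B : R, forall x, `|w x| <= B) -> continuous w -> itg mu Om (w : Rn R N -> R).
  by move=> [B HB] cw; apply: (itg_bounded mO finO (B := B)) => //; exact: continuous_Lmeasurable.
have [B HB] := test_bounded tu; have [B' HB'] := test_bounded tv.
have bp (w : 'rV[R]_N -> R) (M : R) x : enorm (gradient w x) <= M -> `|partial i w x| <= M.
  move=> H; apply: le_trans H; apply: le_trans (norm_le_enorm _).
  by have := norm_coord (gradient w x) i; rewrite mxE.
have i1 : itg mu Om (fun x : Rn R N => u x * partial i v x).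
  apply: bd => //; exists (B * B') => x; rewrite normrM; apply: ler_pM => //; first by have [] := HB x.
  by apply: bp; have [] := HB' x.
have i2 : itg mu Om (fun x : Rn R N => v x * partial i u x).
  apply: bd => //; exists (B' * B) => x; rewrite normrM; apply: ler_pM => //; first by have [] := HB' x.
  by apply: bp; have [] := HB x.
have : Int mu Om (fun x : Rn R N => u x * partial i v x) + Int mu Om (fun x : Rn R N => v x * partial i u x) = 0.
  rewrite -IntD// -I0 /Int; apply: integral_support => // x; last by case.
  by move=> /outO[].
move=> /eqP; rewrite addr_eq0 => /eqP E; apply: etrans E _; congr (- _).
by apply: eq_Rintegral => x _; rewrite mulrC.
Qed.

End integration_by_parts.

(** * Finite colourings, nets and countable dense families *)

Lemma round_colour (R : realType) (J : finType) (B eps : R) : 0 < eps ->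
  exists (I : finType) (col : (J -> R) -> I), forall a b,
    (forall j, `|a j| <= B) -> (forall j, `|b j| <= B) -> col a = col b ->
    forall j, `|a j - b j| <= eps.
Proof.
move=> eps0; pose M := Num.truncn ((B + B) / eps).
pose code (t : R) : 'I_M.+1 := inord (Num.truncn ((t + B) / eps)).
exists {ffun J -> 'I_M.+1}, (fun a => [ffun j => code (a j)]) => a b aB bB /ffunP E j.
have H (t : R) : `|t| <= B -> (code t : nat)%:R <= (t + B) / eps < (code t : nat)%:R + 1.
  rewrite ler_norml => /andP[t1 t2].
  have p0 : 0 <= (t + B) / eps by rewrite divr_ge0 ?(ltW eps0)//; lra.
  rewrite /code inordK; last first.
    by rewrite ltnS; apply: le_truncn; rewrite ler_pM2r ?invr_gt0//; lra.
  by rewrite natr1; exact: truncn_itv.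
have /andP[a1 a2] := H _ (aB j); have /andP[b1 b2] := H _ (bB j).
have Eab : code (a j) = code (b j) by have := E j; rewrite !ffunE.
rewrite Eab in a1 a2.
have : `|(a j + B) / eps - (b j + B) / eps| <= 1 by rewrite ler_norml; apply/andP; split; lra.
rewrite -mulrBl normrM normfV (gtr0_norm eps0) ler_pdivrMr// mul1r.
by congr (`|_| <= _); ring.
Qed.

Lemma finite_net (R : realType) (n : nat) (B eps : R) : 0 < eps ->
  exists (I : finType) (y : I -> 'rV[R]_n), forall x : 'rV[R]_n, `|x| <= B ->
    exists i, `|x - y i| <= eps.
Proof.
move=> eps0; have [I [col H]] := @round_colour R 'I_n B eps eps0.
pose Q i (x : 'rV[R]_n) := `|x| <= B /\ col (fun j => x 0 j) = i.
have /choice[y Hy] : forall i, exists y, (exists x, Q i x) -> Q i y.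
  by move=> i; have [[x Qx]|nQ] := pselect (exists x, Q i x); [exists x|exists 0].
exists I, y => x xB; exists (col (fun j => x 0 j)).
have [yB yc] := Hy (col (fun j => x 0 j)) (ex_intro _ x (conj xB erefl)).
rewrite [leLHS]/Num.norm /= mx_normrE; apply/bigmax_leP; split; first exact: ltW.
move=> [k j] _ /=; rewrite (ord1 k) !mxE.
have Hb (z : 'rV[R]_n) (j' : 'I_n) : `|z| <= B -> `|z 0 j'| <= B by apply: le_trans; exact: norm_coord.
exact: (H (fun j => x 0 j) (fun j => y (col (fun j => x 0 j)) 0 j) (fun j' => Hb x j' xB)
  (fun j' => Hb _ j' yB) (esym yc) j).
Qed.

(** For each accuracy [m] the space is a countable union of pieces [S m n], each with finitely many
    colours. Choosing one representative for every nonempty class with code [(m, n, i)] gives a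
    countable dense family. *)
Lemma finite_colouring_dense (X : Type) (Q : X -> Prop) (S : nat -> nat -> X -> Prop)
  (dist : nat -> X -> X -> Prop) : (exists x, Q x) ->
  (forall m x, Q x -> exists n, S m n x) ->
  (forall m n, exists (I : finType) (col : X -> I), forall x y, Q x -> Q y -> S m n x -> S m n y ->
     col x = col y -> dist m x y) ->
  exists e : nat -> X, (forall k, Q (e k)) /\ forall m x, Q x -> exists k, dist m x (e k).
Proof.
move=> [x0 Qx0] HS Hcol.
have /choice[c Hc] : forall mn : nat * nat, exists c : nat * (X -> nat), 
  (forall x, (c.2 x < c.1)%N) /\ forall x y, Q x -> Q y -> S mn.1 mn.2 x -> S mn.1 mn.2 y ->
     c.2 x = c.2 y -> dist mn.1 x y.
  move=> [m n]; have [I [col H]] := Hcol m n.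
  exists (#|I|, fun x => enum_rank (col x) : nat); split => [x|x y Qx Qy Sx Sy] /=; first exact: ltn_ord.
  by move=> /val_inj/enum_rank_inj; exact: H.
have /choice[e He] : forall k : nat, exists e : X, Q e /\
  forall m n i, unpickle k = Some (m, n, i) -> (exists x, [/\ Q x, S m n x & (c (m, n)).2 x = i]) ->
    S m n e /\ (c (m, n)).2 e = i.
  move=> k; case E : (unpickle k : option (nat * nat * nat)) => [[[m n] i]|]; last by exists x0.
  have [[x [Qx Sx xi]]|nx] := pselect (exists x, [/\ Q x, S m n x & (c (m, n)).2 x = i]).
    by exists x; split => // m' n' i' [<- <- <-].
  by exists x0; split => // m' n' i' [<- <- <-].
exists e; split => [k|m x Qx]; first by have [] := He k.
have [n Sx] := HS m x Qx.
exists (pickle (m, n, (c (m, n)).2 x)).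
have [Qe H] := He (pickle (m, n, (c (m, n)).2 x)).
have [Se ce] := H m n _ (pickleK _) (ex_intro _ x (And3 Qx Sx erefl)).
by have [_ H2] := Hc (m, n); apply: H2.
Qed.

Lemma cube_lty (R : realType) (N : nat) (c : 'rV[R]_N) (r : R) : 0 <= r ->
  (lebesgue_Rn (cube c r) < +oo)%E.
Proof. by move=> r0; rewrite lebesgue_cube ?ltry. Qed.

(** * Integrals of cube averages *)

Section tonelli.
Context {R : realType} {N : nat}.
Local Notation mu := (@lebesgue_Rn R N).
Variable h : Rn R N -> R.
Hypothesis mh : measurable_fun setT h.
Hypothesis h0 : forall x, 0 <= h x.
Hypothesis ih : mu.-integrable setT (EFin \o h).
Variable r : R.
Hypothesis r0 : 0 <= r.

Let near_diag : set (Rn R N * Rn R N) := [set z | cube (z.1 : 'rV[R]_N) r z.2].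

Let near_diag_measurable : measurable near_diag.
Proof.
rewrite (_ : near_diag = \bigcap_(i in [set: 'I_N])
  ((fun z : Rn R N * Rn R N => `|(z.2 : 'rV[R]_N) 0 i - (z.1 : 'rV[R]_N) 0 i|) @^-1` `]-oo, r[)).
  apply: fin_bigcap_measurable => // i _; rewrite -[X in measurable X]setTI.
  have m1 : measurable_fun setT (fun z : Rn R N * Rn R N => (z.1 : 'rV[R]_N) 0 i).
    exact: (measurableT_comp (measurable_coord_Rn i) measurable_fst).
  have m2 : measurable_fun setT (fun z : Rn R N * Rn R N => (z.2 : 'rV[R]_N) 0 i).
    exact: (measurableT_comp (measurable_coord_Rn i) measurable_snd).
  have m3 : measurable_fun setT (fun z : Rn R N * Rn R N => `|(z.2 : 'rV[R]_N) 0 i - (z.1 : 'rV[R]_N) 0 i|).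
    by apply: measurableT_comp => //; exact: measurable_funB.
  exact: m3.
apply/seteqP; split => [z /in_cube H i _|z H]; first by rewrite /= in_itv/=; exact: H.
by apply/in_cube => i; have := H i Logic.I; rewrite /= in_itv.
Qed.

Let K (z : Rn R N * Rn R N) : \bar R := (\1_near_diag z * h z.2)%:E.

Let K_ge0 z : (0 <= K z)%E.
Proof. by rewrite lee_fin mulr_ge0. Qed.

Let mK : measurable_fun setT K.
Proof.
apply/measurable_EFinP; apply: measurable_funM; first exact: measurable_indic.
exact: (measurableT_comp mh measurable_snd).
Qed.

Let K_int x : (\int[mu]_y K (x, y))%E = (Int mu (cube x r : set (Rn R N)) h)%:E.
Proof.
have mQ : measurable (cube x r : set (Rn R N)) by exact: cube_Lmeasurable.
have iQ : itg mu (cube x r : set (Rn R N)) h by apply: integrableS ih.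
rewrite -(Int_EFin mQ iQ) [RHS]integral_mkcond; apply: eq_integral => y _.
rewrite patchE /K indicE; have [/set_mem H|H] := boolP (y \in (cube x r : set (Rn R N))).
  by rewrite mem_set// mul1r.
by rewrite memNset ?mul0r// => /mem_set; exact/negP.
Qed.

Lemma cube_average_measurable :
  measurable_fun setT (fun x : Rn R N => (Int mu (cube (x : 'rV[R]_N) r : set (Rn R N)) h)%:E).
Proof.
rewrite (_ : (fun x => _) = fun x : Rn R N => (\int[mu]_y K (x, y))%E); last first.
  by apply/funext => x; rewrite K_int.
exact: (@measurable_fun_fubini_tonelli_F _ _ _ _ R mu K mK K_ge0).
Qed.

(** The relation of [y] being in the cube around [x] is symmetric, so exchanging the integrals
    leaves [h y] times the volume of a cube. *)
Lemma cube_average_integral :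
  (\int[mu]_x (Int mu (cube (x : 'rV[R]_N) r : set (Rn R N)) h)%:E =
   ((2 * r) ^+ N * Int mu setT h)%:E)%E.
Proof.
have inner (y : Rn R N) : (\int[mu]_x K (x, y) = ((2 * r) ^+ N)%:E * (h y)%:E)%E.
  have -> : (fun x : Rn R N => K (x, y)) = (fun x => (h y)%:E * (\1_(cube (y : 'rV[R]_N) r : set (Rn R N)) x : R)%:E)%E.
    apply/funext => x; rewrite /K /= mulrC EFinM; congr (_ * _%:E)%E.
    rewrite !indicE; congr (_%:R); congr nat_of_bool.
    by apply/idP/idP => /set_mem /in_cube H; apply/mem_set/in_cube => i; rewrite distrC; exact: H.
  have mQ : measurable (cube y r : set (Rn R N)) by exact: cube_Lmeasurable.
  apply: etrans (_ : _ = (h y)%:E * \int[mu]_x (\1_(cube (y : 'rV[R]_N) r : set (Rn R N)) x : R)%:E)%E _.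
    apply: (@ge0_integralZl_EFin _ _ _ mu setT measurableT).
    - by move=> z _; rewrite lee_fin.
    - by apply/measurable_EFinP; exact: measurable_indic.
    - exact: h0.
  by rewrite integral_indic ?setIT// muleC; congr (_ * _)%E; exact: lebesgue_cube.
have E1 : (\int[mu]_x (Int mu (cube (x : 'rV[R]_N) r : set (Rn R N)) h)%:E = \int[mu]_x \int[mu]_y K (x, y))%E.
  by apply: eq_integral => x _; rewrite K_int.
have E2 : (\int[mu]_y \int[mu]_x K (x, y) = \int[mu]_y (((2 * r) ^+ N)%:E * (h y)%:E))%E.
  by apply: eq_integral => y _; exact: inner.
have E3 : (\int[mu]_y (((2 * r) ^+ N)%:E * (h y)%:E) = ((2 * r) ^+ N)%:E * \int[mu]_y (h y)%:E)%E.
  apply: (@ge0_integralZl_EFin _ _ _ mu setT measurableT).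
  - by move=> y _; rewrite lee_fin.
  - exact/measurable_EFinP.
  - by rewrite exprn_ge0// mulr_ge0.
rewrite E1; apply: etrans (fubini_tonelli K mK K_ge0) _.
by rewrite E2 E3 (Int_EFin measurableT ih) EFinM.
Qed.

End tonelli.

(** * Deviation from a mean value along rays *)

Section ray.
Context {R : realType} {N : nat}.
Local Notation mu := (@lebesgue_Rn R N).
Variable u : 'rV[R]_N -> R.
Hypothesis cu : C1 u.
Let f (x : 'rV[R]_N) := enorm (gradient u x).
Variable Bf : R.
Hypothesis fB : forall x, f x <= Bf.
Let cf : continuous f.
Proof.
move=> x; apply: (@continuous_comp _ _ _ (gradient u) (@enorm R N)).
  exact: gradient_continuous.
exact: enorm_continuous.
Qed.
Variables (x c : 'rV[R]_N) (rho L : R).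
Hypothesis rho0 : 0 < rho.
Hypothesis L0 : 0 < L.
Hypothesis sub : cube c rho `<=` cube x L.

Let Q : set (Rn R N) := cube c rho.
Let mQ : measurable Q. Proof. exact: cube_Lmeasurable. Qed.
Let finQ : (mu Q < +oo)%E. Proof. by rewrite [mu Q]lebesgue_cube ?ltry// ltW. Qed.
(** The cube [Q] is contracted towards [x]: [A 1] is the integral of [u] over [Q], and [A 0] is
    [u x] times the volume of [Q]. *)
Let A (s : R) := Int mu Q (fun z => u (x + s *: ((z : 'rV[R]_N) - x))).
Let E (r : R) := Int mu (cube x r : set (Rn R N)) f.
Hypothesis uB : forall x, `|u x| <= Bf.

Let w_le (z : 'rV[R]_N) : Q z -> enorm (z - x) <= Num.sqrt N%:R * L.
Proof.
move=> /sub /cube_ball -/(_ L0) H; apply: le_trans (enorm_le_norm _) _.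
by rewrite ler_wpM2l ?sqrtr_ge0// ltW.
Qed.

Let M0 : R := Num.sqrt N%:R * L.
Let M00 : 0 <= M0. Proof. by rewrite mulr_ge0 ?sqrtr_ge0// ltW. Qed.
Let Bf0 : 0 <= Bf. Proof. by apply: le_trans (fB x); exact: enorm_ge0. Qed.

Let line_continuous (v : 'rV[R]_N -> R) (s : R) : continuous v ->
  @measurable_fun _ _ (Rn R N) R Q (fun z => v (x + s *: ((z : 'rV[R]_N) - x))).
Proof.
move=> cv; apply: continuous_Lmeasurable => // z.
apply: (@continuous_comp _ _ _ (fun z : 'rV[R]_N => x + s *: (z - x)) v); last exact: cv.
apply: (@continuous_comp _ _ _ (fun z : 'rV[R]_N => z - x) (fun y => x + s *: y)).
  exact: continuous_addl.
exact: continuous_affine.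
Qed.

Let dA_measurable (s : R) :
  @measurable_fun _ _ (Rn R N) R Q (fun z => dotv (gradient u (x + s *: ((z : 'rV[R]_N) - x))) ((z : 'rV[R]_N) - x)).
Proof.
rewrite /dotv; apply: measurable_sum => i; apply: measurable_funM.
  apply: (line_continuous s (v := fun y => gradient u y 0 i)) => y.
  apply: (@continuous_comp _ _ _ (gradient u) (fun g : 'rV[R]_N => g 0 i)).
    exact: gradient_continuous.
  exact: row_coord_continuous.
rewrite (_ : (fun z => _) = fun z : Rn R N => (z : 'rV[R]_N) 0 i - x 0 i); last first.
  by apply/funext => z; rewrite !mxE.
apply: measurable_funB; last exact: measurable_cst.
exact: (measurable_funS measurableT (@subsetT _ _) (measurable_coord_Rn i)).
Qed.

Let dA_le (s : R) (z : 'rV[R]_N) : Q z ->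
  `|dotv (gradient u (x + s *: (z - x))) (z - x)| <= M0 * f (x + s *: (z - x)).
Proof.
move=> Qz; apply: le_trans (cauchy_schwarz _ _) _; rewrite mulrC.
by rewrite ler_wpM2r ?enorm_ge0// w_le.
Qed.

Let f_itg (s : R) : itg mu Q (fun z => f (x + s *: ((z : 'rV[R]_N) - x))).
Proof.
apply: (itg_bounded mQ finQ (B := Bf)); first exact: line_continuous.
by move=> z _; rewrite ger0_norm ?enorm_ge0.
Qed.

Let A_step (s0 s1 : R) : 0 <= s0 -> s0 <= s1 -> s1 <= 1 -> exists2 s : R, s0 <= s <= s1 &
  `|A s1 - A s0| <= (s1 - s0) * (M0 * Int mu Q (fun z => f (x + s *: ((z : 'rV[R]_N) - x)))).
Proof.
move=> s00 s01 s11; pose dl := s1 - s0.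
have dl0 : 0 <= dl by rewrite subr_ge0.
have dl1 : dl <= 1 by rewrite /dl; lra.
pose K (z : Rn R N) (t : R) := u (x + (s0 + t * dl) *: ((z : 'rV[R]_N) - x)).
pose dK (z : Rn R N) (t : R) := dl * dotv (gradient u (x + (s0 + t * dl) *: ((z : 'rV[R]_N) - x))) ((z : 'rV[R]_N) - x).
pose B := Bf + M0 * Bf.
have [|||t t01 E0] := @Int_mean_value _ (Rn R N) R mu Q mQ finQ K dK B.
- by move=> t; apply: line_continuous; exact: cu.1.
- move=> z t _; have := C1_is_derive (x + s0 *: ((z : 'rV[R]_N) - x)) (dl *: ((z : 'rV[R]_N) - x)) t cu.
  have lE (t' : R) : x + s0 *: ((z : 'rV[R]_N) - x) + t' *: (dl *: ((z : 'rV[R]_N) - x)) =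
      x + (s0 + t' * dl) *: ((z : 'rV[R]_N) - x).
    by rewrite -addrA scalerA -scalerDl.
  rewrite dotvZr lE; congr is_derive; apply/funext => t'; by rewrite lE.
- move=> z t Qz _; split; first by apply: le_trans (uB _) _; rewrite lerDl mulr_ge0.
  rewrite normrM ger0_norm//.
  apply: (@le_trans _ _ (1 * (M0 * Bf))); last by rewrite mul1r lerDr.
  by apply: ler_pM => //; apply: le_trans (dA_le _ Qz) _; rewrite ler_wpM2l.
have /andP[t0 t1] := t01.
exists (s0 + t * dl).
  apply/andP; split; first by rewrite lerDl mulr_ge0.
  have : t * dl <= dl by rewrite ler_piMl.
  by rewrite /dl; lra.
have i1 : itg mu Q (fun z => M0 * f (x + (s0 + t * dl) *: ((z : 'rV[R]_N) - x))).
  by apply: itgZ => //; exact: f_itg.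
have i2 : itg mu Q (fun z => dotv (gradient u (x + (s0 + t * dl) *: ((z : 'rV[R]_N) - x))) ((z : 'rV[R]_N) - x)).
  apply: (itg_le mQ _ i1) => [|z Qz]; [exact: dA_measurable|exact: dA_le].
have -> : A s1 - A s0 = dl * Int mu Q (fun z => dotv (gradient u (x + (s0 + t * dl) *: ((z : 'rV[R]_N) - x))) ((z : 'rV[R]_N) - x)).
  rewrite -IntZ//; apply: etrans E0; rewrite /A /K mul1r mul0r addr0 /dl.
  by rewrite [s0 + (s1 - s0)]addrC subrK.
rewrite normrM ger0_norm// ler_wpM2l//.
apply: le_trans (Int_norm mQ i2) _; rewrite -IntZ//.
apply: Int_le => //; [exact: itg_norm|by move=> z Qz; exact: dA_le].
Qed.

(** The substitution [y = x + s (z - x)] has Jacobian [s^N] and sends [Q] into the cube of radius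
    [s L] around [x]. *)
Let change (s : R) : 0 < s ->
  Int mu Q (fun z => f (x + s *: ((z : 'rV[R]_N) - x))) <= s ^- N * E (s * L).
Proof.
move=> s0.
have mC : measurable (cube x (s * L) : set (Rn R N)) by exact: cube_Lmeasurable.
pose h (y : 'rV[R]_N) : \bar R := (\1_(cube x (s * L)) y * f y)%:E.
have h0 y : (0 <= h y)%E by rewrite lee_fin mulr_ge0 ?enorm_ge0.
have mh : measurable_fun setT h.
  apply/measurable_EFinP; apply: measurable_funM; last exact: continuous_borel.
  by apply: measurable_indic; exact: cube_measurable.
have fE : (\int[mu]_x0 h x0 = (E (s * L))%:E)%E.
  have iC : itg mu (cube x (s * L) : set (Rn R N)) f.
    apply: (itg_bounded mC _ (B := Bf)) => [||y _]; last by rewrite ger0_norm ?enorm_ge0.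
      by apply: cube_lty; rewrite mulr_ge0// ltW.
    exact: continuous_Lmeasurable.
  rewrite /E -(Int_EFin mC iC) [RHS]integral_mkcond; apply: eq_integral => y _.
  rewrite patchE /h indicE; have [/set_mem H|H] := boolP (y \in (cube x (s * L) : set (Rn R N))).
    by rewrite mul1r.
  by rewrite mul0r.
have H1 := ge0_integral_affine (x - s *: x) s0 mh h0.
have H2 := Int_EFin mQ (f_itg s).
have ms : measurable_fun setT (fun z : Rn R N => h ((x - s *: x) + s *: (z : 'rV[R]_N))%R).
  exact: (measurableT_comp mh (measurable_affine (x - s *: x) s)).
have H3 : (\int[mu]_(z in Q) (f (x + s *: ((z : 'rV[R]_N) - x))%R)%:E <=
    \int[mu]_(z in Q) h ((x - s *: x) + s *: (z : 'rV[R]_N))%R)%E.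
  apply: (@ge0_le_integral _ _ _ mu Q mQ).
  - by move=> z _; rewrite lee_fin enorm_ge0.
  - by apply/measurable_EFinP; exact: line_continuous.
  - exact: (measurable_funS measurableT (@subsetT _ _)).
  move=> z Qz; rewrite lee_fin.
  have -> : x - s *: x + s *: (z : 'rV[R]_N) = x + s *: ((z : 'rV[R]_N) - x).
    by rewrite scalerBr -addrA [- _ + _]addrC.
  rewrite indicE mem_set ?mul1r//; apply/cube_ball; first by rewrite mulr_gt0.
  rewrite addrAC subrr add0r normrZ gtr0_norm// ltr_pM2l//.
  by apply/cube_ball => //; exact: sub.
have H4 : (\int[mu]_(z in Q) h ((x - s *: x) + s *: (z : 'rV[R]_N))%R <=
    \int[mu]_z h ((x - s *: x) + s *: (z : 'rV[R]_N))%R)%E.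
  by apply: ge0_subset_integral.
have H5 := le_trans H3 H4; move: H5.
by rewrite H2 H1 fE -EFinM lee_fin.
Qed.

(** [A] is followed from 1 down to [2^(-n)] in dyadic steps, each bounded by the integral of the
    gradient over a cube around [x]. The factor [2^N] arises because the parameter found in a step
    may be as small as half the size of the cube used. The remainder from [2^(-n)] to 0 is bounded
    crudely by the maximum of the gradient. *)
Lemma ray_bound : exists2 K : R, 0 <= K & forall n,
  `|(2 * rho) ^+ N * u x - Int mu Q u| <=
   M0 * 2 ^+ N * (\sum_(0 <= k < n) 2^-1 ^+ k.+1 * ((2 ^+ k) ^+ N * E (2^-1 ^+ k * L))) + 2^-1 ^+ n * K.
Proof.
have half (k : nat) : 0 < (2^-1 : R) ^+ k /\ (2^-1 : R) ^+ k <= 1.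
  by rewrite exprn_gt0 ?invr_gt0//; split => //; apply: exprn_ile1; lra.
exists (M0 * (Bf * fine (mu Q))) => [|n]; first by rewrite mulr_ge0// mulr_ge0// fine_ge0// measure_ge0.
have A0 : A 0 = (2 * rho) ^+ N * u x.
  rewrite /A (_ : (fun z => _) = fun=> u x); last by apply/funext => z; rewrite scale0r addr0.
  have mQE : mu Q = ((2 * rho) ^+ N)%:E by apply: lebesgue_cube; exact: ltW.
  by have := Int_cst mu mQ (u x); move=> ->; rewrite [X in fine X]mQE mulrC.
have A1 : A 1 = Int mu Q u.
  by apply: Int_eq => z _; rewrite scale1r addrC subrK.
have tail m : `|A (2^-1 ^+ m) - A 0| <= 2^-1 ^+ m * (M0 * (Bf * fine (mu Q))).
  have [m0 m1] := half m.
  have [s _ H] := A_step (lexx 0) (ltW m0) m1.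
  rewrite subr0 in H; apply: le_trans H _; rewrite ler_wpM2l ?(ltW m0)// ler_wpM2l//.
  rewrite -(Int_cst mu mQ); exact: (Int_le mQ (f_itg s) (itg_cst mQ finQ Bf) (fun z _ => fB _)).
rewrite -A0 -A1 distrC.
have step k : `|A (2^-1 ^+ k) - A (2^-1 ^+ k.+1)| <=
    M0 * 2 ^+ N * (2^-1 ^+ k.+1 * ((2 ^+ k) ^+ N * E (2^-1 ^+ k * L))).
  have [k0 k1] := half k; have [k0' k1'] := half k.+1.
  have kS : (2^-1 : R) ^+ k.+1 <= 2^-1 ^+ k by rewrite exprS ler_piMl ?(ltW k0)//; lra.
  have [s /andP[s1 s2] H] := A_step (ltW k0') kS k1.
  apply: le_trans H _.
  have -> : (2^-1 : R) ^+ k - 2^-1 ^+ k.+1 = 2^-1 ^+ k.+1 by rewrite exprS; lra.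
  rewrite [leRHS](_ : _ = 2^-1 ^+ k.+1 * (M0 * ((2 ^+ k.+1) ^+ N * E (2^-1 ^+ k * L)))); last first.
    by rewrite [2 ^+ k.+1]exprS exprMn; ring.
  rewrite ler_wpM2l ?(ltW k0')// ler_wpM2l//.
  have sp : 0 < s by exact: lt_le_trans s1.
  apply: le_trans (change sp) _; apply: ler_pM.
  - by rewrite invr_ge0 exprn_ge0// ltW.
  - by apply: Int_ge0 => z _; exact: enorm_ge0.
  - rewrite -exprVn; apply: lerXn2r; rewrite ?nnegrE ?invr_ge0 ?(ltW sp)// ?exprn_ge0//.
    by rewrite -[leRHS]invrK lef_pV2 ?posrE ?invr_gt0 ?exprn_gt0// -exprVn.
  - rewrite /E; have mC (r : R) : measurable (cube x r : set (Rn R N)) by exact: cube_Lmeasurable.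
    have iC (r : R) : 0 <= r -> itg mu (cube x r : set (Rn R N)) f.
      move=> r0; apply: (itg_bounded (mC r) _ (B := Bf)) => [||y _]; last by rewrite ger0_norm ?enorm_ge0.
        exact: cube_lty.
      exact: continuous_Lmeasurable.
    have sL : 0 <= s * L by rewrite mulr_ge0 ?(ltW sp) ?(ltW L0).
    have kL : 0 <= 2^-1 ^+ k * L by rewrite mulr_ge0 ?(ltW k0) ?(ltW L0).
    rewrite -lee_fin -(Int_EFin (mC _) (iC _ sL)) -(Int_EFin (mC _) (iC _ kL)).
    apply: (@ge0_subset_integral _ _ _ mu _ _ (mC _) (mC _)).
    + by apply/measurable_EFinP; exact: continuous_Lmeasurable.
    + by move=> y _; rewrite lee_fin enorm_ge0.
    + move=> y /in_cube H; apply/in_cube => i; apply: lt_le_trans (H i) _.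
      by rewrite ler_wpM2r// ltW.
have tel : `|A 1 - A (2^-1 ^+ n)| <=
    M0 * 2 ^+ N * (\sum_(0 <= k < n) 2^-1 ^+ k.+1 * ((2 ^+ k) ^+ N * E (2^-1 ^+ k * L))).
  elim: n => [|n IH]; first by rewrite expr0 subrr normr0 big_nil mulr0.
  rewrite big_nat_recr//= mulrDr.
  have -> : A 1 - A (2^-1 ^+ n.+1) = (A 1 - A (2^-1 ^+ n)) + (A (2^-1 ^+ n) - A (2^-1 ^+ n.+1)) by ring.
  by apply: le_trans (ler_normD _ _) _; exact: lerD.
have -> : A 1 - A 0 = (A 1 - A (2^-1 ^+ n)) + (A (2^-1 ^+ n) - A 0) by ring.
by apply: le_trans (ler_normD _ _) _; exact: lerD.
Qed.

End ray.

(** * Averages over small cubes under (A1) *)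

Section mean_values.
Context {R : realType} {N : nat}.
Local Notation mu := (@lebesgue_Rn R N).
Variable Om : set 'rV[R]_N.
Hypothesis oOm : open Om.
Hypothesis bOm : bounded_set Om.
Hypothesis N0 : (0 < N)%N.
Variables (p q r r' C alpha : R) (G Psi : 'rV[R]_N -> R -> R).
Hypothesis p1 : 1 <= p.
Hypothesis q0 : 0 <= q.
Hypothesis C1 : 1 <= C.
Hypothesis gG : forall x, growth p q (G x).
Hypothesis G0 : forall x, G x 0 = 0.
Hypothesis G1 : forall x, C^-1 <= G x 1 <= C.
Hypothesis a0 : 0 < alpha.
Hypothesis aN : alpha * N%:R < 1.
Hypothesis inv : forall x a, 0 < a -> Psi x (a * G x a `^ (- alpha)) = G x a.
Hypothesis A1 : cond_A1 Om G.

Let mOm : measurable (Om : set (Rn R N)). Proof. exact: open_Rn. Qed.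
Let C0 : 0 < C. Proof. exact: lt_le_trans C1. Qed.
Let G_ge0 x t : 0 <= t -> 0 <= G x t. Proof. exact: (gf_ge0 (gG x) (G0 x) C1 (G1 x)). Qed.
Let G_gt0 x t : 0 < t -> 0 < G x t. Proof. exact: (gf_gt0 (gG x) C1 (G1 x)). Qed.

Let qball (c : 'rV[rat]_N) (rho : rat) : set 'rV[R]_N :=
  eball (map_mx ratr c) (ratr rho) `&` Om.

(** The null set in (A1) may vary with the ball. Restricting to rational centres and radii makes the
    union of these sets negligible. *)
Lemma A1_countable : exists2 CA : R, 0 < CA & exists2 Z : set (Rn R N), mu.-negligible Z &
  forall c rho, 0 < (ratr rho : R) < 1 -> forall x y, (qball c rho `\` Z) x -> (qball c rho `\` Z) y ->
    forall t, 0 <= t -> (1%:E <= ess_inf_on (qball c rho) (G ^~ t) <= (ratr rho ^- N)%:E)%E ->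
    G x t <= CA * G y t.
Proof.
move: A1 => [CA CA0 H]; exists CA => //.
have /choice[E HE] : forall cr : 'rV[rat]_N * rat, exists E : set (Rn R N), mu.-negligible E /\
    (0 < (ratr cr.2 : R) < 1 -> forall x y, (qball cr.1 cr.2 `\` E) x -> (qball cr.1 cr.2 `\` E) y ->
    forall t, 0 <= t -> (1%:E <= ess_inf_on (qball cr.1 cr.2) (G ^~ t) <= (ratr cr.2 ^- N)%:E)%E ->
    G x t <= CA * G y t).
  move=> [c rho]; have [r01|nr] := boolP (0 < (ratr rho : R) < 1).
    by have [E nE HE] := H (map_mx ratr c) (ratr rho) r01; exists E; split => // _; exact: HE.
  by exists set0; split => [|h]; [exact: negligible_set0|by []].
exists (\bigcup_k (if (unpickle k : option ('rV[rat]_N * rat)) is Some cr then E cr else set0)).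
  apply: negligible_bigcup => k; case: (unpickle k) => [cr|]; last exact: negligible_set0.
  by have [] := HE cr.
move=> c rho r01 x y [Bx Zx] [By Zy].
have [_ HE2] := HE (c, rho); apply: (HE2 r01); split => // h.
  by apply: Zx; exists (pickle (c, rho)) => //; rewrite pickleK.
by apply: Zy; exists (pickle (c, rho)) => //; rewrite pickleK.
Qed.

Let sN : R := Num.sqrt N%:R.
Let sN1 : 1 <= sN.
Proof. by rewrite /sN -[leLHS]sqrtr1 ler_sqrt// ler1n. Qed.
(** Chosen so that the level [A] below satisfies [A <= 2^(-q) w^(-N)] for the radius [w < 3 sN s] of
    the ball: the range allowed in (A1) then still holds after one doubling of the argument. [R1]
    keeps [w] below [2^(-q)], hence below 1. *)
Let eps0 : R := 2 `^ (- q) * (3 * sN) ^- N.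
Let R1 : R := 2 `^ (- q) / (3 * sN).
Let powN2 : 0 < (2 : R) `^ (- q) <= 1.
Proof.
rewrite powR_gt0//= powRN -[leRHS]invr1 lef_pV2 ?posrE ?powR_gt0//; apply: powR_ge1 => //.
by lra.
Qed.
Let s3 : 3 <= 3 * sN. Proof. by rewrite ler_pMr. Qed.
Let s3p : 0 < 3 * sN. Proof. by apply: lt_le_trans s3. Qed.
Let eps0_gt0 : 0 < eps0.
Proof. by have /andP[h _] := powN2; rewrite mulr_gt0// invr_gt0 exprn_gt0. Qed.
Let eps0_le1 : eps0 <= 1.
Proof.
have /andP[h1 h2] := powN2.
rewrite /eps0 -[leRHS]mulr1; apply: ler_pM => //.
  by rewrite invr_ge0 exprn_ge0// ltW.
rewrite -[leRHS]invr1 lef_pV2 ?posrE ?exprn_gt0//; apply: exprn_ege1.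
by apply: le_trans s3; lra.
Qed.

(* The mean of [f] over a cube of size [r] is controlled by [tau], the least number of the form [2^k/C] for
   which [G y tau >= A] almost everywhere near [x], where [A] bounds the mean of
   [G y (f y)]: (A1) makes [G x tau] comparable with [A]. *)
Lemma mean_modular : exists M1 M2 R1 : R, [/\ 0 < M1, 1 <= M2, 0 < R1 &
  exists2 Z : set (Rn R N), mu.-negligible Z &
  forall f : 'rV[R]_N -> R, (forall x, 0 <= f x) -> (forall x, ~ Om x -> f x = 0) ->
   (forall D : set (Rn R N), measurable D -> (mu D < +oo)%E -> itg mu D f) ->
   itg mu setT (fun y => G y (f y)) -> Int mu setT (fun y => G y (f y)) <= 1 ->
  forall x s, Om x -> ~ Z x -> 0 < s <= R1 -> exists b, [/\ 0 <= b,
    s * (s ^- N * Int mu (cube x s : set (Rn R N)) f) <= M1 * s `^ (1 - alpha * N%:R) * b &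
    Psi x b <= M2 * (1 + s ^- N * Int mu (cube x s : set (Rn R N)) (fun y => G y (f y)))]].
Proof.
have [CA CA0 [Z nZ HA]] := A1_countable.
pose M2 := 2 `^ q * (1 + CA).
have q2 : 1 <= (2 : R) `^ q by apply: powR_ge1 => //; lra.
have M21 : 1 <= M2 by rewrite -[leLHS]mulr1; apply: ler_pM => //; rewrite lerDl ltW.
exists ((2 ^+ N + eps0^-1) * M2 `^ alpha), M2, R1; split => //.
- by rewrite mulr_gt0 ?powR_gt0 ?addr_gt0 ?invr_gt0 ?exprn_gt0//; apply: lt_le_trans M21.
- by have /andP[h _] := powN2; rewrite divr_gt0.
exists Z => // f f0 fOm fi Gi GI x s Omx nZx /andP[s0 sR].
have mC : measurable (cube x s : set (Rn R N)) by exact: cube_Lmeasurable.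
pose I := Int mu (cube x s : set (Rn R N)) (fun y => G y (f y)).
have I0 : 0 <= I by apply: Int_ge0 => y _; exact: G_ge0.
have GiC : itg mu (cube x s : set (Rn R N)) (fun y => G y (f y)) by apply: integrableS Gi.
have I1 : I <= 1.
  apply: le_trans GI; rewrite -lee_fin -(Int_EFin mC GiC) -(Int_EFin measurableT Gi).
  apply: (@ge0_subset_integral _ _ _ mu _ _ mC measurableT).
  - by case/integrableP: Gi.
  - by move=> y _; rewrite lee_fin; exact: G_ge0.
  - exact: subsetT.
have [c cx] : exists c : 'rV[rat]_N, cube x s (map_mx ratr c).
  have ox : open (cube x s).
    rewrite (_ : cube x s = ball x s); first exact: ball_open.
    by apply/seteqP; split => y; rewrite -ball_normE /= distrC => /cube_ball; apply.
  have [|c [n [cx cs]]] := @rational_cube R N (cube x s) x ox.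
    by apply/in_cube => i; rewrite subrr normr0.
  exists c; apply: cs; apply/in_cube => i; rewrite subrr normr0.
  by rewrite invr_gt0.
(* Any two points of the cube are at Euclidean distance less than [2 sN s], so a ball of larger
   radius centred at a rational point of the cube contains the cube. *)
have [rho] : exists rho : rat, (2 * sN * s : R) < ratr rho < 3 * sN * s.
  have [|rho /[!in_itv] H] := @rat_in_itvoo R (2 * sN * s) (3 * sN * s); last by exists rho.
  by rewrite ltr_pM2r// ltr_pM2r ?ltr_nat//; apply: lt_le_trans sN1.
pose w : R := ratr rho => /andP[w2 w3].
have sw : s <= w.
  apply: le_trans (ltW w2); rewrite ler_peMl ?(ltW s0)//.
  by apply: (@le_trans _ _ (2 * 1)); [lra|rewrite ler_wpM2l].
have w0 : 0 < w by exact: lt_le_trans sw.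
have /andP[h1 h2] := powN2.
have wq : w <= 2 `^ (- q).
  apply: le_trans (ltW w3) _; apply: (@le_trans _ _ (3 * sN * R1)); first by rewrite ler_wpM2l ?(ltW s3p).
  by rewrite /R1 mulrC divfK// gt_eqF.
have w1 : w < 1.
  apply: lt_le_trans w3 _; apply: le_trans h2; apply: (@le_trans _ _ (3 * sN * R1)); first by rewrite ler_wpM2l ?(ltW s3p).
  by rewrite /R1 mulrC divfK// gt_eqF.
have cB y : cube x s y -> eball (map_mx ratr c) w y.
  move=> /in_cube ys; apply: le_lt_trans (enorm_le_norm _) _; apply: le_lt_trans w2.
  rewrite -mulrA mulrCA ler_wpM2l ?sqrtr_ge0//.
  rewrite [leLHS]/Num.norm /= mx_normrE; apply/bigmax_leP; split; first by rewrite mulr_ge0// ltW.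
  move=> [i j] _ /=; rewrite (ord1 i) !mxE.
  move: cx => /in_cube /(_ j); rewrite mxE => cj; have yj := ys j.
  have -> : y 0 j - ratr (c 0 j) = (y 0 j - x 0 j) - (ratr (c 0 j) - x 0 j) by ring.
  by apply: le_trans (ler_normB _ _) _; lra.
have Bx : qball c rho x.
  by split => //; apply: cB; apply/in_cube => i; rewrite subrr normr0.
(* [A] is comparable with the mean of [G y (f y)], but at least 1 as (A1) requires. The assumption
   that the total modular is at most 1 keeps it below [2^(-q) w^(-N)]. *)
pose A : R := Num.max 1 (eps0 * s ^- N * I).
have A1' : 1 <= A by rewrite le_max lexx.
have A0 : 0 < A by exact: lt_le_trans A1'.
have wN : w ^+ N <= 2 `^ (- q).
  by apply: le_trans wq; rewrite -[leRHS]expr1; apply: ler_wiXn2l => //; exact: ltW.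
have AU : A <= 2 `^ (- q) * w ^- N.
  rewrite ge_max; apply/andP; split; first by rewrite ler_pdivlMr ?exprn_gt0// mul1r.
  apply: (@le_trans _ _ (eps0 * s ^- N * 1)).
    by rewrite ler_wpM2l// mulr_ge0 ?invr_ge0 ?exprn_ge0 ?(ltW eps0_gt0) ?(ltW s0).
  rewrite mulr1 /eps0 -mulrA ler_wpM2l ?(ltW h1)// -invfM -exprMn.
  have ws : w ^+ N <= (3 * sN * s) ^+ N.
    by apply: lerXn2r; rewrite ?nnegrE ?(ltW w0) ?(ltW w3)// mulr_ge0 ?(ltW s3p) ?(ltW s0).
  by rewrite lef_pV2 ?posrE// exprn_gt0// mulr_gt0.
have As : A <= s ^- N.
  apply: le_trans AU _; rewrite -[leRHS]mul1r; apply: ler_pM; rewrite ?powR_ge0 ?invr_ge0 ?exprn_ge0 ?(ltW w0)//.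
  have ws : s ^+ N <= w ^+ N by apply: lerXn2r; rewrite ?nnegrE ?(ltW w0) ?(ltW s0).
  by rewrite lef_pV2 ?posrE// exprn_gt0.
(* Doubling the argument multiplies [G] by at most [2^q]. At the first level [1 / C] the value of
   [G] is at most 1, which settles the case [k = 0]. *)
pose tk (k : nat) : R := 2 ^+ k * C^-1.
have tk0 k : 0 < tk k by rewrite mulr_gt0 ?exprn_gt0 ?invr_gt0.
pose S k := {ae mu, forall y : Rn R N, qball c rho y -> A <= G y (tk k)}.
have exk : exists k, `[< S k >].
  exists (Num.truncn (A * C * C)).+1; apply/asboolP; apply: aeW => y _.
  set k := _.+1.
  have kt : A * C <= tk k.
    rewrite ler_pdivlMr//; apply: (@le_trans _ _ k%:R); first exact/ltW/truncnS_gt.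
    by rewrite -natrX ler_nat ltnW// ltn_expl.
  have AC : A <= A * C by rewrite ler_peMr// ltW.
  have t1 : 1 <= tk k by apply: le_trans kt; apply: le_trans AC.
  have /andP[H _] := gG y t1 ler01; rewrite mulr1 in H.
  apply: le_trans H; apply: (@le_trans _ _ (tk k * C^-1)).
    by rewrite ler_pdivlMr// ; exact: kt.
  apply: ler_pM; rewrite ?invr_ge0 ?(ltW C0) ?(ltW (tk0 _))//; last by have /andP[] := G1 y.
  by rewrite -[leLHS]powRr1 ?(ltW (tk0 _))//; apply: ler_powR.
case: (ex_minnP exk) => k /asboolP Sk kmin; pose tau := tk k.
have tau0 : 0 < tau by exact: tk0.
have dbl k' y : G y (tk k'.+1) <= 2 `^ q * G y (tk k').
  have /andP[_ +] := gG y (ler1n R 2 : 1 <= 2 :> R) (ltW (tk0 k')).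
  by rewrite /tk exprS mulrA.
have Gx : G x tau <= M2 * A.
  rewrite /tau; case: (k) kmin Sk => [_ _|k' kmin Sk].
    rewrite /tk expr0 mul1r; apply: (@le_trans _ _ 1).
      have C01 : 0 <= C^-1 <= 1 by rewrite invr_ge0 ltW//= invf_le1.
      have := gf_shrink p1 (gG x) (G0 x) C1 (G1 x) C01 ler01; rewrite mulr1 => /le_trans; apply.
      by have /andP[_ H] := G1 x; rewrite mulrC ler_pdivrMr// mul1r.
    by rewrite -[leLHS]mul1r; apply: ler_pM.
  (* By minimality the level before [tau] fails on a set that is not negligible, hence at some [y]
     outside [Z]. There [G y tau] is at most [2^q A], and (A1) carries this bound to [x]. *)
  have [y [By nZy] Gy] : exists2 y, (qball c rho `\` Z) y & G y (tk k') < A.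
    apply: contrapT => ny; have : (k'.+1 <= k')%N; last by rewrite ltnn.
    apply: kmin; apply/asboolP; apply: negligibleS nZ => z /= nz; apply: contrapT => nZz.
    by apply: nz => Bz; rewrite leNgt; apply/negP => lt; apply: ny; exists z.
  have GxA : G x (tk k'.+1) <= CA * G y (tk k'.+1).
    apply: (HA c rho) => //; [by rewrite w0|exact: ltW|].
    apply/andP; split.
      apply/ess_infP; apply: filterS Sk => z Sz; case: ifPn => [/set_mem Bz|_]; last exact: leey.
      by rewrite lee_fin; apply: le_trans A1' _; exact: Sz.
    (* Were the essential infimum at [tau] above [w^(-N)], halving would leave at least
       [2^(-q) w^(-N) >= A] almost everywhere, against the minimality of [k]. *)
    rewrite leNgt; apply/negP => /ltW/ess_infP lt; have : (k'.+1 <= k')%N; last by rewrite ltnn.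
    apply: kmin; apply/asboolP; apply: filterS lt => z Sz Bz; move: Sz; rewrite mem_set// lee_fin => Sz.
    apply: le_trans AU _; rewrite powRN -/w mulrC ler_pdivrMr ?powR_gt0// mulrC.
    by apply: le_trans Sz _; exact: dbl.
  apply: le_trans GxA _; apply: (@le_trans _ _ (CA * (2 `^ q * A))).
    by rewrite ler_wpM2l ?(ltW CA0)//; apply: le_trans (dbl _ _) _; rewrite ler_wpM2l ?powR_ge0// ltW.
  by rewrite /M2 mulrCA -!mulrA ler_wpM2l ?powR_ge0// ler_wpM2r ?(ltW A0)// lerDr ler01.
have iR : itg mu (cube x s : set (Rn R N)) (fun y => tau + tau / A * G y (f y)).
  apply: itgD => //; last exact: itgZ.
  by apply: itg_cst => //; apply: cube_lty; exact: ltW.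
have iF := fi _ mC (cube_lty x (ltW s0)).
(* Where [f y] exceeds [tau], the ratio [G y t / t] is at least [A / tau], so
   [f y <= tau / A * G y (f y)]. *)
have fle : (\int[mu]_(y in (cube x s : set (Rn R N))) (f y)%:E <=
    \int[mu]_(y in (cube x s : set (Rn R N))) (tau + tau / A * G y (f y))%:E)%E.
  apply: (@ae_ge0_le_integral _ _ _ mu _ mC).
  - by move=> y _; rewrite lee_fin.
  - by case/integrableP: iF.
  - move=> y _; rewrite lee_fin; apply: addr_ge0; first exact: ltW.
    by apply: mulr_ge0; [exact: divr_ge0 (ltW tau0) (ltW A0)|exact: G_ge0].
  - by case/integrableP: iR.
  apply: filterS Sk => y Sy Qy; rewrite lee_fin.
  have tG : 0 <= tau / A * G y (f y).
    by apply: mulr_ge0; [exact: divr_ge0 (ltW tau0) (ltW A0)|exact: G_ge0].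
  have [ft|tf] := leP (f y) tau; first by rewrite -[leLHS]addr0; exact: lerD.
  have Omy : Om y by apply: contrapT => /fOm E; move: tf; rewrite E ltNge (ltW tau0).
  have AG := Sy (conj (cB y Qy) Omy).
  have fp : 0 < f y by exact: lt_trans tf.
  have := @gf_ratio_homo R p q C (G y) p1 (gG y) (G0 y) C1 (G1 y) tau (f y) (ltW tau0) (ltW tf).
  rewrite ler_pdivrMr// mulrAC ler_pdivlMr// => H.
  apply: (@le_trans _ _ (tau / A * G y (f y))); last by rewrite lerDr ltW.
  rewrite mulrAC ler_pdivlMr// [leRHS]mulrC; apply: le_trans H.
  by rewrite mulrC ler_wpM2r ?(ltW fp).
have fle2 : Int mu (cube x s : set (Rn R N)) f <= tau * (2 * s) ^+ N + tau / A * I.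
  have E1 : Int mu (cube x s : set (Rn R N)) (fun y => tau + tau / A * G y (f y)) = tau * (2 * s) ^+ N + tau / A * I.
    have i1 : itg mu (cube x s : set (Rn R N)) (fun=> tau) by apply: itg_cst => //; apply: cube_lty; exact: ltW.
    have := IntD mC i1 (itgZ mC (tau / A) GiC); rewrite (IntZ mC _ GiC) (Int_cst mu mC) => ->.
    have -> : fine (mu (cube x s : set (Rn R N))) = (2 * s) ^+ N by rewrite [X in fine X]lebesgue_cube ?(ltW s0).
    by [].
  by rewrite -E1 -lee_fin -(Int_EFin mC iF) -(Int_EFin mC iR).
(* The argument at which [Psi x] equals [G x tau]. Dividing by [G(x, tau)^alpha], at most a constant
   times [s^(-alpha N)], produces the exponent [1 - alpha N]. *)
exists (tau * G x tau `^ (- alpha)); split.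
- by rewrite mulr_ge0 ?powR_ge0 ?(ltW tau0).
- have IA : s ^- N * I <= eps0^-1 * A.
    by rewrite [leRHS]mulrC ler_pdivlMr// mulrC mulrA le_max lexx orbT.
  have Ga : G x tau `^ alpha <= M2 `^ alpha * (s ^- N) `^ alpha.
    rewrite -powRM ?(le_trans ler01 M21)//; last by rewrite invr_ge0 exprn_ge0// ltW.
    apply: powR_homo; rewrite ?(ltW a0) ?G_ge0 ?(ltW tau0)//.
    by apply: le_trans Gx _; rewrite ler_wpM2l// (le_trans ler01 M21).
  have tauE : tau = G x tau `^ alpha * (tau * G x tau `^ (- alpha)).
    by rewrite mulrCA powRN divff ?mulr1// gt_eqF// powR_gt0// G_gt0.
  have sE : s `^ (1 - alpha * N%:R) = s * (s ^- N) `^ alpha.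
    rewrite powRV ?exprn_gt0// -powR_mulrn ?(ltW s0)// -powRrM [N%:R * _]mulrC -powRN.
    by rewrite powRD ?powRr1 ?(ltW s0)// (gt_eqF s0) implybT.
  apply: (@le_trans _ _ (s * ((2 ^+ N + eps0^-1) * tau))).
    rewrite ler_wpM2l ?(ltW s0)//.
    apply: (@le_trans _ _ (s ^- N * (tau * (2 * s) ^+ N + tau / A * I))).
      by rewrite ler_wpM2l// invr_ge0 exprn_ge0// ltW.
    rewrite mulrDr [leRHS]mulrDl; apply: lerD.
      have sN0 : s ^+ N != 0 by rewrite gt_eqF// exprn_gt0.
      have -> : s ^- N * (tau * (2 * s) ^+ N) = 2 ^+ N * tau * (s ^- N * s ^+ N) by rewrite exprMn; ring.
      by rewrite mulVf// mulr1.
    rewrite (_ : s ^- N * (tau / A * I) = tau / A * (s ^- N * I)); last by ring.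
    apply: (@le_trans _ _ (tau / A * (eps0^-1 * A))).
      by rewrite ler_wpM2l// divr_ge0 ?(ltW tau0) ?(ltW A0).
    by rewrite mulrCA divfK ?gt_eqF.
  have Kt : tau <= M2 `^ alpha * (s ^- N) `^ alpha * (tau * G x tau `^ (- alpha)).
    by rewrite {1}tauE ler_wpM2r// mulr_ge0 ?powR_ge0 ?(ltW tau0).
  rewrite sE; apply: (@le_trans _ _ (s * ((2 ^+ N + eps0^-1) * (M2 `^ alpha * (s ^- N) `^ alpha * (tau * G x tau `^ (- alpha)))))).
    by rewrite ler_wpM2l ?(ltW s0)// ler_wpM2l// addr_ge0 ?invr_ge0 ?exprn_ge0 ?(ltW eps0_gt0).
  by rewrite le_eqVlt; apply/orP; left; apply/eqP; ring.
- rewrite inv//; apply: le_trans Gx _; rewrite ler_wpM2l ?(le_trans ler01 M21)//.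
  have sI : 0 <= s ^- N * I by rewrite mulr_ge0// invr_ge0 exprn_ge0// ltW.
  rewrite ge_max lerDl sI/=; apply: (@le_trans _ _ (1 * (s ^- N * I))); last by rewrite mul1r lerDr.
  by rewrite -mulrA ler_wpM2r.
Qed.
End mean_values.

Lemma geometric_le (R : realType) (th : R) n : 0 <= th < 1 ->
  \sum_(0 <= k < n) th ^+ k <= (1 - th)^-1.
Proof.
move=> /andP[t0 t1]; have d0 : 0 < 1 - th by rewrite subr_gt0.
rewrite -[leRHS]mul1r ler_pdivlMr//.
suff -> : (\sum_(0 <= k < n) th ^+ k) * (1 - th) = 1 - th ^+ n by rewrite lerBlDr lerDl exprn_ge0.
elim: n => [|n IH]; first by rewrite big_nil mul0r subrr.
by rewrite big_nat_recr//= mulrDl IH exprS; ring.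
Qed.

Section series_dominated.
Context {R : realType} {N : nat}.
Local Notation mu := (@lebesgue_Rn R N).
Variables (Om : set (Rn R N)) (h : Rn R N -> R).
Hypothesis mOm : measurable Om.
Hypothesis finOm : (mu Om < +oo)%E.
Hypothesis mh : measurable_fun setT h.
Hypothesis h0 : forall x, 0 <= h x.
Hypothesis ih : itg mu setT h.
Variables (r_ a_ b_ : nat -> R).
Hypothesis r_0 : forall k, 0 <= r_ k.
Hypothesis a_0 : forall k, 0 <= a_ k.
Hypothesis b_0 : forall k, 0 <= b_ k.

Let E k (x : Rn R N) := Int mu (cube (x : 'rV[R]_N) (r_ k) : set (Rn R N)) h.

Let E0 k x : 0 <= E k x. Proof. by apply: Int_ge0. Qed.

Let term_measurable k : measurable_fun Om (fun x => (a_ k + b_ k * E k x)%:E).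
Proof.
apply/measurable_EFinP; apply: measurable_funD; first exact: measurable_cst.
apply: measurable_funM; first exact: measurable_cst.
have := cube_average_measurable mh h0 ih (r_ k); move/measurable_EFinP => H.
exact: (measurable_funS measurableT (@subsetT _ _) H).
Qed.

Let term_integral k : (\int[mu]_(x in Om) (a_ k + b_ k * E k x)%:E <=
  (a_ k * fine (mu Om) + b_ k * ((2 * r_ k) ^+ N * Int mu setT h))%:E)%E.
Proof.
have mE : measurable_fun setT (fun x => (E k x)%:E) by exact: (cube_average_measurable mh h0 ih (r_ k)).
have mE' : measurable_fun Om (fun x => (E k x)%:E) by exact: (measurable_funS measurableT (@subsetT _ _) mE).
have e1 : (\int[mu]_(x in Om) ((a_ k)%:E + (b_ k)%:E * (E k x)%:E) =
    \int[mu]_(x in Om) (a_ k)%:E + \int[mu]_(x in Om) ((b_ k)%:E * (E k x)%:E))%E.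
  apply: (@ge0_integralD _ _ _ mu Om mOm).
  - by move=> x _; rewrite lee_fin.
  - exact: measurable_cst.
  - by move=> x _; rewrite lee_fin mulr_ge0.
  - apply: emeasurable_funM => //; exact: measurable_cst.
have e2 : (\int[mu]_(x in Om) ((b_ k)%:E * (E k x)%:E) = (b_ k)%:E * \int[mu]_(x in Om) (E k x)%:E)%E.
  apply: (@ge0_integralZl_EFin _ _ _ mu Om mOm) => //.
  by move=> x _; rewrite lee_fin.
have e3 : (\int[mu]_(x in Om) (a_ k)%:E = (a_ k)%:E * mu Om)%E.
  exact: (@integral_cst _ _ _ mu Om mOm (a_ k)%:E).
have e4 : (\int[mu]_(x in Om) (E k x)%:E <= ((2 * r_ k) ^+ N * Int mu setT h)%:E)%E.
  have <- := cube_average_integral mh h0 ih (r_0 k).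
  apply: (@ge0_subset_integral _ _ _ mu _ _ mOm measurableT _ mE).
    by move=> x _; rewrite lee_fin.
  exact: subsetT.
have -> : (\int[mu]_(x in Om) (a_ k + b_ k * E k x)%:E =
    \int[mu]_(x in Om) ((a_ k)%:E + (b_ k)%:E * (E k x)%:E))%E.
  by apply: eq_integral => x _; rewrite EFinD EFinM.
rewrite e1 e2 e3 EFinD; apply: leeD.
  by rewrite EFinM fineK// ge0_fin_numE.
by rewrite EFinM; apply: lee_wpmul2l; rewrite ?lee_fin.
Qed.

(** The number of terms needed may depend on [x], so the partial sums are replaced by the full
    series of nonnegative terms, integrated term by term. *)
Lemma series_dominated (U : Rn R N -> R) (c0 B : R) : measurable_fun Om U ->
  (forall x, Om x -> 0 <= U x) -> 0 <= c0 ->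
  (forall n, \sum_(0 <= k < n) (a_ k * fine (mu Om) + b_ k * ((2 * r_ k) ^+ N * Int mu setT h)) <= B) ->
  {ae mu, forall x, Om x -> exists n, U x <= c0 + \sum_(0 <= k < n) (a_ k + b_ k * E k x)} ->
  itg mu Om U /\ Int mu Om U <= c0 * fine (mu Om) + B.
Proof.
move=> mU U0 c00 HB HU.
pose S x : \bar R := (\sum_(0 <= k <oo) (a_ k + b_ k * E k x)%:E)%E.
have t0 k x : (0 <= (a_ k + b_ k * E k x)%:E)%E by rewrite lee_fin addr_ge0// mulr_ge0.
have mS : measurable_fun Om S.
  by apply: ge0_emeasurable_sum => [k x _ _|k _]; [exact: t0|exact: term_measurable].
have S0 x : (0 <= S x)%E by apply: nneseries_ge0 => k _ _; exact: t0.
have IS : (\int[mu]_(x in Om) S x <= B%:E)%E.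
  rewrite (@integral_nneseries _ _ _ mu Om mOm _ term_measurable (fun k x _ => t0 k x)).
  apply: lime_le.
    by apply: is_cvg_nneseries => k _ _; apply: integral_ge0 => x _; exact: t0.
  apply: nearW => n; apply: (@le_trans _ _ (\sum_(0 <= k < n) (a_ k * fine (mu Om) + b_ k * ((2 * r_ k) ^+ N * Int mu setT h)))%:E).
    by rewrite -sumEFin; apply: lee_sum => k _; exact: term_integral.
  by rewrite lee_fin.
have IU : (\int[mu]_(x in Om) (U x)%:E <= (c0 * fine (mu Om) + B)%:E)%E.
  apply: (@le_trans _ _ (\int[mu]_(x in Om) (c0%:E + S x))%E).
    apply: (@ae_ge0_le_integral _ _ _ mu _ mOm).
    - by move=> x Ox; rewrite lee_fin; exact: U0.
    - exact/measurable_EFinP.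
    - by move=> x _; apply: adde_ge0 => //; rewrite lee_fin.
    - by apply: emeasurable_funD => //; exact: measurable_cst.
    apply: filterS HU => x HU Ox; have [n Hn] := HU Ox.
    apply: (@le_trans _ _ (c0 + \sum_(0 <= k < n) (a_ k + b_ k * E k x))%:E); first by rewrite lee_fin.
    by rewrite EFinD; apply: leeD => //; rewrite -sumEFin; apply: nneseries_lim_ge => k _ _; exact: t0.
  have e1 : (\int[mu]_(x in Om) (c0%:E + S x) = \int[mu]_(x in Om) c0%:E + \int[mu]_(x in Om) S x)%E.
    by apply: (@ge0_integralD _ _ _ mu Om mOm).
  have e3 : (\int[mu]_(x in Om) c0%:E = c0%:E * mu Om)%E.
    exact: (@integral_cst _ _ _ mu Om mOm c0%:E).
  by rewrite e1 e3 EFinD; apply: leeD => //; rewrite EFinM fineK// ge0_fin_numE.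
exact: (Int_lt_EFin mOm mU U0 IU).
Qed.

End series_dominated.

Section ray_half.
Context {R : realType} {N : nat}.
Local Notation mu := (@lebesgue_Rn R N).

(** The remainder of [ray_bound] is absorbed: if the deviation is positive, [n] is taken so large
    that the remainder is at most half of it, whence the factor 2. This [n] depends on [x]. *)
Lemma ray_half (u : 'rV[R]_N -> R) (Bf : R) (x c : 'rV[R]_N) (rho L : R) : C1 u ->
  (forall x, enorm (gradient u x) <= Bf) -> (forall x, `|u x| <= Bf) -> 0 < rho -> 0 < L ->
  cube c rho `<=` cube x L -> exists n,
  `|(2 * rho) ^+ N * u x - Int mu (cube c rho : set (Rn R N)) u| <=
   2 * (Num.sqrt N%:R * L * 2 ^+ N) * (\sum_(0 <= k < n) 2^-1 ^+ k.+1 * ((2 ^+ k) ^+ N *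
     Int mu (cube x (2^-1 ^+ k * L) : set (Rn R N)) (enorm \o gradient u))).
Proof.
move=> cu fB uB rho0 L0 sub; have [K K0 H] := ray_bound cu fB rho0 L0 sub uB.
set D := `|_| in H *; have : 0 <= D by exact: normr_ge0.
rewrite /comp; move: D H => D H; rewrite le_eqVlt => /predU1P[<-|Dp].
  by exists 0%N; rewrite big_nil mulr0.
pose n := Num.truncn (2 * K / D); exists n.+1.
have Kn : 2^-1 ^+ n.+1 * K <= D / 2.
  have h : 2 * K / D <= 2 ^+ n.+1.
    apply: (@le_trans _ _ n.+1%:R); first exact/ltW/truncnS_gt.
    by rewrite -natrX ler_nat ltnW// ltn_expl.
  rewrite exprVn mulrC ler_pdivrMr ?exprn_gt0// mulrAC ler_pdivlMr// mulrC.
  by move: h; rewrite ler_pdivrMr// [_ * D]mulrC.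
have := H n.+1; set S := \sum_(_ <= _ < _) _; set X := _ * S => HD.
have HD2 : D <= X + D / 2 by apply: le_trans HD _; rewrite lerD2l.
rewrite -mulrA -/X; clear -HD2; lra.
Qed.

End ray_half.

Lemma cube_sub (R : realType) (N : nat) (x c : 'rV[R]_N) (rho L : R) : 2 * rho <= L ->
  cube c rho x -> cube c rho `<=` cube x L.
Proof.
move=> rL /in_cube Hx y /in_cube Hy; apply/in_cube => i.
have -> : y 0 i - x 0 i = (y 0 i - c 0 i) - (x 0 i - c 0 i) by ring.
apply: le_lt_trans (ler_normB _ _) _; apply: lt_le_trans (ltrD (Hy i) (Hx i)) _.
by move: rL; lra.
Qed.

Lemma exprn_powR (R : realType) (a s : R) k : 0 <= a -> (a ^+ k) `^ s = (a `^ s) ^+ k.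
Proof.
move=> a0; elim: k => [|k IH]; first by rewrite !expr0 powR1.
by rewrite !exprS powRM ?exprn_ge0// IH.
Qed.

(** * Embedding and total boundedness *)

Section embedding.
Context {R : realType} {N : nat}.
Local Notation mu := (@lebesgue_Rn R N).
Variable Om : set 'rV[R]_N.
Hypothesis oOm : open Om.
Hypothesis bOm : bounded_set Om.
Hypothesis N0 : (0 < N)%N.
Variables (p q r r' C alpha : R) (G Psi : 'rV[R]_N -> R -> R).
Hypothesis p1 : 1 <= p.
Hypothesis q0 : 0 <= q.
Hypothesis r1 : 1 <= r.
Hypothesis r'0 : 0 <= r'.
Hypothesis C1 : 1 <= C.
Hypothesis gG : forall x, growth p q (G x).
Hypothesis G0 : forall x, G x 0 = 0.
Hypothesis G1 : forall x, C^-1 <= G x 1 <= C.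
Hypothesis gP : forall x, growth r r' (Psi x).
Hypothesis P0 : forall x, Psi x 0 = 0.
Hypothesis P1 : forall x, C^-1 <= Psi x 1 <= C.
Hypothesis mG : forall w : 'rV[R]_N -> R, Lmeasurable Om w -> (forall x, 0 <= w x) ->
  Lmeasurable Om (fun x => G x (w x)).
Hypothesis mP : forall w : 'rV[R]_N -> R, Lmeasurable Om w -> (forall x, 0 <= w x) ->
  Lmeasurable Om (fun x => Psi x (w x)).
Hypothesis a0 : 0 < alpha.
Hypothesis aN : alpha * N%:R < 1.
Hypothesis inv : forall x a, 0 < a -> Psi x (a * G x a `^ (- alpha)) = G x a.
Hypothesis A1 : cond_A1 Om G.

Let OmR : set (Rn R N) := Om.
Let mOm : measurable OmR. Proof. exact: open_Rn. Qed.
Let finOm : (mu OmR < +oo)%E. Proof. exact: bounded_finite_measure. Qed.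
Let C0 : 0 < C. Proof. exact: lt_le_trans C1. Qed.
Let G_ge0 x t : 0 <= t -> 0 <= G x t. Proof. exact: (gf_ge0 (gG x) (G0 x) C1 (G1 x)). Qed.
Let P_ge0 x t : 0 <= t -> 0 <= Psi x t. Proof. exact: (gf_ge0 (gP x) (P0 x) C1 (P1 x)). Qed.

Let df u (x : 'rV[R]_N) := enorm (gradient u x).
Let Hf u (x : 'rV[R]_N) := G x (df u x).
Let Phi u := Int mu OmR (Hf u).

Let df0 u x : 0 <= df u x. Proof. exact: enorm_ge0. Qed.

Let df_out u x : test_function Om u -> ~ Om x -> df u x = 0.
Proof. by move=> tu /(test_out tu)[_ E]; rewrite /df E enorm0. Qed.

Let df_continuous u : test_function Om u -> continuous (df u).
Proof.
move=> tu x; apply: (@continuous_comp _ _ _ (gradient u) (@enorm R N)).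
  exact/gradient_continuous/(test_C1 tu).
exact: enorm_continuous.
Qed.

Let df_itg u (D : set (Rn R N)) : test_function Om u -> measurable D -> (mu D < +oo)%E -> itg mu D (df u).
Proof.
move=> tu mD fD; have [B HB] := test_bounded tu.
apply: (itg_bounded mD fD (B := B)); first exact/continuous_Lmeasurable/df_continuous.
by move=> x _; rewrite ger0_norm//; have [] := HB x.
Qed.

Let u_itg u (D : set (Rn R N)) : test_function Om u -> measurable D -> (mu D < +oo)%E -> itg mu D u.
Proof.
move=> tu mD fD; have [B HB] := test_bounded tu.
apply: (itg_bounded mD fD (B := B)); first by have [cu _] := test_C1 tu; apply: continuous_Lmeasurable => //; exact: @cu.
by move=> x _; have [] := HB x.
Qed.

Let extend (v : 'rV[R]_N -> R) : (forall x, ~ Om x -> v x = 0) -> itg mu OmR v ->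
  itg mu setT v /\ Int mu setT v = Int mu OmR v.
Proof.
move=> v0 vi; split.
  have := (@integrable_mkcond _ _ _ mu _ (EFin \o v) mOm).1 vi.
  apply: eq_integrable => // x _; rewrite patchE; case: ifPn => // /negP nO /=.
  by rewrite v0// => h; apply: nO; exact/mem_set.
exact: (@integral_support R N setT OmR v measurableT mOm (fun x h => False_ind _ (h Logic.I)) v0).
Qed.

Let Hf_itg u : test_function Om u -> itg mu OmR (Hf u).
Proof.
move=> tu; have [B HB] := test_bounded tu.
have B0 : 0 <= B by have [+ _] := HB 0; apply: le_trans.
apply: (itg_bounded mOm finOm (B := (1 + B) `^ q * C)).
  by apply: mG => //; apply: continuous_Lmeasurable => //; exact: df_continuous.
move=> x _; rewrite ger0_norm ?G_ge0//; apply: (gf_bound p1 (gG x) (G0 x) C1 (G1 x)) => //.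
  by rewrite lerDl.
by have [_ h] := HB x; apply: le_trans h _; rewrite lerDr.
Qed.

Let Hf_out u x : test_function Om u -> ~ Om x -> Hf u x = 0.
Proof. by move=> tu nO; rewrite /Hf df_out. Qed.

(* A cube disjoint from [Om] serves as the base of the rays, so that no mean value is subtracted. *)
Lemma poincare : exists2 K : R, 0 <= K & forall u, test_function Om u ->
  Int mu OmR (fun x => `|u x|) <= K * Int mu OmR (df u).
Proof.
have [D D0 OD] := bounded_in_cube bOm.
(* [Om] lies in the cube of radius [D] around 0 and the base cube has all coordinates in []2 D, 4
   D[], so they are disjoint. Differences of their points have coordinates in []D, 5 D[], hence
   [L = 5 D]. *)
pose c : 'rV[R]_N := const_mx (3 * D).
pose L := 5 * D; have L0 : 0 < L by rewrite mulr_gt0.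
pose M := 2 * (Num.sqrt N%:R * L * 2 ^+ N).
have M0 : 0 <= M.
  by apply: mulr_ge0 => //; apply: mulr_ge0; [exact: mulr_ge0 (sqrtr_ge0 _) (ltW L0)|exact: exprn_ge0].
have Dn : 0 < (2 * D) ^+ N by rewrite exprn_gt0// mulr_gt0.
exists (((2 * D) ^+ N)^-1 * (M * (2 * L) ^+ N)).
  by rewrite mulr_ge0 ?invr_ge0 ?(ltW Dn)// mulr_ge0// exprn_ge0// mulr_ge0// ltW.
move=> u tu; have [B HB] := test_bounded tu.
have [di dE] := extend (fun x => @df_out u x tu) (df_itg tu mOm finOm).
pose r_ k : R := 2^-1 ^+ k * L.
pose b_ k : R := M * (2^-1 ^+ k.+1 * (2 ^+ k) ^+ N).
have r_0 k : 0 <= r_ k by rewrite mulr_ge0 ?exprn_ge0 ?invr_ge0 ?(ltW L0).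
have b_0 k : 0 <= b_ k.
  by apply: mulr_ge0 => //; apply: mulr_ge0; rewrite ?exprn_ge0 ?invr_ge0.
have md : measurable_fun setT (df u : Rn R N -> R) by exact/continuous_Lmeasurable/df_continuous.
have uOm : itg mu OmR (fun x => `|u x|) by apply: itg_norm => //; exact: u_itg.
have Id0 : 0 <= Int mu OmR (df u) by apply: Int_ge0.
pose B0 := M * (2 * L) ^+ N * Int mu OmR (df u).
have mU : measurable_fun OmR (fun x => (2 * D) ^+ N * `|u x|).
  exact: (itg_measurable (itgZ mOm ((2 * D) ^+ N) uOm)).
have U0 (x : Rn R N) : OmR x -> 0 <= (2 * D) ^+ N * `|u x| by rewrite mulr_ge0// ltW.
have HBn n : \sum_(0 <= k < n) (0 * fine (mu OmR) + b_ k * ((2 * r_ k) ^+ N * Int mu setT (df u))) <= B0.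
  rewrite dE (eq_bigr (fun k => M * (2 * L) ^+ N * Int mu OmR (df u) * 2^-1 * 2^-1 ^+ k)); last first.
    move=> k _; rewrite mul0r add0r /b_.
    have K1 : (2 ^+ k) ^+ N * (2 * r_ k) ^+ N = (2 * L) ^+ N.
      rewrite -exprMn; congr (_ ^+ _); rewrite /r_; transitivity (2 * L * (2 ^+ k * 2^-1 ^+ k)); first by ring.
      by rewrite -exprMn mulfV// expr1n mulr1.
    by rewrite -K1 exprS; ring.
  rewrite -mulr_sumr -/B0; have B00 : 0 <= B0 by rewrite mulr_ge0// mulr_ge0// exprn_ge0// mulr_ge0// ltW.
  have h2 : 0 <= (2^-1 : R) < 1 by lra.
  apply: (@le_trans _ _ (B0 / 2 * (1 - 2^-1)^-1)); first by rewrite ler_wpM2l ?geometric_le// divr_ge0.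
  by rewrite (_ : (1 - 2^-1) = 2^-1 :> R) ?invrK ?divfK//; lra.
have HU : {ae mu, forall x : Rn R N, OmR x -> exists n, (2 * D) ^+ N * `|u x| <=
    0 + \sum_(0 <= k < n) (0 + b_ k * Int mu (cube (x : 'rV[R]_N) (r_ k) : set (Rn R N)) (df u))}.
  apply: aeW => x Ox.
  have [|||n Hn] := @ray_half R N u B x c D L (test_C1 tu) _ _ D0 L0.
  + by move=> y; have [] := HB y.
  + by move=> y; have [] := HB y.
  + move=> y /in_cube Hy; apply/in_cube => i; have := Hy i; have := (in_cube _ _ _).1 (OD _ Ox) i.
    rewrite !mxE subr0 !ltr_norml => /andP[h1 h2] /andP[h3 h4]; apply/andP; split; rewrite /L; lra.
  exists n; have E : Int mu (cube c D : set (Rn R N)) u = 0.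
    rewrite (_ : Int mu _ u = Int mu (cube c D : set (Rn R N)) (fun=> 0)).
      by rewrite (Int_cst mu (cube_Lmeasurable c D)) mul0r.
    apply: Int_eq => y /in_cube Hy; have [Oy|nO] := pselect (Om y); last by have [-> _] := test_out tu nO.
    exfalso; have h1 := (in_cube _ _ _).1 (OD _ Oy) (Ordinal N0); have h2 := Hy (Ordinal N0).
    move: h1 h2; rewrite !mxE subr0 !ltr_norml => /andP[h1 h2] /andP[h3 h4]; lra.
  move: Hn; rewrite E subr0 normrM ger0_norm ?(ltW Dn)// => Hn.
  rewrite add0r; apply: le_trans Hn _; rewrite -/M mulr_sumr.
  by apply: ler_sum => k _; rewrite add0r /b_ /r_ /comp !mulrA.
have [_] := series_dominated mOm finOm md (@df0 u) di r_0 (fun=> lexx 0) b_0 mU U0 (lexx 0) HBn HU.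
rewrite mul0r add0r IntZ// => H.
by rewrite -mulrA [leRHS]mulrC ler_pdivlMr// mulrC.
Qed.

(* At a point [x] where the deviation [D] of [u] from its mean is positive, the ray lemma makes [D]
   at most a sum of [r_k^del b_k = w_k (w_k b_k)] with [sum w_k] small, so one [w_k b_k] dominates [D]. *)
Lemma deviation : exists M5 M6 R2 kap : R, [/\ 0 <= M5, 0 < M6, 0 < R2 <= 1, 0 <= kap &
  exists th s : R, [/\ 0 < th < 1, 0 < s, (1 - th)^-1 <= kap &
  exists2 Z : set (Rn R N), mu.-negligible Z &
  forall (L : R) u, 0 < L <= R2 -> test_function Om u -> Phi u <= 1 ->
  forall x c, Om x -> ~ Z x -> cube c (L / 2) x -> exists n,
    Psi x (`|u x - L ^- N * Int mu (cube c (L / 2) : set (Rn R N)) u| / (M6 * L `^ s)) <=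
    \sum_(0 <= k < n) (th ^+ k * M5 +
       th ^+ k * M5 * (2^-1 ^+ k * L) ^- N * Int mu (cube x (2^-1 ^+ k * L) : set (Rn R N)) (Hf u))]].
Proof.
have [M1 [M2 [R1 [M10 M21 R10 [Z nZ key]]]]] := mean_modular N0 p1 q0 C1 gG G0 G1 a0 inv A1.
(* The gain [r_k^del] is split evenly: one factor [w_k] makes the sum of the scales converge, the
   other passes out of [Psi] by sublinear shrinking and leaves the weights [th^k]. *)
pose del := 1 - alpha * N%:R; pose s := del / 2.
have s0 : 0 < s by rewrite /s /del divr_gt0// subr_gt0.
pose th := (2^-1 : R) `^ s.
have th01 : 0 < th < 1.
  rewrite /th powR_gt0 ?invr_gt0//= powRV// invf_lt1 ?powR_gt0//.
  by apply: powR_gt1 => //; lra.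
have /andP[th0 th1] := th01.
pose kap := (1 - th)^-1.
have kap0 : 0 < kap by rewrite invr_gt0 subr_gt0.
pose sN : R := Num.sqrt N%:R.
have sN1 : 0 < sN by rewrite sqrtr_gt0 ltr0n.
pose M6 := 2 * (sN * 2 ^+ N * M1 * kap).
have M60 : 0 < M6 by rewrite /M6 !pmulr_rgt0// exprn_gt0.
exists M2, M6, (Num.min R1 1), kap; split; rewrite ?(ltW kap0)//.
- by apply: le_trans M21.
- by rewrite lt_min R10 ltr01 ge_min lexx orbT.
exists th, s; split => //; exists Z => // L u /andP[L0 +] tu Pu x c Ox nZx cx.
rewrite le_min => /andP[LR L1].
have [B HB] := test_bounded tu.
have sub : cube c (L / 2) `<=` cube x L.
  by apply: cube_sub cx; rewrite mulrC divfK.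
have L20 : 0 < L / 2 by rewrite divr_gt0.
have [||n Hn] := @ray_half R N u B x c (L / 2) L (test_C1 tu) _ _ L20 L0 sub.
- by move=> y; have [] := HB y.
- by move=> y; have [] := HB y.
pose rr k : R := 2^-1 ^+ k * L.
have h2 : 0 < (2^-1 : R) < 1 by lra.
have rr0 k : 0 < rr k by rewrite mulr_gt0 ?exprn_gt0 ?invr_gt0.
have rrL k : rr k <= L by rewrite /rr ler_piMl ?(ltW L0)// exprn_ile1//; lra.
have [Gi GE] := extend (fun x => @Hf_out u x tu) (Hf_itg tu).
have /choice[b Hb] k : exists b, [/\ 0 <= b,
    rr k * (rr k ^- N * Int mu (cube x (rr k) : set (Rn R N)) (df u)) <= M1 * rr k `^ del * b &
    Psi x b <= M2 * (1 + rr k ^- N * Int mu (cube x (rr k) : set (Rn R N)) (Hf u))].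
  apply: (key (df u)) => //.
  - by move=> y; exact: df_out.
  - by move=> D mD fD; exact: df_itg.
  - by rewrite [leLHS]GE.
  - by rewrite rr0/=; apply: le_trans LR.
pose w k : R := L `^ s * th ^+ k.
have w0 k : 0 < w k by rewrite mulr_gt0 ?powR_gt0 ?exprn_gt0.
have Ls : L `^ s <= 1 by have := powR_homo (ltW s0) (ltW L0) L1; rewrite powR1.
have wth k : w k <= th ^+ k by rewrite ler_piMl// exprn_ge0// ltW.
have w1 k : w k <= 1 by apply: le_trans (wth k) _; apply: exprn_ile1; rewrite ?ltW.
have wE k : rr k `^ del = w k * w k.
  have dE : del = s + s by rewrite /s -splitr.
  rewrite dE powRD ?(gt_eqF (rr0 k)) ?implybT//.
  suff -> : rr k `^ s = w k by [].
  by rewrite /rr powRM ?exprn_ge0 ?invr_ge0 ?(ltW L0)// exprn_powR ?invr_ge0// mulrC.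
have Sw m : \sum_(0 <= k < m) w k <= L `^ s * kap.
  by rewrite -mulr_sumr ler_wpM2l ?powR_ge0// geometric_le// th1 ltW.
set D := `|_|.
pose Y := D / (M6 * L `^ s).
have MLs : 0 < M6 * L `^ s by rewrite mulr_gt0 ?powR_gt0.
have [D0|Dp] := eqVneq D 0.
  by exists 0%N; rewrite big_nil D0 mul0r P0.
have {}Dp : 0 < D by rewrite lt_neqAle eq_sym Dp normr_ge0.
have Y0 : 0 < Y by rewrite divr_gt0.
have LN : 0 < L ^+ N by rewrite exprn_gt0.
have DE : L ^+ N * D = `|(2 * (L / 2)) ^+ N * u x - Int mu (cube c (L / 2) : set (Rn R N)) u|.
  rewrite [2 * (L / 2)]mulrC divfK// /D -{1}(gtr0_norm LN) -normrM mulrBr mulVKf// gt_eqF//.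
rewrite -DE in Hn.
(* If every [w k * b k] were below [Y], the ray bound would give [D <= D / 2]: the constant [M6]
   contains the factor 2 that makes this so. *)
have [k [kn Yk]] : exists k, (k < n)%N /\ Y <= w k * b k.
  apply: contrapT => nk; have lt k : (k < n)%N -> w k * b k <= Y.
    by move=> kn; rewrite leNgt; apply/negP => h; apply: nk; exists k; split => //; exact: ltW.
  have T : \sum_(0 <= k < n) 2^-1 ^+ k.+1 * ((2 ^+ k) ^+ N * Int mu (cube x (rr k) : set (Rn R N)) (df u)) <=
      \sum_(0 <= k < n) L ^+ N / (2 * L) * M1 * Y * w k.
    rewrite big_nat_cond [leRHS]big_nat_cond; apply: ler_sum => k /andP[/andP[_ kn] _].
    have [b0 Hk _] := Hb k; rewrite wE in Hk.
    have E : 2^-1 ^+ k.+1 * ((2 ^+ k) ^+ N * Int mu (cube x (rr k) : set (Rn R N)) (df u)) =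
        L ^+ N / (2 * L) * (rr k * (rr k ^- N * Int mu (cube x (rr k) : set (Rn R N)) (df u))).
      have K1 : (2 ^+ k) ^+ N * rr k ^+ N = L ^+ N.
        by rewrite -exprMn /rr mulrA -exprMn mulfV// expr1n mul1r.
      have K2 : L ^+ N * rr k ^- N = (2 ^+ k) ^+ N by rewrite -K1 mulfK// expf_neq0// gt_eqF.
      have K3 : rr k / (2 * L) = 2^-1 ^+ k.+1 by rewrite /rr exprS; field; rewrite gt_eqF.
      by rewrite -K2 -K3; ring.
    rewrite E (_ : L ^+ N / (2 * L) * M1 * Y * w k = L ^+ N / (2 * L) * (M1 * (Y * w k))); last by ring.
    rewrite ler_wpM2l//; first by rewrite divr_ge0 ?mulr_ge0 ?(ltW LN) ?(ltW L0).
    apply: le_trans Hk _; rewrite (_ : M1 * (w k * w k) * b k = M1 * (w k * b k * w k)); last by ring.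
    by rewrite ler_wpM2l ?(ltW M10)// ler_wpM2r ?(ltW (w0 k))//; exact: lt.
  have T2 : L ^+ N * D <= 2 * (sN * L * 2 ^+ N) * (L ^+ N / (2 * L) * M1 * Y * (L `^ s * kap)).
    apply: le_trans Hn _; rewrite ler_wpM2l//; first by rewrite !mulr_ge0 ?exprn_ge0 ?(ltW L0) ?(ltW sN1).
    apply: le_trans T _; rewrite -mulr_sumr ler_wpM2l//.
    have h4 : 0 <= L ^+ N / (2 * L) by rewrite divr_ge0 ?mulr_ge0 ?(ltW LN) ?(ltW L0).
    by apply: mulr_ge0; [apply: mulr_ge0; rewrite ?(ltW M10)|exact: ltW].
  have E2 : 2 * (sN * L * 2 ^+ N) * (L ^+ N / (2 * L) * M1 * Y * (L `^ s * kap)) = L ^+ N * (D / 2).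
    rewrite /Y /M6; move: (gt_eqF kap0) (gt_eqF sN1) (gt_eqF M10) (gt_eqF (powR_gt0 s L0)) (gt_eqF L0) => z1 z2 z3 z4 z5.
    by field; rewrite z1 z2 z3 z4 z5 expf_neq0// pnatr_eq0.
  by move: T2; rewrite E2 ler_pM2l// leNgt ltr_pdivrMr// ltr_pMr// ltr1n.
exists n; rewrite -/Y.
have [b0 _ Hk] := Hb k.
have Ht j : 0 <= th ^+ j * M2 + th ^+ j * M2 * rr j ^- N * Int mu (cube x (rr j) : set (Rn R N)) (Hf u).
  have tj : 0 <= th ^+ j * M2 by rewrite mulr_ge0 ?exprn_ge0 ?(ltW th0)//; apply: le_trans M21.
  rewrite addr_ge0// mulr_ge0//; first by rewrite mulr_ge0// invr_ge0 exprn_ge0// ltW.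
  by apply: Int_ge0 => y _; exact: G_ge0.
apply: (@le_trans _ _ (th ^+ k * M2 + th ^+ k * M2 * rr k ^- N * Int mu (cube x (rr k) : set (Rn R N)) (Hf u))).
  have wb0 : 0 <= w k * b k by rewrite mulr_ge0// ltW.
  apply: le_trans (gf_homo r1 (gP x) (P0 x) C1 (P1 x) (ltW Y0) Yk) _.
  have w01 : 0 <= w k <= 1 by rewrite (ltW (w0 k)) w1.
  apply: le_trans (gf_shrink r1 (gP x) (P0 x) C1 (P1 x) w01 b0) _.
  rewrite (_ : th ^+ k * M2 + _ = th ^+ k * (M2 * (1 + rr k ^- N * Int mu (cube x (rr k) : set (Rn R N)) (Hf u)))); last by ring.
  by apply: ler_pM; rewrite ?(ltW (w0 k)) ?P_ge0.
rewrite big_mkord (bigD1 (Ordinal kn))//= lerDl; apply: sumr_ge0 => j _; exact: Ht.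
Qed.

(** Bounds the mean values that are subtracted in [deviation]: the Poincare inequality, with the
    gradient estimated by [1 + C G]. *)
Lemma average_bound : exists2 K : R, 0 <= K & forall u, test_function Om u ->
  forall c (rho : R), 0 <= rho -> `|Int mu (cube c rho : set (Rn R N)) u| <= K * (fine (mu OmR) + C * Phi u).
Proof.
have [K K0 HK] := poincare; exists K => // u tu c rho rho0.
have mC : measurable (cube c rho : set (Rn R N)) by exact: cube_Lmeasurable.
have uC := u_itg tu mC (cube_lty c rho0).
have [ui uE] : itg mu setT (fun x => `|u x|) /\ Int mu setT (fun x => `|u x|) = Int mu OmR (fun x => `|u x|).
  apply: extend => [x nO|]; last by apply: itg_norm => //; exact: u_itg.
  by have [-> _] := test_out tu nO; rewrite normr0.
apply: le_trans (Int_norm mC uC) _.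
apply: (@le_trans _ _ (Int mu setT (fun x => `|u x|))).
  have uC' := itg_norm mC uC.
  rewrite -lee_fin -(Int_EFin mC uC') -(Int_EFin measurableT ui).
  apply: (@ge0_subset_integral _ _ _ mu _ _ mC measurableT).
  - by case/integrableP: ui.
  - by move=> y _; rewrite lee_fin.
  - exact: subsetT.
rewrite uE; apply: le_trans (HK u tu) _; rewrite ler_wpM2l//.
have i1 : itg mu OmR (fun=> 1) by exact: itg_cst.
have i2 : itg mu OmR (fun x => C * Hf u x) by apply: itgZ => //; exact: Hf_itg.
have E1 : Int mu OmR (fun x => 1 + C * Hf u x) = fine (mu OmR) + C * Phi u.
  by rewrite (IntD mOm i1 i2) (Int_cst mu mOm) mul1r (IntZ mOm C (Hf_itg tu)).
rewrite -E1; apply: (Int_le mOm (df_itg tu mOm finOm)); first exact: itgD.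
by move=> x _; exact: (gf_ge p1 (gG x) (G0 x) C1 (G1 x) (df0 u x)).
Qed.

(** One estimate for two purposes. With [lam = 1] and a fixed [L] it gives the embedding; with a
    small [L] the factor [L^s] makes the deviation from the means small, so that closeness of
    finitely many means decides, as compactness requires. *)
Lemma local_bound : exists M6 M7 R2 s : R, [/\ 0 < M6, 0 <= M7, 0 < R2, 0 < s &
  forall (L : R) u (lam A kp a : R), 0 < L <= R2 -> test_function Om u -> Phi u <= 1 ->
  0 <= lam -> 0 <= A -> 0 <= kp -> 0 <= a ->
  (forall x y, 0 <= y -> Psi x (lam * (M6 * L `^ s) * y) <= kp * Psi x y) ->
  (forall x, Psi x (lam * A) <= a) ->
  (forall x, Om x -> exists c, cube c (L / 2) x /\
     `|L ^- N * Int mu (cube c (L / 2) : set (Rn R N)) u| <= A) ->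
  Int mu OmR (fun x => Psi x (lam * `|u x|)) <= 2 `^ r' * (a * fine (mu OmR) + kp * M7)].
Proof.
have [M5 [M6 [R2 [kap [M50 M60 /andP[R20 R21] kap0 [th [s [/andP[th0 th1] s0 thk [Z nZ H]]]]]]]]] := deviation.
pose m := fine (mu OmR); have m0 : 0 <= m by apply: fine_ge0.
exists M6, (M5 * (m + 2 ^+ N) * kap), R2, s; split => //.
  by rewrite mulr_ge0// mulr_ge0// addr_ge0// exprn_ge0.
move=> L u lam A kp a LR tu Pu lam0 A0 kp0 a0' Hkp Ha HA.
have /andP[L0 _] := LR.
have [Gi GE] := extend (fun x => @Hf_out u x tu) (Hf_itg tu).
have mH : measurable_fun setT (Hf u : Rn R N -> R) by exact: itg_measurable Gi.
have H0 (x : Rn R N) : 0 <= Hf u x by exact: G_ge0.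
pose q2 := 2 `^ r' : R; have q20 : 0 <= q2 by exact: powR_ge0.
pose rr k : R := 2^-1 ^+ k * L.
have rr0 k : 0 < rr k by rewrite mulr_gt0 ?exprn_gt0 ?invr_gt0.
pose a_ k := q2 * (kp * (th ^+ k * M5)).
pose b_ k := q2 * (kp * (th ^+ k * M5 * rr k ^- N)).
have thM k : 0 <= th ^+ k * M5 by rewrite mulr_ge0 ?exprn_ge0 ?(ltW th0).
have a_0 k : 0 <= a_ k by rewrite mulr_ge0// mulr_ge0.
have b_0 k : 0 <= b_ k by rewrite mulr_ge0// mulr_ge0// mulr_ge0// invr_ge0 exprn_ge0// ltW.
have lu0 x : 0 <= lam * `|u x| by rewrite mulr_ge0.
have mU : measurable_fun OmR (fun x => Psi x (lam * `|u x|)).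
  have iu := itg_norm mOm (u_itg tu mOm finOm).
  by apply: (mP (w := fun x => lam * `|u x|)) => //; exact: (itg_measurable (itgZ mOm lam iu)).
have U0 (x : Rn R N) : OmR x -> 0 <= Psi x (lam * `|u x|) by move=> _; exact: P_ge0.
have HBn n : \sum_(0 <= k < n) (a_ k * m + b_ k * ((2 * rr k) ^+ N * Int mu setT (Hf u))) <=
    q2 * (kp * (M5 * (m + 2 ^+ N) * kap)).
  apply: (@le_trans _ _ (\sum_(0 <= k < n) q2 * (kp * (M5 * (m + 2 ^+ N))) * th ^+ k)).
    apply: ler_sum => k _.
    have -> : q2 * (kp * (M5 * (m + 2 ^+ N))) * th ^+ k = a_ k * m + q2 * (kp * (th ^+ k * M5)) * 2 ^+ N.
      by rewrite /a_; ring.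
    rewrite lerD2l /b_ [(2 * rr k) ^+ N]exprMn.
    have rN : rr k ^+ N != 0 by rewrite expf_neq0// gt_eqF.
    rewrite (_ : q2 * (kp * (th ^+ k * M5 * rr k ^- N)) * (2 ^+ N * rr k ^+ N * Int mu setT (Hf u)) =
      q2 * (kp * (th ^+ k * M5)) * 2 ^+ N * (rr k ^- N * rr k ^+ N) * Int mu setT (Hf u)); last by ring.
    rewrite mulVf// mulr1 ler_piMr//; last by rewrite [leLHS]GE.
    by rewrite mulr_ge0 ?exprn_ge0// mulr_ge0// mulr_ge0.
  rewrite -mulr_sumr (_ : q2 * (kp * (M5 * (m + 2 ^+ N) * kap)) = q2 * (kp * (M5 * (m + 2 ^+ N))) * kap); last by ring.
  rewrite ler_wpM2l//; first by rewrite mulr_ge0// mulr_ge0// mulr_ge0// addr_ge0// exprn_ge0.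
  by apply: le_trans thk; apply: geometric_le; rewrite th1 ltW.
have HU : {ae mu, forall x : Rn R N, OmR x -> exists n, Psi x (lam * `|u x|) <=
    q2 * a + \sum_(0 <= k < n) (a_ k + b_ k * Int mu (cube (x : 'rV[R]_N) (rr k) : set (Rn R N)) (Hf u))}.
  apply: negligibleS nZ => x /= nx; apply: contrapT => nZx; apply: nx => Ox.
  have [c [cx cA]] := HA x Ox.
  have [n Hn] := H L u LR tu Pu x c Ox nZx cx.
  exists n; set av := L ^- N * _ in cA Hn; set Y := `|_| / _ in Hn.
  have ML : 0 < M6 * L `^ s by rewrite mulr_gt0 ?powR_gt0.
  have Y0 : 0 <= Y by rewrite divr_ge0// ltW.
  have YE : (M6 * L `^ s) * Y = `|u x - av| by rewrite /Y mulrC divfK// gt_eqF.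
  have le1 : lam * `|u x| <= lam * (M6 * L `^ s) * Y + lam * A.
    rewrite -mulrA YE -mulrDr ler_wpM2l//; apply: (@le_trans _ _ (`|u x - av| + `|av|)); last by rewrite lerD2l.
    by apply: le_trans (ler_normD _ _); rewrite subrK.
  apply: le_trans (gf_homo r1 (gP x) (P0 x) C1 (P1 x) (lu0 x) le1) _.
  have y1 : 0 <= lam * (M6 * L `^ s) * Y by rewrite mulr_ge0// mulr_ge0// ltW.
  have y2 : 0 <= lam * A by rewrite mulr_ge0.
  apply: le_trans (gf_add r1 (gP x) (P0 x) C1 (P1 x) y1 y2) _.
  apply: (@le_trans _ _ (q2 * (kp * Psi x Y + a))).
    by rewrite ler_wpM2l//; apply: lerD; [exact: Hkp|exact: Ha].
  have -> : \sum_(0 <= k < n) (a_ k + b_ k * Int mu (cube x (rr k) : set (Rn R N)) (Hf u)) =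
      q2 * (kp * \sum_(0 <= k < n) (th ^+ k * M5 +
       th ^+ k * M5 * rr k ^- N * Int mu (cube x (rr k) : set (Rn R N)) (Hf u))).
    by rewrite 2!mulr_sumr; apply: eq_bigr => k _; rewrite /a_ /b_; ring.
  rewrite mulrDr addrC lerD2l ler_wpM2l// ler_wpM2l//; exact: Hn.
have [_] := series_dominated mOm finOm mH H0 Gi (fun k => ltW (rr0 k)) a_0 b_0 mU U0 (mulr_ge0 q20 a0') HBn HU.
move=> h; apply: le_trans h _; rewrite le_eqVlt; apply/orP; left; apply/eqP; rewrite /q2; ring.
Qed.

Lemma embedding : exists2 Ce : R, 0 < Ce & forall u, test_function Om u -> Phi u <= 1 ->
  Int mu OmR (fun x => Psi x `|u x|) <= Ce.
Proof.
have [M6 [M7 [R2 [s [M60 M70 R20 s0 H]]]]] := local_bound.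
have [K K0 HK] := average_bound.
pose m := fine (mu OmR); have m0 : 0 <= m by apply: fine_ge0.
pose A := R2 ^- N * (K * (m + C)); pose E := M6 * R2 `^ s.
have RN : 0 <= R2 ^- N by rewrite invr_ge0 exprn_ge0// ltW.
have A0 : 0 <= A by rewrite mulr_ge0// mulr_ge0// addr_ge0// ltW.
have E0 : 0 <= E by rewrite mulr_ge0 ?powR_ge0// ltW.
pose kp := (1 + E) `^ r'; pose a := (1 + A) `^ r' * C.
have a0' : 0 <= a by rewrite mulr_ge0 ?powR_ge0// ltW.
pose B := 2 `^ r' * (a * m + kp * M7).
have B0 : 0 <= B by rewrite mulr_ge0 ?powR_ge0// addr_ge0// mulr_ge0 ?powR_ge0.
exists (1 + B) => [|u tu Pu]; first by rewrite ltr_pwDl.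
apply: (@le_trans _ _ B); last by rewrite lerDr.
have := H R2 u 1 A kp a _ tu Pu ler01 A0 (powR_ge0 _ _) a0'.
rewrite (_ : (fun x => Psi x (1 * `|u x|)) = fun x => Psi x `|u x|); last by apply/funext => x; rewrite mul1r.
apply; first by rewrite R20 lexx.
- move=> x y y0; rewrite mul1r -/E.
  have E1 : 1 <= 1 + E by rewrite lerDl.
  apply: le_trans (gf_grow (gP x) E1 y0); apply: (gf_homo r1 (gP x) (P0 x) C1 (P1 x)); first by rewrite mulr_ge0.
  by rewrite ler_wpM2r// lerDr.
- move=> x; rewrite mul1r; apply: (gf_bound r1 (gP x) (P0 x) C1 (P1 x)) => //; first by rewrite lerDl.
  by rewrite lerDr.
- move=> x Ox; exists x; split; first by apply/in_cube => i; rewrite subrr normr0 divr_gt0.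
  rewrite normrM ger0_norm// ler_wpM2l//; apply: le_trans (HK u tu x (R2 / 2) _) _; first by rewrite divr_ge0// ltW.
  by rewrite ler_wpM2l// lerD2l ler_piMr// ltW.
Qed.

(** The colour records the rounded means over finitely many cubes of radius [L / 2] that cover [Om].
    Equal colours make all means of the difference small, and [local_bound] controls the rest. *)
Lemma compact_colouring (K eps : R) : 0 < eps -> exists (I : finType) (col : ('rV[R]_N -> R) -> I),
  forall u v, test_function Om u -> test_function Om v -> Phi u <= K -> Phi v <= K -> col u = col v ->
    Int mu OmR (fun x => Psi x `|u x - v x|) <= eps.
Proof.
move=> eps0.
have [M6 [M7 [R2 [s [M60 M70 R20 s0 H]]]]] := local_bound.
have [KA KA0 HK] := average_bound.
pose m := fine (mu OmR); have m0 : 0 <= m by apply: fine_ge0.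
(* Dividing the difference by [lam] brings its modular below 1, where [local_bound] applies; the
   weight [lam] inside [Psi] restores it. *)
pose lam := 1 + 2 `^ q * (`|K| + `|K|).
have lam1 : 1 <= lam by rewrite lerDl mulr_ge0 ?powR_ge0// addr_ge0.
have lam0 : 0 < lam by exact: lt_le_trans lam1.
have e20 : 0 < eps / 2 by rewrite divr_gt0.
have q20 : 0 <= (2 : R) `^ r' by exact: powR_ge0.
have [e /andP[e0 e1] He] := small_factor (mulr_ge0 q20 M70) e20.
have [eta /andP[t0 t1] Ht] := small_factor (mulr_ge0 (mulr_ge0 q20 (ltW C0)) m0) e20.
(* The size at which the deviation, weighted by [lam], is at most the fraction [e]. The covering
   below uses a net of mesh [L / 4]. *)
pose L := Num.min R2 ((e / (lam * M6)) `^ s^-1).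
have L0 : 0 < L by rewrite lt_min R20 powR_gt0// divr_gt0// mulr_gt0.
have Le : lam * (M6 * L `^ s) <= e.
  have h1 : 0 <= e / (lam * M6) by rewrite divr_ge0 ?mulr_ge0 ?ltW.
  have h2 : L <= (e / (lam * M6)) `^ s^-1 by rewrite ge_min lexx orbT.
  have := powR_homo (ltW s0) (ltW L0) h2; rewrite powRK// ler_pdivlMr ?mulr_gt0//.
  by rewrite mulrC mulrA.
have [D D0 OD] := bounded_in_cube bOm.
have L40 : 0 < L / 4 by rewrite divr_gt0.
have [J [y Hy]] := @finite_net R N D (L / 4) L40.
pose Bd := KA * (m + C * K).
have LN : 0 < L ^+ N by rewrite exprn_gt0.
have tol0 : 0 < L ^+ N * eta by rewrite mulr_gt0.
have [I [col0 Hcol]] := @round_colour R J Bd (L ^+ N * eta) tol0.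
have L20 : 0 <= L / 2 by rewrite divr_ge0// ltW.
pose av u j := Int mu (cube (y j) (L / 2) : set (Rn R N)) u.
exists I, (fun u => col0 (av u)) => u v tu tv Pu Pv E.
have avB w j : test_function Om w -> Phi w <= K -> `|av w j| <= Bd.
  move=> tw Pw; apply: le_trans (HK w tw _ _ L20) _; by rewrite ler_wpM2l// lerD2l ler_wpM2l// ltW.
have avE j : `|av u j - av v j| <= L ^+ N * eta.
  by apply: (Hcol (av u) (av v)) => // i; exact: avB.
(* Written in the shape [a * u + v] twice over, so that [test_lin] and [gradient_lin] apply. *)
pose w x := lam^-1 * u x + (- lam^-1 * v x + 0).
have li0 : 0 <= lam^-1 by rewrite invr_ge0 ltW.
have wE x : w x = lam^-1 * (u x - v x) by rewrite /w addr0 mulrBr mulNr.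
have tv' : test_function Om (fun x => - lam^-1 * v x + 0) by apply: test_lin => //; exact: test0.
have tw : test_function Om w by exact: test_lin.
have dw x : df w x = lam^-1 * enorm (gradient u x - gradient v x).
  rewrite /df /w (gradient_lin _ (test_C1 tu) (test_C1 tv')) (gradient_lin _ (test_C1 tv) (test_C1 (test0 Om))).
  by rewrite gradient0 addr0 scaleNr -scalerBr enormZ ger0_norm.
have Pw : Phi w <= 1.
  have i1 := Hf_itg tu; have i2 := Hf_itg tv.
  have iD : itg mu OmR (fun x => lam^-1 * (2 `^ q * (Hf u x + Hf v x))).
    by apply: itgZ => //; apply: itgZ => //; exact: itgD.
  apply: (@le_trans _ _ (Int mu OmR (fun x => lam^-1 * (2 `^ q * (Hf u x + Hf v x))))).
    apply: (Int_le mOm (Hf_itg tw) iD) => x _; rewrite /Hf dw.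
    have l01 : 0 <= lam^-1 <= 1 by rewrite li0 invf_le1.
    apply: le_trans (gf_shrink p1 (gG x) (G0 x) C1 (G1 x) l01 (enorm_ge0 _)) _.
    rewrite ler_wpM2l//; apply: (@le_trans _ _ (G x (df u x + df v x))).
      by apply: (gf_homo p1 (gG x) (G0 x) C1 (G1 x)); [exact: enorm_ge0|exact: enormB].
    exact: (gf_add p1 (gG x) (G0 x) C1 (G1 x)).
  rewrite IntZ//; last by apply: itgZ => //; exact: itgD.
  rewrite IntZ//; last exact: itgD.
  rewrite IntD// mulrC ler_pdivrMr// mul1r; apply: (@le_trans _ _ (2 `^ q * (`|K| + `|K|))); last by rewrite lerDr.
  by rewrite ler_wpM2l ?powR_ge0// lerD//; [apply: le_trans Pu _|apply: le_trans Pv _]; exact: ler_norm.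
have Hw : Int mu OmR (fun x => Psi x (lam * `|w x|)) <= 2 `^ r' * ((eta * C) * m + e * M7).
  apply: (H L w lam (eta / lam) e (eta * C)) => //; rewrite ?(ltW lam0) ?(ltW e0)//.
  - by rewrite L0 ge_min lexx.
  - by rewrite divr_ge0 ?ltW.
  - by rewrite mulr_ge0 ?ltW.
  - move=> x z z0; have e01 : 0 <= e <= 1 by rewrite ltW.
    apply: le_trans (gf_shrink r1 (gP x) (P0 x) C1 (P1 x) e01 z0).
    apply: (gf_homo r1 (gP x) (P0 x) C1 (P1 x)); last by rewrite ler_wpM2r.
    by rewrite mulr_ge0// mulr_ge0 ?mulr_ge0 ?powR_ge0 ?(ltW lam0) ?(ltW M60).
  - move=> x; rewrite mulrC divfK ?gt_eqF// -[eta in Psi x eta]mulr1.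
    have e01 : 0 <= eta <= 1 by rewrite ltW.
    apply: le_trans (gf_shrink r1 (gP x) (P0 x) C1 (P1 x) e01 ler01) _.
    by rewrite ler_wpM2l ?(ltW t0)//; have /andP[] := P1 x.
  - move=> x Ox; have xD : `|x| <= D.
      by apply: ltW; rewrite -[x]subr0; apply/cube_ball => //; exact: OD.
    have [j Hj] := Hy x xD; exists (y j); split.
      apply/cube_ball; first by rewrite divr_gt0.
      by apply: le_lt_trans Hj _; rewrite ltr_pM2l// ltf_pV2 ?posrE// ltr_nat.
    have mC : measurable (cube (y j) (L / 2) : set (Rn R N)) by exact: cube_Lmeasurable.
    have iu := u_itg tu mC (cube_lty (y j) L20); have iv := u_itg tv mC (cube_lty (y j) L20).
    have -> : Int mu (cube (y j) (L / 2) : set (Rn R N)) w = lam^-1 * (av u j - av v j).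
      rewrite /av -(IntB mC iu iv) -(IntZ mC _ (itgB mC iu iv)); apply: Int_eq => z _; exact: wE.
    rewrite normrM normrM [`|L ^- N|]ger0_norm ?invr_ge0 ?(ltW LN)// [`|lam^-1|]ger0_norm//.
    by rewrite mulrCA [leRHS]mulrC ler_wpM2l// mulrC ler_pdivrMr// [leRHS]mulrC; exact: avE.
have -> : (fun x => Psi x `|u x - v x|) = fun x => Psi x (lam * `|w x|).
  apply/funext => x; rewrite wE normrM ger0_norm// mulrA mulfV ?mul1r// gt_eqF//.
apply: le_trans Hw _.
rewrite (_ : 2 `^ r' * (eta * C * m + e * M7) = eta * (2 `^ r' * C * m) + e * (2 `^ r' * M7)); last by ring.
by apply: le_trans (lerD Ht He) _; rewrite -splitr.
Qed.

End embedding.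

(** Density is needed for gradients only, uniformly on [Om]. Arzela-Ascoli is replaced by colouring:
    within a class of equicontinuous bounded gradients, rounded values on a finite net determine the
    gradient up to a fixed tolerance. *)
Lemma test_functions_separable (R : realType) (N : nat) (Om : set 'rV[R]_N) : bounded_set Om ->
  exists e_ : nat -> 'rV[R]_N -> R, (forall k, test_function Om (e_ k)) /\
    forall u (eps : R), test_function Om u -> 0 < eps -> exists k, forall x, Om x ->
      enorm (gradient u x - gradient (e_ k) x) <= eps.
Proof.
move=> bOm; have [D D0 OD] := bounded_in_cube bOm.
have xD x : Om x -> `|x| <= D by move=> Ox; apply: ltW; rewrite -[x]subr0; apply/cube_ball => //; exact: OD.
(* The class in which gradients are bounded by [n] and vary by less than [1 / (m + 1)] over
   distances below [1 / (n + 1)]. Every test function lies in one for each [m], by uniform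
   continuity. *)
pose S (m n : nat) (u : 'rV[R]_N -> R) := (forall x, `|gradient u x| <= n%:R) /\
  forall x y, `|x| <= D -> `|x - y| < n.+1%:R^-1 -> `|gradient u x - gradient u y| < m.+1%:R^-1.
pose dist (m : nat) (u v : 'rV[R]_N -> R) := forall x, Om x -> `|gradient u x - gradient v x| <= 3 * m.+1%:R^-1.
have [||e_ [te He]] := @finite_colouring_dense _ (test_function Om) S dist (ex_intro _ _ (test0 Om)).
- move=> m u tu; have [B HB] := test_bounded tu.
  have cK : compact [set x : 'rV[R]_N | `|x| <= D].
    apply: bounded_closed_compact.
      by exists D; split; [exact: num_real|move=> M DM x xM; exact: le_trans xM (ltW DM)].
    apply: (@preimage_closed _ _ (fun x : 'rV[R]_N => `|x|) [set y : R | y <= D]); last exact: closed_le.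
    by move=> x _; exact: norm_continuous.
  have m0 : 0 < m.+1%:R^-1 :> R by rewrite invr_gt0.
  have [d d0 Hd] := compact_uniformly_continuous (gradient_continuous (test_C1 tu)) cK m0.
  pose n1 := (Num.truncn B).+1; pose n2 := (Num.truncn d^-1).+1.
  exists (maxn n1 n2); split => [x|x y xK xy].
    apply: (@le_trans _ _ B); first by apply: le_trans (norm_le_enorm _) _; have [] := HB x.
    by apply: (@le_trans _ _ n1%:R); [exact/ltW/truncnS_gt|rewrite ler_nat leq_maxl].
  apply: Hd => //; apply: lt_le_trans xy _.
  rewrite -[leRHS]invrK lef_pV2 ?posrE ?invr_gt0//.
  by apply: (@le_trans _ _ n2%:R); [exact/ltW/truncnS_gt|rewrite ler_nat leqW// leq_maxr].
- move=> m n; have h0 : 0 < n.+1%:R^-1 / 2 :> R by rewrite divr_gt0.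
  have m0 : 0 < m.+1%:R^-1 :> R by rewrite invr_gt0.
  have [J [y Hy]] := @finite_net R N D _ h0.
  have [I [col Hcol]] := @round_colour R (J * 'I_N)%type n%:R _ m0.
  exists I, (fun u => col (fun ij => gradient u (y ij.1) 0 ij.2)) => u v tu tv [Su1 Su2] [Sv1 Sv2] E x Ox.
  have [i Hi] := Hy x (xD x Ox).
  have hi : `|x - y i| < n.+1%:R^-1.
    by apply: le_lt_trans Hi _; rewrite ltr_pdivrMr// ltr_pMr ?invr_gt0// ltr1n.
  have h1 := Su2 x (y i) (xD x Ox) hi; have h2 := Sv2 x (y i) (xD x Ox) hi.
  have h3 : `|gradient u (y i) - gradient v (y i)| <= m.+1%:R^-1.
    rewrite [leLHS]/Num.norm /= mx_normrE; apply/bigmax_leP; split; first exact: ltW.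
    move=> [j k] _ /=; rewrite (ord1 j) !mxE.
    have := Hcol _ _ (fun ij => le_trans (norm_coord _ _) (Su1 _)) (fun ij => le_trans (norm_coord _ _) (Sv1 _)) E (i, k).
    by rewrite /= !mxE.
  have h4 := ler_distD (gradient u (y i)) (gradient u x) (gradient v x).
  have h5 := ler_distD (gradient v (y i)) (gradient u (y i)) (gradient v x).
  rewrite [`|gradient v (y i) - gradient v x|]distrC in h5.
  apply: le_trans h4 _; apply: (le_trans (lerD (ltW h1) (le_trans h5 (lerD h3 (ltW h2))))).
  move: (m.+1%:R^-1) => t; by rewrite le_eqVlt; apply/orP; left; apply/eqP; ring.
exists e_; split => // u eps tu eps0.
pose sN : R := Num.sqrt N%:R.
have s0 : 0 <= sN by exact: sqrtr_ge0.
pose m := Num.truncn (sN * 3 / eps).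
have [k Hk] := He m u tu; exists k => x Ox.
apply: le_trans (enorm_le_norm _) _; apply: (@le_trans _ _ (sN * (3 * m.+1%:R^-1))).
  by rewrite ler_wpM2l//; exact: Hk.
have h := ltW (truncnS_gt (sN * 3 / eps)).
by move: h; rewrite ler_pdivrMr// mulrA [leRHS]mulrC ler_pdivrMr.
Qed.

(** * Superposition operators *)

Section caratheodory.
Context d (T : measurableType d) (R : realType) (D : set T).
Hypothesis mD : measurable D.
Variable h : T -> R -> R.
Hypothesis mh : forall t, measurable_fun D (h ^~ t).
Hypothesis ch : forall x, continuous (h x).

(** [w] is rounded down to multiples of [1 / (n + 1)]. The composition with a countably valued
    function is measurable, and continuity in the second variable gives the limit. *)
Lemma caratheodory_comp (w : T -> R) : measurable_fun D w -> measurable_fun D (fun x => h x (w x)).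
Proof.
move=> mw; pose k (n : nat) x := Num.floor (w x * n.+1%:R).
pose v (n : nat) (z : int) : R := z%:~R / n.+1%:R.
have kP (n : nat) x z : k n x = z <-> v n z <= w x < v n (z + 1).
  have n0 : 0 < n.+1%:R :> R by rewrite ltr0n.
  rewrite /v ler_pdivrMr// ltr_pdivlMr//; split => [<-|H]; first exact: floor_itv.
  exact: floor_def.
apply: (@measurable_fun_cvg _ _ _ _ (fun n x => h x (v n (k n x)))) => [n|x Dx].
  move=> _ Y mY.
  rewrite (_ : D `&` _ = \bigcup_z ((D `&` w @^-1` `[v n z, v n (z + 1)[%classic) `&` (D `&` h ^~ (v n z) @^-1` Y))).
    apply: countable_bigcupT_measurable => // z.
    by apply: measurableI; [apply: mw|apply: mh].
  apply/seteqP; split => [x [Dx Yx]|x [z _ [[Dx wx] [_ Yx]]]].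
    by exists (k n x) => //; split; split => //=; rewrite in_itv/=; apply/kP.
  by split => //=; move: wx; rewrite /= in_itv/= => /kP ->.
apply: (@cvg_comp _ _ _ (fun n => v n (k n x)) (h x) _ (nbhs (w x))); last exact: ch.
apply: cvg_dist_natSinv => n.
have /andP[a b] := (kP n x _).1 erefl.
have E : v n (k n x + 1) = v n (k n x) + n.+1%:R^-1 by rewrite /v intrD mulrDl mul1r.
by rewrite ger0_norm ?subr_ge0// ltrBlDl -E.
Qed.

End caratheodory.

(** Exhibits the primitive as a limit of finite sums of values of [h], so that measurability in [x]
    of these values passes to the primitive. *)
Lemma riemann_sum_cvg (R : realType) (h H : R -> R) (t : R) : continuous h ->
  (forall s : R, is_derive s 1 H (h s)) -> H 0 = 0 ->
  \sum_(0 <= k < n.+1) t / n.+1%:R * h (k%:R / n.+1%:R * t) @[n --> \oo] --> H t.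
Proof.
move=> ch dH H0; apply/cvgrPdist_le => e e0.
have cK : compact [set x : R | x \in `[- `|t|, `|t|]] by exact: segment_compact.
have t1 : 0 < `|t| + 1 by rewrite ltr_wpDl.
have [del del0 Hdel] := @compact_uniformly_continuous R R R h _ ch cK (e / (`|t| + 1)) (divr_gt0 e0 t1).
near=> n.
have n0 : 0 < n.+1%:R :> R by rewrite ltr0n.
have nd : `|t| / n.+1%:R < del.
  rewrite ltr_pdivrMr// -ltr_pdivrMl// mulrC.
  near: n; exists (Num.truncn (`|t| / del)) => // n /= nn.
  by apply: lt_le_trans (truncnS_gt _) _; rewrite ler_nat ltnS.
pose a_ (k : nat) : R := k%:R / n.+1%:R.
have step k : (k < n.+1)%N -> `|(H (a_ k.+1 * t) - H (a_ k * t)) - t / n.+1%:R * h (a_ k * t)| <=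
    e / (`|t| + 1) * (`|t| / n.+1%:R).
  move=> kn; pose phi (s : R) := H (s * t).
  have dphi (s : R) : is_derive s 1 phi (t * h (s * t)).
    have dm : is_derive s 1 (fun s : R => s * t) t.
      rewrite (_ : (fun s => _) = fun s : R => t * s); last by apply/funext => z; rewrite /= mulrC.
      by apply: is_derive_eq; rewrite scaler1.
    by have := @is_derive1_comp _ H (fun s : R => s * t) s _ _ (dH _) dm; rewrite mulrC.
  have aS : a_ k.+1 = a_ k + n.+1%:R^-1 by rewrite /a_ -natr1 mulrDl mul1r.
  have ni : 0 < n.+1%:R^-1 :> R by rewrite invr_gt0.
  have ak0 : 0 <= a_ k by rewrite divr_ge0.
  have ak1 : a_ k.+1 <= 1 by rewrite ler_pdivrMr// mul1r ler_nat.
  have akS : a_ k <= a_ k.+1 by rewrite aS lerDl ltW.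
  have [|c [/andP[c1 c2] _] Ec] := @mean_value R phi (fun s => t * h (s * t)) _ _ akS (fun s _ => dphi s).
    apply: derivable_within_continuous => s _; by have [] := dphi s.
  have -> : H (a_ k.+1 * t) - H (a_ k * t) = t / n.+1%:R * h (c * t).
    by rewrite -/(phi _) -/(phi _) Ec aS addrC addKr; ring.
  rewrite -mulrBr normrM [e / _ * _]mulrC normrM normfV (gtr0_norm n0).
  rewrite ler_wpM2l ?divr_ge0 ?(ltW n0)//; apply: ltW; rewrite distrC.
  apply: Hdel.
    rewrite /= in_itv/= -ler_norml normrM ler_piMl// ger0_norm//.
    by apply: le_trans ak1; rewrite aS lerDl ltW.
  rewrite -mulrBl normrM mulrC; apply: le_lt_trans nd; rewrite ler_wpM2l// distrC ger0_norm ?subr_ge0//.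
  by rewrite lerBlDl -aS.
have tele : H t = \sum_(0 <= k < n.+1) (H (a_ k.+1 * t) - H (a_ k * t)).
  by rewrite telescope_sumr// /a_ mul0r mul0r H0 subr0 divff ?gt_eqF// mul1r.
rewrite tele -sumrB; apply: le_trans (ler_norm_sum _ _ _) _.
apply: (@le_trans _ _ (\sum_(0 <= k < n.+1) e / (`|t| + 1) * (`|t| / n.+1%:R))).
  by rewrite big_nat_cond [leRHS]big_nat_cond; apply: ler_sum => k /andP[/andP[_ kn] _]; exact: step.
rewrite sumr_const_nat subn0 -[_ *+ _]mulr_natr -mulrA divfK ?gt_eqF// mulrAC ler_pdivrMr//.
by rewrite ler_wpM2l ?(ltW e0)// lerDl.
Unshelve. all: by end_near. Qed.

Section primitive.
Context d (T : measurableType d) (R : realType) (D : set T).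
Hypothesis mD : measurable D.
Variable h : T -> R -> R.
Hypothesis mh : forall t, measurable_fun D (h ^~ t).
Hypothesis ch : forall x, continuous (h x).

Lemma primitive_comp (w : T -> R) : measurable_fun D w ->
  measurable_fun D (fun x => primitive (h x) (w x)).
Proof.
move=> mw; apply: (@caratheodory_comp _ _ _ _ mD (fun x => primitive (h x)) _ _ _ mw) => [t|x]; last exact: primitive_continuous.
apply: (@measurable_fun_cvg _ _ _ _
    (fun n x => \sum_(0 <= k < n.+1) t / n.+1%:R * h x (k%:R / n.+1%:R * t))) => [n|x Dx].
  by apply: measurable_sum => k; apply: measurable_funM.
apply: riemann_sum_cvg => //; [exact: primitive_is_derive|exact: primitive0].
Qed.

End primitive.

(** Rests on completeness of the Lebesgue sigma-algebra. *)
Lemma Lmeasurable_ae (R : realType) (N : nat) (D Z : set (Rn R N)) (u v : 'rV[R]_N -> R) :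
  (@lebesgue_Rn R N).-negligible Z -> (forall x, D x -> ~ Z x -> u x = v x) ->
  Lmeasurable D u -> Lmeasurable D v.
Proof.
move=> nZ uv mu_; apply/measurable_EFinP.
apply: (@ae_measurable_fun _ _ _ (@lebesgue_Rn R N) _ D (EFin \o u)).
- exact: measure_is_complete_caratheodory.
- apply: negligibleS nZ => x /= nx; apply: contrapT => nZx; apply: nx => Dx.
  by rewrite /= uv.
- exact/measurable_EFinP.
Qed.

Lemma measurable_norm_div d (T : measurableType d) (R : realType) (D : set T) (h : T -> R) (l : R) :
  measurable_fun D h -> measurable_fun D (fun x => `|h x / l|).
Proof. by move=> mh; apply: measurableT_comp => //; apply: measurable_funM => //; exact: measurable_cst. Qed.

Lemma measurable_normf d (T : measurableType d) (R : realType) (D : set T) (h : T -> R) :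
  measurable_fun D h -> measurable_fun D (fun x => `|h x|).
Proof. by move=> mh; apply: measurableT_comp. Qed.

Lemma measurable_normB d (T : measurableType d) (R : realType) (D : set T) (h k : T -> R) :
  measurable_fun D h -> measurable_fun D k -> measurable_fun D (fun x => `|h x - k x|).
Proof. by move=> mh mk; apply: measurableT_comp => //; exact: measurable_funB. Qed.

(** * Solutions in generalized Orlicz-Sobolev spaces *)

Section modular_comparison.
Context {R : realType}.
Variables (p q C : R) (h : R -> R).
Hypothesis p1 : 1 <= p.
Hypothesis q0 : 0 <= q.
Hypothesis C1 : 1 <= C.
Hypothesis gh : growth p q h.
Hypothesis h0 : h 0 = 0.
Hypothesis hC : C^-1 <= h 1 <= C.

Let C0 : 0 < C. Proof. exact: lt_le_trans C1. Qed.

Lemma growth_lower (e t : R) : 0 < e <= 1 -> e <= t -> t <= 1 -> e `^ q / C <= h t.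
Proof.
move=> /andP[e0 e1] et t1; have ei : 1 <= e^-1 by rewrite invf_ge1.
have := gf_grow gh ei (ltW e0); rewrite mulVf ?gt_eqF// powRV// => H.
apply: le_trans (gf_homo p1 gh h0 C1 hC (ltW e0) et).
rewrite ler_pdivrMr// [_ * C]mulrC; have /andP[h1 _] := hC.
by have := le_trans h1 H; rewrite ler_pdivlMl ?powR_gt0// ler_pdivrMr// [h e * C]mulrC.
Qed.

(** Below [e] the bound is trivial, above [e] the modular has a positive lower bound. Integrated
    over a set of finite measure, it makes a small modular force a small integral. *)
Lemma le_modular (e t : R) : 0 < e <= 1 -> 0 <= t -> t <= e + C / e `^ q * h t.
Proof.
move=> e01 t0; have /andP[e0 e1] := e01.
have eq0 : 0 < e `^ q by rewrite powR_gt0.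
have eq1 : e `^ q <= 1 by have := powR_homo q0 (ltW e0) e1; rewrite powR1.
have ht : 0 <= h t by exact: (gf_ge0 gh h0 C1 hC).
have K0 : 0 <= C / e `^ q * h t by rewrite mulr_ge0// divr_ge0// ltW.
have [te|et] := leP t e; first by apply: le_trans te _; rewrite lerDl.
apply: (@le_trans _ _ (C / e `^ q * h t)); last by rewrite lerDr ltW.
have [t1|t1] := leP t 1.
  have := growth_lower e01 (ltW et) t1; rewrite ler_pdivrMr// => H.
  by apply: le_trans t1 _; rewrite mulrAC ler_pdivlMr// mul1r mulrC.
have /andP[H _] := gh (ltW t1) ler01; rewrite mulr1 in H.
have /andP[h1 _] := hC.
apply: (@le_trans _ _ (C * h t)).
  rewrite -ler_pdivrMl// mulrC; apply: le_trans H; apply: ler_pM => //.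
    by rewrite invr_ge0 ltW.
  by rewrite -[leLHS]powRr1//; apply: ler_powR => //; exact: ltW.
by rewrite ler_wpM2r// ler_pMr// invf_ge1.
Qed.

End modular_comparison.

Section modular_domination.
Context {R : realType}.
Variables (p q r r' C : R) (h k : R -> R).
Hypothesis p1 : 1 <= p.
Hypothesis q0 : 0 <= q.
Hypothesis qr : q <= r.
Hypothesis r1 : 1 <= r.
Hypothesis r'0 : 0 <= r'.
Hypothesis C1 : 1 <= C.
Hypothesis gh : growth p q h.
Hypothesis h0 : h 0 = 0.
Hypothesis hC : C^-1 <= h 1 <= C.
Hypothesis gk : growth r r' k.
Hypothesis k0 : k 0 = 0.
Hypothesis kC : C^-1 <= k 1 <= C.
Let C0 : 0 < C. Proof. exact: lt_le_trans C1. Qed.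

(** The same device between two integrands: [k] may be much smaller than [h] near 0, which costs the
    additive [e * C], and dominates it for [t > 1] because [q <= r]. *)
Lemma modular_dominated (e t : R) : 0 < e <= 1 -> 0 <= t ->
  h t <= e * C + C * (C / e `^ r') * k t.
Proof.
move=> e01 t0; have /andP[e0 e1] := e01.
have eq0 : 0 < e `^ r' by rewrite powR_gt0.
have eq1 : e `^ r' <= 1 by have := powR_homo r'0 (ltW e0) e1; rewrite powR1.
have kt : 0 <= k t by exact: (gf_ge0 gk k0 C1 kC).
have K0 : 0 <= C * (C / e `^ r') * k t by rewrite mulr_ge0// mulr_ge0 ?divr_ge0// ltW.
have eC : 0 <= e * C by rewrite mulr_ge0// ltW.
have /andP[h1 h2] := hC.
have [te|et] := leP t e.
  apply: (@le_trans _ _ (e * C)); last by rewrite lerDl.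
  apply: le_trans (gf_homo p1 gh h0 C1 hC t0 te) _.
  have e01' : 0 <= e <= 1 by rewrite ltW.
  have := gf_shrink p1 gh h0 C1 hC e01' ler01; rewrite mulr1 => /le_trans; apply.
  by rewrite ler_wpM2l// ltW.
apply: (@le_trans _ _ (C * (C / e `^ r') * k t)); last by rewrite lerDr.
have [t1|t1] := leP t 1.
  have := growth_lower r1 C1 gk k0 kC e01 (ltW et) t1; rewrite ler_pdivrMr// => H.
  apply: le_trans (gf_homo p1 gh h0 C1 hC t0 t1) _; apply: le_trans h2 _.
  rewrite -mulrA ler_pMr//; rewrite mulrAC ler_pdivlMr// mul1r [C * _]mulrC; exact: H.
have tp : 0 < t by exact: lt_trans t1.
have := gf_grow gh (ltW t1) ler01; rewrite mulr1 => H.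
have /andP[H2 _] := gk (ltW t1) ler01; rewrite mulr1 in H2.
have tqr : t `^ q <= t `^ r by apply: ler_powR => //; exact: ltW.
have tk : t `^ q <= C * k t.
  rewrite -ler_pdivrMl// mulrC; apply: le_trans H2; apply: ler_pM; rewrite ?powR_ge0 ?invr_ge0 ?(ltW C0)//.
  by have /andP[] := kC.
apply: le_trans H _; apply: (@le_trans _ _ (C * k t * C)).
  by apply: ler_pM => //; rewrite ?powR_ge0// (gf_ge0 gh h0 C1 hC).
by rewrite mulrAC ler_wpM2r// ler_wpM2l ?(ltW C0)// ler_pMr// invf_ge1.
Qed.

End modular_domination.

(** * The problem with hypotheses that hold at every point *)

Section everywhere.
Context {R : realType} {N : nat}.
Local Notation mu := (@lebesgue_Rn R N).
Variables (Om : set 'rV[R]_N) (c0 : 'rV[R]_N).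
Hypothesis oOm : open Om.
Hypothesis bOm : bounded_set Om.
Hypothesis Om0 : Om c0.
Hypothesis N0 : (0 < N)%N.
Variables (p q r r' C alpha : R) (G g Psi f F : 'rV[R]_N -> R -> R).
Hypothesis p1 : 1 < p.
Hypothesis pq : p <= q.
Hypothesis qr : q < r.
Hypothesis rr' : r <= r'.
Hypothesis C1 : 1 <= C.
Hypothesis gG : forall x, density_pair p q (g x) (G x).
Hypothesis G1 : forall x, C^-1 <= G x 1 <= C.
Hypothesis gP : forall x, growth r r' (Psi x).
Hypothesis P0 : forall x, Psi x 0 = 0.
Hypothesis P1 : forall x, C^-1 <= Psi x 1 <= C.

Definition superposition_measurable (h : 'rV[R]_N -> R -> R) := forall w : 'rV[R]_N -> R,
  Lmeasurable Om w -> (forall x, 0 <= w x) -> Lmeasurable Om (fun x => h x (w x)).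

Hypothesis mG : superposition_measurable G.
Hypothesis mg : superposition_measurable g.
Hypothesis mP : superposition_measurable Psi.
Hypothesis mf : forall w : 'rV[R]_N -> R, Lmeasurable Om w -> Lmeasurable Om (fun x => f x (w x)).
Hypothesis mF : forall w : 'rV[R]_N -> R, Lmeasurable Om w -> Lmeasurable Om (fun x => F x (w x)).
Hypothesis fc : forall x, continuous (f x).
Hypothesis Fd : forall x (t : R), is_derive t 1 (F x) (f x t).
Hypothesis F0 : forall x, F x 0 = 0.
Hypothesis fb : forall x t, `|f x t| <= C * (1 + Psi x `|t| / `|t|).
Hypothesis fs : forall e : R, 0 < e -> exists2 del : R, 0 < del &
  forall x t, `|t| < del -> `|f x t| <= e * `|t| `^ (q - 1).
Variables (t0 theta : R).
Hypothesis t0_gt0 : 0 < t0.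
Hypothesis thq : q < theta.
Hypothesis AR : forall x t, t0 <= `|t| ->
  0 < theta * F x t /\ theta * F x t <= t * f x t.
Hypothesis a0 : 0 < alpha.
Hypothesis aN : alpha * N%:R < 1.
Hypothesis inv : forall x a, 0 < a -> Psi x (a * G x a `^ (- alpha)) = G x a.
Hypothesis A1 : cond_A1 Om G.

Let OmR : set (Rn R N) := Om.
Let mOm : measurable OmR. Proof. exact: open_Rn. Qed.
Let finOm : (mu OmR < +oo)%E. Proof. exact: bounded_finite_measure. Qed.
Let p1' : 1 <= p. Proof. exact: ltW. Qed.
Let q0 : 0 <= q. Proof. by move: p1 pq; lra. Qed.
Let r1 : 1 <= r. Proof. by move: p1 pq qr; lra. Qed.
Let r'0 : 0 <= r'. Proof. by move: r1 rr'; lra. Qed.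
Let C0 : 0 < C. Proof. exact: lt_le_trans C1. Qed.
Let gGx x : growth p q (G x). Proof. by have [[]] := gG x. Qed.
Let G0 x : G x 0 = 0. Proof. by have [[]] := gG x. Qed.
Let G_ge0 x t : 0 <= t -> 0 <= G x t. Proof. exact: (gf_ge0 (gGx x) (G0 x) C1 (G1 x)). Qed.
Let P_ge0 x t : 0 <= t -> 0 <= Psi x t. Proof. exact: (gf_ge0 (gP x) (P0 x) C1 (P1 x)). Qed.

Local Notation itg := (itg mu OmR).
Local Notation Int := (Int mu OmR).
Local Notation adm := (adm mu OmR G Psi).
Local Notation Phi := (Phi mu OmR G).

(** The concrete class for which the abstract predicate [P] of the variational part was set up. *)
Let TP (u : Rn R N -> R) (Du : Rn R N -> 'rV[R]_N) := test_function Om u /\ Du = gradient u.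

Let TP_zero : TP (fun=> 0) (fun=> 0).
Proof. by split; [exact: test0|rewrite gradient0]. Qed.

Let TP_lin a u Du v Dv : TP u Du -> TP v Dv ->
  TP (fun x => a * u x + v x) (fun x => a *: Du x + Dv x).
Proof.
move=> [tu ->] [tv ->]; split; first exact: test_lin.
by rewrite (gradient_lin a (test_C1 tu) (test_C1 tv)).
Qed.

Let TP_meas u Du : TP u Du -> measurable_fun OmR u /\ measurable_vec OmR Du.
Proof.
move=> [tu ->]; have [cu du] := test_C1 tu; split; first by apply: continuous_Lmeasurable => //; exact: @cu.
move=> i; apply: (continuous_Lmeasurable mOm (f := fun x => gradient u x 0 i)) => x.
apply: (@continuous_comp _ _ _ (gradient u) (fun g : 'rV[R]_N => g 0 i)).
  exact: gradient_continuous (test_C1 tu) _.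
exact: row_coord_continuous.
Qed.

Let TP_bdd u Du : TP u Du -> exists B : R, forall x, `|u x| <= B /\ enorm (Du x) <= B.
Proof. by move=> [tu ->]; exact: test_bounded tu. Qed.

Let TP_nondeg u Du : TP u Du -> {ae mu, forall x, OmR x -> u x = 0} -> u = (fun=> 0) /\ Du = (fun=> 0).
Proof.
move=> [tu ->] u0; have [cu _] := test_C1 tu.
have E : u = fun=> 0.
  apply/funext => x; have [Ox|nO] := pselect (Om x); last by have [] := test_out tu nO.
  exact: (ae_continuous_eq0 oOm (@cu) u0).
by rewrite E gradient0.
Qed.

Let emb : exists2 Ce : R, 0 < Ce & forall u Du, TP u Du -> Phi Du <= 1 ->
  Int (fun x => Psi x `|u x|) <= Ce.
Proof.
have [Ce Ce0 H] := embedding oOm bOm N0 p1' q0 r1 C1 gGx G0 G1 gP P0 P1 mG mP a0 aN inv A1.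
by exists Ce => // u Du [tu ->]; exact: H.
Qed.

Let tot (K eps : R) : 0 < eps -> exists (I : finType) (col : (Rn R N -> R) -> I),
  forall u Du v Dv, TP u Du -> TP v Dv -> Phi Du <= K -> Phi Dv <= K -> col u = col v ->
    Int (fun x => Psi x `|u x - v x|) <= eps.
Proof.
move=> eps0.
have [I [col H]] := compact_colouring oOm bOm N0 p1' q0 r1 C1 gGx G0 G1 gP P0 P1 mG mP a0 aN inv A1 K eps0.
by exists I, col => u Du v Dv [tu ->] [tv ->]; exact: H.
Qed.

Let TPB u v : test_function Om u -> test_function Om v ->
  TP (fun x => u x - v x) (fun x => gradient u x - gradient v x).
Proof.
move=> tu tv; have := TP_lin (-1) (conj tv erefl) (conj tu erefl).
congr TP; apply/funext => x; first by rewrite mulN1r addrC.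
by rewrite scaleN1r addrC.
Qed.

Let dense : exists e_ : nat -> Rn R N -> R, [/\ forall n, TP (e_ n) (gradient (e_ n)),
  ~ {ae mu, forall x, OmR x -> e_ 0%N x = 0} &
  forall u Du (eps : R), TP u Du -> 0 < eps -> exists n, Phi (fun x => Du x - gradient (e_ n) x) <= eps].
Proof.
have [b tb bc0] := test_bump oOm Om0.
have [e_ [te He]] := test_functions_separable bOm.
exists (fun n => if n is n'.+1 then e_ n' else b); split.
- by case=> [|n]; split.
- by move=> /(TP_nondeg (conj tb erefl))[E _]; move: bc0; rewrite E eqxx.
move=> u Du eps [tu ->] eps0.
have CM0 : 0 <= C * fine (mu OmR) by rewrite mulr_ge0 ?fine_ge0// ltW.
have [e /andP[e0 e1] He2] := small_factor CM0 eps0.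
have [k Hk] := He u e tu e0; exists k.+1; apply: le_trans He2.
rewrite mulrA -(Int_cst mu mOm (e * C)).
have Tb := TPB tu (te k).
apply: (Int_le mOm) => [||x Ox].
- exact: (itg_G mOm finOm p1 C1 gG G1 mG TP_meas TP_bdd Tb).
- exact: itg_cst.
apply: le_trans (gf_homo p1' (gGx x) (G0 x) C1 (G1 x) (enorm_ge0 _) (Hk x Ox)) _.
have e01 : 0 <= e <= 1 by rewrite ltW.
have := gf_shrink p1' (gGx x) (G0 x) C1 (G1 x) e01 ler01; rewrite mulr1 => /le_trans; apply.
by rewrite ler_wpM2l ?(ltW e0)//; have /andP[] := G1 x.
Qed.

Let itg_test u : test_function Om u -> adm u (gradient u).
Proof. by move=> tu; exact: (P_adm mOm finOm p1 pq qr C1 gG G1 gP P0 P1 mG mP TP_meas TP_bdd (conj tu erefl)). Qed.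

Lemma itg_of_modular (h : Rn R N -> R) : measurable_fun OmR h ->
  itg (fun x => G x `|h x|) -> itg h.
Proof.
move=> mh ih; have i1 : itg (fun x => 1 + C * G x `|h x|).
  by apply: itgD => //; [exact: itg_cst|exact: itgZ].
by apply: (itg_le mOm mh i1) => x _; exact: (gf_ge p1' (gGx x) (G0 x) C1 (G1 x)).
Qed.

Lemma modular_to_L1 (eps : R) : 0 < eps -> exists2 del : R, 0 < del & forall h : Rn R N -> R,
  measurable_fun OmR h -> itg (fun x => G x `|h x|) -> Int (fun x => G x `|h x|) <= del ->
  Int (fun x => `|h x|) <= eps.
Proof.
move=> eps0; have e20 : 0 < eps / 2 by rewrite divr_gt0.
have m0 : 0 <= fine (mu OmR) by apply: fine_ge0.
have [e e01 He] := small_factor m0 e20; have /andP[e0 e1] := e01.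
have K0 : 0 < C / e `^ q by rewrite divr_gt0 ?powR_gt0.
exists (eps / 2 / (C / e `^ q)) => [|h mh ih Ih]; first by rewrite divr_gt0.
have i1 : itg (fun=> e) by exact: itg_cst.
have i2 := itgZ mOm (C / e `^ q) ih.
apply: (@le_trans _ _ (Int (fun x => e + C / e `^ q * G x `|h x|))).
  apply: (Int_le mOm); [exact/itg_norm/itg_of_modular|exact: itgD|move=> x _].
  exact: (le_modular p1' q0 C1 (gGx x) (G0 x) (G1 x)).
rewrite (IntD mOm i1 i2) (Int_cst mu mOm) (IntZ mOm _ ih) [leRHS](splitr eps).
by apply: lerD => //; rewrite mulrC -ler_pdivlMr.
Qed.

Lemma itg_G_of_Psi (h : Rn R N -> R) : measurable_fun OmR h -> itg (fun x => Psi x `|h x|) ->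
  itg (fun x => G x `|h x|).
Proof.
move=> mh ih; have mnh := measurable_normf mh.
have i1 : itg (fun x => 1 * C + C * (C / 1 `^ r') * Psi x `|h x|).
  by apply: itgD => //; [exact: itg_cst|exact: itgZ].
apply: (itg_le mOm _ i1) => [|x _]; first exact: (mG (w := fun x => `|h x|)).
rewrite ger0_norm ?G_ge0//; apply: (@modular_dominated R p q r r' C (G x) (Psi x)) => //; first exact: ltW.
by rewrite ltr01 lexx.
Qed.

Lemma Psi_to_G (eps : R) : 0 < eps -> exists2 del : R, 0 < del & forall h : Rn R N -> R,
  measurable_fun OmR h -> itg (fun x => Psi x `|h x|) -> Int (fun x => Psi x `|h x|) <= del ->
  Int (fun x => G x `|h x|) <= eps.
Proof.
move=> eps0; have e20 : 0 < eps / 2 by rewrite divr_gt0.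
have m0 : 0 <= C * fine (mu OmR) by rewrite mulr_ge0 ?fine_ge0// ltW.
have [e e01 He] := small_factor m0 e20; have /andP[e0 e1] := e01.
have K0 : 0 < C * (C / e `^ r') by rewrite mulr_gt0// divr_gt0 ?powR_gt0.
exists (eps / 2 / (C * (C / e `^ r'))) => [|h mh ih Ih]; first by rewrite divr_gt0.
have i1 : itg (fun=> e * C) by exact: itg_cst.
have i2 := itgZ mOm (C * (C / e `^ r')) ih.
apply: (@le_trans _ _ (Int (fun x => e * C + C * (C / e `^ r') * Psi x `|h x|))).
  apply: (Int_le mOm); [exact: itg_G_of_Psi|exact: itgD|move=> x _].
  by apply: (@modular_dominated R p q r r' C (G x) (Psi x)) => //; exact: ltW.
rewrite (IntD mOm i1 i2) (Int_cst mu mOm) (IntZ mOm _ ih) [leRHS](splitr eps).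
by apply: lerD; [rewrite -mulrA|rewrite mulrC -ler_pdivlMr].
Qed.

Lemma modularE (h : Rn R N -> R) : itg (fun x => G x `|h x|) ->
  modular Om G h = (Int (fun x => G x `|h x|))%:E.
Proof. by move=> ih; exact: (Int_EFin mOm ih). Qed.

Lemma normLG_le (eps : R) : 0 < eps -> exists2 del : R, 0 < del & forall h : Rn R N -> R,
  measurable_fun OmR h -> itg (fun x => G x `|h x|) -> Int (fun x => G x `|h x|) <= del ->
  (normLG Om G h <= eps%:E)%E.
Proof.
move=> eps0; pose l := Num.min eps 1.
have l0 : 0 < l by rewrite lt_min eps0 ltr01.
have l1 : l <= 1 by rewrite ge_min lexx orbT.
have le : l <= eps by rewrite ge_min lexx.
have li : 1 <= l^-1 by rewrite invf_ge1.
have lq : 0 < l^-1 `^ q by rewrite powR_gt0 ?invr_gt0.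
exists (l^-1 `^ q)^-1 => [|h mh ih Ih]; first by rewrite invr_gt0.
apply: (@le_trans _ _ l%:E); last by rewrite lee_fin.
apply: ereal_inf_lbound; exists l => //; split => //.
have mh' : measurable_fun OmR (fun x => `|h x / l|).
  exact: measurable_norm_div.
have i2 := itgZ mOm (l^-1 `^ q) ih.
have Gle (x : Rn R N) : G x `|h x / l| <= l^-1 `^ q * G x `|h x|.
  rewrite normrM [`|l^-1|]ger0_norm ?invr_ge0 ?(ltW l0)// mulrC.
  exact: (gf_grow (gGx x)).
have i1 : itg (fun x => G x `|h x / l|).
  apply: (itg_le mOm _ i2) => [|x _]; first exact: (mG (w := fun x => `|h x / l|)).
  by rewrite ger0_norm ?G_ge0.
rewrite (modularE i1) lee_fin; apply: (le_trans (Int_le mOm i1 i2 (fun x _ => Gle x))).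
by rewrite (IntZ mOm _ ih) mulrC -ler_pdivlMr// mul1r.
Qed.

Lemma normLG_lt (eps : R) (h : Rn R N -> R) : 0 < eps <= 1 -> measurable_fun OmR h ->
  (normLG Om G h < eps%:E)%E -> itg (fun x => G x `|h x|) /\ Int (fun x => G x `|h x|) <= eps.
Proof.
move=> /andP[e0 e1] mh /ereal_inf_lt[_ [l [l0 ml] <-]]; rewrite lte_fin => le.
have mh' : measurable_fun OmR (fun x => `|h x / l|).
  exact: measurable_norm_div.
have mGh : measurable_fun OmR (fun x => G x `|h x / l|) by exact: (mG (w := fun x => `|h x / l|)).
have [i1 I1] : itg (fun x => G x `|h x / l|) /\ Int (fun x => G x `|h x / l|) <= 1.
  by apply: (Int_lt_EFin mOm mGh) => [x _|]; [exact: G_ge0|exact: ml].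
have i2 := itgZ mOm l i1.
have l01 : 0 <= l <= 1 by rewrite (ltW l0)/= (le_trans (ltW le)).
have Gle (x : Rn R N) : G x `|h x| <= l * G x `|h x / l|.
  have := gf_shrink p1' (gGx x) (G0 x) C1 (G1 x) l01 (normr_ge0 (h x / l)).
  by rewrite normrM [`|l^-1|]ger0_norm ?invr_ge0 ?(ltW l0)// mulrCA mulfV ?gt_eqF// mulr1.
have i3 : itg (fun x => G x `|h x|).
  apply: (itg_le mOm _ i2) => [|x _]; last by rewrite ger0_norm ?G_ge0.
  exact: (mG (measurable_normf mh) (fun x => normr_ge0 _)).
split => //; apply: (le_trans (Int_le mOm i3 i2 (fun x _ => Gle x))).
rewrite (IntZ mOm _ i1); apply: le_trans (ltW le); by rewrite ler_piMr// ltW.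
Qed.

(** Dominated convergence of a constant sequence: its almost everywhere limit may be any function
    equal to it off a null set. *)
Lemma Int_ae (v w : Rn R N -> R) : measurable_fun OmR v -> measurable_fun OmR w ->
  {ae mu, forall x, OmR x -> v x = w x} -> itg v -> itg w /\ Int w = Int v.
Proof.
move=> mv mw vw iv.
have [||iw cw] := @Int_dominated _ (Rn R N) R mu OmR mOm (fun=> v) w (fun x => `|v x|) (fun=> mv) mw _ (itg_norm mOm iv).
- by apply: filterS vw => x H Ox; rewrite -(H Ox); exact: cvg_cst.
- by apply: aeW => x n _.
by split => //; apply/esym; apply: (cvg_unique _ (cvg_cst (Int v)) cw).
Qed.

Lemma loc_of_itg (v : 'rV[R]_N -> R) : itg v -> loc_integrable Om v.
Proof.
move=> iv; split; first exact: itg_measurable iv.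
move=> K cK KO; apply: (integrableS mOm _ KO iv).
rewrite -[K]setCK; apply: measurableC; apply: open_Rn; apply: closed_openC.
exact: compact_closed.
Qed.

Lemma enorm_itg (Dv : Rn R N -> 'rV[R]_N) : measurable_vec OmR Dv -> itg (fun x => G x (enorm (Dv x))) ->
  itg (fun x => enorm (Dv x)).
Proof.
move=> mv iv; apply: itg_of_modular; first exact: measurable_enorm.
by apply: (itg_eq mOm _ iv) => x _; rewrite ger0_norm ?enorm_ge0.
Qed.

Lemma coord_itg (Dv : Rn R N -> 'rV[R]_N) i : measurable_vec OmR Dv -> itg (fun x => G x (enorm (Dv x))) ->
  itg (fun x => Dv x 0 i).
Proof.
move=> mv iv; apply: (itg_le mOm (mv i) (enorm_itg mv iv)) => x _.
exact: le_trans (norm_coord _ _) (norm_le_enorm _).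
Qed.

Lemma itg_bounded_mul (v b : Rn R N -> R) (B : R) : itg v -> measurable_fun OmR b ->
  (forall x, `|b x| <= B) -> itg (fun x => v x * b x).
Proof.
move=> iv mb bB; apply: (itg_le mOm _ (itgZ mOm B (itg_norm mOm iv))) => [|x _].
  by apply: measurable_funM => //; exact: itg_measurable iv.
by rewrite normrM mulrC ler_wpM2r.
Qed.

Lemma Int_bounded_mul (v b : Rn R N -> R) (B : R) : itg v -> measurable_fun OmR b ->
  (forall x, `|b x| <= B) -> `|Int (fun x => v x * b x)| <= B * Int (fun x => `|v x|).
Proof.
move=> iv mb bB; have ib := itg_bounded_mul iv mb bB.
apply: le_trans (Int_norm mOm ib) _; rewrite -(IntZ mOm B (itg_norm mOm iv)).
apply: (Int_le mOm (itg_norm mOm ib) (itgZ mOm B (itg_norm mOm iv))) => x _.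
by rewrite normrM mulrC ler_wpM2r.
Qed.

Let approximable u Du := forall eps : R, 0 < eps -> exists w, [/\ test_function Om w,
  Phi (fun x => Du x - gradient w x) <= eps & Int (fun x => Psi x `|u x - w x|) <= eps].

(** The distributional identity holds for the approximating test functions by [test_parts], and both
    of its sides are continuous in [L^1], which small modulars control. *)
Lemma weak_gradient_limit u Du : adm u Du -> approximable u Du -> weak_gradient Om u Du.
Proof.
move=> au ap; have [mu_ mDu iP iG] := au.
have iu : itg u by apply: itg_of_modular => //; exact: itg_G_of_Psi.
split; [exact: loc_of_itg|by move=> i; apply: loc_of_itg; exact: coord_itg|].
move=> phi tphi i; have [B HB] := test_bounded tphi.
have [mphi mdphi] := TP_meas (conj tphi erefl).
have md : measurable_fun OmR (partial i phi : Rn R N -> R).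
  by apply: eq_measurable_fun (mdphi i) => x _; rewrite mxE.
have dB x : `|partial i phi x| <= B.
  have [_ h] := HB x; apply: le_trans h; apply: le_trans (norm_le_enorm _).
  by have := norm_coord (gradient phi x) i; rewrite mxE.
have B0 : 0 <= B by have [+ _] := HB c0; apply: le_trans.
have iD := coord_itg i mDu iG.
apply/eqP; rewrite -subr_eq0 opprK -normr_eq0 eq_le normr_ge0 andbT.
apply/ler_addgt0Pl => eps eps0; rewrite addr0.
have B1 : 0 <= B + B by rewrite addr_ge0.
have [e /andP[e0 _] He] := small_factor B1 eps0.
have [d1 d10 Hd1] := modular_to_L1 e0.
have [d2 d20 Hd2] := Psi_to_G d10.
have m0 : 0 < Num.min d1 d2 by rewrite lt_min d10.
have [w [tw]] := ap _ m0; rewrite !le_min => /andP[w1 _] /andP[_ w2].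
have [aw1 aw2 aw3 aw4] := itg_test tw.
have [b1 b2 b3 b4] := admB mOm p1 pq qr C1 gG G1 gP P0 P1 mG mP au (itg_test tw).
have iw : itg w by apply: itg_of_modular => //; exact: itg_G_of_Psi.
have iuw := itgB mOm iu iw.
have iDw := coord_itg i aw2 aw4.
have iDD : itg (fun x => Du x 0 i - gradient w x 0 i) by exact: itgB.
have s1 : Int (fun x => `|u x - w x|) <= e.
  by apply: Hd1 => //; [exact: itg_G_of_Psi|apply: Hd2].
have s2 : Int (fun x => `|Du x 0 i - gradient w x 0 i|) <= e.
  have iE := enorm_itg b2 b4.
  apply: (@le_trans _ _ (Int (fun x => `|enorm (Du x - gradient w x)|))).
    apply: (Int_le mOm (itg_norm mOm iDD) (itg_norm mOm iE)) => x _.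
    rewrite [leRHS]ger0_norm ?enorm_ge0//; apply: le_trans (norm_le_enorm _).
    by have := norm_coord (Du x - gradient w x) i; rewrite !mxE.
  apply: Hd1; first exact: measurable_enorm.
    by apply: (itg_eq mOm _ b4) => x _; rewrite ger0_norm ?enorm_ge0.
  apply: le_trans w1; rewrite le_eqVlt; apply/orP; left; apply/eqP.
  by apply: Int_eq => x _; rewrite ger0_norm ?enorm_ge0.
have tp := test_parts i oOm bOm tw tphi.
have tp' : Int (fun x => w x * partial i phi x) + Int (fun x => gradient w x 0 i * phi x) = 0.
  rewrite [X in X + _]tp (_ : Int (fun x => gradient w x 0 i * phi x) = Int (fun x => partial i w x * phi x)).
    by rewrite addNr.
  by apply: Int_eq => x _; rewrite mxE.
have pB x : `|phi x| <= B by have [] := HB x.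
have e1 : Int (fun x => u x * partial i phi x) =
    Int (fun x => (u x - w x) * partial i phi x) + Int (fun x => w x * partial i phi x).
  rewrite -(IntD mOm (itg_bounded_mul iuw md dB) (itg_bounded_mul iw md dB)).
  by apply: Int_eq => x _; rewrite -mulrDl subrK.
have e2 : Int (fun x => Du x 0 i * phi x) =
    Int (fun x => (Du x 0 i - gradient w x 0 i) * phi x) + Int (fun x => gradient w x 0 i * phi x).
  rewrite -(IntD mOm (itg_bounded_mul iDD mphi pB) (itg_bounded_mul iDw mphi pB)).
  by apply: Int_eq => x _; rewrite -mulrDl subrK.
have -> : \int[mu]_(x in (Om : set (Rn R N))) (u x * partial i phi x) +
    \int[mu]_(x in (Om : set (Rn R N))) (Du x 0 i * phi x) =
  Int (fun x => (u x - w x) * partial i phi x) + Int (fun x => (Du x 0 i - gradient w x 0 i) * phi x).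
  rewrite -[LHS]/(Int (fun x => u x * partial i phi x) + Int (fun x => Du x 0 i * phi x)) e1 e2.
  by rewrite addrACA tp' addr0.
apply: le_trans (ler_normD _ _) _; apply: le_trans He; rewrite mulrDr.
apply: lerD.
  by apply: le_trans (Int_bounded_mul iuw md dB) _; rewrite mulrC ler_wpM2r.
by apply: le_trans (Int_bounded_mul iDD mphi pB) _; rewrite mulrC ler_wpM2r.
Qed.

Lemma W1G0_limit u Du : adm u Du -> approximable u Du -> W1G0 Om G u Du.
Proof.
move=> au ap; have [mu_ mDu iP iG] := au.
have iGe (Dv : Rn R N -> 'rV[R]_N) : itg (fun x => G x (enorm (Dv x))) -> itg (fun x => G x `|enorm (Dv x)|).
  by apply: (itg_eq mOm) => x _; rewrite ger0_norm ?enorm_ge0.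
split.
  split; last 1 first.
  - split; first exact: measurable_enorm.
    by rewrite modularE ?ltry//; exact: iGe.
  - split => //; rewrite modularE ?ltry//; exact: itg_G_of_Psi.
  - exact: weak_gradient_limit.
move=> e e0; have e40 : 0 < e / 4 by rewrite divr_gt0.
have [d1 d10 Hd1] := normLG_le e40.
have [d2 d20 Hd2] := Psi_to_G d10.
have m0 : 0 < Num.min d1 d2 by rewrite lt_min d10.
have [w [tw]] := ap _ m0; rewrite !le_min => /andP[w1 _] /andP[_ w2].
exists w => //.
have [b1 b2 b3 b4] := admB mOm p1 pq qr C1 gG G1 gP P0 P1 mG mP au (itg_test tw).
have n1 : (normLG Om G (u \- w)%R <= (e / 4)%:E)%E.
  by apply: Hd1 => //; [exact: itg_G_of_Psi|apply: Hd2].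
have n2 : (normLG Om G (enorm \o (fun x => Du x - gradient w x)%R) <= (e / 4)%:E)%E.
  apply: Hd1; [exact: measurable_enorm|exact: iGe|].
  apply: le_trans w1; rewrite le_eqVlt; apply/orP; left; apply/eqP.
  by apply: Int_eq => x _; rewrite /comp ger0_norm ?enorm_ge0.
apply: le_lt_trans (leeD n1 n2) _; rewrite -EFinD lte_fin.
by move: e0; lra.
Qed.

Lemma normLG_ge0 (h : 'rV[R]_N -> R) : (0 <= normLG Om G h)%E.
Proof. by apply: le_ereal_inf_tmp => _ [l [l0 _] <-]; rewrite lee_fin ltW. Qed.

Lemma W1G0_measurable v Dv : W1G0 Om G v Dv ->
  [/\ measurable_fun OmR v, measurable_vec OmR Dv & itg (fun x => G x (enorm (Dv x)))].
Proof.
move=> [[[mv _] [_ lD _] [mD fD]] _].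
have mvD : measurable_vec OmR Dv by move=> i; have [] := lD i.
split; [exact: mv|exact: mvD|].
apply/integrableP; split.
  by apply/measurable_EFinP; apply: (mG (w := fun x => enorm (Dv x))) => // x; exact: enorm_ge0.
rewrite (@eq_integral _ _ _ mu OmR (fun x => (G x `|(enorm \o Dv) x|)%:E)); first exact: fD.
by move=> x _ /=; rewrite (ger0_norm (enorm_ge0 _)) ger0_norm// G_ge0// enorm_ge0.
Qed.

Lemma W1G0_approx v Dv (eps : R) : W1G0 Om G v Dv -> 0 < eps <= 1 -> exists w,
  [/\ test_function Om w, itg (fun x => G x `|v x - w x|), Int (fun x => G x `|v x - w x|) <= eps &
     Phi (fun x => Dv x - gradient w x) <= eps].
Proof.
move=> Wv /andP[e0 e1]; have [mv mDv iDv] := W1G0_measurable Wv.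
have [w tw nw] := Wv.2 _ e0.
have [mw mDw] := TP_meas (conj tw erefl).
have e01 : 0 < eps <= 1 by rewrite e0.
have n1 : (normLG Om G (v \- w)%R < eps%:E)%E.
  by apply: le_lt_trans nw; rewrite leeDl// normLG_ge0.
have n2 : (normLG Om G (enorm \o (fun x => Dv x - gradient w x)%R) < eps%:E)%E.
  by apply: le_lt_trans nw; rewrite leeDr// normLG_ge0.
have [i1 I1] := normLG_lt e01 (measurable_funB mv mw) n1.
have mDD : measurable_vec OmR (fun x => Dv x - gradient w x) by exact: measurable_vecB.
have [_ I2] := normLG_lt e01 (measurable_enorm mDD) n2.
exists w; split => //; apply: le_trans I2; rewrite le_eqVlt; apply/orP; left; apply/eqP.
by apply: Int_eq => x _; rewrite /comp ger0_norm ?enorm_ge0.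
Qed.

Let delta (k : nat) : R := k.+1%:R^-1.
Let delta01 k : 0 < delta k <= 1. Proof. by rewrite invr_gt0 ltr0n /= invf_le1// ler1n. Qed.
Let delta_le k n : (k <= n)%N -> delta n <= delta k.
Proof. by move=> kn; rewrite lef_pV2 ?posrE ?ltr0n// ler_nat ltnS. Qed.
Let delta_small (e : R) : 0 < e -> exists k, delta k <= e.
Proof.
move=> e0; exists (Num.truncn e^-1); rewrite /delta -[leRHS]invrK lef_pV2 ?posrE ?invr_gt0//.
exact/ltW/truncnS_gt.
Qed.

(** Convergence of the gradients in the [G]-modular makes differences of the approximants small
    there, and the scaled embedding then applies to these differences. *)
Lemma psi_cauchy (psi : nat -> 'rV[R]_N -> R) Dv : measurable_vec OmR Dv ->
  itg (fun x => G x (enorm (Dv x))) -> (forall n, test_function Om (psi n)) ->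
  (forall n, Phi (fun x => Dv x - gradient (psi n) x) <= delta n) ->
  forall eps : R, 0 < eps -> exists n0, forall n m, (n0 <= n)%N -> (n0 <= m)%N ->
    Int (fun x => Psi x `|psi n x - psi m x|) <= eps.
Proof.
move=> mDv iDv tpsi Hpsi eps eps0.
have [Ce Ce0 H] := emb_scaled mOm finOm p1 pq qr C1 gG G1 gP P0 P1 mG mP TP_zero TP_lin TP_meas TP_bdd emb.
have [l l01 Hl] := small_factor (ltW Ce0) eps0; have /andP[l0 l1] := l01.
have lq : 0 < l `^ q / (2 `^ q * 2) by rewrite divr_gt0 ?mulr_gt0 ?powR_gt0.
have [k Hk] := delta_small lq.
exists k => n m kn km.
have Pnm : Phi (fun x => gradient (psi n) x - gradient (psi m) x) <= l `^ q.
  have iDn j : itg (fun x => G x (enorm (Dv x - gradient (psi j) x))).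
    have [_ mj _ ij] := itg_test (tpsi j).
    have aD : measurable_vec OmR (fun x => Dv x - gradient (psi j) x) by exact: measurable_vecB.
    have i1 : itg (fun x => 2 `^ q * (G x (enorm (Dv x)) + G x (enorm (gradient (psi j) x)))).
      by apply: itgZ => //; exact: itgD.
    apply: (itg_le mOm _ i1) => [|x _].
      apply: (mG (w := fun x => enorm (Dv x - gradient (psi j) x))); first exact: measurable_enorm.
      by move=> x; exact: enorm_ge0.
    rewrite ger0_norm ?G_ge0 ?enorm_ge0//.
    apply: le_trans (gf_homo p1' (gGx x) (G0 x) C1 (G1 x) (enorm_ge0 _) (enormB _ _)) _.
    by apply: (gf_add p1' (gGx x) (G0 x) C1 (G1 x)); exact: enorm_ge0.
  have iS := itgZ mOm (2 `^ q) (itgD mOm (iDn m) (iDn n)).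
  have [_ _ _ inm] := admB mOm p1 pq qr C1 gG G1 gP P0 P1 mG mP (itg_test (tpsi n)) (itg_test (tpsi m)).
  apply: (@le_trans _ _ (2 `^ q * (Phi (fun x => Dv x - gradient (psi m) x) + Phi (fun x => Dv x - gradient (psi n) x)))).
    rewrite -(IntD mOm (iDn m) (iDn n)) -(IntZ mOm _ (itgD mOm (iDn m) (iDn n))).
    apply: (Int_le mOm inm iS) => x _.
    apply: le_trans (gf_add p1' (gGx x) (G0 x) C1 (G1 x) (enorm_ge0 _) (enorm_ge0 _)).
    apply: (gf_homo p1' (gGx x) (G0 x) C1 (G1 x) (enorm_ge0 _)).
    apply: le_trans (enormB _ _); rewrite le_eqVlt; apply/orP; left; apply/eqP; congr enorm.
    by rewrite [in RHS]opprB [RHS]addrC addrA subrK.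
  apply: (@le_trans _ _ (2 `^ q * (delta k + delta k))).
    rewrite ler_wpM2l ?powR_ge0//; apply: lerD; apply: le_trans (Hpsi _) _; exact: delta_le.
  by move: Hk; rewrite ler_pdivlMr ?mulr_gt0 ?powR_gt0// => Hk; apply: le_trans Hk; rewrite le_eqVlt; apply/orP; left; apply/eqP; ring.
have [B _] := H l _ _ (TPB (tpsi n) (tpsi m)) l01 Pnm; apply: le_trans B _; apply: le_trans Hl.
rewrite mulrC ler_wpM2r ?(ltW Ce0)//.
by have := ger_powR l01 r1; rewrite powRr1// ltW.
Qed.

(** Membership only provides test functions that approach [v] in the [G]-norm. They are Cauchy in
    the [Psi]-modular, so a subsequence has a [Psi]-limit [u], and it remains to see that [u = v]
    almost everywhere. *)
Lemma W1G0_adm v Dv : W1G0 Om G v Dv -> adm v Dv /\ approximable v Dv.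
Proof.
move=> Wv; have [mv mDv iDv] := W1G0_measurable Wv.
have /choice[psi Hpsi] n := W1G0_approx Wv (delta01 n).
have tpsi n : test_function Om (psi n) by have [] := Hpsi n.
have cau : forall eps : R, 0 < eps -> exists n0, forall n m, (n0 <= n)%N -> (n0 <= m)%N ->
    Int (fun x => Psi x `|psi n x - psi m x|) <= eps.
  by apply: (psi_cauchy mDv iDv tpsi) => n; have [] := Hpsi n.
have k1 (k : nat) : (1 : R) <= 2 ^+ k by rewrite exprn_ege1// ler1n.
have k0 (k : nat) : (0 : R) < 2 ^+ k by rewrite exprn_gt0.
have iB n m : itg (fun x => Psi x `|psi n x - psi m x|).
  by have [] := admB mOm p1 pq qr C1 gG G1 gP P0 P1 mG mP (itg_test (tpsi n)) (itg_test (tpsi m)).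
have mB n : measurable_fun OmR (psi n) by have [] := TP_meas (conj (tpsi n) erefl).
have mnB n m : measurable_fun OmR (fun x => `|psi n x - psi m x|).
  exact: (measurable_normB (mB n) (mB m)).
have iP k n m : itg (fun x => Psi x (2 ^+ k * `|psi n x - psi m x|)).
  apply: (itg_le mOm _ (itgZ mOm ((2 ^+ k) `^ r') (iB n m))) => [|x _].
    apply: (mP (w := fun x => 2 ^+ k * `|psi n x - psi m x|)) => [|x]; last by rewrite mulr_ge0// ltW.
    by apply: measurable_funM => //; exact: measurable_cst.
  by rewrite ger0_norm ?P_ge0 ?mulr_ge0 ?(ltW (k0 k))//; exact: (gf_grow (gP x)).
pose Q k n m := Int (fun x => Psi x (2 ^+ k * `|psi n x - psi m x|)) <= 2^-1 ^+ k.
have [|t tk HQ] := @rapid_subsequence Q.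
  move=> k; have e0 : 0 < (2^-1 : R) ^+ k / (2 ^+ k) `^ r' by rewrite divr_gt0 ?powR_gt0 ?exprn_gt0 ?invr_gt0.
  have [n0 Hn0] := cau _ e0; exists n0 => n m n0n n0m.
  apply: (@le_trans _ _ ((2 ^+ k) `^ r' * Int (fun x => Psi x `|psi n x - psi m x|))).
    rewrite -(IntZ mOm _ (iB n m)); apply: (Int_le mOm (iP k n m) (itgZ mOm _ (iB n m))) => x _.
    exact: (gf_grow (gP x)).
  by rewrite mulrC -ler_pdivlMr ?powR_gt0//; exact: Hn0.
pose w k := psi (t k); have mw k : measurable_fun OmR (w k) by exact: mB.
have [u [h [mu_ mh hu ih cu]]] := @modular_limit _ (Rn R N) R mu OmR mOm r r' C Psi r1 gP P0 C1 P1 mP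
  w (fun k => mB _) (fun k => iP k _ _) HQ.
have h0 x : 0 <= h x by have [] := hu x.
have uw0 x : `|u x - w 0%N x| <= h x by have [] := hu x.
have ih' : itg h.
  apply: itg_of_modular => //; apply: itg_G_of_Psi => //.
  by apply: (itg_eq mOm _ ih) => x _; rewrite ger0_norm.
have near0 : {ae mu, forall x, OmR x -> u x - w n x @[n --> \oo] --> 0 /\ forall k, `|u x - w k x| <= h x + h x}.
  apply: filterS cu => x H Ox; have [c1 c2] := H Ox; split.
    by rewrite -(subrr (u x)); apply: cvgB => //; exact: cvg_cst.
  move=> k; have -> : u x - w k x = (u x - w 0%N x) - (w k x - w 0%N x) by ring.
  by apply: le_trans (ler_normB _ _) _; exact: lerD.
have mD k : measurable_fun OmR (fun x => `|u x - w k x|).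
  exact: (measurable_normB mu_ (mw k)).
have L1 : Int (fun x => `|u x - w k x|) @[k --> \oo] --> Int (fun=> 0).
  have [||_ ] // := @Int_dominated _ (Rn R N) R mu OmR mOm (fun k x => `|u x - w k x|) (fun=> 0)
    (fun x => h x + h x) mD (measurable_cst _) _ (itgD mOm ih' ih').
  - apply: filterS near0 => x H Ox; have [c1 _] := H Ox.
    by rewrite -(normr0 R); exact: cvg_norm.
  - by apply: filterS near0 => x H n Ox; rewrite normr_id; have [_] := H Ox; apply.
have mPD k : measurable_fun OmR (fun x => Psi x `|u x - w k x|) by exact: (mP (w := fun x => `|u x - w k x|) (mD k) (fun x => normr_ge0 _)).
have LP : Int (fun x => Psi x `|u x - w k x|) @[k --> \oo] --> Int (fun=> 0).
  have i2 := itg_PsiD mOm p1 pq qr C1 gP P0 P1 mP mh mh h0 h0 ih ih.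
  have [||_ ] // := @Int_dominated _ (Rn R N) R mu OmR mOm (fun k x => Psi x `|u x - w k x|) (fun=> 0)
    (fun x => Psi x (h x + h x)) mPD (measurable_cst _) _ i2.
  - apply: filterS near0 => x H Ox; have [c1 _] := H Ox.
    apply: (gf_cvg0 r1 (gP x) (P0 x) C1 (P1 x)) => //.
    by rewrite -(normr0 R); exact: cvg_norm.
  - apply: filterS near0 => x H n Ox; have [_ c2] := H Ox; rewrite ger0_norm ?P_ge0//.
    exact: (gf_homo r1 (gP x) (P0 x) C1 (P1 x)).
rewrite (Int_cst mu mOm) mul0r in L1 LP.
have iw k : itg (w k) by have [a1 _ a3 _] := itg_test (tpsi (t k)); apply: itg_of_modular => //; exact: itg_G_of_Psi.
have iPu : itg (fun x => Psi x `|u x|).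
  have [_ _ a3 _] := itg_test (tpsi (t 0%N)).
  have iU : itg (fun x => Psi x (`|w 0%N x| + h x)).
    exact: (itg_PsiD mOm p1 pq qr C1 gP P0 P1 mP (measurable_normf (mw 0%N)) mh (fun x => normr_ge0 _) h0 a3 ih).
  apply: (itg_Psi_le mOm p1 pq qr C1 gP P0 P1 mP mu_ iU) => x.
  by rewrite -[u x](subrK (w 0%N x)) addrC; apply: le_trans (ler_normD _ _) _; rewrite lerD2l.
have iu : itg u by apply: itg_of_modular => //; exact: itg_G_of_Psi.
have ivw k : itg (fun x => v x - w k x).
  have [_ i1 _ _] := Hpsi (t k).
  exact: (itg_of_modular (measurable_funB mv (mw k)) i1).
have ivu : itg (fun x => v x - u x).
  have := itgD mOm (ivw 0%N) (itgB mOm (iw 0%N) iu).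
  by apply: (itg_eq mOm) => x _; rewrite addrA subrK.
(* Both modulars control the [L^1] distance, so [v] and [u] are [L^1] limits of the same
   sequence. *)
have I0 : Int (fun x => `|v x - u x|) <= 0.
  apply/ler_addgt0Pl => e e0; rewrite addr0.
  have e20 : 0 < e / 2 by rewrite divr_gt0.
  have [d1 d10 Hd1] := modular_to_L1 e20.
  have [j Hj] := delta_small d10.
  have /cvgrPdist_le /(_ _ e20) [j' _ Hj'] := L1.
  pose k := maxn j j'.
  have a1 : Int (fun x => `|v x - w k x|) <= e / 2.
    have [_ i1 I1 _] := Hpsi (t k).
    apply: (Hd1 _ (measurable_funB mv (mw k)) i1).
    apply: le_trans I1 _; apply: le_trans Hj; apply: delta_le.
    by apply: leq_trans (tk k); exact: leq_maxl.
  have a2 : Int (fun x => `|u x - w k x|) <= e / 2.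
    by have := Hj' k (leq_maxr _ _); rewrite sub0r normrN; apply: le_trans; exact: ler_norm.
  have i1 := itg_norm mOm (ivw k); have i2 := itg_norm mOm (itgB mOm iu (iw k)).
  rewrite (splitr e); apply: le_trans (lerD a1 a2); rewrite -(IntD mOm i1 i2).
  apply: (Int_le mOm (itg_norm mOm ivu) (itgD mOm i1 i2)) => x _.
  have -> : v x - u x = (v x - w k x) - (u x - w k x) by ring.
  exact: ler_normB.
have vu : {ae mu, forall x, OmR x -> u x = v x}.
  have := Int_eq0 mOm (itg_norm mOm ivu) (fun x _ => normr_ge0 _) I0.
  apply: filterS => x H Ox; have /eqP := H Ox.
  by rewrite normr_eq0 subr_eq0 => /eqP.
have mPv : measurable_fun OmR (fun x => Psi x `|v x|).
  exact: (mP (measurable_normf mv) (fun x => normr_ge0 _)).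
have mPu : measurable_fun OmR (fun x => Psi x `|u x|).
  exact: (mP (measurable_normf mu_) (fun x => normr_ge0 _)).
split.
  split => //.
  have [|//] := Int_ae mPu mPv _ iPu.
  by apply: filterS vu => x H Ox; rewrite H.
move=> eps eps0.
have /cvgrPdist_le /(_ _ eps0) [j' _ Hj'] := LP.
have [j Hj] := delta_small eps0; pose k := maxn j j'.
exists (w k); split; first exact: tpsi.
  have [_ _ _ I1] := Hpsi (t k); apply: le_trans I1 _; apply: le_trans Hj; apply: delta_le.
  by apply: leq_trans (tk k); exact: leq_maxl.
have mv' : measurable_fun OmR (fun x => Psi x `|v x - w k x|).
  exact: (mP (measurable_normB mv (mw k)) (fun x => normr_ge0 _)).
have iuw : itg (fun x => Psi x `|u x - w k x|).
  have iPw : itg (fun x => Psi x `|w k x|) by have [_ _ ? _] := itg_test (tpsi (t k)).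
  have iU : itg (fun x => Psi x (`|u x| + `|w k x|)).
    exact: (itg_PsiD mOm p1 pq qr C1 gP P0 P1 mP (measurable_normf mu_) (measurable_normf (mw k))
      (fun x => normr_ge0 _) (fun x => normr_ge0 _) iPu iPw).
  by apply: (itg_Psi_le mOm p1 pq qr C1 gP P0 P1 mP (measurable_funB mu_ (mw k)) iU) => x; exact: ler_normB.
have [|_ ->] := Int_ae (mPD k) mv' _ iuw.
  by apply: filterS vu => x H Ox; rewrite H.
by have := Hj' k (leq_maxr _ _); rewrite sub0r normrN; apply: le_trans; exact: ler_norm.
Qed.

Lemma solution_everywhere : exists u Du, [/\ W1G0 Om G u Du,
  forall v Dv, W1G0 Om G v Dv -> [/\
    itg (fun x => dotv (flux g x (Du x)) (Dv x)), itg (fun x => f x (u x) * v x) &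
    Int (fun x => dotv (flux g x (Du x)) (Dv x)) = Int (fun x => f x (u x) * v x)] &
  ~ ae_in Om (fun x => u x = 0)].
Proof.
have [e_ [te e0 He]] := dense.
have [u [Du [w [Dw [au Pw lim eqn nz]]]]] := galerkin_limit mOm finOm p1 pq qr C1 gG G1 gP P0 P1 mG mg mP mf mF
  fc Fd F0 fb fs t0_gt0 thq AR TP_zero TP_lin TP_meas TP_bdd emb TP_nondeg te e0 He tot.
have ap : approximable u Du.
  move=> eps eps0; have [k [l1 l2]] := lim eps eps0; have [tw Ew] := Pw k.
  exists (w k); split; [exact: tw| |]; rewrite -?Ew.
    by rewrite (Phi_sym mu OmR G).
  by apply: le_trans l2; rewrite le_eqVlt; apply/orP; left; apply/eqP; apply: Int_eq => x _; rewrite distrC.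
exists u, Du; split => //; first exact: W1G0_limit.
move=> v Dv /W1G0_adm[av apv]; split.
- exact: (adm_stress mOm p1 pq C1 gG G1 mg au av).
- exact: (adm_force mOm finOm p1 pq qr C1 gP P0 P1 mf fb au av).
apply: (weak_equation_closed mOm finOm p1 pq qr C1 gG G1 gP P0 P1 mG mg mP mf fb au av) => eps eps0.
have [w' [tw' w1 w2]] := apv eps eps0.
by exists w', (gradient w'); split => //; [exact: itg_test|exact: eqn].
Qed.

End everywhere.

Lemma measurable_div d (T : measurableType d) (R : realType) (D : set T) (h : T -> R) (l : R) :
  measurable_fun D h -> measurable_fun D (fun x => h x / l).
Proof. by move=> mh; apply: measurable_funM => //; exact: measurable_cst. Qed.

(** * Changing the integrands on a null set *)

Section almost_everywhere.
Context {R : realType} {N : nat}.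
Local Notation mu := (@lebesgue_Rn R N).
Variable Om : set 'rV[R]_N.
Hypothesis oOm : open Om.
Variable Z : set (Rn R N).
Hypothesis nZ : mu.-negligible Z.

Let OmR : set (Rn R N) := Om.
Let mOm : measurable OmR. Proof. exact: open_Rn. Qed.

Let ae_of (P : 'rV[R]_N -> Prop) : (forall x, Om x -> ~ Z x -> P x) -> {ae mu, forall x, OmR x -> P x}.
Proof.
move=> H; apply: negligibleS nZ => x /= nx; apply: contrapT => nZx; apply: nx => Ox.
exact: H.
Qed.

Lemma Int_congr_ae (v w : 'rV[R]_N -> R) : (forall x, Om x -> ~ Z x -> v x = w x) ->
  itg mu OmR v -> itg mu OmR w /\ Int mu OmR w = Int mu OmR v.
Proof.
move=> vw iv; have mv : Lmeasurable Om v by exact: itg_measurable iv.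
have mw : Lmeasurable Om w by exact: (Lmeasurable_ae nZ vw mv).
exact: (Int_ae oOm mv mw (ae_of vw) iv).
Qed.

Variables G H : 'rV[R]_N -> R -> R.
Hypothesis GH : forall x, Om x -> ~ Z x -> G x = H x.
Hypothesis mG : superposition_measurable Om G.

Lemma superposition_ae : superposition_measurable Om H.
Proof.
by move=> w mw w0; apply: (Lmeasurable_ae nZ _ (mG mw w0)) => x Ox nZx; rewrite GH.
Qed.

Lemma modular_ae (v : 'rV[R]_N -> R) : Lmeasurable Om v -> modular Om G v = modular Om H v.
Proof.
move=> mv; have mn : Lmeasurable Om (fun x => `|v x|) by exact: (measurable_normf mv).
apply: (@ae_eq_integral _ _ _ mu OmR (fun x => (H x `|v x|)%:E) (fun x => (G x `|v x|)%:E) mOm).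
- by apply/measurable_EFinP; exact: (mG mn (fun x => normr_ge0 _)).
- by apply/measurable_EFinP; exact: (superposition_ae mn (fun x => normr_ge0 _)).
by apply: (ae_of (P := fun x => (G x `|v x|)%:E = (H x `|v x|)%:E)) => x Ox nZx; rewrite GH.
Qed.

Lemma normLG_ae (v : 'rV[R]_N -> R) : Lmeasurable Om v -> normLG Om G v = normLG Om H v.
Proof.
move=> mv; rewrite /normLG; congr ereal_inf; congr (image _ _); apply/seteqP.
have ml (l : R) : Lmeasurable Om (fun x => v x / l) by exact: measurable_div.
by split => l [l0 Hl]; split => //; move: Hl; rewrite (modular_ae (ml l)).
Qed.

Lemma LG_ae (v : 'rV[R]_N -> R) : LG Om G v -> LG Om H v.
Proof. by move=> [mv fv]; split => //; rewrite -modular_ae. Qed.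

Lemma W1G0_ae u Du : W1G0 Om G u Du -> W1G0 Om H u Du.
Proof.
move=> [[Lu wu Ld] Hd]; split; first by split => //; exact: LG_ae.
move=> e e0; have [phi tphi Hphi] := Hd e e0; exists phi => //.
have [mu_ _] := Lu; have [_ lD _] := wu.
have mDu : measurable_vec OmR Du by move=> i; have [] := lD i.
have [cphi dphi] := test_C1 tphi.
have mphi : Lmeasurable Om phi by apply: continuous_Lmeasurable => //; exact: @cphi.
have mdphi : measurable_vec OmR (gradient phi).
  move=> i; apply: (continuous_Lmeasurable mOm (f := fun x => gradient phi x 0 i)) => x.
  apply: (@continuous_comp _ _ _ (gradient phi) (fun g : 'rV[R]_N => g 0 i)).
    exact: gradient_continuous (test_C1 tphi) _.
  exact: row_coord_continuous.
move: Hphi; rewrite /normW1G (normLG_ae (v := (u \- phi)%R)); last exact: (measurable_funB mu_ mphi).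
rewrite (normLG_ae (v := enorm \o (fun x => Du x - gradient phi x)%R)) //.
apply: (@measurable_enorm _ (Rn R N) R OmR N (fun x => Du x - gradient phi x)).
exact: measurable_vecB.
Qed.

End almost_everywhere.

Lemma ae_in_and (R : realType) (N : nat) (Om : set 'rV[R]_N) (P Q : 'rV[R]_N -> Prop) :
  ae_in Om P -> ae_in Om Q -> ae_in Om (fun x => P x /\ Q x).
Proof.
rewrite /ae_in => hP hQ; apply: negligibleS (negligibleU hP hQ) => x /= nx.
by apply: contrapT => /not_orP[/contrapT h1 /contrapT h2]; apply: nx => Ox; split; [exact: h1|exact: h2].
Qed.

Lemma widen_bounds (R : realType) (c C v : R) : 0 < c -> c <= C -> c^-1 <= v <= c -> C^-1 <= v <= C.
Proof.
move=> c0 cC /andP[h1 h2]; rewrite (le_trans h2 cC) andbT; apply: le_trans h1.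
by rewrite lef_pV2 ?posrE// (lt_le_trans c0).
Qed.

(** Hypothesis (ii) speaks of [t] near 0 but different from 0; the value at 0 follows by
    continuity. *)
Lemma small_at0 (R : realType) (a : R) (f : R -> R) : 0 < a -> continuous f ->
  (\forall t \near (0 : R)^', `|f t| <= `|t| `^ a) -> f 0 = 0.
Proof.
move=> a0 cf H; apply/eqP; rewrite -normr_eq0 eq_le normr_ge0 andbT.
have c1 : `|t| `^ a - `|f t| @[t --> (0 : R)^'] --> 0 - `|f 0|.
  apply: cvgB.
    have c : `|t| `^ a @[t --> (0 : R)] --> `|0 : R| `^ a by exact: (@continuous_norm_powR R a a0).
    rewrite normr0 powR0 ?gt_eqF// in c.
    exact: (cvg_trans (cvg_app _ (@nbhs_dnbhs _ _)) c).
  apply: cvg_norm; exact: (cvg_trans (cvg_app _ (@nbhs_dnbhs _ _)) (cf 0)).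
have : 0 <= 0 - `|f 0|.
  by apply: (cvgr_to_ge c1); apply: filterS H => t Ht; rewrite subr_ge0.
by rewrite sub0r oppr_ge0.
Qed.

Theorem theorem3p1 (R : realType) (N : nat) (Omega : set 'rV[R]_N)
  (hOmega : bounded_domain Omega)
  (g : 'rV[R]_N -> R -> R) (g0 g1 : R)
  (G : 'rV[R]_N -> R -> R) (hG : G = fun x => primitive (g x))
  (hg : standing_g Omega g)
  (hg0 : 1 < g0) (hg01 : g0 <= g1)
  (hSC : cond_SC Omega g0 g1 g)
  (hA0 : cond_A0 Omega g)
  (hA1 : cond_A1 Omega G)
  (hg1 : g1 < Num.min (N%:R * g0 / (N%:R - g0)) N%:R)
  (alpha : R) (halpha : g0^-1 - g1^-1 < alpha < N%:R^-1)
  (Psi : 'rV[R]_N -> R -> R) (hPsi : generalized_Phi Omega Psi)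
  (hPsiG : ae_in Omega (fun x => forall t : R, 0 < t ->
    Phi_inverse (Psi x) t = t `^ (- alpha) * Phi_inverse (G x) t))
  (psi : 'rV[R]_N -> R -> R) (hpsi : psi = fun x => derive_half_line (Psi x))
  (f : 'rV[R]_N -> R -> R) (hf : caratheodory_fun Omega f)
  (F : 'rV[R]_N -> R -> R) (hF : F = fun x => primitive (f x))
  (hi : exists2 C : R, 0 < C & ae_in Omega (fun x => forall t : R,
    `|f x t| <= C * (1 + psi x `|t|)))
  (hii : forall e : R, 0 < e -> \forall t \near (0 : R)^',
    forall x, Omega x -> `|f x t| <= e * `|t| `^ (g1 - 1))
  (hiii : exists t0 : R, exists theta : R,
    [/\ 0 < t0, g1 < theta & ae_in Omega (fun x => forall t : R, t0 <= `|t| ->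
      0 < theta * F x t /\ theta * F x t <= t * f x t)]) :
  exists (u : 'rV[R]_N -> R) (Du : 'rV[R]_N -> 'rV[R]_N),
    weak_solution Omega g f u Du /\ ~ ae_in Omega (fun x => u x = 0).
Proof.
have [[c0 Oc0] oOm _ bOm] := hOmega.
have [g_ge0 mgt Cg] := hg.
have [mPsi Phi_ae _] := hPsi.
have [mft fc_ae] := hf.
have [CA CA1 A0_ae] := hA0.
have [Cf Cf0 hi_ae] := hi.
have [t0 [theta [t00 thq AR_ae]]] := hiii.
have g00 : 0 < g0 by move: hg0; lra.
have g10 : 0 < g1 by exact: lt_le_trans hg01.
have g1N : g1 < N%:R by move: hg1; rewrite lt_min => /andP[].
have N0 : (0 < N)%N by rewrite -(ltr0n R); exact: lt_trans g1N.
have NR : 0 < N%:R :> R by rewrite ltr0n.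
have /andP[al1 al2] := halpha.
have a0 : 0 < alpha by apply: le_lt_trans al1; rewrite subr_ge0 lef_pV2 ?posrE.
have aN : alpha * N%:R < 1 by rewrite -ltr_pdivlMr// div1r.
have aq : alpha * g1 < 1 by apply: lt_trans aN; rewrite ltr_pM2l.
have ap : alpha * g0 < 1 by apply: le_lt_trans aq; rewrite ler_pM2l.
pose Gd x := [/\ C1_half_line (g x),
  forall t, 0 < t -> g0 - 1 <= t * derive_half_line (g x) t / g x t <= g1 - 1,
  CA^-1 <= g x 1 <= CA & [/\ 
   [/\ forall s t, 0 <= s -> s <= t -> Psi x s <= Psi x t, Psi x 0 = 0,
      Psi x t @[t --> 0^'+] --> 0 & Psi x t @[t --> +oo] --> +oo],
   forall t : R, 0 < t -> Phi_inverse (Psi x) t = t `^ (- alpha) * Phi_inverse (G x) t,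
   continuous (f x),
   forall t : R, `|f x t| <= Cf * (1 + psi x `|t|) &
   forall t : R, t0 <= `|t| -> 0 < theta * F x t /\ theta * F x t <= t * f x t]].
have Gd_ae : ae_in Omega Gd.
  have H := ae_in_and (ae_in_and (ae_in_and Cg hSC) (ae_in_and A0_ae Phi_ae))
    (ae_in_and (ae_in_and hPsiG fc_ae) (ae_in_and hi_ae AR_ae)).
  apply: negligibleS H => x /= nx H; apply: nx => Ox.
  by have [[[h1 h2] [h3 h4]] [[h5 h6] [h7 h8]]] := H Ox; split.
pose Z : set (Rn R N) := ~` [set x | Omega x -> Gd x].
have nZ : (@lebesgue_Rn R N).-negligible Z by exact: Gd_ae.
have GdZ x : Omega x -> ~ Z x -> Gd x by move=> Ox /contrapT; apply.
(* A good point exists because a nonempty open set is not negligible. *)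
have [x0 Ox0 nZ0] : exists2 x, Omega x & ~ Z x.
  apply: contrapT => nx.
  have H : {ae @lebesgue_Rn R N, forall x, Omega x -> (1 : R) = 0}.
    apply: negligibleS nZ => x /= nH; apply: contrapT => nZx; apply: nH => Ox.
    by exfalso; apply: nx; exists x.
  have c1 : continuous (fun _ : 'rV[R]_N => 1 : R) by exact: cst_continuous.
  have : (1 : R) = 0 by exact: (ae_continuous_eq0 oOm c1 H Oc0).
  by move/eqP; rewrite oner_eq0.
(* Bad points are sent to [x0], so the modified data satisfy every pointwise hypothesis at all
   points and agree with the given ones on [Omega] off [Z]. *)
pose pi_ (x : 'rV[R]_N) : 'rV[R]_N := if `[< Omega x /\ ~ Z x >] then x else x0.
have piP x : Omega (pi_ x) /\ Gd (pi_ x).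
  by rewrite /pi_; case: asboolP => [[Ox nZx]|_]; split => //; exact: GdZ.
have piE x : Omega x -> ~ Z x -> pi_ x = x by move=> Ox nZx; rewrite /pi_ asboolT.
pose g' x := g (pi_ x); pose G' x := G (pi_ x); pose Psi' x := Psi (pi_ x).
pose f' x := f (pi_ x); pose F' x := F (pi_ x).
have eqG x : Omega x -> ~ Z x -> G x = G' x by move=> Ox nZx; rewrite /G' piE.
have dp x : density_pair g0 g1 (g' x) (G' x).
  have [Ox [h1 h2 h3 _]] := piP x; rewrite /G' hG; split; split.
  - exact: (SC_growth h1 (fun t => g_ge0 _ t Ox) hg0 h2).
  - exact: (prim_growth h1 (fun t => g_ge0 _ t Ox) hg0 h2).
  - exact: (SC_at0 h1 (fun t => g_ge0 _ t Ox) hg0 h2).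
  - exact: primitive0.
  - by move=> t; exact: g_ge0.
  - exact: (prim_ge0 h1 (fun t => g_ge0 _ t Ox) hg0 h2).
  - exact: (prim_convex h1 (fun t => g_ge0 _ t Ox) hg0 h2).
  - exact: (prim_ge h1 (fun t => g_ge0 _ t Ox) hg0 h2).
  - exact: C1_half_line_continuous.
(* [G 1] lies between [g(1) / g1] and [g(1)], so (A0) for [g] passes to [G] with this constant. *)
pose CG := g1 * CA.
have CA0 : 0 < CA by exact: lt_trans CA1.
have g11 : 1 <= g1 by move: hg0 hg01; lra.
have CG1 : 1 <= CG by rewrite -[leLHS]mulr1; apply: ler_pM => //; exact: ltW.
have CG0 : 0 < CG by exact: lt_le_trans CG1.
have G1' x : CG^-1 <= G' x 1 <= CG.
  have [Ox [h1 h2 /andP[h3 h4] _]] := piP x; rewrite /G' hG.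
  have k1 := prim_le h1 (fun t => g_ge0 _ t Ox) hg0 h2 ler01.
  have k2 := prim_ge h1 (fun t => g_ge0 _ t Ox) hg0 h2 ler01.
  rewrite mul1r in k1; rewrite mul1r in k2; apply/andP; split.
    by rewrite invfM ler_pdivrMl//; apply: le_trans k2; rewrite h3.
  apply: le_trans k1 _; apply: le_trans h4 _; by rewrite ler_peMl// ltW.
have gG' x : growth g0 g1 (G' x) by have [[]] := dp x.
have G0' x : G' x 0 = 0 by have [[]] := dp x.
have Gp1 x : 0 < G' x 1 by have /andP[h _] := G1' x; apply: lt_le_trans h; rewrite invr_gt0.
have cG x : exists2 Gc : R -> R, continuous Gc & forall t, 0 <= t -> Gc t = G' x t.
  have [Ox [h1 _ _ _]] := piP x.
  exists (primitive (fun s => g' x `|s|)); first exact/primitive_continuous/C1_half_line_continuous.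
  by move=> t t0'; rewrite /G' hG -primitive_ge0E.
have Ph x s t : 0 <= s -> s <= t -> Psi' x s <= Psi' x t by have [_ [_ _ _ [[h _ _ _] _ _ _ _]]] := piP x; apply: h.
have P0' x : Psi' x 0 = 0 by have [_ [_ _ _ [[_ h _ _] _ _ _ _]]] := piP x.
have Py' x : Psi' x t @[t --> +oo] --> +oo by have [_ [_ _ _ [[_ _ _ h] _ _ _ _]]] := piP x; exact: h.
have inv' x t : 0 < t -> Phi_inverse (Psi' x) t = t `^ (- alpha) * Phi_inverse (G' x) t.
  by have [_ [_ _ _ [_ h _ _ _]]] := piP x; apply: h.
pose r := g0 / (1 - alpha * g0); pose r' := g1 / (1 - alpha * g1).
have gP x : growth r r' (Psi' x).
  exact: (inverse_growth g00 (gG' x) (G0' x) (Gp1 x) (cG x) (Ph x) (P0' x) (Py' x) a0 aq (inv' x) hg01).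
pose D := CG `^ (alpha * r' + 1).
have P1' x : D^-1 <= Psi' x 1 <= D.
  exact: (inverse_at1 g00 (gG' x) (G0' x) (Gp1 x) (cG x) (Ph x) (P0' x) (Py' x) a0 aq (inv' x) hg01 CG1 (G1' x)).
have invP x a : 0 < a -> Psi' x (a * G' x a `^ (- alpha)) = G' x a.
  exact: (P_inv_arg g00 (gG' x) (G0' x) (Gp1 x) (cG x) (Ph x) (P0' x) (Py' x) a0 aq (inv' x)).
have d0 : 0 < 1 - alpha * g0 by rewrite subr_gt0.
have d1 : 0 < 1 - alpha * g1 by rewrite subr_gt0.
have r'0 : 0 < r' by rewrite divr_gt0.
(* Equivalent to the lower bound on [alpha], multiplied by [g0 * g1]. *)
have qr : g1 < r.
  rewrite ltr_pdivlMr//; have E : (g0^-1 - g1^-1) * (g0 * g1) = g1 - g0 by field; rewrite !gt_eqF.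
  by move: al1; rewrite -(ltr_pM2r (mulr_gt0 g00 g10)) E => H; move: H; lra.
have rr' : r <= r'.
  apply: ler_pM; rewrite ?invr_ge0 ?(ltW g00) ?(ltW d0)//.
  by rewrite lef_pV2 ?posrE// lerD2l lerN2 ler_pM2l.
(* The constant of [derive_half_line_le], which replaces [psi] by [Psi t / t] in (i). *)
pose Kf := Cf * (1 + r' * expR r').
have re0 : 0 <= r' * expR r' by rewrite mulr_ge0 ?expR_ge0// ltW.
have Kf0 : 0 <= Kf by rewrite mulr_ge0 ?addr_ge0// ltW.
have D0 : 0 < D by rewrite powR_gt0.
pose C := CG + D + Kf.
have CGC : CG <= C by rewrite /C -addrA lerDl addr_ge0// ltW.
have DC : D <= C by rewrite /C [CG + D]addrC -addrA lerDl addr_ge0// ltW.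
have KC : Kf <= C by rewrite /C lerDr addr_ge0// ltW.
have C1 : 1 <= C by exact: le_trans CGC.
have fc' x : continuous (f' x) by have [_ [_ _ _ [_ _ h _ _]]] := piP x; exact: h.
(* At [t = 0] the quotient [Psi t / t] is 0 by convention, and (i) involves [psi x 0]; the value of
   [f] there is taken from (ii) instead. *)
have f0' x : f' x 0 = 0.
  have [Ox _] := piP x.
  have q1 : 0 < g1 - 1 by move: hg0 hg01; lra.
  apply: (small_at0 q1 (@fc' x)).
  by apply: filterS (hii 1 ltr01) => t /(_ _ Ox); rewrite mul1r.
have Pge0 x t : 0 <= t -> 0 <= Psi' x t by move=> t0'; rewrite -(P0' x); exact: Ph.
have fb' x t : `|f' x t| <= C * (1 + Psi' x `|t| / `|t|).
  have [->|tn] := eqVneq t 0; first by rewrite f0' normr0 P0' mul0r addr0 mulr1 (le_trans ler01).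
  have tp : 0 < `|t| by rewrite normr_gt0.
  have [_ [_ _ _ [_ _ _ h _]]] := piP x; apply: le_trans (h t) _; rewrite hpsi.
  have Pt : 0 <= Psi' x `|t| / `|t| by rewrite divr_ge0 ?Pge0.
  have H := derive_half_line_le (gP x) r'0 (Pge0 x) tp.
  apply: (@le_trans _ _ (Kf * (1 + Psi' x `|t| / `|t|))); last by rewrite ler_wpM2r// addr_ge0.
  rewrite /Kf -mulrA ler_wpM2l ?(ltW Cf0)//.
  apply: (@le_trans _ _ (1 + r' * expR r' * (Psi' x `|t| / `|t|))); first by rewrite lerD2l.
  rewrite mulrDr mulr1 [X in _ <= _ + X]mulrDl mul1r -addrA lerD2l addrA lerDr addr_ge0//.
have fs' e : 0 < e -> exists2 del : R, 0 < del & forall x t, `|t| < del -> `|f' x t| <= e * `|t| `^ (g1 - 1).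
  move=> e0; have [d /= d_gt0 Hd] := hii e e0; exists d => // x t td.
  have [->|tn] := eqVneq t 0; first by rewrite f0' normr0 mulr_ge0 ?powR_ge0// ltW.
  have [Ox _] := piP x; apply: Hd => //; by rewrite /= sub0r normrN.
have AR' x t : t0 <= `|t| -> 0 < theta * F' x t /\ theta * F' x t <= t * f' x t.
  by have [_ [_ _ _ [_ _ _ _ h]]] := piP x; apply: h.
have mOm : measurable (Omega : set (Rn R N)) by exact: open_Rn.
have mgn (t : R) : Lmeasurable Omega (fun x => g' x `|t|).
  by apply: (Lmeasurable_ae nZ _ (mgt _ (normr_ge0 t))) => x Ox nZx; rewrite /g' piE.
have cgn x : continuous (fun t : R => g' x `|t|) by have [_ [h _ _ _]] := piP x; exact: C1_half_line_continuous h.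
have mg' : superposition_measurable Omega g'.
  move=> w mw w0; have := caratheodory_comp mOm mgn cgn mw.
  rewrite (_ : (fun x => _) = (fun x => g' x (w x)))//; apply/funext => x; by rewrite ger0_norm.
have mG' : superposition_measurable Omega G'.
  move=> w mw w0; have := primitive_comp mOm mgn cgn mw.
  rewrite (_ : (fun x => _) = (fun x => G' x (w x)))//; apply/funext => x; by rewrite /G' hG -primitive_ge0E.
have mP' : superposition_measurable Omega Psi'.
  move=> w mw w0; apply: (Lmeasurable_ae nZ _ (mPsi w mw)) => x Ox nZx.
  by rewrite ger0_norm// /Psi' piE.
have mft' t : Lmeasurable Omega (f' ^~ t).
  by apply: (Lmeasurable_ae nZ _ (mft t)) => x Ox nZx; rewrite /f' piE.
have mf' (w : 'rV[R]_N -> R) : Lmeasurable Omega w -> Lmeasurable Omega (fun x => f' x (w x)).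
  exact: (caratheodory_comp mOm mft' fc').
have mF' (w : 'rV[R]_N -> R) : Lmeasurable Omega w -> Lmeasurable Omega (fun x => F' x (w x)).
  by rewrite /F' hF; exact: (primitive_comp mOm mft' fc').
have Fd' x (t : R) : is_derive t 1 (F' x) (f' x t) by rewrite /F' hF; exact: (primitive_is_derive (fc' x) t).
have F0' x : F' x 0 = 0 by rewrite /F' hF; exact: primitive0.
(* The set [Z] joins the exceptional set of each ball, and the essential infimum does not see it. *)
have A1' : cond_A1 Omega G'.
  have [CA' CA0' H] := hA1; exists CA' => // c rho rho01 B.
  have [E nE HE] := H c rho rho01; exists (E `|` Z); first exact: negligibleU.
  move=> x y [Bx nx] [By ny] t t0' Ht.
  have [nEx nZx] : ~ E x /\ ~ Z x by split => h; apply: nx; [left|right].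
  have [nEy nZy] : ~ E y /\ ~ Z y by split => h; apply: ny; [left|right].
  rewrite -(eqG x Bx.2 nZx) -(eqG y By.2 nZy).
  apply: (HE x y (conj Bx nEx) (conj By nEy) t t0').
  suff -> : ess_inf_on B (G ^~ t) = ess_inf_on B (G' ^~ t) by [].
  apply: eq_ess_inf; apply: negligibleS nZ => z /= nz; apply: contrapT => nZz; apply: nz.
  by case: ifPn => // /set_mem[_ Oz]; rewrite eqG.
have [u [Du [Wu eqn nz]]] := solution_everywhere oOm bOm Oc0 N0 hg0 hg01 qr rr' C1 dp
  (fun x => widen_bounds CG0 CGC (G1' x)) gP P0' (fun x => widen_bounds D0 DC (P1' x))
  mG' mg' mP' mf' mF' fc' Fd' F0' fb' fs' t00 thq AR' a0 aN invP A1'.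
exists u, Du; split => //.
have mG : superposition_measurable Omega G.
  by apply: (superposition_ae nZ _ mG') => x Ox nZx; rewrite eqG.
rewrite /weak_solution -hG /=.
split; first by apply: (W1G0_ae oOm nZ _ mG' Wu) => x Ox nZx; rewrite eqG.
move=> phi Dphi Wphi.
have [i1 i2 E] := eqn phi Dphi (W1G0_ae oOm nZ eqG mG Wphi).
have [|j1 E1] := @Int_congr_ae R N Omega oOm Z nZ _ (fun x => dotv (flux g x (Du x)) (Dphi x)) _ i1.
  by move=> x Ox nZx; rewrite /flux /g' piE.
have [|j2 E2] := @Int_congr_ae R N Omega oOm Z nZ _ (fun x => f x (u x) * phi x) _ i2.
  by move=> x Ox nZx; rewrite /f' piE.
split; [exact: j1|exact: j2|].
by rewrite -[LHS]/(Int _ _ _) E1 E -E2.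
Qed.
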